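(* There exist constants $c,C>0$, depending only on $\nu$, $L_H$, $L_{H_p}$, $L_F$, $L_S$, $M_\infty$, $T$ and $\operatorname{diam}\Omega$, such that for every $(\overline u,\overline m)\in X\times Y$ with $\overline m\ge 0$ a.e. in $Q_T$, $$c\,\mathcal R(\overline u,\overline m)\;\le\;\|u-\overline u\|_X+\|m-\overline m\|_Y\;\le\; C\,\mathcal R(\overline u,\overline m),$$ where $(u,m)\in X\times Y$ is the weak solution of the mean field game system and $\mathcal R$ is the total residual norm functional defined in the context.
   Context: **Spaces.** Let $d\in\mathbb N$, let $\Omega\subset\mathbb R^d$ be a bounded connected open set with Lipschitz boundary, $T>0$, $I=(0,T)$, $Q_T=I\times\Omega$. $(\cdot,\cdot)_\omega$ and $\|\cdot\|_\omega$ are the inner product and norm of $L^2(\omega)$ (scalar- or vector-valued). $H^1_0(\Omega)$ is normed by $v\mapsto\|\nabla v\|_\Omega$; $H^{-1}(\Omega)$ is its dual with the dual norm, and $\langle\cdot,\cdot\rangle$ is the duality pairing. $X=L^2(I;H^1_0(\Omega))$ with $\|w\|_X^2=\int_0^T\|\nabla w\|_\Omega^2\,dt$; $X^*$ is its dual with dual norm, identified with $L^2(I;H^{-1}(\Omega))$. $Y=L^2(I;H^1_0(\Omega))\cap H^1(I;H^{-1}(\Omega))$ with $\|v\|_Y^2=\int_0^T(\|\partial_t v\|_{H^{-1}(\Omega)}^2+\|\nabla v\|_\Omega^2)\,dt+\|v(T)\|_\Omega^2$ (recall $Y\hookrightarrow C([0,T];L^2(\Omega))$). $Y_0=\{v\in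 Y: v(0)=0\}$ with norm $\|\cdot\|_Y$, and $Y_0^*$ has the dual norm. **Data.** $\nu>0$ is constant; $m_0\in L^\infty(\Omega)$, $m_0\ge0$ a.e. The Hamiltonian is $H(t,x,p)=\sup_{\alpha\in\mathcal A}[b(t,x,\alpha)\cdot p-f(t,x,\alpha)]$ for $(t,x,p)\in\overline{Q_T}\times\mathbb R^d$, with $\mathcal A$ a compact metric space and $b$ ($\mathbb R^d$-valued), $f$ (real-valued) uniformly continuous on $\overline{Q_T}\times\mathcal A$. Hence $H$ is convex in $p$ and $|H(t,x,p)-H(t,x,q)|\le L_H|p-q|$ with $L_H=\|b\|_{C(\overline{Q_T}\times\mathcal A;\mathbb R^d)}$. It is assumed that $H$ is differentiable in $p$, with gradient $H_p=\partial_pH$ satisfying $|H_p(t,x,p)-H_p(t,x,q)|\le L_{H_p}|p-q|$ for all arguments. For $v\in X$: $H[\nabla v](t,x)=H(t,x,\nabla v(t,x))$, $H_p[\nabla v](t,x)=H_p(t,x,\nabla v(t,x))$. There is a Hilbert space $Z$ into which $X$ and $Y$ embed continuously, with $Y\hookrightarrow Z$ compact ($Z$ and these embeddings are fixed data, and the constants may depend on the embedding constants). $F:Z\to X^*$ satisfies $\|F[v_1]-F[v_2]\|_{X^*}\le L_F\|v_1-v_2\|_Z$; $S:L^2(\Omega)\to L^2(\Omega)$ satisfies $\|S[v_1]-S[v_2]\|_\Omega\le L_S\|v_1-v_2\|_\Omega$; and for all $v_1,v_2\in Y$: $0\le\int_0^T\langle F[v_1]-F[v_2],v_1-v_2\rangle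 dt+(S[v_1(T)]-S[v_2(T)],v_1(T)-v_2(T))_\Omega$. $G=g_0-\nabla\cdot g_1\in L^2(I;H^{-1}(\Omega))$ with $g_0\in L^r(I;L^s(\Omega))$, $g_1\in L^{2r}(I;L^{2s}(\Omega;\mathbb R^d))$ for some $r,s\in(1,\infty]$ with $\frac1r+\frac d{2s}<1$, and $\int_0^T\langle G,w\rangle dt\ge0$ for all $w\in X$ with $w\ge0$ a.e. **Weak solution.** $(u,m)\in X\times Y$ denotes the unique pair (known to exist) with $m(0)=m_0$ and, for all $(v,\phi)\in Y_0\times X$, $$\int_0^T[\langle\partial_tv,u\rangle+(\nu\nabla u,\nabla v)_\Omega+(H[\nabla u],v)_\Omega]dt=\int_0^T\langle F[m],v\rangle dt+(S[m(T)],v(T))_\Omega,$$ $$\int_0^T[\langle\partial_tm,\phi\rangle+(\nu\nabla m,\nabla\phi)_\Omega+(mH_p[\nabla u],\nabla\phi)_\Omega]dt=\int_0^T\langle G,\phi\rangle dt.$$ It is known that $m\ge0$ a.e. and $\|m\|_{L^\infty(Q_T)}\le M_\infty$ for a constant $M_\infty$ depending on the data. **Residuals.** For $(\overline u,\overline m)\in X\times Y$, $R_1^X(\overline u,\overline m)\in Y_0^*$ and $R_2^Y(\overline u,\overline m)\in X^*$ are defined for $v\in Y_0$, $w\in X$ by $$\langle R_1^X(\overline u,\overline m),v\rangle=\int_0^T\langle F[\overline m],v\rangle dt+(S[\overline m(T)],v(T))_\Omega-\int_0^T[\langle\partial_tv,\overline u\rangle+(\nu\nabla\overline u,\nabla v)_\Omega+(H[\nabla\overline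 u],v)_\Omega]dt,$$ $$\langle R_2^Y(\overline u,\overline m),w\rangle=\int_0^T[\langle G-\partial_t\overline m,w\rangle-(\nu\nabla\overline m+\overline mH_p[\nabla\overline u],\nabla w)_\Omega]dt,$$ and $\mathcal R(\overline u,\overline m)=\|R_1^X(\overline u,\overline m)\|_{Y_0^*}+\|R_2^Y(\overline u,\overline m)\|_{X^*}+\|\overline m(0)-m_0\|_\Omega$. *)

(* Defs.v *)
From HB Require Import structures.
From mathcomp Require Import all_boot all_order all_algebra.
From mathcomp Require Import all_classical all_reals all_analysis.

Set Implicit Arguments.
Unset Strict Implicit.
Unset Printing Implicit Defensive.

Import Order.TTheory GRing.Theory Num.Theory.
Import numFieldNormedType.Exports.

Local Open Scope classical_set_scope.
Local Open Scope ring_scope.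

Section matrix_measurable.
Context {R : realType} {m n : nat}.

(* The Borel sigma-algebra is generated by the coordinates. *)
Definition mx_coord_sets : set (set 'M[R]_(m, n)) :=
  \bigcup_(ij in [set: 'I_m * 'I_n])
    preimage_set_system setT (fun M : 'M[R]_(m, n) => M ij.1 ij.2)
      (@measurable _ R).

HB.instance Definition _ := @isMeasurable.Build (sigma_display mx_coord_sets)
  'M[R]_(m, n) <<s mx_coord_sets >>
  (@sigma_algebra0 _ setT mx_coord_sets) (@sigma_algebraC _ mx_coord_sets)
  (@sigma_algebra_bigcup _ setT mx_coord_sets).

Lemma measurable_mx_coord (i : 'I_m) (j : 'I_n) :
  measurable_fun setT (fun M : 'M[R]_(m, n) => M i j).
Proof.
move=> _ A mA; apply: sub_sigma_algebra.
by exists (i, j) => //; exists A.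
Qed.

Lemma measurable_fun_mx d (X : measurableType d) (f : X -> 'M[R]_(m, n)) :
  (forall i j, measurable_fun setT (fun x => f x i j)) -> measurable_fun setT f.
Proof.
move=> mf; apply: (@measurability _ _ _ _ _ _ mx_coord_sets) => //.
move=> _ [_ [[i j] _ [A mA <-]] <-].
by rewrite !setTI -comp_preimage; have := mf i j measurableT A mA; rewrite setTI.
Qed.
End matrix_measurable.

Section leb_cons.
Context {R : realType} {n : nat}.

Definition rV_cons (p : measurableTypeR R * 'rV[R]_n) : 'rV[R]_n.+1 :=
  \row_j oapp (p.2 ord0) p.1 (unlift ord0 j).

Definition rV_uncons (x : 'rV[R]_n.+1) : measurableTypeR R * 'rV[R]_n :=
  (x ord0 ord0, \row_j x ord0 (lift ord0 j)).

Lemma rV_consK : cancel rV_cons rV_uncons.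
Proof.
move=> [t y]; rewrite /rV_uncons mxE unlift_none; congr pair.
by apply/rowP => j; rewrite !mxE liftK.
Qed.

Lemma measurable_rV_cons : measurable_fun setT rV_cons.
Proof.
apply: measurable_fun_mx => i j; under eq_fun do rewrite mxE.
case: unliftP => [k _|_] /=; last exact: measurable_fst.
exact: (measurableT_comp (measurable_mx_coord ord0 k) measurable_snd).
Qed.

HB.instance Definition _ :=
  isMeasurableFun.Build _ _ _ _ rV_cons measurable_rV_cons.

Lemma measurable_rV_uncons : measurable_fun setT rV_uncons.
Proof.
apply: measurable_fun_pair; first exact: measurable_mx_coord.
apply: measurable_fun_mx => i j; under eq_fun do rewrite mxE.
exact: measurable_mx_coord.
Qed.

Variable mu : {sigma_finite_measure set 'rV[R]_n -> \bar R}.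

Definition leb_cons : set 'rV[R]_n.+1 -> \bar R :=
  pushforward (lebesgue_measure \x mu)%E rV_cons.

Let leb_cons0 : leb_cons set0 = 0%E.
Proof. by rewrite /leb_cons /pushforward preimage_set0 measure0. Qed.

Let leb_cons_ge0 A : (0 <= leb_cons A)%E.
Proof. exact: measure_ge0. Qed.

Let leb_cons_sigma_additive : semi_sigma_additive leb_cons.
Proof.
exact: measure_semi_sigma_additive.
Qed.

HB.instance Definition _ := isMeasure.Build _ _ _ leb_cons
  leb_cons0 leb_cons_ge0 leb_cons_sigma_additive.

Let leb_cons_sigma_finite : sigma_finite setT leb_cons.
Proof.
have /sigma_finiteP[F [TF ndF Foo]] := sigma_finiteT (@lebesgue_measure R).
have /sigma_finiteP[G [TG ndG Goo]] := sigma_finiteT mu.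
exists (fun k => rV_uncons @^-1` (F k `*` G k)).
  rewrite -preimage_bigcup -[LHS](preimage_setT rV_uncons); congr (_ @^-1` _).
  rewrite -setXTT TF TG predeqE => -[x y]; split.
    move=> [/= [i _ Fx] [j _ Gy]]; exists (maxn i j) => //; split.
    - by move: x Fx; exact/subsetPset/ndF/leq_maxl.
    - by move: y Gy; exact/subsetPset/ndG/leq_maxr.
  by move=> [k _ []/= ? ?]; split; exists k.
move=> k; have [mF ltF] := Foo k; have [mG ltG] := Goo k.
have mFG : measurable (F k `*` G k) by exact: measurableX.
split; first by have := measurable_rV_uncons measurableT mFG; rewrite setTI.
rewrite /leb_cons /pushforward -comp_preimage (_ : _ \o _ = id) ?preimage_id//.
  by rewrite product_measure1E// lte_mul_pinfty// ge0_fin_numE.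
by apply/funext => p; exact: rV_consK.
Qed.

HB.instance Definition _ := Measure_isSigmaFinite.Build _ _ _ leb_cons
  leb_cons_sigma_finite.
End leb_cons.

Fixpoint lebesgue_rV {R : realType} (n : nat) :
    {sigma_finite_measure set 'rV[R]_n -> \bar R} :=
  match n with
  | 0 => @dirac _ 'rV[R]_0 0 R
  | n'.+1 => leb_cons (lebesgue_rV n')
  end.

Lemma lebesgue_rV_box {R : realType} (n : nat) (A : 'I_n -> set R) :
  (forall i, measurable (A i)) ->
  lebesgue_rV n [set x : 'rV[R]_n | forall i, A i (x ord0 i)] =
  (\prod_(i < n) lebesgue_measure (A i))%E.
Proof.
elim: n A => [|n IH] A mA; first by rewrite big_ord0 /= diracE mem_set// => -[].
rewrite big_ord_recl -IH//= /leb_cons /pushforward.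
pose B := [set x : 'rV[R]_n | forall i, A (lift ord0 i) (x ord0 i)].
have mB : measurable B.
  rewrite (_ : B = \bigcap_(i in [set: 'I_n])
      ((fun x : 'rV[R]_n => x ord0 i) @^-1` A (lift ord0 i))); last first.
    by apply/seteqP; split=> x Bx i => [_|]; exact: Bx.
  apply: fin_bigcap_measurable => // i _.
  rewrite -[X in measurable X]setTI.
  exact: (measurable_mx_coord ord0 i) measurableT _ (mA (lift ord0 i)).
rewrite (_ : _ @^-1` _ = A ord0 `*` B); first by rewrite product_measure1E //; exact: mA.
apply/seteqP; split=> -[t y] /=.
  move=> h; split; first by have := h ord0; rewrite mxE unlift_none.
  by move=> i; have := h (lift ord0 i); rewrite mxE liftK.
by move=> [At By] i; rewrite mxE; case: unliftP => [k ->|->] /=.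
Qed.

Section euclidean.
Context {R : realType} {n : nat}.
Implicit Types (p q : 'rV[R]_n) (A : set 'rV[R]_n).

Definition dotv p q : R := \sum_i p ord0 i * q ord0 i.

(* The norm that the library puts on row vectors is the maximum norm. *)
Definition enorm p : R := Num.sqrt (dotv p p).

Definition diam A : R := sup [set enorm (x - y) | x in A & y in A].

Definition cgrad (phi : 'rV[R]_n -> R) (x : 'rV[R]_n) : 'rV[R]_n :=
  \row_i 'D_(delta_mx ord0 i) phi x.
End euclidean.

(* Near each boundary point, and in suitable orthonormal coordinates, Om is
   the strict epigraph of a Lipschitz function of the last d coordinates; the
   columns of the orthogonal matrix O are the coordinate directions. *)
Definition lipschitz_boundary {R : realType} {d : nat} (Om : set 'rV[R]_d.+1) :=
  forall x0, (closure Om `\` interior Om) x0 ->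
  exists (r L : R) (O : 'M[R]_d.+1) (gam : 'rV[R]_d -> R),
    [/\ 0 < r, O *m O^T = 1%:M,
        forall y z, `|gam y - gam z| <= L * enorm (y - z)
      & forall x, enorm (x - x0) < r ->
          Om x <-> gam (col' ord0 (x *m O)) < (x *m O) ord0 ord0].

Section test_functions.
Context {R : realType} {V : normedModType R}.

Fixpoint iter_derive (vs : seq V) (phi : V -> R) : V -> R :=
  if vs is v :: vs' then fun x => 'D_v (iter_derive vs' phi) x else phi.

Definition smooth (phi : V -> R) := forall vs,
  continuous (iter_derive vs phi) /\
  forall x v, derivable (iter_derive vs phi) x v.

Definition test_fun (U : set V) (phi : V -> R) :=
  [/\ smooth phi, compact (closure [set x | phi x != 0])
    & closure [set x | phi x != 0] `<=` U].
End test_functions.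

Section L2.
Context d {X : measurableType d} {R : realType} {n : nat}.
Variables (mu : {measure set X -> \bar R}) (D : set X).

Definition L2 (f : X -> R) := (f \_ D) \in Lfun mu 2%:E.

Definition L2v (g : X -> 'rV[R]_n) := forall i, L2 (fun x => g x ord0 i).

Definition L2norm (f : X -> R) : R := fine ('N[mu]_2%:E [EFin \o (f \_ D)])%E.
End L2.

Section dual.
Context {R : realType} {P : Type}.
Variables (V : set (P -> R)) (nrm : (P -> R) -> R).

(* Elements of a function space are represented by functions, and a
   functional that is bounded for nrm does not see the choice of the
   representative. *)
Definition dual : set ((P -> R) -> R) := [set l |
  (forall a v w, V v -> V w -> l (fun z => a * v z + w z) = a * l v + l w) /\
  exists C, forall v, V v -> `|l v| <= C * nrm v].

(* sup of an unbounded set is 0, so this is the dual norm on dual only. *)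
Definition dualnorm (l : (P -> R) -> R) : R :=
  sup [set `|l v| | v in [set v | V v /\ nrm v <= 1]].
End dual.

Section spaces.
Context {R : realType} {n : nat}.
Variables (T : R) (Om : set 'rV[R]_n).

Local Notation mu := (lebesgue_rV n).
Local Notation pt := (measurableTypeR R * 'rV[R]_n)%type.

Definition lebQ : {measure set pt -> \bar R} :=
  (lebesgue_measure \x lebesgue_rV n)%E.

Definition QT : set pt := `]0, T[%classic `*` Om.

Definition QTbar : set (R * 'rV[R]_n) := closure (QT : set (R * 'rV[R]_n)).

Definition weak_grad (w : 'rV[R]_n -> R) (g : 'rV[R]_n -> 'rV[R]_n) :=
  forall phi, test_fun Om phi -> forall i,
  \int[mu]_(x in Om) (w x * 'D_(delta_mx ord0 i) phi x) =
  - \int[mu]_(x in Om) (g x ord0 i * phi x).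

(* w lies in the closure of the test functions in H^1(Om), with gradient g *)
Definition H10_grad (w : 'rV[R]_n -> R) (g : 'rV[R]_n -> 'rV[R]_n) :=
  [/\ L2 mu Om w, L2v mu Om g, weak_grad w g &
    exists phi : nat -> 'rV[R]_n -> R, [/\ forall k, test_fun Om (phi k),
      (fun k => L2norm mu Om (fun x => w x - phi k x)) @ \oo --> (0 : R) &
      (fun k => L2norm mu Om (fun x => enorm (g x - cgrad (phi k) x))) @ \oo
        --> (0 : R)]].

Definition H10 (w : 'rV[R]_n -> R) := exists g, H10_grad w g.

(* X = L^2(0, T; H^1_0(Om)); an element is represented by a jointly measurable
   function on the cylinder, together with its spatial gradient. *)
Definition X_grad (v : pt -> R) (g : pt -> 'rV[R]_n) :=
  [/\ L2 lebQ QT v, L2v lebQ QT g &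
    {ae lebesgue_measure, forall t : measurableTypeR R, `]0, T[%classic t ->
      H10_grad (fun x => v (t, x)) (fun x => g (t, x))}].

Definition spX : set (pt -> R) := [set v | exists g, X_grad v g].

(* gradx, dt and trace below pick an object that, when it exists, is unique up
   to null sets (for dt: unique as a functional on spX). *)
Definition gradx (v : pt -> R) : pt -> 'rV[R]_n :=
  xget (fun=> 0) [set g | X_grad v g].

Definition normX (v : pt -> R) : R := L2norm lebQ QT (fun z => enorm (gradx v z)).

Local Notation Xdual := (dual spX normX).

(* D in X^* = L^2(0, T; H^-1(Om)) is the weak time derivative of v *)
Definition is_dt (v : pt -> R) (D : (pt -> R) -> R) := Xdual D /\
  forall (phi : R -> R) w, test_fun `]0, T[%classic phi -> H10 w ->
  D (fun z => phi z.1 * w z.2) =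
  - \int[lebQ]_(z in QT) (v z * w z.2 * derive1 phi z.1).

Definition dt (v : pt -> R) : (pt -> R) -> R :=
  xget (fun=> 0) [set D | is_dt v D].

Definition spY : set (pt -> R) := [set v | spX v /\ exists D, is_dt v D].

(* W represents v in C([0, T]; L^2(Om)), so that trace v t is v(t) *)
Definition is_crep (v : pt -> R) (W : R -> 'rV[R]_n -> R) :=
  [/\ forall t, `[0, T]%classic t -> L2 mu Om (W t),
      forall t, `[0, T]%classic t -> forall e, 0 < e -> exists2 del, 0 < del &
        forall t', `[0, T]%classic t' -> `|t' - t| < del ->
          L2norm mu Om (fun x => W t' x - W t x) < e &
      {ae lebesgue_measure, forall t : measurableTypeR R, `]0, T[%classic t ->
        {ae mu, forall x, Om x -> W t x = v (t, x)}}].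

Definition trace (v : pt -> R) : R -> 'rV[R]_n -> R :=
  xget (fun _ _ => 0) [set W | is_crep v W].

(* The norm of the time derivative in L^2(0, T; H^-1(Om)) is its norm in X^*. *)
Definition normY (v : pt -> R) : R :=
  Num.sqrt (dualnorm spX normX (dt v) ^+ 2 + normX v ^+ 2
            + L2norm mu Om (trace v T) ^+ 2).

Definition spY0 : set (pt -> R) :=
  [set v | spY v /\ {ae mu, forall x, Om x -> trace v 0 x = 0}].

(* g in L^r(0, T; L^s(Om)) *)
Definition LrLs (r s : \bar R) (g : pt -> R) :=
  measurable_fun setT (g \_ QT) /\
  ('N[lebesgue_measure]_r [(fun t : measurableTypeR R =>
     'N[mu]_s [EFin \o ((fun x => g (t, x)) \_ Om)]) \_ `]0%R, T[%classic]
   < +oo)%E.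

(* G in X^* equals g0 - div g1 in the sense of distributions *)
Definition is_source (G : (pt -> R) -> R) (g0 : pt -> R) (g1 : pt -> 'rV[R]_n) :=
  Xdual G /\ forall (phi : R -> R) w,
  test_fun `]0, T[%classic phi -> test_fun Om w ->
  G (fun z => phi z.1 * w z.2) =
  \int[lebQ]_(z in QT) (phi z.1 * (g0 z * w z.2 + dotv (g1 z) (cgrad w z.2))).

Section system.
Variables (nu : R) (H : pt -> 'rV[R]_n -> R).
Variables (Z : normedModType R) (iota : (pt -> R) -> Z).
Variables (F : Z -> (pt -> R) -> R) (S : ('rV[R]_n -> R) -> 'rV[R]_n -> R).
Variables (G : (pt -> R) -> R) (m0 : 'rV[R]_n -> R).

Definition Hp (z : pt) (p : 'rV[R]_n) : 'rV[R]_n := cgrad (H z) p.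

Definition res1 (u m v : pt -> R) : R :=
  F (iota m) v + \int[mu]_(x in Om) (S (trace m T) x * trace v T x)
  - (dt v u + \int[lebQ]_(z in QT)
       (nu * dotv (gradx u z) (gradx v z) + H z (gradx u z) * v z)).

Definition res2 (u m w : pt -> R) : R :=
  G w - dt m w - \int[lebQ]_(z in QT)
    dotv (nu *: gradx m z + m z *: Hp z (gradx u z)) (gradx w z).

Definition residual (u m : pt -> R) : R :=
  dualnorm spY0 normY (res1 u m) + dualnorm spX normX (res2 u m)
  + L2norm mu Om (fun x => trace m 0 x - m0 x).

Definition weak_solution (u m : pt -> R) :=
  [/\ spX u, spY m, {ae mu, forall x, Om x -> trace m 0 x = m0 x},
    forall v, spY0 v ->
      dt v u + \int[lebQ]_(z in QT)
        (nu * dotv (gradx u z) (gradx v z) + H z (gradx u z) * v z)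
      = F (iota m) v + \int[mu]_(x in Om) (S (trace m T) x * trace v T x) &
    forall w, spX w ->
      dt m w + \int[lebQ]_(z in QT)
        (nu * dotv (gradx m z) (gradx w z)
         + m z * dotv (Hp z (gradx u z)) (gradx w z))
      = G w].
End system.
End spaces.

Definition hilbert {R : realType} (Z : normedModType R) :=
  exists ip : Z -> Z -> R,
  [/\ forall x y, ip x y = ip y x,
      forall a x y z, ip (a *: x + y) z = a * ip x z + ip y z
    & forall x, ip x x = `|x| ^+ 2].

Definition unif_continuous_on {R : realType} {M A : pseudoMetricType R}
    {W : normedModType R} (D : set M) (h : M -> A -> W) :=
  forall e, 0 < e -> exists2 del, 0 < del &
  forall z z' a a', D z -> D z' -> ball z del z' -> ball a del a' ->
  `|h z a - h z' a'| < e.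

Definition Ham {R : realType} {n : nat} {M A : Type}
    (b : M -> A -> 'rV[R]_n) (f : M -> A -> R) (z : M) (p : 'rV[R]_n) : R :=
  sup [set dotv (b z a) p - f z a | a in [set: A]].

(* Main.v *)
Require Import Defs.
From mathcomp Require Import all_boot all_order all_algebra.
From mathcomp Require Import all_classical all_reals all_analysis.
From mathcomp Require Import measurable_realfun ring lra.

Set Implicit Arguments.
Unset Strict Implicit.
Unset Printing Implicit Defensive.

Import Order.TTheory GRing.Theory Num.Theory.
Import numFieldNormedType.Exports.

Local Open Scope classical_set_scope.
Local Open Scope ring_scope.

(** Let e_u, e_m be the errors, R the total residual, p and p' the values of
    H_p at the gradients of u and of its approximation. Everything rests on the
    drift operators A_b v = dv/dt - nu Lap v - div (b v) with |b| <= L_H.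
    Testing with exp(- lam t) v bounds the Y-norm of v by the dual norm of A_b v
    and the norm of v(0); the same energy identity for the adjoint problem shows
    that the range of A_b on Y_0 is dense in the dual of X.

    If b is the difference quotient of H along the gradient of e_u, the first
    equation tested with v in Y_0 is an identity for <A_b v, e_u>, and taking
    A_b v close to the Riesz image of e_u gives |e_u| <= C (|e_m| + R). Since
    m p - mb p' = m (p - p') + e_m p', the energy estimate for A_p' gives
    |e_m| <= C (R + |m^(1/2) (p - p')|). Finally, testing the first equation with
    e_m (corrected to vanish at time 0) and the second with e_u, the monotonicity
    of F and S and the cocoercivity of H_p, that is
    |p - p'|^2 <= 4 L (H(q') - H(q) - p.(q' - q)), give
    |m^(1/2) (p - p')|^2 <= C (R^2 + R |e_u| + R |e_m|), which closes the loop.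

    The identity d|v|^2/dt = 2 <dv/dt, v>, on which the energy estimates depend,
    is obtained from difference quotients in time of the pairing of v with its
    shifts, and it also yields the continuous representatives. *)

(** * Hilbert space arguments in semi-inner product spaces of functions *)

(** Elements are functions and not classes, so all forms are only semidefinite; projection and Riesz
    representation are proved once in that setting and used for L^2, H^1_0 and X. Solvability of the
    auxiliary parabolic problems is never established. The bounds only need a right-hand side up to
    e for every e > 0, so a dense range suffices, and density follows from uniqueness for the
    adjoint problem alone. The obstacle in the upper bound is circularity: the value error is
    controlled by the density error, the density error by the gap, that is the integral of m |p -
    p'|^2, and the gap by products of residuals and errors. Since the gap enters under a square root
    and each of these products contains a residual, a quadratic inequality results that can be
    solved without any smallness. Nonnegativity of both densities enters here: m weights the
    cocoercivity inequality and mb the convexity inequality. A weak time derivative is known only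
    through products phi(t) w(x). They determine it because they are total in X, which rests on a
    countable total family in H^1_0: countability gives one exceptional null set of times for the
    whole family. *)

Section semi_inner_product.
Context {R : realType} {E : lmodType R}.

Definition subspace (V : set E) :=
  V 0 /\ forall a v w, V v -> V w -> V (a *: v + w).

(** The form may vanish on nonzero elements, such as functions that are 0 almost everywhere, and the
    axioms are restricted to [V] because outside it integrals may take default values. *)
Definition semi_ip (V : set E) (ip : E -> E -> R) :=
  [/\ subspace V, forall v w, V v -> V w -> ip v w = ip w v,
      forall a u v w, V u -> V v -> V w -> ip (a *: u + v) w = a * ip u w + ip v w
    & forall v, V v -> 0 <= ip v v].

(** Distances are squared, and the limit is merely some element of [V], since limits for a
    semidefinite form are not unique. *)
Definition ip_complete (V : set E) (ip : E -> E -> R) :=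
  forall u : nat -> E, (forall k, V (u k)) ->
  (forall e, 0 < e -> exists N, forall i j, (N <= i)%N -> (N <= j)%N ->
    ip (u i - u j) (u i - u j) < e) ->
  exists2 l, V l & forall e, 0 < e -> exists N, forall k, (N <= k)%N ->
    ip (u k - l) (u k - l) < e.

Lemma subspaceD V v w : subspace V -> V v -> V w -> V (v + w).
Proof. by move=> [_ h] Vv Vw; rewrite -[v]scale1r; exact: h. Qed.

Lemma subspaceZ V a v : subspace V -> V v -> V (a *: v).
Proof. by move=> [V0 h] Vv; rewrite -[_ *: _]addr0; exact: h. Qed.

Lemma subspaceB V v w : subspace V -> V v -> V w -> V (v - w).
Proof. by move=> [_ h] Vv Vw; rewrite addrC -scaleN1r; exact: h. Qed.

Section theory.
Variables (V : set E) (ip : E -> E -> R).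
Hypothesis hip : semi_ip V ip.

Let sV : subspace V. Proof. by case: hip. Qed.

Lemma ipC v w : V v -> V w -> ip v w = ip w v.
Proof. by case: hip => _ h _ _; exact: h. Qed.

Lemma ip_ge0 v : V v -> 0 <= ip v v.
Proof. by case: hip => _ _ _; exact. Qed.

Lemma ipDl u v w : V u -> V v -> V w -> ip (u + v) w = ip u w + ip v w.
Proof.
by case: hip => _ _ h _ Vu Vv Vw; rewrite -[u]scale1r h// mul1r scale1r.
Qed.

Lemma ip0l w : V w -> ip 0 w = 0.
Proof.
move=> Vw; have [V0 _] := sV.
by have := ipDl V0 V0 Vw; rewrite addr0; lra.
Qed.

Lemma ipZl a u w : V u -> V w -> ip (a *: u) w = a * ip u w.
Proof.
case: hip => _ _ h _ Vu Vw; have [V0 _] := sV.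
by rewrite -[a *: u]addr0 h// ip0l// addr0.
Qed.

Lemma ipBl u v w : V u -> V v -> V w -> ip (u - v) w = ip u w - ip v w.
Proof.
move=> Vu Vv Vw; rewrite -scaleN1r ipDl//; last exact: subspaceZ.
by rewrite ipZl// mulN1r.
Qed.

Lemma ipDr u v w : V u -> V v -> V w -> ip w (u + v) = ip w u + ip w v.
Proof.
move=> Vu Vv Vw; rewrite ipC ?ipDl//; last exact: subspaceD.
by rewrite (ipC Vu)// (ipC Vv).
Qed.

Lemma ipZr a u w : V u -> V w -> ip w (a *: u) = a * ip w u.
Proof.
move=> Vu Vw; rewrite ipC ?ipZl//; last exact: subspaceZ.
by rewrite (ipC Vu).
Qed.

Lemma ipBr u v w : V u -> V v -> V w -> ip w (u - v) = ip w u - ip w v.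
Proof.
move=> Vu Vv Vw; rewrite ipC ?ipBl//; last exact: subspaceB.
by rewrite (ipC Vu)// (ipC Vv).
Qed.

Lemma ip_sqrD a u v : V u -> V v ->
  ip (a *: u + v) (a *: u + v) = a ^+ 2 * ip u u + 2 * a * ip u v + ip v v.
Proof.
move=> Vu Vv; have Vau : V (a *: u) by exact: subspaceZ.
have VD := subspaceD sV Vau Vv.
rewrite ipDl// !ipDr// !ipZl// !ipZr// (ipC Vv Vu); ring.
Qed.

Lemma ip_sqrB u v : V u -> V v ->
  ip (u - v) (u - v) = ip u u - 2 * ip u v + ip v v.
Proof.
move=> Vu Vv; rewrite addrC -scaleN1r ip_sqrD// (ipC Vv Vu); ring.
Qed.

Lemma ip_subC u v : V u -> V v -> ip (u - v) (u - v) = ip (v - u) (v - u).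
Proof. by move=> Vu Vv; rewrite !ip_sqrB// (ipC Vv Vu); ring. Qed.

Lemma ip_sqr_le u v : V u -> V v -> ip u v ^+ 2 <= ip u u * ip v v.
Proof.
move=> Vu Vv; have Pu := ip_ge0 Vu; have Pv := ip_ge0 Vv.
have h a : 0 <= a ^+ 2 * ip u u + 2 * a * ip u v + ip v v.
  by rewrite -ip_sqrD//; apply: ip_ge0; apply: subspaceD => //; exact: subspaceZ.
have [u0|u0] := eqVneq (ip u u) 0.
  have [->|c0] := eqVneq (ip u v) 0; first by rewrite expr0n /= mulr_ge0.
  (* With [ip u u = 0] the quadratic in [a] is affine; this [a] gives it the value -1, which is
     absurd. *)
  have := h (- (ip v v + 1) / (2 * ip u v)).
  rewrite u0 mulr0 add0r [X in _ <= X + _](_ : _ = - (ip v v + 1)); first lra.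
  by field.
have {}u0 : 0 < ip u u by rewrite lt0r u0.
have := h (- ip u v / ip u u).
rewrite [X in _ <= X](_ : _ = (ip u u * ip v v - ip u v ^+ 2) / ip u u).
  by rewrite pmulr_lge0 ?invr_gt0//; lra.
by field; rewrite gt_eqF.
Qed.

Lemma ip_le u v : V u -> V v -> `|ip u v| <= Num.sqrt (ip u u) * Num.sqrt (ip v v).
Proof.
move=> Vu Vv; rewrite -sqrtrM ?ip_ge0// -sqrtr_sqr.
by rewrite ler_sqrt ?ip_sqr_le// mulr_ge0 ?ip_ge0.
Qed.

Lemma ip_sqrt_leD u v : V u -> V v ->
  Num.sqrt (ip (u + v) (u + v)) <= Num.sqrt (ip u u) + Num.sqrt (ip v v).
Proof.
move=> Vu Vv; have VD := subspaceD sV Vu Vv.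
rewrite -(@ler_pXn2r _ 2) ?nnegrE ?addr_ge0// sqr_sqrtr ?ip_ge0//.
have := ip_sqrD 1 Vu Vv; rewrite scale1r => ->.
rewrite sqrrD !sqr_sqrtr ?ip_ge0//.
have := le_trans (ler_norm _) (ip_le Vu Vv); lra.
Qed.

Lemma ip_leD2 u v : V u -> V v ->
  ip (u + v) (u + v) <= 2 * ip u u + 2 * ip v v.
Proof.
move=> Vu Vv; have := ip_ge0 (subspaceB sV Vu Vv); rewrite ip_sqrB//.
by have := ip_sqrD 1 Vu Vv; rewrite scale1r => ->; lra.
Qed.

Hypothesis cip : ip_complete V ip.

(** [M] need not be closed: [p] is the limit of a minimising sequence, so it lies in the closure of
    [M] and only its approximations belong to [M]. *)
Lemma ip_projection (M : set E) v : subspace M -> M `<=` V -> V v ->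
  exists p, [/\ V p, forall e, 0 < e -> exists2 m, M m & ip (p - m) (p - m) < e
    & forall m, M m -> ip (v - p) m = 0].
Proof.
move=> sM MV Vv; have [M0 _] := sM.
pose q m := ip (v - m) (v - m).
have q0 m : M m -> 0 <= q m.
  by move=> Mm; apply: ip_ge0; apply: subspaceB => //; exact: MV.
pose d := inf [set q m | m in M].
have hinf : has_inf [set q m | m in M].
  by split; [exists (q 0), 0 | exists 0 => _ [m Mm <-]; exact: q0].
have dq m : M m -> d <= q m.
  by move=> Mm; apply: ge_inf; [case: hinf | exists m].
have /choice[u hu] : forall k : nat, exists m, M m /\ q m < d + k.+1%:R^-1.
  move=> k; have k0 : 0 < k.+1%:R^-1 :> R by rewrite invr_gt0.
  by have [_ [m Mm <-] lt] := inf_adherent k0 hinf; exists m.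
have Vu k : V (u k) by apply: MV; case: (hu k).
have Vvu k : V (v - u k) by exact: subspaceB.
have small e : 0 < e -> exists N : nat, forall k, (N <= k)%N -> q (u k) < d + e.
  move=> e0; have [N1] := ltr_add_invr e0; rewrite add0r => Ne.
  exists N1 => k Nk; have [_ /lt_trans] := hu k; apply.
  rewrite ltrD2l; apply: le_lt_trans Ne; rewrite lef_pV2 ?posrE//.
  by rewrite ler_nat ltnS.
(* The midpoint of [u i] and [u j] lies in [M], so its squared distance to [v] is at least [d]; the
   parallelogram identity then bounds [u i - u j]. *)
have cauchy i j : ip (u i - u j) (u i - u j) <= 2 * (q (u i) - d) + 2 * (q (u j) - d).
  have Mm : M (2^-1 *: (u i + u j)).
    apply: subspaceZ => //; apply: subspaceD => //; by [case: (hu i)|case: (hu j)].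
  have := dq _ Mm.
  have -> : q (2^-1 *: (u i + u j)) = 4^-1 * (q (u i) + q (u j)) + 2^-1 * ip (v - u i) (v - u j).
    rewrite /q; have -> : v - 2^-1 *: (u i + u j) = 2^-1 *: (v - u i) + 2^-1 *: (v - u j).
      rewrite -scalerDr addrACA -opprD scalerBr; congr (_ - _).
      by rewrite scalerDr -scalerDl (_ : 2^-1 + 2^-1 = 1) ?scale1r//; field.
    rewrite ip_sqrD ?ipZr ?ipZl//; [by field| exact: subspaceZ..].
  have -> : u i - u j = (v - u j) - (v - u i).
    by rewrite opprB [RHS]addrC addrA subrK.
  rewrite ip_sqrB// (ipC (Vvu j) (Vvu i)) /q; lra.
have [||p Vp hp] := cip (u := u) => //.
  move=> e e0; have e4 : 0 < e / 4 by lra.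
  have [N hN] := small _ e4; exists N => i j /hN hi /hN hj.
  apply: le_lt_trans (cauchy _ _) _; lra.
have Vvp : V (v - p) by exact: subspaceB.
exists p; split => //.
  move=> e /hp[N hN]; exists (u N); first by case: (hu N).
  have -> : p - u N = (-1) *: (u N - p) by rewrite scaleN1r opprB.
  have VN : V (u N - p) by exact: subspaceB.
  rewrite ipZl ?ipZr//; last exact: subspaceZ.
  by rewrite mulrA mulrNN mul1r mul1r; exact: hN.
move=> m Mm; have Vm := MV _ Mm; set c := ip (v - p) m.
have key k t : 2 * t * ip (v - u k) m <= q (u k) - d + t ^+ 2 * ip m m.
  have Mk : M (t *: m + u k) by apply: subspaceD => //; [exact: subspaceZ|case: (hu k)].
  have := dq _ Mk; rewrite /q.
  have -> : v - (t *: m + u k) = (- t) *: m + (v - u k).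
    by rewrite opprD scaleNr addrCA.
  rewrite ip_sqrD// (ipC Vm)// sqrrN; lra.
(* Along the minimising sequence the defect [q (u k) - d] disappears. What remains is linear in [t]
   on the left and quadratic on the right, so [c] must vanish. *)
have lim t : 2 * t * c <= t ^+ 2 * ip m m.
  apply/ler_addgt0Pr => e e0.
  pose K := ip m m + 1; have K0 : 0 < K by rewrite ltr_wpDl// ip_ge0.
  pose del := e / (4 * (`|t| + 1)).
  have t1 : 0 < `|t| + 1 by rewrite ltr_wpDl.
  have del0 : 0 < del by rewrite divr_gt0// mulr_gt0.
  have e2 : 0 < e / 2 by lra.
  have d2 : 0 < del ^+ 2 / K by rewrite divr_gt0// exprn_gt0.
  have [N1 h1] := hp _ d2; have [N2 h2] := small _ e2.
  have {}h1 := h1 _ (leq_maxl N1 N2); have {}h2 := h2 _ (leq_maxr N1 N2).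
  set k := maxn N1 N2 in h1 h2.
  have Vkp : V (u k - p) by exact: subspaceB.
  have cE : c = ip (v - u k) m + ip (u k - p) m.
    by rewrite -ipDl// subrKA.
  have : ip (u k - p) m ^+ 2 <= del ^+ 2.
    apply: le_trans (ip_sqr_le Vkp Vm) _.
    apply: le_trans (_ : (del ^+ 2 / K) * K <= _); last by rewrite divfK ?gt_eqF.
    apply: ler_pM => //; rewrite ?ip_ge0//; first exact: ltW.
    by rewrite /K lerDl.
  rewrite -[X in X <= _]real_normK ?num_real// ler_pXn2r ?nnegrE ?(ltW del0)// => hd.
  have : 2 * t * ip (u k - p) m <= e / 2.
    apply: le_trans (ler_norm _) _; rewrite normrM normrM (ger0_norm (ler0n _ 2)).
    apply: le_trans (_ : 2 * (`|t| + 1) * del <= _).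
      by apply: ler_pM; rewrite ?mulr_ge0 ?ler_pM2l ?lerDl.
    by rewrite /del le_eqVlt; apply/orP; left; apply/eqP; field; rewrite gt_eqF.
  have k1 := key k t; rewrite cE mulrDr; lra.
have Pm := ip_ge0 Vm.
apply/eqP/contraT => c0.
have c2 : 0 < c ^+ 2 by rewrite exprn_even_gt0.
(* Adding 1 keeps the divisor positive when [ip m m = 0]. *)
have := lim (c / (ip m m + 1)).
have K0 : 0 < ip m m + 1 by rewrite ltr_wpDl.
rewrite [leLHS](_ : _ = 2 * (c ^+ 2 / (ip m m + 1))); last first.
  by field; rewrite gt_eqF.
rewrite [leRHS](_ : _ = c ^+ 2 / (ip m m + 1) * (ip m m / (ip m m + 1))); last first.
  by field; rewrite gt_eqF.
rewrite (mulrC 2) ler_pM2l ?divr_gt0//.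
by rewrite ler_pdivlMr//; lra.
Qed.

(** The projection residual is orthogonal to [M], hence null by hypothesis; elements of [M] near the
    projection are therefore near [v] itself. *)
Lemma ip_dense (M : set E) v : subspace M -> M `<=` V -> V v ->
  (forall w, V w -> (forall m, M m -> ip w m = 0) -> ip w w = 0) ->
  forall e, 0 < e -> exists2 m, M m & ip (v - m) (v - m) < e.
Proof.
move=> sM MV Vv tot e e0; have [p [Vp hp ort]] := ip_projection sM MV Vv.
have Vvp : V (v - p) by exact: subspaceB.
have z := tot _ Vvp ort.
have [m Mm lt] := hp _ e0; exists m => //; have Vm := MV _ Mm.
have Vpm : V (p - m) by exact: subspaceB.
have -> : v - m = 1 *: (v - p) + (p - m) by rewrite scale1r subrKA.
rewrite ip_sqrD// z.
have -> : ip (v - p) (p - m) = 0.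
  have := ip_sqr_le Vvp Vpm; rewrite z mul0r => h.
  by apply/eqP; rewrite -sqrf_eq0 eq_le h sqr_ge0.
by rewrite !mulr0 !add0r.
Qed.

Lemma ip_riesz (l : E -> R) C :
  (forall a v w, V v -> V w -> l (a *: v + w) = a * l v + l w) ->
  (forall v, V v -> `|l v| <= C * Num.sqrt (ip v v)) ->
  exists2 w, V w & forall v, V v -> l v = ip w v.
Proof.
move=> lin bnd; have [V0 _] := sV.
have l0 : l 0 = 0 by have := lin 1 0 0 V0 V0; rewrite scale1r addr0; lra.
have lZ a v : V v -> l (a *: v) = a * l v.
  by move=> Vv; rewrite -[a *: v]addr0 lin// l0 addr0.
have [[v Vv lv]|none] := pselect (exists2 v, V v & l v != 0); last first.
  exists 0 => // v Vv; rewrite ip0l//; apply/eqP/contraT => lv.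
  by exfalso; apply: none; exists v.
pose M := [set m | V m /\ l m = 0].
have sM : subspace M.
  split; first by [].
  by move=> a x y [Vx lx] [Vy ly]; split; [case: sV => _; exact|rewrite lin// lx ly mulr0 addr0].
have MV : M `<=` V by move=> x [].
have [p [Vp hp ort]] := ip_projection sM MV Vv.
(* The projection is only a limit of elements of the kernel [M]; the bound on [l] carries the
   vanishing to the limit. *)
have lp : l p = 0.
  apply/eqP; rewrite -normr_le0; apply/ler_addgt0Pr => e e0; rewrite add0r.
  have C1 : 0 < `|C| + 1 by rewrite ltr_wpDl.
  have [m [Vm lm] lt] := hp _ (exprn_gt0 2 (divr_gt0 e0 C1)).
  have Vpm : V (p - m) by exact: subspaceB.
  have -> : l p = l (p - m) by rewrite addrC -scaleN1r lin// lm mulr0 add0r.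
  apply: le_trans (bnd _ Vpm) _.
  apply: le_trans (_ : (`|C| + 1) * (e / (`|C| + 1)) <= _); last first.
    by rewrite mulrC divfK// gt_eqF.
  apply: le_trans (ler_wpM2r (sqrtr_ge0 _) (_ : _ <= `|C| + 1)) _.
    by rewrite (le_trans (ler_norm _))// lerDl.
  rewrite ler_pM2l//.
  rewrite -(ger0_norm (ltW (divr_gt0 e0 C1))) -sqrtr_sqr ler_sqrt; last exact: ltW (exprn_gt0 _ (divr_gt0 e0 C1)).
  exact: ltW.
pose r := v - p; have Vr : V r by exact: subspaceB.
have lr : l r = l v by rewrite /r addrC -scaleN1r lin// lp mulr0 add0r.
have rr : 0 < ip r r.
  rewrite lt0r ip_ge0// andbT; apply: contra lv => /eqP r0.
  by have := bnd _ Vr; rewrite r0 sqrtr0 mulr0 normr_le0 lr.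
(* [r] is orthogonal to the kernel, and every [y] differs from a multiple of [r] by an element of
   the kernel; the factor normalises the value at [r]. *)
exists ((l v / ip r r) *: r); first exact: subspaceZ.
move=> y Vy; have My : M (y - (l y / l v) *: r).
  have Vs : V ((l y / l v) *: r) by exact: subspaceZ.
  split; first exact: subspaceB.
  by rewrite addrC -scaleN1r lin// lZ// lr divfK// mulN1r addNr.
have Vs : V ((l y / l v) *: r) by exact: subspaceZ.
have := ort _ My; rewrite -/r ipBr// ipZr// => /eqP; rewrite subr_eq0 => /eqP ry.
rewrite ipZl// ry; field; by rewrite lv gt_eqF.
Qed.

End theory.
End semi_inner_product.

(** * Integrable and square integrable functions *)

Section L1.
Context d {X : measurableType d} {R : realType}.
Variables (mu : {measure set X -> \bar R}) (D : set X).
Hypothesis mD : measurable D.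
Implicit Types f g h : X -> R.

Definition L1 f := mu.-integrable D (EFin \o f).

Lemma L1_measurable f : L1 f -> measurable_fun D f.
Proof. by move=> /measurable_int/measurable_EFinP. Qed.

Lemma L1_ge0P f : measurable_fun D f -> (forall x, D x -> 0 <= f x) ->
  (\int[mu]_(x in D) (f x)%:E < +oo)%E -> L1 f.
Proof.
move=> mf f0 foo; apply/integrableP; split; first exact/measurable_EFinP.
rewrite (eq_integral (fun x => (f x)%:E))//= => x /set_mem Dx.
by rewrite /= ger0_norm// f0.
Qed.

Lemma L1_lin a f g : L1 f -> L1 g -> L1 (fun x => a * f x + g x).
Proof.
move=> If Ig; rewrite /L1 (_ : _ \o _ =
  (fun x => a%:E * (EFin \o f) x)%E \+ (EFin \o g))%E//.
by apply: integrableD => //; exact: integrableZl.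
Qed.

Lemma L1D f g : L1 f -> L1 g -> L1 (fun x => f x + g x).
Proof. by move=> If /(L1_lin 1 If); under eq_fun do rewrite mul1r. Qed.

Lemma L1Z a f : L1 f -> L1 (fun x => a * f x).
Proof.
move=> If; rewrite /L1 (_ : _ \o _ = (fun x => a%:E * (EFin \o f) x)%E)//.
exact: integrableZl.
Qed.

Lemma L1B f g : L1 f -> L1 g -> L1 (fun x => f x - g x).
Proof.
move=> If Ig; have := L1_lin (-1) Ig If.
by under eq_fun do rewrite mulN1r addrC.
Qed.

Lemma L1_sum (I : Type) (s : seq I) (F : I -> X -> R) :
  (forall i, L1 (F i)) -> L1 (fun x => \sum_(i <- s) F i x).
Proof.
move=> IF; elim: s => [|i s IH].
  under eq_fun do rewrite big_nil; rewrite /L1.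
  exact: (@integrable0 _ X R mu D).
by under eq_fun do rewrite big_cons; exact: L1D.
Qed.

Lemma L1_le f g : measurable_fun D f -> L1 g ->
  (forall x, D x -> `|f x| <= g x) -> L1 f.
Proof.
move=> mf Ig fg; apply: le_integrable Ig => //; first exact/measurable_EFinP.
move=> x Dx /=; rewrite lee_fin (le_trans (fg _ Dx))//.
by rewrite ger0_norm// (le_trans _ (fg _ Dx)).
Qed.

Lemma L1_abs f : L1 f -> L1 (fun x => `|f x|).
Proof. exact: integrable_norm. Qed.

Lemma ae_eq_Rintegral f g : measurable_fun D f -> measurable_fun D g ->
  {ae mu, forall x, D x -> f x = g x} ->
  \int[mu]_(x in D) f x = \int[mu]_(x in D) g x.
Proof.
move=> mf mg fg; congr fine; apply: ae_eq_integral => //.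
- exact/measurable_EFinP.
- exact/measurable_EFinP.
- by apply: filterS fg => x + Dx => /(_ Dx) ->.
Qed.

Lemma L1_ae f g : L1 f -> measurable_fun D g ->
  {ae mu, forall x, D x -> f x = g x} -> L1 g.
Proof.
move=> If mg fg; apply/integrableP; split; first exact/measurable_EFinP.
have /integrableP[_] := If; congr (_ < _)%E.
apply: ae_eq_integral => //.
- by apply: measurableT_comp => //; exact: measurable_int If.
- by apply: measurableT_comp => //; exact/measurable_EFinP.
- by apply: filterS fg => x + Dx => /(_ Dx) /= ->.
Qed.

Lemma ae_le_Rintegral f g : L1 f -> L1 g ->
  {ae mu, forall x, D x -> f x <= g x} ->
  \int[mu]_(x in D) f x <= \int[mu]_(x in D) g x.
Proof.
move=> If Ig fg; have mf := L1_measurable If; have mg := L1_measurable Ig.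
(* The maximum equals [g] almost everywhere and dominates [f] at every point. *)
rewrite (@ae_eq_Rintegral g (fun x => Num.max (f x) (g x)))//; last 2 first.
- exact: measurable_maxr.
- by apply: filterS fg => x + Dx => /(_ Dx) /max_idPr ->.
apply: le_Rintegral => //; last by move=> x _; rewrite le_max lexx.
apply: (L1_ae Ig); first exact: measurable_maxr.
by apply: filterS fg => x + Dx => /(_ Dx) /max_idPr ->.
Qed.

Lemma ae_Rintegral_ge0 f : L1 f -> {ae mu, forall x, D x -> 0 <= f x} ->
  0 <= \int[mu]_(x in D) f x.
Proof.
move=> If f0; have I0 : L1 (fun=> 0) by have := L1Z 0 If; under eq_fun do rewrite mul0r.
have := ae_le_Rintegral I0 If f0.
by rewrite [X in X <= _]Rintegral_cst// mul0r.
Qed.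

Lemma Rintegral_eq0_ae f : L1 f -> (forall x, D x -> 0 <= f x) ->
  \int[mu]_(x in D) f x = 0 -> {ae mu, forall x, D x -> f x = 0}.
Proof.
move=> If f0 i0; have mf := L1_measurable If.
have : ae_eq mu D (EFin \o f) (cst 0%E).
  apply/ae_eq_integral_abs => //; first exact/measurable_EFinP.
  rewrite -[RHS](_ : (\int[mu]_(x in D) f x)%:E = 0%E); last by rewrite i0.
  rewrite fineK; last exact: integrable_fin_num.
  by apply: eq_integral => x /set_mem Dx; rewrite /= ger0_norm// f0.
by apply: filterS => x /[apply] /= -[].
Qed.

Lemma Rdominated_cvg (f_ : nat -> X -> R) f g :
  (forall k, measurable_fun D (f_ k)) ->
  (forall x, D x -> f_ ^~ x @ \oo --> f x) -> L1 g ->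
  (forall k x, D x -> `|f_ k x| <= g x) ->
  (fun k => \int[mu]_(x in D) f_ k x) @ \oo --> \int[mu]_(x in D) f x.
Proof.
move=> mf_ f_f Ig fg; have mf : measurable_fun D f by exact: measurable_fun_cvg f_f.
have [|||||If _ cv] := @dominated_convergence _ X R mu D mD
  (fun k => EFin \o f_ k) (EFin \o f) (EFin \o g).
- by move=> k; exact/measurable_EFinP.
- exact/measurable_EFinP.
- by apply: aeW => x /f_f h; apply/fine_cvgP; split; [exact: nearW|].
- exact: Ig.
- by apply: aeW => x k Dx; rewrite /= lee_fin fg.
have := fine_cvg; move: cv; rewrite -[X in _ --> X]fineK; last exact: integrable_fin_num.
by move=> /fine_cvgP[_].
Qed.

End L1.

Section L2.
Context d {X : measurableType d} {R : realType}.
Variables (mu : {measure set X -> \bar R}) (D : set X).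
Hypothesis mD : measurable D.
Implicit Types f g h : X -> R.

Notation L2 := (L2 mu D).

Lemma L2P f : L2 f <-> measurable_fun D f /\ L1 mu D (fun x => f x ^+ 2).
Proof.
have e : (fun x => (f \_ D) x ^+ 2) = (fun x => f x ^+ 2) \_ D.
  by apply/funext => x; rewrite /patch; case: ifP => //; rewrite expr0n.
rewrite /Defs.L2; split.
  move=> l2; have := Lfun2_integrable_sqr l2; rewrite e.
  move: l2; rewrite inE => /andP[/set_mem mf _].
  move=> /= h; split; first exact/measurable_restrictT.
  apply/(integrable_mkcond _ mD); move: h; congr (_.-integrable _ _).
  by apply/funext => x; rewrite /patch /=; case: ifP.
move=> [mf If]; rewrite inE; apply/andP; split; apply/mem_set.
  exact/(measurable_restrictT _ mD).
rewrite /= /finite_norm unlock /=; apply: poweR_lty.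
have /(integrable_mkcond _ mD)/integrableP[_] := If.
congr (_ < _)%E; apply: eq_integral => x _ /=.
rewrite /patch; case: ifP => _ /=; last by rewrite normr0 powR0.
by rewrite powR_mulrn// normrX.
Qed.

Lemma L2_measurable f : L2 f -> measurable_fun D f.
Proof. by move=> /L2P[]. Qed.

Lemma L2_sqr f : L2 f -> L1 mu D (fun x => f x ^+ 2).
Proof. by move=> /L2P[]. Qed.

Lemma L2M f g : L2 f -> L2 g -> L1 mu D (fun x => f x * g x).
Proof.
move=> /L2P[mf If] /L2P[mg Ig].
apply: (L1_le _ _ (L1D mD If Ig)) => //; first exact: measurable_funM.
move=> x _; rewrite normrM -[X in _ <= X + _]real_normK ?num_real//.
rewrite -[X in _ <= _ + X]real_normK ?num_real//; nra.
Qed.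

Lemma L2_lin a f g : L2 f -> L2 g -> L2 (fun x => a * f x + g x).
Proof.
move=> f2 g2; have fg := L2M f2 g2.
move/L2P : f2 => [mf If]; move/L2P : g2 => [mg Ig]; apply/L2P; split.
  by apply: measurable_funD => //; exact: measurable_funM.
have := L1_lin mD (a ^+ 2) If (L1_lin mD (2 * a) fg Ig).
by congr (L1 _ _ _); apply/funext => x; ring.
Qed.

Lemma L2_0 : L2 (fun=> 0).
Proof.
apply/L2P; split; first exact: measurable_cst.
under eq_fun do rewrite expr0n; exact: (@integrable0 _ X R mu D).
Qed.

Lemma L2Z a f : L2 f -> L2 (fun x => a * f x).
Proof. by move=> f2; have := L2_lin a f2 L2_0; under eq_fun do rewrite addr0. Qed.

Lemma L2D f g : L2 f -> L2 g -> L2 (fun x => f x + g x).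
Proof. by move=> f2 /(L2_lin 1 f2); under eq_fun do rewrite mul1r. Qed.

Lemma L2B f g : L2 f -> L2 g -> L2 (fun x => f x - g x).
Proof.
move=> f2 g2; have := L2_lin (-1) g2 f2.
by under eq_fun do rewrite mulN1r addrC.
Qed.

Lemma L2_le f g : measurable_fun D f -> L2 g ->
  (forall x, D x -> `|f x| <= `|g x|) -> L2 f.
Proof.
move=> mf /L2P[mg Ig] fg; apply/L2P; split => //.
apply: (L1_le mD _ Ig); first exact: measurable_funX.
move=> x Dx; rewrite normrX -[leRHS]real_normK ?num_real//.
by rewrite ler_pXn2r ?nnegrE// fg.
Qed.

Lemma L2_bounded C (b f : X -> R) : measurable_fun D b -> (forall x, D x -> `|b x| <= C) ->
  L2 f -> L2 (fun x => b x * f x).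
Proof.
move=> mb bC f2; apply: (@L2_le _ (fun x => C * f x)); last 2 first.
- exact: L2Z.
- move=> x Dx; rewrite !normrM ler_wpM2r// (le_trans (bC _ Dx))// ler_norm//.
by apply: measurable_funM => //; exact: L2_measurable.
Qed.

Lemma L2_ae f g : L2 f -> measurable_fun D g ->
  {ae mu, forall x, D x -> f x = g x} -> L2 g.
Proof.
move=> /L2P[mf If] mg fg; apply/L2P; split => //.
apply: (L1_ae mD If); first exact: measurable_funX.
by apply: filterS fg => x /[apply] ->.
Qed.

Lemma L2_bnd (C : R) f : (mu D < +oo)%E -> measurable_fun D f ->
  (forall x, D x -> `|f x| <= C) -> L2 f.
Proof.
move=> Doo mf fC.
have c2 : L2 (fun=> C).
  apply/L2P; split => //; apply: L1_ge0P => //; first by move=> x _; exact: sqr_ge0.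
  by rewrite integral_cst// lte_mul_pinfty// lee_fin sqr_ge0.
apply: (L2_le mf c2) => x Dx; exact: le_trans (fC _ Dx) (ler_norm _).
Qed.

Lemma L1_finite_L2 f : (mu D < +oo)%E -> L2 f -> L1 mu D f.
Proof.
move=> Doo f2; have c2 : L2 (fun=> 1).
  by apply: (@L2_bnd 1 (fun=> 1)) => // x _; rewrite normr1.
by have := L2M f2 c2; under eq_fun do rewrite mulr1.
Qed.

Definition ipL f g := \int[mu]_(x in D) (f x * g x).

Lemma ipL_semi : semi_ip (L2 : set (X -> R)) ipL.
Proof.
split.
- by split; [exact: L2_0|move=> a f g; exact: L2_lin].
- by move=> f g _ _; apply: eq_Rintegral => x _; rewrite mulrC.
- move=> a f g h f2 g2 h2; rewrite /ipL -RintegralZl//; last exact: L2M.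
  rewrite -RintegralD//; [|exact: L1Z (L2M _ _)|exact: L2M].
  by apply: eq_Rintegral => x _; rewrite mulrDl mulrA.
- by move=> f f2; apply: Rintegral_ge0 => x _; rewrite -expr2 sqr_ge0.
Qed.

Lemma L2normE f : L2 f -> L2norm mu D f = Num.sqrt (ipL f f).
Proof.
move=> /L2P[mf If]; rewrite /L2norm unlock /=.
have -> : (\int[mu]_x `|((f \_ D) x)%:E| `^ 2 = \int[mu]_(x in D) (f x ^+ 2)%:E)%E.
  rewrite [RHS]integral_mkcond; apply: eq_integral => x _ /=.
  rewrite /patch; case: ifP => _ /=; last by rewrite normr0 powR0.
  by rewrite powR_mulrn// real_normK ?num_real.
rewrite -(fineK (integrable_fin_num mD If)) /= powR12_sqrt; last first.
  by apply: Rintegral_ge0 => x _; rewrite sqr_ge0.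
by rewrite /ipL; under [in RHS]eq_Rintegral do rewrite -expr2.
Qed.

Lemma L2norm_sqr f : L2 f -> L2norm mu D f ^+ 2 = ipL f f.
Proof. by move=> f2; rewrite L2normE// sqr_sqrtr// (ip_ge0 ipL_semi). Qed.

Lemma L2norm_ge0 f : L2 f -> 0 <= L2norm mu D f.
Proof. by move=> f2; rewrite L2normE. Qed.

Lemma L2_eq0_ipL f : L2 f -> {ae mu, forall x, D x -> f x = 0} -> ipL f f = 0.
Proof.
move=> f2 f0; transitivity (\int[mu]_(x in D) 0); last by rewrite Rintegral_cst// mul0r.
apply: ae_eq_Rintegral => //; first exact: (L1_measurable (L2M f2 f2)).
by apply: filterS f0 => x h Dx; rewrite h// mul0r.
Qed.

Lemma ipL_eq0 f : L2 f -> ipL f f = 0 -> {ae mu, forall x, D x -> f x = 0}.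
Proof.
move=> f2 f0; have := @Rintegral_eq0_ae _ X R mu D mD (fun x => f x ^+ 2) (L2_sqr f2).
case.
- by move=> x _; exact: sqr_ge0.
- by rewrite -[RHS]f0; apply: eq_Rintegral => x _; rewrite expr2.
- move=> N [mN N0 sub]; exists N; split => // x /= h; apply: sub => /= h'.
  by apply: h => Dx; apply/eqP; rewrite -sqrf_eq0; apply/eqP; exact: h'.
Qed.

Lemma ipL_ae f f' g g' : L2 f -> L2 f' -> L2 g -> L2 g' ->
  {ae mu, forall x, D x -> f x = f' x} -> {ae mu, forall x, D x -> g x = g' x} ->
  ipL f g = ipL f' g'.
Proof.
move=> f2 f2' g2 g2' e e'; apply: ae_eq_Rintegral => //.
- exact: L1_measurable (L2M f2 g2).
- exact: L1_measurable (L2M f2' g2').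
- by apply: filterS2 e e' => x h h' Dx; rewrite h// h'.
Qed.

(** The intervals with centre [w k] and radius [2 * C * 2^-1 ^+ k] are nested, because the radius is
    the tail of the geometric series from [k] on; the limit is the supremum of the left end
    points. *)
Lemma geometric_cvg (w : nat -> R) C : (forall k, `|w k.+1 - w k| <= C * 2^-1 ^+ k) ->
  exists l, forall k, `|w k - l| <= 2 * C * 2^-1 ^+ k.
Proof.
move=> hw.
have C0 : 0 <= C by have := hw 0%N; rewrite expr0 mulr1; exact: le_trans.
have step k j : w j - 2 * C * 2^-1 ^+ j <= w (j + k)%N - 2 * C * 2^-1 ^+ (j + k) /\
    w (j + k)%N + 2 * C * 2^-1 ^+ (j + k) <= w j + 2 * C * 2^-1 ^+ j.
  elim: k => [|k [IH1 IH2]]; first by rewrite addn0.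
  rewrite addnS; have := hw (j + k)%N; rewrite ler_norml exprS => /andP[h1 h2].
  by split; lra.
have cross i j : w i - 2 * C * 2^-1 ^+ i <= w j + 2 * C * 2^-1 ^+ j.
  have p k : 0 <= 2 * C * 2^-1 ^+ k by rewrite mulr_ge0 ?mulr_ge0 ?exprn_ge0.
  have [ij|/ltnW ij] := leqP i j.
    have [+ _] := step (j - i)%N i; rewrite subnKC// => h; have := p j; lra.
  have [_] := step (i - j)%N j; rewrite subnKC// => h; have := p i; lra.
pose A := [set w i - 2 * C * 2^-1 ^+ i | i in [set: nat]].
have hA : has_sup A.
  split; first by exists (w 0%N - 2 * C * 2^-1 ^+ 0), 0%N.
  by exists (w 0%N + 2 * C * 2^-1 ^+ 0) => _ [i _ <-]; exact: cross.
exists (sup A) => k; rewrite ler_norml; apply/andP; split.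
  have : sup A <= w k + 2 * C * 2^-1 ^+ k.
    by apply: ge_sup; [case: hA|move=> _ [i _ <-]; exact: cross].
  lra.
have : w k - 2 * C * 2^-1 ^+ k <= sup A.
  by apply: ub_le_sup; [case: hA|exists k].
lra.
Qed.

(** Riesz-Fischer: a fast subsequence converges pointwise wherever a weighted series of its squared
    increments is finite, and the pointwise rate gives the rate in norm. *)
Lemma ipL_complete : ip_complete (L2 : set (X -> R)) ipL.
Proof.
move=> u u2 cau.
have e8 k : 0 < 8^-1 ^+ k :> R by rewrite exprn_gt0.
have /choice[N hN] : forall k, exists N, forall i j, (N <= i)%N -> (N <= j)%N ->
  ipL (u i - u j) (u i - u j) < 8^-1 ^+ k by move=> k; exact: cau.
(* For [k <= i] the index [n i] dominates [N k]. *)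
pose n k := (k + \sum_(i < k.+1) N i)%N.
have nN k i : (k <= i)%N -> (N k <= n i)%N.
  by move=> ki; rewrite /n (bigD1 (Ordinal (ki : (k < i.+1)%N)))//= addnCA leq_addr.
pose w k := u (n k); have w2 k : L2 (w k) by exact: u2.
pose del k x := w k.+1 x - w k x.
have del2 k : L2 (del k) by exact: L2B.
have dip k : ipL (del k) (del k) < 8^-1 ^+ k.
  by apply: hN; apply: nN.
(* The weight [4 ^+ k] against the bound [8^-1 ^+ k] leaves the summable [2^-1 ^+ k], and it turns
   finiteness of the series at a point into geometric decay of the increments there. *)
pose f k x := (4 ^+ k * del k x ^+ 2)%:E.
have f0 k x : (0 <= f k x)%E by rewrite lee_fin mulr_ge0 ?sqr_ge0 ?exprn_ge0.
have mf k : measurable_fun D (f k).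
  apply/measurable_EFinP; apply: measurable_funM => //.
  by apply: measurable_funX; exact: L2_measurable.
pose g x := (\sum_(k <oo) f k x)%E.
have mg : measurable_fun D g by apply: ge0_emeasurable_sum => // k x _ _.
have intf k : (\int[mu]_(x in D) f k x <= (2^-1 ^+ k)%:E)%E.
  have I1 : L1 mu D (fun x => 4 ^+ k * del k x ^+ 2) by exact: L1Z (L2_sqr _).
  rewrite -(fineK (integrable_fin_num mD I1)) lee_fin.
  rewrite -[X in X <= _]/(\int[mu]_(x in D) (4 ^+ k * del k x ^+ 2)).
  rewrite RintegralZl//; last exact: L2_sqr.
  have -> : \int[mu]_(x in D) del k x ^+ 2 = ipL (del k) (del k).
    by apply: eq_Rintegral => x _; rewrite expr2.
  have -> : (2^-1 : R) ^+ k = 4 ^+ k * 8^-1 ^+ k by rewrite -exprMn; congr (_ ^+ _); field.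
  by rewrite ler_pM2l ?exprn_gt0// ltW.
have intg : (\int[mu]_(x in D) g x <= 2%:E)%E.
  rewrite integral_nneseries//.
  have part K : (\sum_(0 <= k < K) \int[mu]_(x in D) f k x <= (2 - 2 * 2^-1 ^+ K)%:E)%E.
    elim: K => [|K IH]; first by rewrite big_nil expr0 mulr1 subrr.
    rewrite big_nat_recr//=; apply: le_trans (leeD IH (intf K)) _.
    by rewrite -EFinD lee_fin exprS; lra.
  apply: lime_le; first by apply: is_cvg_nneseries => k _ _; exact: integral_ge0.
  apply: nearW => K; apply: le_trans (part K) _.
  by rewrite lee_fin lerBlDr lerDl mulr_ge0// exprn_ge0.
have g0 x : (0 <= g x)%E by apply: nneseries_ge0 => k _ _; exact: f0.
have Ig : mu.-integrable D g.
  apply/integrableP; split => //.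
  rewrite (eq_integral g); last by move=> x _; rewrite gee0_abs.
  by apply: le_lt_trans intg _; rewrite ltry.
(* Outside [A] the sequence is replaced by 0, so that it converges everywhere on [D] and its limit
   is measurable. *)
pose A := D `&` [set x | (g x < +oo)%E].
have mA : measurable A by apply: emeasurable_fun_infty_o.
pose w' k x := w k x * \1_A x.
have mI : measurable_fun D (\1_A : X -> R) by exact: measurable_indic.
have mw' k : measurable_fun D (w' k).
  by apply: measurable_funM => //; exact: L2_measurable.
have dg x k : A x -> `|del k x| <= Num.sqrt (fine (g x)) * 2^-1 ^+ k.
  move=> [Dx /= goo].
  have : (f k x <= (fine (g x))%:E)%E.
    rewrite fineK ?ge0_fin_numE// /g (@nneseriesD1 _ (f^~ x) k xpredT)//= leeDl//.
    by apply: nneseries_ge0 => ? _ _; exact: f0.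
  rewrite lee_fin => fg.
  rewrite -(@ler_pXn2r _ 2)// ?nnegrE ?mulr_ge0 ?exprn_ge0// real_normK ?num_real//.
  rewrite exprMn sqr_sqrtr ?fine_ge0// -exprM mulnC exprM.
  have -> : ((2^-1 : R) ^+ 2) ^+ k = (4 ^+ k)^-1 by rewrite -exprVn; congr (_ ^+ _); field.
  by rewrite ler_pdivlMr ?exprn_gt0// mulrC.
have /choice[l hl] : forall x, exists l, forall k, 
    `|w' k x - l| <= 2 * (Num.sqrt (fine (g x)) * \1_A x) * 2^-1 ^+ k.
  move=> x; apply: geometric_cvg => k; rewrite /w' -mulrBl indicE.
  have [/set_mem Ax|_] := boolP (x \in A); last by rewrite !mulr0 normr0 mul0r.
  by rewrite !mulr1; exact: dg.
have cvl x : D x -> w' ^~ x @ \oo --> l x.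
  move=> Dx; apply/cvgrPdist_lt => /= e e0.
  pose C := 2 * (Num.sqrt (fine (g x)) * \1_A x).
  have C0 : 0 <= C by rewrite !mulr_ge0// indicE.
  have : (fun k => C * 2^-1 ^+ k) @ \oo --> C * 0.
    by apply: cvgM; [exact: cvg_cst|apply: cvg_expr; rewrite ger0_norm; lra].
  rewrite mulr0 => /cvgr0_norm_lt /(_ _ e0); apply: filterS => k.
  rewrite ger0_norm ?mulr_ge0 ?exprn_ge0// => h.
  by rewrite distrC; apply: le_lt_trans h; exact: hl.
have ml : measurable_fun D l by exact: measurable_fun_cvg cvl.
have aeA : {ae mu, forall x, D x -> A x}.
  have := integrable_ae mD Ig; apply: filterS => x h Dx; split => //=.
  by rewrite ltey_eq h.
pose r k x := w k x - l x.
have rb k : {ae mu, forall x, D x -> r k x ^+ 2 <= 4 * 4^-1 ^+ k * fine (g x)}.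
  apply: filterS aeA => x /[apply] Ax; have := hl x k.
  rewrite /w' indicE mem_set// !mulr1 => h.
  rewrite -[X in X <= _]real_normK ?num_real//.
  have -> : 4 * 4^-1 ^+ k * fine (g x) = (2 * Num.sqrt (fine (g x)) * 2^-1 ^+ k) ^+ 2.
    rewrite !exprMn sqr_sqrtr ?fine_ge0// -exprM mulnC exprM.
    by rewrite (_ : (2^-1 : R) ^+ 2 = 4^-1); [ring|field].
  by rewrite ler_pXn2r ?nnegrE// mulr_ge0 ?mulr_ge0 ?exprn_ge0.
have mr k : measurable_fun D (r k).
  by apply: measurable_funB => //; exact: L2_measurable.
have Igf : L1 mu D (fun x => fine (g x)).
  apply: L1_ge0P.
  - exact: measurableT_comp.
  - by move=> x _; rewrite fine_ge0.
  - apply: le_lt_trans (_ : _ <= \int[mu]_(x in D) g x)%E _; last first.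
      by apply: le_lt_trans intg _; rewrite ltry.
    apply: ge0_le_integral => //; first by move=> x _; rewrite lee_fin fine_ge0.
      by apply/measurable_EFinP; exact: measurableT_comp.
    move=> x _; have [gx|] := ltP (g x) +oo%E; last by rewrite leye_eq => /eqP ->; rewrite leey.
    by rewrite fineK// ge0_fin_numE.
have r2 k : L2 (r k).
  apply/L2P; split => //.
  have mr2 : measurable_fun D (fun x => r k x ^+ 2) by exact: measurable_funX.
  have I1 := L1Z mD (4 * 4^-1 ^+ k) Igf.
  (* The bound on the square holds only almost everywhere; the minimum satisfies it at every point
     and agrees with the square almost everywhere. *)
  have I2 : L1 mu D (fun x => Num.min (r k x ^+ 2) (4 * 4^-1 ^+ k * fine (g x))).
    apply: (L1_le mD _ I1).
      by apply: measurable_minr => //; exact: L1_measurable I1.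
    move=> x _; rewrite ger0_norm; first by rewrite ge_min lexx orbT.
    by rewrite le_min sqr_ge0 mulr_ge0 ?mulr_ge0 ?exprn_ge0 ?fine_ge0.
  apply: (L1_ae mD I2 mr2); apply: filterS (rb k) => x /[apply] h.
  exact/min_idPl.
have rip k : ipL (r k) (r k) <= 8 * 4^-1 ^+ k.
  have I1 := L1Z mD (4 * 4^-1 ^+ k) Igf.
  apply: le_trans (_ : \int[mu]_(x in D) (4 * 4^-1 ^+ k * fine (g x)) <= _).
    apply: ae_le_Rintegral => //; first exact: L2M.
    by apply: filterS (rb k) => x /[apply]; rewrite expr2.
  rewrite RintegralZl// (_ : 8 * _ = 4 * 4^-1 ^+ k * 2); last by ring.
  rewrite ler_pM2l ?mulr_gt0 ?exprn_gt0//.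
  rewrite -lee_fin; apply: le_trans intg; rewrite fineK; last exact: integrable_fin_num.
  apply: ge0_le_integral => //; first by move=> x _; rewrite lee_fin fine_ge0.
    exact/measurable_EFinP/(L1_measurable Igf).
  move=> x _; have [gx|] := ltP (g x) +oo%E; last by rewrite leye_eq => /eqP ->; rewrite leey.
  by rewrite fineK// ge0_fin_numE.
have l2 : L2 l.
  have := L2B (w2 0%N) (r2 0%N); congr L2; apply/funext => x; rewrite /r; ring.
exists l => // e e0.
have e4 : 0 < e / 4 by lra.
have [M1 hM1] := cau _ e4.
have : (fun k => 8 * 4^-1 ^+ k) @ \oo --> (8 * 0 : R).
  by apply: cvgM; [exact: cvg_cst|apply: cvg_expr; rewrite ger0_norm; lra].
rewrite mulr0 => /cvgr0_norm_lt /(_ _ e4)[M2 _ hM2].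
exists M1 => i Mi; pose k := (M1 + M2)%N.
have h1 : ipL (u i - w k) (u i - w k) < e / 4.
  by apply: hM1 => //; rewrite (leq_trans (leq_addr M2 M1))// leq_addr.
have h2 : ipL (r k) (r k) < e / 4.
  apply: le_lt_trans (rip k) _; have := hM2 k (leq_addl _ _).
  by rewrite ger0_norm// mulr_ge0// exprn_ge0.
have ui2 : L2 (u i - w k) by exact: L2B.
have -> : u i - l = 1 *: (u i - w k) + r k.
  by rewrite scale1r; apply/funext => x; rewrite /r !fctE /=; ring.
move: (u i - w k) ui2 h1 => a a2 h1; rewrite (ip_sqrD ipL_semi)//.
have := ip_ge0 ipL_semi (L2B a2 (r2 k)).
rewrite -[X in ipL X X]/(a - r k) (ip_sqrB ipL_semi)//.
lra.
Qed.

Section pi_system.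
Variables (G : set (set X)).
Hypotheses (setIG : setI_closed G) (mG : measurable = <<s G>>).

(** The sets over which [f] has integral 0 form a lambda-system, so the vanishing spreads from [G]
    to all measurable sets. The whole space has its own hypothesis, as it need not belong to [G]. *)
Lemma ae0_pi_system f : L1 mu D f -> \int[mu]_(x in D) f x = 0 ->
  (forall A, G A -> \int[mu]_(x in D `&` A) f x = 0) ->
  {ae mu, forall x, D x -> f x = 0}.
Proof.
move=> If f0 fG; have mf := L1_measurable If.
have IfS A : measurable A -> mu.-integrable (D `&` A) (EFin \o f).
  by move=> mA; apply: (integrableS mD _ _ If) => //; exact: measurableI.
pose H := [set A | measurable A /\ \int[mu]_(x in D `&` A) f x = 0].
have lamH : lambda_system setT H.
  split => //.
  - by split => //; rewrite setIT.
  - move=> A B BA [mA A0] [mB B0]; split; first exact: measurableD.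
    have : \int[mu]_(x in D `&` A) f x =
        \int[mu]_(x in D `&` B) f x + \int[mu]_(x in D `&` (A `\` B)) f x.
      rewrite -Rintegral_setU.
      + by congr Rintegral; rewrite -setIUr setDUK.
      + exact: measurableI.
      + by apply: measurableI => //; exact: measurableD.
      + by rewrite -setIUr setDUK//; exact: IfS.
      + by apply/disj_setPS => x [[_ Bx] [_ [_ /(_ Bx)]]].
    by rewrite A0 B0 add0r => <-.
  - move=> F ndF HF; have mF k : measurable (F k) by case: (HF k).
    have mU : measurable (\bigcup_k F k) by exact: bigcupT_measurable.
    split => //.
    have cv : (fun k => \int[mu]_(x in D) (f \_ (F k)) x) @ \oo -->
        \int[mu]_(x in D) (f \_ (\bigcup_k F k)) x.
      apply: (Rdominated_cvg (g := fun x => `|f x|) mD) => //.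
      - move=> k; apply/measurable_restrict => //.
        by apply: measurable_funS mf.
      - move=> x Dx; rewrite /patch; case: ifPn => [/set_mem[k _ Fkx]|/negP nU].
          apply: cvg_near_cst; exists k => // j /= kj.
          by rewrite mem_set//; move: x Fkx {Dx}; apply/subsetPset/ndF.
        apply: cvg_near_cst; apply: nearW => k.
        by case: ifPn => // /set_mem Fkx; case: nU; apply/mem_set; exists k.
      - exact: L1_abs.
      - by move=> k x _; rewrite /patch; case: ifP => //; rewrite normr0.
    move: cv; rewrite -Rintegral_mkcondr.
    under eq_fun => k do rewrite -Rintegral_mkcondr (HF k).2.
    by move=> /(cvg_unique _ (cvg_cst 0)) <-.
have GH : G `<=` H.
  by move=> A GA; split; [rewrite mG; exact: sub_sigma_algebra|exact: fG].
have sub : measurable `<=` H.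
  by rewrite mG; exact: lambda_system_subset.
have : ae_eq mu D (EFin \o f) (cst 0%E).
  apply: integral_ae_eq => // E ED mE.
  rewrite [RHS]integral0; have [_] := sub _ mE.
  rewrite setIidr// => h; rewrite -[LHS]fineK.
    by congr EFin; exact: h.
  by apply: integrable_fin_num => //; exact: integrableS If.
by apply: filterS => x /[apply] /= -[].
Qed.

End pi_system.
End L2.

(** * Measurability and translation invariance in row vector spaces *)

Lemma bounded_norm (R : realType) (V : normedModType R) (A : set V) :
  bounded_set A -> exists M, forall x, A x -> `|x| <= M.
Proof. by move=> [M [_ h]]; exists (M + 1); apply: h; rewrite ltrDl. Qed.

Section open_measurable.
Context {R : realType} {n : nat}.

(** The sigma-algebra is generated by the coordinates and not by the topology, so an open set is
    written as a countable union of cubes with rational centre and radius [k.+1%:R^-1]. *)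
Lemma open_prod_measurable (U : set (R * 'rV[R]_n)) :
  open U -> measurable (U : set (measurableTypeR R * 'rV[R]_n)).
Proof.
move=> oU.
pose B (i : rat * 'rV[rat]_n * nat) : set (measurableTypeR R * 'rV[R]_n) :=
  (fun z => z.1) @^-1` ball (ratr i.1.1 : R) i.2.+1%:R^-1 `&`
  \bigcap_(j in [set: 'I_n])
    (fun z : measurableTypeR R * 'rV[R]_n => z.2 ord0 j) @^-1` ball (ratr (i.1.2 ord0 j) : R) i.2.+1%:R^-1.
have mB i : measurable (B i).
  apply: measurableI.
    rewrite -[X in measurable X]setTI.
    exact: (measurable_fst measurableT _ (measurable_ball _ _)).
  apply: fin_bigcap_measurable => // j _.
  rewrite -[X in measurable X]setTI.
  have mj : measurable_fun setT
      (fun z : measurableTypeR R * 'rV[R]_n => z.2 ord0 j).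
    exact: (measurableT_comp (measurable_mx_coord ord0 j) measurable_snd).
  exact: (mj measurableT _ (measurable_ball _ _)).
rewrite (_ : U = \bigcup_i (if `[< B i `<=` U >] then B i else set0)).
  by apply: countable_bigcupT_measurable => // i; case: ifP.
apply/seteqP; split => [z Uz|z [i _]]; last by case: asboolP => // BU /BU.
have /nbhs_ballP[e /= e0 eU] : nbhs z U by exact: open_nbhs_nbhs.
(* A cube of radius below [e / 2] that contains [z] stays in the ball of radius [e]. *)
have [k] := ltr_add_invr (divr_gt0 e0 (ltr0n R 2)); rewrite add0r => ke.
have k0 : 0 < k.+1%:R^-1 :> R by rewrite invr_gt0.
set r := k.+1%:R^-1 in ke k0.
have rat_near (x : R) : exists q : rat, `|ratr q - x| < r.
  have [|q] := @rat_in_itvoo R (x - r) (x + r); first by rewrite ltrBlDr -addrA ltrDl addr_gt0.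
  by rewrite in_itv /= => /andP[h1 h2]; exists q; rewrite ltr_norml; apply/andP; split; lra.
have [q hq] := rat_near z.1.
have /choice[c hc] : forall j, exists q : rat, `|ratr q - z.2 ord0 j| < r.
  by move=> j; exact: rat_near.
pose i := (q, \row_j c j, k).
have BU : B i `<=` U.
  move=> y [/= y1 y2]; apply: eU; split => /=.
    rewrite /ball /= -[_ - _](subrKA (ratr q)).
    apply: le_lt_trans (ler_normD _ _) _; rewrite distrC.
    by move: y1; rewrite /ball /= -/r; move: hq ke; clearbody r; lra.
  split => // a j; rewrite !ord1.
  have := y2 j I; rewrite mxE /ball /= => yj.
  rewrite -[_ - _](subrKA (ratr (c j))).
  apply: le_lt_trans (ler_normD _ _) _; rewrite distrC.
  by move: yj (hc j) ke; rewrite -/r; clearbody r; lra.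
exists i => //; rewrite asboolT//; split => [|j _] /=; rewrite /ball //=.
by rewrite mxE; exact: hc.
Qed.

Lemma open_rV_measurable (U : set 'rV[R]_n) : open U -> measurable U.
Proof.
move=> oU.
have oU' : open ((fun z : R * 'rV[R]_n => z.2) @^-1` U).
  by apply: open_comp => // z _; exact: cvg_snd.
have mp : measurable_fun [set: 'rV[R]_n]
    (fun x => (0, x) : measurableTypeR R * 'rV[R]_n).
  by apply: measurable_fun_pair.
have := mp measurableT _ (open_prod_measurable oU'); rewrite setTI.
by rewrite -comp_preimage.
Qed.

Lemma continuous_prod_measurable (D : set (measurableTypeR R * 'rV[R]_n))
    (f : R * 'rV[R]_n -> R) : open (D : set (R * 'rV[R]_n)) ->
  {in D, continuous f} -> measurable_fun D f.
Proof.
move=> oD cf; apply: (measurability _ (RGenOpens.measurableE R)) => _ [_ [a [b ->]] <-].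
apply: open_prod_measurable.
rewrite openE => z [Dz fz].
apply: filterI; first exact: open_nbhs_nbhs.
have /cf := mem_set Dz; apply; apply: open_nbhs_nbhs; split => //.
Qed.

Lemma continuous_rV_measurable (f : 'rV[R]_n -> R) : continuous f ->
  measurable_fun [set: 'rV[R]_n] f.
Proof.
move=> cf; apply: (measurability _ (RGenOpens.measurableE R)) => _ [_ [a [b ->]] <-].
rewrite setTI; apply: open_rV_measurable; exact: open_comp.
Qed.

End open_measurable.

(** * Boxes and translation invariance of Lebesgue measure *)

Section boxes.
Context {R : realType} {n : nat}.
Implicit Types lo hi : 'I_n -> R.

Definition box lo hi : set 'rV[R]_n :=
  [set x | forall i, lo i < x ord0 i < hi i].

Definition boxes : set (set 'rV[R]_n) := [set A | exists lo hi, A = box lo hi].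

Lemma box_setI lo hi lo' hi' : box lo hi `&` box lo' hi' =
  box (fun i => Num.max (lo i) (lo' i)) (fun i => Num.min (hi i) (hi' i)).
Proof.
apply/seteqP; split => x.
  move=> [h h'] i; move: (h i) (h' i) => /andP[? ?] /andP[? ?].
  by rewrite gt_max lt_min; apply/andP; split; apply/andP.
by move=> h; split => i; move: (h i); rewrite gt_max lt_min => /andP[/andP[? ?] /andP[? ?]];
  apply/andP.
Qed.

Lemma setI_boxes : setI_closed boxes.
Proof. by move=> _ _ [? [? ->]] [? [? ->]]; rewrite box_setI; do 2 eexists. Qed.

Lemma box_measurable lo hi : measurable (box lo hi).
Proof.
rewrite (_ : box lo hi = \bigcap_(i in [set: 'I_n])
    (fun x : 'rV[R]_n => x ord0 i) @^-1` `]lo i, hi i[%classic); last first.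
  by apply/seteqP; split => [x h i _|x h i]; move: (h i); rewrite /= in_itv/=; auto.
apply: fin_bigcap_measurable => // i _; rewrite -[X in measurable X]setTI.
by apply: measurable_mx_coord => //; exact: measurable_itv.
Qed.

Lemma measurable_boxes : @measurable _ 'rV[R]_n = <<s boxes>>.
Proof.
apply/seteqP; split; last first.
  apply: smallest_sub; first exact: sigma_algebra_measurable.
  by move=> _ [lo [hi ->]]; exact: box_measurable.
apply: smallest_sub; first exact: smallest_sigma_algebra.
move=> _ [[i0 i] _ [A mA <-]]; rewrite /= (ord1 i0) => {i0}.
have : measurable_fun [set: g_sigma_algebraType boxes] (fun M => M ord0 i).
  apply: (measurability _ (RGenOpens.measurableE R)) => _ [_ [a [b ->]] <-].
  (* A slab in the coordinate [i] is the union of boxes whose other sides grow to the whole line. *)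
  rewrite setTI (_ : _ @^-1` _ = \bigcup_k
      box (fun j => if j == i then a else - k%:R) (fun j => if j == i then b else k%:R)).
    apply: bigcupT_measurable => k; apply: sub_sigma_algebra.
    by do 2 eexists.
  apply/seteqP; split => [x /=|x [k _ h] /=]; last first.
    by have := h i; rewrite eqxx in_itv.
  rewrite in_itv /= => hx.
  have /choice[N hN] : forall j, exists N : nat, `|x ord0 j| < N%:R.
    by move=> j; exists (Num.bound `|x ord0 j|); exact: archi_boundP.
  exists (\max_j N j)%N => // j; case: eqP => [->//|_].
  have := hN j; rewrite -ltr_norml => /lt_le_trans; apply.
  by rewrite ler_nat; exact: leq_bigmax.
by move=> /(_ measurableT _ mA).
Qed.

Lemma boxT : \bigcup_k box (fun=> - k%:R) (fun=> k%:R) = [set: 'rV[R]_n].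
Proof.
apply/seteqP; split => // x _.
have /choice[N hN] : forall j, exists N : nat, `|x ord0 j| < N%:R.
  by move=> j; exists (Num.bound `|x ord0 j|); exact: archi_boundP.
exists (\max_j N j)%N => // j; rewrite -ltr_norml; apply: lt_le_trans (hN j) _.
by rewrite ler_nat; exact: leq_bigmax.
Qed.

Lemma lebesgue_box lo hi : lebesgue_rV n (box lo hi) =
  (\prod_(i < n) lebesgue_measure `]lo i, hi i[%classic)%E.
Proof.
rewrite -(lebesgue_rV_box (A := fun i => `]lo i, hi i[%classic)); last first.
  by move=> i; exact: measurable_itv.
by congr (lebesgue_rV n _); apply/seteqP; split => x h i; move: (h i); rewrite /= in_itv/=.
Qed.

Lemma lebesgue_box_lty lo hi : (lebesgue_rV n (box lo hi) < +oo)%E.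
Proof.
rewrite lebesgue_box.
suff [r ->] : exists r : R, (\prod_(i < n) lebesgue_measure `]lo i, hi i[%classic = r%:E)%E.
  exact: ltry.
elim/big_ind: _ => [|x y [r ->] [s ->]|i _]; [by exists 1|by exists (r * s)|].
rewrite lebesgue_measure_itv /=; case: ifP => _; last by exists 0.
by exists (hi i - lo i).
Qed.

Lemma bounded_lty (A : set 'rV[R]_n) : bounded_set A -> measurable A ->
  (lebesgue_rV n A < +oo)%E.
Proof.
move=> /bounded_norm[M AM] mA.
apply: le_lt_trans (lebesgue_box_lty (fun=> - (M + 1)) (fun=> M + 1)).
apply: le_measure; rewrite ?inE//; first exact: box_measurable.
move=> x /AM xM i; rewrite -ltr_norml; apply: le_lt_trans (_ : M < M + 1); last by rewrite ltrDl.
apply: le_trans xM; rewrite /Num.norm /= mx_normrE.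
exact: (le_bigmax _ (fun i : 'I_1 * 'I_n => `|x i.1 i.2|) (ord0, i)).
Qed.

Definition shiftv (h x : 'rV[R]_n) : 'rV[R]_n := x + h.

Lemma measurable_shiftv h : measurable_fun [set: 'rV[R]_n] (shiftv h).
Proof.
apply: measurable_fun_mx => i j; rewrite /shiftv; under eq_fun do rewrite mxE.
by apply: measurable_funD => //; exact: measurable_mx_coord.
Qed.

(** The measure and its shift agree on boxes by the product formula; boxes form a generating
    pi-system that exhausts the space by sets of finite measure, so the two coincide. *)
Lemma lebesgue_rV_shift h (A : set 'rV[R]_n) : measurable A ->
  lebesgue_rV n (shiftv h @^-1` A) = lebesgue_rV n A.
Proof.
rewrite measurable_boxes => mA.
pose g k := box (fun=> - k%:R) (fun=> k%:R).
have gb k : boxes (g k) by do 2 eexists.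
have bm : boxes `<=` @measurable _ 'rV[R]_n by move=> _ [lo [hi ->]]; exact: box_measurable.
apply: (@g_sigma_algebra_measure_unique _ R _ boxes bm g gb boxT
  (pushforward (lebesgue_rV n) (shiftv h)) (lebesgue_rV n)) => //.
- exact: measurable_shiftv.
- exact: setI_boxes.
- move=> ? _ [lo [hi ->]] /=; rewrite /pushforward.
  rewrite (_ : _ @^-1` _ = box (fun i => lo i - h ord0 i) (fun i => hi i - h ord0 i)).
    rewrite !lebesgue_box; apply: eq_bigr => i _.
    rewrite !lebesgue_measure_itv /= !lte_fin ltrD2r.
    by case: ifP => // _; rewrite -!EFinB; congr EFin; ring.
  by apply/seteqP; split => x hx i; move: (hx i);
    rewrite /= /shiftv mxE ltrBlDr ltrBrDr.
- move=> ? k; rewrite /= /pushforward.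
  rewrite (_ : _ @^-1` _ = box (fun i => - k%:R - h ord0 i) (fun i => k%:R - h ord0 i)).
    exact: lebesgue_box_lty.
  by apply/seteqP; split => x hx i; move: (hx i);
    rewrite /= /shiftv mxE ltrBlDr ltrBrDr.
Qed.

Lemma Rintegral_shiftv h (f : 'rV[R]_n -> R) : measurable_fun [set: 'rV[R]_n] f ->
  (lebesgue_rV n).-integrable setT (EFin \o f \o shiftv h) ->
  \int[lebesgue_rV n]_x f (x + h) = \int[lebesgue_rV n]_x f x.
Proof.
move=> mf If.
have mEf : measurable_fun [set: 'rV[R]_n] (EFin \o f) by exact/measurable_EFinP.
have := @integral_pushforward _ _ _ _ R _ (measurable_shiftv h) (lebesgue_rV n) setT (EFin \o f) mEf.
rewrite preimage_setT => /(_ If measurableT) e.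
rewrite /Rintegral -[in LHS]/(fine (\int[lebesgue_rV n]_x (EFin \o f \o shiftv h) x)%E) -e.
congr fine; apply: (@eq_measure_integral _ _ R setT (lebesgue_rV n)).
  exact: measurable_shiftv.
by move=> ? A mA _; exact: lebesgue_rV_shift.
Qed.

End boxes.

Lemma cvg_harmonic_dnbhs (R : realType) : (fun k : nat => k.+1%:R^-1 : R) @ \oo --> 0^'.
Proof.
move=> A; rewrite /dnbhs /within /= => A0.
have h : \forall k \near \oo, harmonic k != 0 :> R -> A (harmonic k).
  exact: (@cvg_harmonic R _ A0).
apply: filterS h => k; apply.
by rewrite invr_eq0 pnatr_eq0.
Qed.

(** * Integrals of directional derivatives *)

Section integral_derive.
Context {R : realType} {n : nat}.
Local Notation mu := (@lebesgue_rV R n).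

Lemma is_derive_line (f : 'rV[R]_n -> R) x v s : derivable f (x + s *: v) v ->
  is_derive s 1 (fun s => f (x + s *: v)) ('D_v f (x + s *: v)).
Proof.
have e : (fun h : R => h^-1 *: (f (x + (h *: 1 + s) *: v) - f (x + s *: v))) =
    (fun h => h^-1 *: (f (h *: v + (x + s *: v)) - f (x + s *: v))).
  by apply/funext => h; rewrite [h *: 1]mulr1 scalerDl addrCA.
move=> df; split; first by rewrite /derivable e.
by rewrite /derive e.
Qed.

Lemma derive_eq0 (V : normedModType R) (f : V -> R) (v x : V) : ~ closure [set x | f x != 0] x -> 'D_v f x = 0.
Proof.
move=> ncx; have : (~` closure [set x | f x != 0]) x by [].
have oC : open (~` closure [set x | f x != 0]).
  exact/closed_openC/closed_closure.
move=> Cx; have f0 y : (~` closure [set x | f x != 0]) y -> f y = 0.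
  by move=> ny; apply/eqP/contraT => fy; exfalso; apply: ny; exact: subset_closure.
have nx : \forall h \near 0^', (h^-1 *: (f (h *: v + x) - f x)) = (0 : R).
  have ct : {for 0, continuous (fun h : R => h *: v + x)}.
    apply: continuousD; last exact: cvg_cst.
    by apply: continuousZr_tmp; exact: cvg_id.
  have : \forall h \near (0 : R), (~` closure [set x | f x != 0]) (h *: v + x).
    by apply: ct; rewrite scale0r add0r; exact: open_nbhs_nbhs.
  move=> H; apply: cvg_within; apply: filterS H => h Ch.
  by rewrite !f0// subrr scaler0.
rewrite /derive; apply: cvg_lim => //.
by apply: cvg_near_cst.
Qed.

(** By translation invariance the difference quotients have integral 0. They converge to the
    derivative and, by the mean value theorem, are dominated by a constant on a bounded set. *)
Lemma Rintegral_derive0 (f : 'rV[R]_n -> R) v : continuous f ->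
  (forall x, derivable f x v) -> continuous ('D_v f) ->
  compact (closure [set x | f x != 0]) ->
  \int[mu]_x 'D_v f x = 0.
Proof.
move=> cf df cD cK; set K := closure _ in cK.
have [M0 KM0] : exists M, forall x, K x -> `|x| <= M by exact/bounded_norm/compact_bounded.
have [M1 KM1] : exists M, forall x, K x -> `|'D_v f x| <= M.
  have : compact ('D_v f @` K) by apply: continuous_compact => //; apply: continuous_subspaceT.
  by move=> /compact_bounded/bounded_norm[M hM]; exists M => x Kx; apply: hM; exists x.
pose M := Num.max 0 M1.
have DM x : `|'D_v f x| <= M.
  have [Kx|nK] := pselect (K x); first by rewrite le_max KM1// orbT.
  by rewrite derive_eq0// normr0 le_max lexx.
(* The support enlarged by the length of [v], since quotients with step at most 1 see points that
   far away. *)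
pose B := [set x : 'rV[R]_n | `|x| < M0 + `|v| + 1].
have oB : open B.
  have -> : B = (fun x => `|x|) @^-1` `]-oo, M0 + `|v| + 1[%classic.
    by apply/seteqP; split => x; rewrite /= in_itv.
  by apply: open_comp => [x _|]; [exact: norm_continuous|exact: interval_open].
have mB : measurable B by exact: open_rV_measurable.
have Boo : (mu B < +oo)%E.
  apply: bounded_lty => //; exists (M0 + `|v| + 1); split; first exact: num_real.
  by move=> x hx y /= /ltW/le_trans; apply; exact: ltW.
pose q k x := k.+1%:R * (f (x + k.+1%:R^-1 *: v) - f x).
have qM k x : `|q k x| <= M * \1_B x.
  have k0 : 0 < k.+1%:R :> R by [].
  have [] := @MVT_segment R (fun s => f (x + s *: v)) (fun s => 'D_v f (x + s *: v)) 0 k.+1%:R^-1.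
  - by rewrite invr_ge0.
  - by move=> s _; exact: is_derive_line.
  - apply: continuous_subspaceT => s; apply: continuous_comp; last exact: cf.
    apply: continuousD; first exact: cvg_cst.
    by apply: continuousZr_tmp; exact: cvg_id.
  move=> s; rewrite in_itv /= => /andP[s0 s1]; rewrite scale0r addr0 subr0 => e.
  rewrite /q e mulrCA divff// ?mulr1.
  rewrite indicE; have [xB|/negP nB] := boolP (x \in B); first by rewrite mulr1.
  rewrite mulr0 normr_le0 derive_eq0// => Kx; apply: nB; apply/mem_set; rewrite /B /=.
  have -> : x = (x + s *: v) - s *: v by rewrite addrK.
  apply: le_lt_trans (ler_normB _ _) _.
  have sv : `|s *: v| <= `|v|.
    rewrite normrZ ger0_norm//; apply: ler_piMl => //; apply: le_trans s1 _.
    by rewrite invf_le1// ler1n.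
  have := KM0 _ Kx; lra.
have mf := continuous_rV_measurable cf.
have mq k : measurable_fun setT (q k).
  apply: measurable_funM => //; apply: measurable_funB => //.
  exact: (measurableT_comp mf (measurable_shiftv _)).
have IB0 : L1 mu setT (\1_B : 'rV[R]_n -> R).
  apply: L1_ge0P; [exact: measurable_indic|by move=> x _; rewrite indicE|].
  by rewrite integral_indic// setIT.
have IB : L1 mu setT (fun x => M * \1_B x) by exact: L1Z.
have If : L1 mu setT f.
  have [M2 KM2] : exists M, forall x, K x -> `|f x| <= M.
    have : compact (f @` K) by apply: continuous_compact => //; apply: continuous_subspaceT.
    by move=> /compact_bounded/bounded_norm[M' hM]; exists M' => x Kx; apply: hM; exists x.
  apply: (@L1_le _ _ _ _ _ measurableT _ (fun x => `|M2| * \1_B x)) => //.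
    exact: L1Z.
  move=> x _; have [fx|fx] := eqVneq (f x) 0; first by rewrite fx normr0 mulr_ge0.
  have Kx : K x by exact: subset_closure.
  rewrite indicE mem_set ?mulr1; first by rewrite (le_trans (KM2 _ Kx))// ler_norm.
  rewrite /B /=; have := KM0 _ Kx; have := normr_ge0 v; lra.
have qD x : q ^~ x @ \oo --> 'D_v f x.
  have : (fun h => h^-1 *: (f (h *: v + x) - f x)) @ 0^' --> 'D_v f x by exact: df.
  move=> /(cvg_comp _ _ (@cvg_harmonic_dnbhs R)); apply: cvg_trans; apply: near_eq_cvg.
  by apply: nearW => k; rewrite /q /= invrK [x + _]addrC.
have := Rdominated_cvg measurableT mq (fun x _ => qD x) IB (fun k x _ => qM k x).
have q0 k : \int[mu]_x q k x = 0.
  have Ifs : L1 mu setT (fun x => f (x + k.+1%:R^-1 *: v)).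
    have := L1D measurableT (L1Z measurableT k.+1%:R^-1 (_ : L1 mu setT (q k))) If.
    under eq_fun do rewrite /q mulrA mulVf ?pnatr_eq0// mul1r subrK.
    by apply; apply: L1_le IB _.
  rewrite /q RintegralZl//; last exact: L1B.
  by rewrite RintegralB// Rintegral_shiftv// subrr mulr0.
under eq_fun do rewrite q0.
by move=> /(cvg_unique _ (cvg_cst 0)) <-.
Qed.

End integral_derive.

(** * Smooth functions and test functions *)

Section flat.
Context {R : realType}.
Implicit Types (p q : {poly R}) (x y : R).

(* The space of these functions is closed under differentiation, and all of
   them vanish to infinite order at 0. *)
Definition flat p x : R := if 0 < x then p.[x^-1] * expR (- x^-1) else 0.

(** With N = n + 1, raise exp (y / N) >= y / N to the power N and invert. *)
Lemma expRN_le_pow n y : 0 < y -> expR (- y) <= n.+1%:R ^+ n.+1 / y ^+ n.+1.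
Proof.
move=> y0; rewrite expRN -invf_div lef_pV2 ?posrE ?expR_gt0 ?divr_gt0 ?exprn_gt0//.
have -> : y = n.+1%:R * (y / n.+1%:R) by rewrite mulrCA divff// mulr1.
rewrite -expr_div_n expRM_natl ler_pXn2r ?nnegrE ?expR_ge0//.
  by rewrite mulrAC divff// mul1r (le_trans _ (expR_ge1Dx _))// lerDr.
by rewrite divr_ge0// mulr_ge0// divr_ge0// ltW.
Qed.

Lemma horner_le p y : 1 <= y -> `|p.[y]| <= (\sum_(i < size p) `|p`_i|) * y ^+ size p.
Proof.
move=> y1; rewrite horner_coef; apply: le_trans (ler_norm_sum _ _ _) _.
rewrite mulr_suml; apply: ler_sum => i _; rewrite normrM ler_wpM2l//.
rewrite normrX ger0_norm ?(le_trans _ y1)//.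
by apply: ler_weXn2l => //; rewrite ltnW.
Qed.

(** In y = 1 / x the polynomial grows at most like y to the power [size p], and the exponential is
    bounded by the inverse of one more power, so one factor x survives. *)
Lemma flat_small p : exists2 K, 0 <= K & forall x, x <= 1 -> `|flat p x| <= K * `|x|.
Proof.
pose n := size p; pose S := \sum_(i < n) `|p`_i|.
have S0 : 0 <= S by apply: sumr_ge0.
exists (S * n.+1%:R ^+ n.+1); first by rewrite mulr_ge0 ?exprn_ge0.
move=> x x1; rewrite /flat; case: ltP => [x0|_]; last by rewrite normr0 !mulr_ge0 ?exprn_ge0.
have y0 : 0 < x^-1 by rewrite invr_gt0.
have y1 : 1 <= x^-1 by rewrite invf_ge1.
rewrite normrM (ger0_norm (expR_ge0 _)) (gtr0_norm x0).
apply: le_trans (ler_pM (normr_ge0 _) (expR_ge0 _) (horner_le p y1) (expRN_le_pow n y0)) _.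
have e : x^-1 ^+ size p * (x^-1 ^+ (size p).+1)^-1 = x.
  rewrite exprS invfM invrK mulrCA divff ?mulr1// expf_eq0 invr_eq0.
  by rewrite gt_eqF// andbF.
rewrite [leRHS](_ : _ = S * n.+1%:R ^+ n.+1 *
    (x^-1 ^+ size p * (x^-1 ^+ (size p).+1)^-1)); last by rewrite e.
rewrite le_eqVlt; apply/orP; left; apply/eqP; rewrite /S /n.
move: (x^-1 ^+ size p) (x^-1 ^+ (size p).+1)^-1 => A B; ring.
Qed.

(** Differentiating p (1 / x) exp (- 1 / x) produces the factor 1 / x^2 and the polynomial p -
    p'. *)
Lemma is_derive_flat p x : is_derive x 1 (flat p) (flat ('X^2 * (p - p^`())) x).
Proof.
have [x0|x0|->] := ltgtP x 0.
- have e : \near x, 0 = flat p x.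
    have : \forall z \near x, z < 0 by exact: (cvgr_lt x (@cvg_id _ (nbhs x))).
    apply: filterS => z z0.
    by rewrite /flat ltNge (ltW z0).
  rewrite {2}/flat ltNge (ltW x0) /=.
  exact: near_eq_is_derive e (is_derive_cst _ _ _).
- pose g z : R := p.[z^-1] * expR (- z^-1).
  have e : \near x, g x = flat p x.
    have : \forall z \near x, 0 < z by exact: (cvgr_gt x (@cvg_id _ (nbhs x))).
    apply: filterS => z z0.
    by rewrite /flat z0.
  apply: near_eq_is_derive e _; rewrite /flat x0.
  have xn0 : x != 0 by rewrite gt_eqF.
  have dV : is_derive x 1 (fun z : R => z^-1) (- x ^- 2 *: 1).
    split; first by apply: derivableV => //; exact: derivable_id.
    by rewrite deriveV// ?derive_id//; exact: derivable_id.
  have dp : is_derive x 1 (fun z : R => p.[z^-1]) (p^`().[x^-1] * (- x ^- 2 *: 1)).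
    have := @is_derive1_comp R (horner p) (fun z => z^-1) x; apply.
    have dN : is_derive x 1 (fun z : R => - z^-1) (- (- x ^- 2 *: 1)).
    by have [h1 h2] := dV; split; [exact: derivableN|rewrite deriveN// h2].
  have de : is_derive x 1 (fun z : R => expR (- z^-1)) (expR (- x^-1) * (- (- x ^- 2 *: 1))).
    exact: (@is_derive1_comp R expR (fun z => - z^-1) x).
  have := is_deriveM dp de; rewrite /g => /is_derive_eq; apply.
  rewrite hornerM hornerXn hornerD hornerN /GRing.scale /=.
  by rewrite -exprVn; ring.
(* The difference quotient of [flat p] at 0 is [flat ('X * p)], which tends to 0. *)
- have [K K0 hK] := flat_small ('X * p).
  have h0 : (fun h : R => h^-1 *: (flat p (h *: 1 + 0) - flat p 0)) @ 0^' --> (0 : R).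
    apply/cvgrPdist_lt => e e0.
    have d0 : 0 < e / (K + 1) by rewrite divr_gt0// ltr_wpDl.
    have m0 : 0 < Num.min 1 (e / (K + 1)) by rewrite lt_min ltr01.
    apply: cvg_within; apply/nbhs_ballP; exists (Num.min 1 (e / (K + 1))) => //= h.
    move=> hb; have : `|h| < Num.min 1 (e / (K + 1)).
      by move: hb; rewrite /ball /= sub0r normrN.
    rewrite lt_min => /andP[h1 h2].
    rewrite sub0r normrN [h *: 1]mulr1 addr0 {2}/flat ltxx subr0.
    have -> : h^-1 *: flat p h = flat ('X * p) h.
      by rewrite /flat hornerM hornerX; case: ifP => _; rewrite ?scaler0// /GRing.scale /= mulrA.
    apply: le_lt_trans (hK _ _) _; first by rewrite ltW// (le_lt_trans (ler_norm _)).
    move: h2; rewrite ltr_pdivlMr ?ltr_wpDl// => h2; apply: le_lt_trans h2.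
    by rewrite mulrC ler_wpM2l// lerDl.
  rewrite {2}/flat ltxx; split; first by apply/cvg_ex; exists 0.
  exact: cvg_lim.
Qed.

End flat.

(** * An algebra of smooth functions stable under differentiation *)

Section smooth_algebra.
Context {R : realType} {V : normedModType R}.
Implicit Types (f g l : V -> R).

Definition linear_form l := continuous l /\ forall a x y, l (a *: x + y) = a * l x + l y.

(** A class given by formulas and stable under directional derivatives, so that smoothness of a
    member follows by induction on the list of directions. [flat] and [expR] occur only along linear
    forms, which keeps the chain rule one-dimensional. *)
Inductive smooth_alg : (V -> R) -> Prop :=
| sa_smooth f : smooth f -> smooth_alg f
| sa_cst c : smooth_alg (fun=> c)
| sa_lin l : linear_form l -> smooth_alg l
| sa_flat p l c : linear_form l -> smooth_alg (fun x => flat p (l x + c))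
| sa_exp l : linear_form l -> smooth_alg (fun x => expR (l x))
| sa_add f g : smooth_alg f -> smooth_alg g -> smooth_alg (fun x => f x + g x)
| sa_mul f g : smooth_alg f -> smooth_alg g -> smooth_alg (fun x => f x * g x)
| sa_inv f : (forall x, f x != 0) -> smooth_alg f -> smooth_alg (fun x => (f x)^-1).

Lemma smooth_derive f v : smooth f -> smooth ('D_v f).
Proof.
move=> sf; have e vs : iter_derive vs ('D_v f) = iter_derive (rcons vs v) f.
  by elim: vs => //= w vs ->.
by move=> vs; rewrite e; exact: sf.
Qed.

(** Along the line through [x] in the direction [v] the form is affine with slope [l v], so only a
    composition of functions of one variable is differentiated. *)
Lemma is_derive_comp_lin (F dF : R -> R) l c x v : linear_form l ->
  is_derive (l x + c) 1 F (dF (l x + c)) ->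
  is_derive x v (fun x => F (l x + c)) (l v * dF (l x + c)).
Proof.
move=> [_ lin] dFx.
have e : (fun h : R => h^-1 *: (F (l (h *: v + x) + c) - F (l x + c))) =
    (fun h : R => h^-1 *: ((fun h => F (h * l v + (l x + c))) (h *: 1 + 0)
      - (fun h => F (h * l v + (l x + c))) 0)).
  by apply/funext => h; rewrite lin [h *: 1]mulr1 addr0 mul0r add0r addrA.
have dA : is_derive (0 : R) 1 (fun h : R => h * l v + (l x + c)) (l v).
  have := @is_deriveD R R R (fun h => h * l v) (cst (l x + c)) 0 1 (l v) 0.
  rewrite addr0; apply.
  have := @is_deriveM R R id (cst (l v)) 0 1 1 0; rewrite scaler0 add0r => h.
  by apply: is_derive_eq; rewrite /GRing.scale /= mulr1.
have dFx' : is_derive (0 * l v + (l x + c)) 1 F (dF (l x + c)) by rewrite mul0r add0r.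
have [d1 d2] := @is_derive1_comp R F (fun h => h * l v + (l x + c)) 0 _ _ dFx' dA.
split; first by rewrite /derivable e.
by rewrite /derive e [RHS]mulrC -d2.
Qed.

Lemma smooth_alg_derive f : smooth_alg f ->
  continuous f /\ forall v, (forall x, derivable f x v) /\ smooth_alg ('D_v f).
Proof.
elim=> {f}.
- move=> f sf; have [cf df] := sf [::]; split => // v; split => [x|]; first exact: df.
  by apply: sa_smooth; exact: smooth_derive.
- move=> c; split; first by move=> x; exact: cvg_cst.
  move=> v; split => [x|]; first exact: derivable_cst.
  rewrite (_ : 'D_v _ = fun=> 0); first exact: sa_cst.
  by apply/funext => x; rewrite derive_cst.
- move=> l ll; have [cl lin] := ll; split => // v.
  have dl x : is_derive x v l (l v).
    have := @is_derive_comp_lin id (fun=> 1) l 0 x v ll (is_derive_id _ _).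
    rewrite mulr1; congr (is_derive _ _ _ _).
    by apply/funext => y; rewrite addr0.
  split => [x|]; first exact: ex_derive.
  rewrite (_ : 'D_v _ = fun=> l v); first exact: sa_cst.
  by apply/funext => x; rewrite derive_val.
- move=> p l c ll; have [cl lin] := ll.
  have dl x v : is_derive x v (fun x => flat p (l x + c))
      (l v * flat ('X^2 * (p - p^`())) (l x + c)).
    by apply: (is_derive_comp_lin _ ll); exact: is_derive_flat.
  split.
    move=> x; apply: (@continuous_comp _ _ _ (fun x => l x + c) (flat p)).
      by apply: continuousD; [exact: cl|exact: cvg_cst].
    apply/differentiable_continuous/derivable1_diffP.
    exact: (@ex_derive _ _ _ _ _ _ _ (is_derive_flat p _)).
  move=> v; split => [x|]; first exact: (@ex_derive _ _ _ _ _ _ _ (dl x v)).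
  rewrite (_ : 'D_v _ = fun x => l v * flat ('X^2 * (p - p^`())) (l x + c)).
    by apply: sa_mul; [exact: sa_cst|exact: sa_flat].
  by apply/funext => x; exact: (@derive_val _ _ _ _ _ _ _ (dl x v)).
- move=> l ll; have [cl lin] := ll.
  have dl x v : is_derive x v (fun x => expR (l x)) (l v * expR (l x)).
    have := @is_derive_comp_lin expR expR l 0 x v ll (is_derive_expR _).
    rewrite addr0; congr (is_derive _ _ _ _).
    by apply/funext => y; rewrite addr0.
  split; first by move=> x; apply: continuous_comp; [exact: cl|exact: continuous_expR].
  move=> v; split => [x|]; first exact: (@ex_derive _ _ _ _ _ _ _ (dl x v)).
  rewrite (_ : 'D_v _ = fun x => l v * expR (l x)).
    by apply: sa_mul; [exact: sa_cst|exact: sa_exp].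
  by apply/funext => x; exact: (@derive_val _ _ _ _ _ _ _ (dl x v)).
- move=> f g sf [cf df] sg [cg dg]; split.
    by move=> x; apply: continuousD; [exact: cf|exact: cg].
  move=> v; have [df1 df2] := df v; have [dg1 dg2] := dg v.
  split => [x|]; first exact: derivableD.
  rewrite (_ : 'D_v _ = fun x => 'D_v f x + 'D_v g x); first exact: sa_add.
  by apply/funext => x; exact: deriveD.
- move=> f g sf [cf df] sg [cg dg]; split.
    by move=> x; apply: continuousM; [exact: cf|exact: cg].
  move=> v; have [df1 df2] := df v; have [dg1 dg2] := dg v.
  split => [x|]; first exact: derivableM.
  rewrite (_ : 'D_v _ = fun x => f x * 'D_v g x + g x * 'D_v f x).
    by apply: sa_add; exact: sa_mul.
  by apply/funext => x; exact: deriveM.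
- move=> f f0 sf [cf df]; split.
    by move=> x; apply: continuousV; [exact: f0|exact: cf].
  move=> v; have [df1 df2] := df v.
  split => [x|]; first exact: derivableV.
  rewrite (_ : 'D_v _ = fun x => -1 * ((f x)^-1 * (f x)^-1) * 'D_v f x).
    apply: sa_mul => //; apply: sa_mul; first exact: sa_cst.
    by apply: sa_mul; exact: sa_inv.
  apply/funext => x; rewrite deriveV// /GRing.scale /= -exprVn; ring.
Qed.

Lemma smooth_algP f : smooth_alg f -> smooth f.
Proof.
move=> sf vs; have : smooth_alg (iter_derive vs f).
  elim: vs => //= v vs /smooth_alg_derive[_ /(_ v)[_]].
  by rewrite (_ : (fun x => _) = 'D_v (iter_derive vs f)).
by move=> /smooth_alg_derive[cf df]; split => // x v; have [] := df v.
Qed.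

Lemma smoothM f g : smooth f -> smooth g -> smooth (fun x => f x * g x).
Proof. by move=> sf sg; apply: smooth_algP; apply: sa_mul; exact: sa_smooth. Qed.

Lemma smooth_continuous f : smooth f -> continuous f.
Proof. by move=> /(_ [::])[]. Qed.

Lemma smooth_derivable f x v : smooth f -> derivable f x v.
Proof. by move=> /(_ [::])[_]; exact. Qed.

Lemma sa_prod (I : Type) (s : seq I) (F : I -> V -> R) :
  (forall i, smooth_alg (F i)) -> smooth_alg (fun x => \prod_(i <- s) F i x).
Proof.
move=> sF; elim: s => [|i s IH].
  by under eq_fun do rewrite big_nil; exact: sa_cst.
by under eq_fun do rewrite big_cons; exact: sa_mul.
Qed.

End smooth_algebra.

(** * Plateau functions on intervals and boxes *)

Section bump.
Context {R : realType}.
Implicit Types (a b : R).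

Lemma flat1_gt0 (x : R) : 0 < x -> 0 < flat 1 x.
Proof. by move=> x0; rewrite /flat x0 hornerC mul1r expR_gt0. Qed.

Lemma flat1_eq0 (x : R) : x <= 0 -> flat 1 x = 0.
Proof. by move=> x0; rewrite /flat ltNge x0. Qed.

Lemma flat1_ge0 (x : R) : 0 <= flat 1 x.
Proof. by have [/flat1_gt0/ltW|/flat1_eq0 ->] := ltP 0 x. Qed.

Lemma step_den (x : R) : 0 < flat 1 x + flat 1 (1 - x).
Proof.
have [x0|x0] := ltP 0 x; first by rewrite ltr_pwDl ?flat1_gt0 ?flat1_ge0.
by rewrite ltr_wpDl ?flat1_ge0 ?flat1_gt0//; lra.
Qed.

Definition step (x : R) : R := flat 1 x * (flat 1 x + flat 1 (1 - x))^-1.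

Lemma step0 (x : R) : x <= 0 -> step x = 0.
Proof. by move=> x0; rewrite /step flat1_eq0// mul0r. Qed.

Lemma step1 (x : R) : 1 <= x -> step x = 1.
Proof.
move=> x1; have := step_den x; rewrite /step [flat 1 (1 - x)]flat1_eq0 ?addr0; last by lra.
by move=> h; rewrite divff// gt_eqF.
Qed.

Lemma step_ge0 (x : R) : 0 <= step x.
Proof. by rewrite mulr_ge0 ?flat1_ge0// invr_ge0 ltW ?step_den. Qed.

Lemma step_le1 (x : R) : step x <= 1.
Proof. by rewrite /step ler_pdivrMr ?step_den// mul1r lerDl flat1_ge0. Qed.

(** With K = k + 1, it is 0 up to a + 1/K and from b - 1/K on, and 1 between a + 2/K and b - 2/K.
    The margin 1/K gives compact support inside the open interval, and as k grows the indicator of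
    the interval is approached pointwise. *)
Definition bump (k : nat) a b (x : R) : R :=
  step (k.+1%:R * x + (- (k.+1%:R * a) - 1)) *
  step (- k.+1%:R * x + (k.+1%:R * b - 1)).

Lemma bump_ge0 k a b x : 0 <= bump k a b x.
Proof. by rewrite mulr_ge0 ?step_ge0. Qed.

Lemma bump_le1 k a b x : bump k a b x <= 1.
Proof. by rewrite mulr_ile1 ?step_ge0 ?step_le1. Qed.

Lemma bump_supp k a b x : bump k a b x != 0 ->
  a + k.+1%:R^-1 <= x <= b - k.+1%:R^-1.
Proof.
have k0 : 0 < k.+1%:R :> R by [].
move=> h; rewrite -(ler_pM2l k0) -[X in _ && X](ler_pM2l k0) mulrDr mulrBr divff ?gt_eqF//.
apply/andP; split; rewrite leNgt; apply: contra h => h; rewrite /bump.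
  by rewrite step0 ?mul0r//; lra.
by rewrite mulrC step0 ?mul0r//; lra.
Qed.

Lemma cvg_bump a b x : (fun k => bump k a b x) @ \oo --> (\1_`]a, b[ x : R).
Proof.
apply: cvg_near_cst; rewrite indicE; have [/set_mem|/negP nx] := boolP (x \in _); last first.
  apply: nearW => k; apply/eqP/contraT => /bump_supp/andP[h1 h2]; exfalso; apply: nx.
  have k0 : 0 < k.+1%:R^-1 :> R by rewrite invr_gt0.
  apply/mem_set; rewrite /= in_itv /=; apply/andP; split.
    by apply: lt_le_trans h1; rewrite ltrDl.
  by apply: le_lt_trans h2 _; rewrite ltrBlDr ltrDl.
rewrite /= in_itv /= => /andP[ax xb].
have near2 (y : R) : 0 < y -> \forall k \near \oo, 2 <= k.+1%:R * y.
  move=> y0; exists (Num.bound (2 / y)) => // k /= hk.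
  rewrite -ler_pdivrMr//; apply: ltW.
  have := @archi_boundP R (2 / y); rewrite divr_ge0 ?(ltW y0)// => /(_ isT)/lt_trans; apply.
  by rewrite ltr_nat ltnS.
apply: filterS2 (near2 (x - a) _) (near2 (b - x) _); rewrite ?subr_gt0// => k h1 h2.
by rewrite /bump !step1 ?mulr1; lra.
Qed.

Lemma linear_formZ (V : normedModType R) (l : V -> R) c :
  linear_form l -> linear_form (fun v => c * l v).
Proof.
move=> [cl lin]; split.
  by move=> x; apply: continuousM; [exact: cvg_cst|exact: cl].
by move=> a x y; rewrite lin; ring.
Qed.

Lemma sa_step (V : normedModType R) (l : V -> R) c : linear_form l ->
  smooth_alg (fun v => step (l v + c)).
Proof.
move=> ll; apply: sa_mul; first exact: sa_flat.
apply: sa_inv; first by move=> x; rewrite gt_eqF// step_den.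
apply: sa_add; first exact: sa_flat.
rewrite (_ : (fun _ => _) = fun v => flat 1 (-1 * l v + (1 - c))).
  by apply: sa_flat; exact: linear_formZ.
by apply/funext => v; congr (flat 1 _); ring.
Qed.

Lemma sa_bump (V : normedModType R) (l : V -> R) k a b : linear_form l ->
  smooth_alg (fun v => bump k a b (l v)).
Proof. by move=> ll; apply: sa_mul; apply: sa_step; exact: linear_formZ. Qed.

Lemma linear_form_id : linear_form (@id R).
Proof. by split => // x; exact: cvg_id. Qed.

Lemma linear_form_coord n i : linear_form (fun x : 'rV[R]_n => x ord0 i).
Proof. by split=> [|a x y]; [exact: coord_continuous|rewrite !mxE]. Qed.

Lemma test_funP (V : normedModType R) (U C : set V) (f : V -> R) : smooth f ->
  compact C -> (forall x, f x != 0 -> C x) -> C `<=` U -> test_fun U f.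
Proof.
move=> sf cC fC CU.
have cl : closure [set x | f x != 0] `<=` C.
  have <- : closure C = C.
    by apply/esym/closure_id; apply: compact_closed => //; exact: norm_hausdorff.
  exact: closureS.
split => //; last exact: subset_trans CU.
by apply: (subclosed_compact _ cC) => //; exact: closed_closure.
Qed.

Lemma test_bump k a b U : `]a, b[%classic `<=` U -> test_fun U (bump k a b).
Proof.
move=> abU; have k0 : 0 < k.+1%:R^-1 :> R by rewrite invr_gt0.
apply: (@test_funP _ _ `[a + k.+1%:R^-1, b - k.+1%:R^-1]%classic).
- by apply: smooth_algP; exact: (sa_bump _ _ _ linear_form_id).
- exact: segment_compact.
- by move=> x /bump_supp; rewrite /= in_itv.
- move=> x; rewrite /= in_itv /= => /andP[h1 h2]; apply: abU; rewrite /= in_itv /=.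
  by rewrite (lt_le_trans _ h1) ?ltrDl// (le_lt_trans h2)// ltrBlDr ltrDl.
Qed.

Definition boxbump n k (lo hi : 'I_n -> R) (x : 'rV[R]_n) : R :=
  \prod_(i < n) bump k (lo i) (hi i) (x ord0 i).

Lemma test_boxbump n k (lo hi : 'I_n -> R) (U : set 'rV[R]_n) :
  box lo hi `<=` U -> test_fun U (boxbump k lo hi).
Proof.
move=> bU; have k0 : 0 < k.+1%:R^-1 :> R by rewrite invr_gt0.
apply: (@test_funP _ _ [set x : 'rV[R]_n | forall i,
    `[lo i + k.+1%:R^-1, hi i - k.+1%:R^-1]%classic (x ord0 i)]).
- apply: smooth_algP; apply: sa_prod => i.
  exact: (sa_bump _ _ _ (linear_form_coord i)).
- apply: (@rV_compact _ _ (fun i => `[lo i + k.+1%:R^-1, hi i - k.+1%:R^-1]%classic)).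
  by move=> i; exact: segment_compact.
- move=> x /prodf_neq0 h i; rewrite /= in_itv /=; apply: bump_supp.
  exact: (h i).
- move=> x /= hx; apply: bU => i; have := hx i; rewrite in_itv /= => /andP[h1 h2].
  by rewrite (lt_le_trans _ h1) ?ltrDl// (le_lt_trans h2)// ltrBlDr ltrDl.
Qed.

Lemma boxbump_ge0 n k (lo hi : 'I_n -> R) (x : 'rV[R]_n) : 0 <= boxbump k lo hi x.
Proof. by apply: prodr_ge0 => i _; exact: bump_ge0. Qed.

Lemma boxbump_le1 n k (lo hi : 'I_n -> R) (x : 'rV[R]_n) : boxbump k lo hi x <= 1.
Proof. by apply: prodr_ile1 => i _; rewrite bump_ge0 bump_le1. Qed.

Lemma cvg_boxbump n (lo hi : 'I_n -> R) (x : 'rV[R]_n) :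
  (fun k => boxbump k lo hi x) @ \oo --> (\1_(box lo hi) x : R).
Proof.
rewrite (_ : \1_(box lo hi) x = \prod_(i < n) (\1_`]lo i, hi i[ (x ord0 i) : R)); last first.
  rewrite indicE; have [/set_mem bx|/negP nb] := boolP (x \in _).
    by rewrite big1// => i _; rewrite indicE mem_set//= in_itv; exact: bx.
  have /existsNP[i ni] : ~ forall i, lo i < x ord0 i < hi i.
    by move=> h; apply: nb; exact/mem_set.
  have ni' : ~ `]lo i, hi i[%classic (x ord0 i) by rewrite /= in_itv.
  by rewrite (bigD1 i)//= indicE memNset// mul0r.
rewrite /boxbump; elim: (index_enum _) => [|i s IH].
  by under eq_fun do rewrite big_nil; rewrite big_nil; exact: cvg_cst.
under eq_fun do rewrite big_cons; rewrite big_cons.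
by apply: cvgM => //; exact: cvg_bump.
Qed.

Lemma test_funM (V : normedModType R) (U : set V) (f g : V -> R) :
  smooth f -> test_fun U g -> test_fun U (fun x => f x * g x).
Proof.
move=> sf [sg cg gU]; apply: (@test_funP V U (closure [set x | g x != 0]) _ _ cg _ gU).
  exact: smoothM.
by move=> x; rewrite mulf_eq0 negb_or => /andP[_ gx]; exact: subset_closure.
Qed.

End bump.

(** * Square integrable vector fields *)

Section dotv.
Context {R : realType} {n : nat}.
Implicit Types p q r : 'rV[R]_n.

Lemma dotvC p q : dotv p q = dotv q p.
Proof. by apply: eq_bigr => i _; rewrite mulrC. Qed.

Lemma dotv_linl a p q r : dotv (a *: p + q) r = a * dotv p r + dotv q r.
Proof.
rewrite /dotv mulr_sumr -big_split; apply: eq_bigr => i _.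
by rewrite !mxE mulrDl mulrA.
Qed.

Lemma dotv_ge0 p : 0 <= dotv p p.
Proof. by apply: sumr_ge0 => i _; rewrite -expr2 sqr_ge0. Qed.

Lemma dotv_semi : semi_ip [set: 'rV[R]_n] dotv.
Proof.
split => //.
- by move=> p q _ _; exact: dotvC.
- by move=> a p q r _ _ _; exact: dotv_linl.
- by move=> p _; exact: dotv_ge0.
Qed.

Lemma dotvZl a p q : dotv (a *: p) q = a * dotv p q.
Proof. exact: (ipZl dotv_semi). Qed.

Lemma dotvZr a p q : dotv p (a *: q) = a * dotv p q.
Proof. exact: (ipZr dotv_semi). Qed.

Lemma dotvDl p q r : dotv (p + q) r = dotv p r + dotv q r.
Proof. exact: (ipDl dotv_semi). Qed.

Lemma dotvDr p q r : dotv r (p + q) = dotv r p + dotv r q.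
Proof. exact: (ipDr dotv_semi). Qed.

Lemma dotvBl p q r : dotv (p - q) r = dotv p r - dotv q r.
Proof. exact: (ipBl dotv_semi). Qed.

Lemma dotvBr p q r : dotv r (p - q) = dotv r p - dotv r q.
Proof. exact: (ipBr dotv_semi). Qed.

Lemma enorm_ge0 p : 0 <= enorm p.
Proof. exact: sqrtr_ge0. Qed.

Lemma enorm_sqr p : enorm p ^+ 2 = dotv p p.
Proof. by rewrite sqr_sqrtr// dotv_ge0. Qed.

Lemma dot0v p : dotv 0 p = 0.
Proof. by rewrite /dotv big1// => i _; rewrite mxE mul0r. Qed.

Lemma dotv_eq0 p : dotv p p = 0 -> p = 0.
Proof.
move=> /eqP; rewrite /dotv psumr_eq0 => [/allP h|i _]; last by rewrite -expr2 sqr_ge0.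
apply/rowP => i; rewrite mxE; have /= := h i (mem_index_enum i).
by rewrite -expr2 sqrf_eq0 => /eqP.
Qed.

Lemma dotv_le p q : `|dotv p q| <= enorm p * enorm q.
Proof. exact: (ip_le dotv_semi). Qed.

Lemma enormZ a p : enorm (a *: p) = `|a| * enorm p.
Proof.
by rewrite /enorm dotvZl dotvZr mulrA -expr2 sqrtrM ?sqr_ge0// sqrtr_sqr.
Qed.

Lemma coord_le_enorm p i : `|p ord0 i| <= enorm p.
Proof.
rewrite -(@ler_pXn2r _ 2)// ?nnegrE ?enorm_ge0// enorm_sqr real_normK ?num_real//.
by rewrite /dotv (bigD1 i)//= expr2 lerDl; apply: sumr_ge0 => j _; rewrite -expr2 sqr_ge0.
Qed.

End dotv.

Section L2v.
Context d {X : measurableType d} {R : realType} {n : nat}.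
Variables (mu : {measure set X -> \bar R}) (D : set X).
Hypothesis mD : measurable D.
Implicit Types g h : X -> 'rV[R]_n.

Notation L2v := (L2v mu D).
Definition ipV g h := \int[mu]_(x in D) dotv (g x) (h x).

Lemma L2v_lin a g h : L2v g -> L2v h -> L2v (fun x => a *: g x + h x).
Proof.
by move=> g2 h2 i; under eq_fun do rewrite !mxE; exact: L2_lin (g2 i) (h2 i).
Qed.

Lemma L2v_0 : L2v (fun=> 0 : 'rV[R]_n).
Proof. by move=> i; under eq_fun do rewrite mxE; exact: L2_0. Qed.

Lemma L2v_subspace : subspace (L2v : set (X -> 'rV[R]_n)).
Proof. by split; [exact: L2v_0|move=> a v w; exact: L2v_lin]. Qed.

Lemma L2v_dotv g h : L2v g -> L2v h -> L1 mu D (fun x => dotv (g x) (h x)).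
Proof. by move=> g2 h2; apply: L1_sum => // i; exact: L2M (g2 i) (h2 i). Qed.

Lemma Rintegral_sum (I : Type) (s : seq I) (F : I -> X -> R) :
  (forall i, L1 mu D (F i)) ->
  \int[mu]_(x in D) (\sum_(i <- s) F i x) = \sum_(i <- s) \int[mu]_(x in D) F i x.
Proof.
move=> IF; elim: s => [|i s IH].
  by under eq_Rintegral do rewrite big_nil; rewrite big_nil Rintegral_cst// mul0r.
under eq_Rintegral do rewrite big_cons; rewrite big_cons.
by rewrite RintegralD; [rewrite IH|exact: mD|exact: IF|exact: L1_sum].
Qed.

Lemma ipVE g h : L2v g -> L2v h ->
  ipV g h = \sum_i ipL mu D (fun x => g x ord0 i) (fun x => h x ord0 i).
Proof.
by move=> g2 h2; rewrite /ipV Rintegral_sum// => i; exact: L2M (g2 i) (h2 i).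
Qed.

Lemma ipV_semi : semi_ip (L2v : set (X -> 'rV[R]_n)) ipV.
Proof.
split.
- exact: L2v_subspace.
- by move=> g h _ _; apply: eq_Rintegral => x _; exact: dotvC.
- move=> a f g h f2 g2 h2; rewrite /ipV -RintegralZl//; last exact: L2v_dotv.
  rewrite -RintegralD//; [|exact: L1Z (L2v_dotv _ _)|exact: L2v_dotv].
  by apply: eq_Rintegral => x _; rewrite -dotv_linl.
- by move=> f f2; apply: Rintegral_ge0 => x _; exact: dotv_ge0.
Qed.

Lemma ipV_ae g g' h h' : L2v g -> L2v g' -> L2v h -> L2v h' ->
  {ae mu, forall x, D x -> g x = g' x} -> {ae mu, forall x, D x -> h x = h' x} ->
  ipV g h = ipV g' h'.
Proof.
move=> g2 g2' h2 h2' e e'; apply: ae_eq_Rintegral => //.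
- exact: L1_measurable (L2v_dotv g2 h2).
- exact: L1_measurable (L2v_dotv g2' h2').
- by apply: filterS2 e e' => x p p' Dx; rewrite p// p'.
Qed.

Lemma measurable_sqrt : measurable_fun [set: R] (@Num.sqrt R).
Proof. by apply: continuous_measurable_fun; exact: sqrt_continuous. Qed.

Lemma L2_enorm g : L2v g -> L2 mu D (fun x => enorm (g x)).
Proof.
move=> g2; have I := L2v_dotv g2 g2; apply/L2P => //; split.
  exact: (measurableT_comp measurable_sqrt (L1_measurable I)).
by under eq_fun do rewrite enorm_sqr.
Qed.

Lemma L2norm_enorm g : L2v g -> L2norm mu D (fun x => enorm (g x)) = Num.sqrt (ipV g g).
Proof.
move=> g2; rewrite L2normE//; last exact: L2_enorm.
by congr (Num.sqrt _); apply: eq_Rintegral => x _; rewrite -expr2 enorm_sqr.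
Qed.

Lemma ipL_coord_le g i : L2v g ->
  ipL mu D (fun x => g x ord0 i) (fun x => g x ord0 i) <= ipV g g.
Proof.
move=> g2; rewrite ipVE// (bigD1 i)//= lerDl; apply: sumr_ge0 => j _.
exact: (ip_ge0 (ipL_semi mu mD)) (g2 j).
Qed.

Lemma ipV_complete : ip_complete (L2v : set (X -> 'rV[R]_n)) ipV.
Proof.
move=> u u2 cau.
have ucau i j : L2v (u i - u j) by exact: (subspaceB L2v_subspace).
have /choice[l hl] : forall i, exists l, L2 mu D l /\ forall e, 0 < e ->
    exists N, forall k, (N <= k)%N ->
    ipL mu D (fun x => u k x ord0 i - l x) (fun x => u k x ord0 i - l x) < e.
  move=> i; have [|e e0|l l2 hl] := @ipL_complete _ X R mu D mD (fun k x => u k x ord0 i).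
  - by move=> k; exact: u2.
  - have [N hN] := cau e e0; exists N => a b /hN h /h; apply: le_lt_trans.
    apply: le_trans (ipL_coord_le i (ucau a b)).
    rewrite le_eqVlt; apply/orP; left; apply/eqP.
    by apply: eq_Rintegral => x _; rewrite !fctE !mxE.
  - by exists l; split.
have l2 : L2v (fun x => \row_i l i x).
  by move=> i; under eq_fun do rewrite mxE; case: (hl i).
exists (fun x => \row_i l i x) => // e e0.
(* Dividing by [n.+1] makes the sum of [n] terms strictly less than [e] and covers [n = 0]. *)
have e1 : 0 < e / n.+1%:R by rewrite divr_gt0.
have /choice[N hN] := fun i => (hl i).2 _ e1.
exists (\max_i N i)%N => k Nk.
rewrite ipVE; [|exact: (subspaceB L2v_subspace)..].
apply: le_lt_trans (_ : \sum_(i < n) e / n.+1%:R < e).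
  apply: ler_sum => i _; apply: ltW.
  apply: le_lt_trans (hN i k (leq_trans (leq_bigmax i) Nk)).
  rewrite le_eqVlt; apply/orP; left; apply/eqP.
  by apply: eq_Rintegral => x _; rewrite !fctE !mxE.
rewrite sumr_const card_ord -[X in X < _]mulr_natr mulrAC ltr_pdivrMr//.
by rewrite ltr_pM2l// ltr_nat.
Qed.

End L2v.

Lemma ae_forall_count d (T : measurableType d) (R : realType)
    (mu : {measure set T -> \bar R}) (I : countType) (P : I -> T -> Prop) :
  (forall i, {ae mu, forall x, P i x}) -> {ae mu, forall x, forall i, P i x}.
Proof.
move=> aeP; have : {ae mu, forall x, forall k : nat,
    if unpickle k is Some i then P i x else True}.
  by apply: ae_foralln => k; case: unpickle => [i|]; [exact: aeP|exact: aeW].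
by apply: filterS => x h i; have := h (pickle i); rewrite pickleK.
Qed.

(** * The fundamental lemma of the calculus of variations *)

Section fundamental_lemma.
Context {R : realType} {n : nat}.
Local Notation mu := (@lebesgue_rV R n).
Variable Om : set 'rV[R]_n.
Hypothesis oOm : open Om.

(** Rational end points make the boxes and the bumps on them countable, so that conditions on all of
    them can be imposed simultaneously at almost every time. *)
Definition rbox (q : {ffun 'I_n -> rat} * {ffun 'I_n -> rat}) : set 'rV[R]_n :=
  box (fun i => ratr (q.1 i)) (fun i => ratr (q.2 i)).

Definition rbump (q : {ffun 'I_n -> rat} * {ffun 'I_n -> rat}) k : 'rV[R]_n -> R :=
  boxbump k (fun i => ratr (q.1 i)) (fun i => ratr (q.2 i)).

Lemma rbox_nbhs x : Om x -> exists q, rbox q x /\ rbox q `<=` Om.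
Proof.
move=> Ox; have /nbhs_ballP[e /= e0 eO] : nbhs x Om by exact: open_nbhs_nbhs.
have /choice[lo hlo] : forall i, exists q : rat, x ord0 i - e < ratr q < x ord0 i.
  move=> i; have [|q] := @rat_in_itvoo R (x ord0 i - e) (x ord0 i); last by exists q.
  by rewrite ltrBlDr ltrDl.
have /choice[hi hhi] : forall i, exists q : rat, x ord0 i < ratr q < x ord0 i + e.
  move=> i; have [|q] := @rat_in_itvoo R (x ord0 i) (x ord0 i + e); last by exists q.
  by rewrite ltrDl.
exists ([ffun i => lo i], [ffun i => hi i]); split.
  move=> i /=; rewrite !ffunE; have /andP[_ ->] := hlo i.
  by have /andP[->] := hhi i.
move=> y hy; apply: eO; split => // a i; rewrite !ord1.
have := hy i; rewrite /= !ffunE => /andP[h1 h2].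
have /andP[h3 h4] := hlo i; have /andP[h5 h6] := hhi i.
by rewrite /ball /= ltr_norml; apply/andP; split; lra.
Qed.

(** Bumps converge to indicators of rational boxes, and these to indicators of arbitrary boxes
    inside [Om]. Within one rational box the boxes are a generating pi-system, and countably many
    rational boxes cover [Om]. *)
Lemma fundamental_ae0 f : L1 mu Om f ->
  (forall q k, rbox q `<=` Om -> \int[mu]_(x in Om) (f x * rbump q k x) = 0) ->
  {ae mu, forall x, Om x -> f x = 0}.
Proof.
move=> If f0; have mOm : measurable Om by exact: open_rV_measurable.
have mf := L1_measurable If.
have mI (B : set 'rV[R]_n) : measurable B -> measurable_fun Om (fun x => f x * \1_B x).
  by move=> mB; apply: measurable_funM => //; exact: measurable_indic.
have dom (g : 'rV[R]_n -> R) x : 0 <= g x -> g x <= 1 -> `|f x * g x| <= `|f x|.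
  by move=> g0 g1; rewrite normrM (ger0_norm g0) ler_piMr.
have rat0 q : rbox q `<=` Om -> \int[mu]_(x in Om) (f x * \1_(rbox q) x) = 0.
  move=> qO; have cv : (fun k => \int[mu]_(x in Om) (f x * rbump q k x)) @ \oo -->
      \int[mu]_(x in Om) (f x * \1_(rbox q) x).
    apply: (Rdominated_cvg mOm (g := fun x => `|f x|)).
    - move=> k; apply: measurable_funM => //; apply: measurable_funTS.
      apply: continuous_rV_measurable; apply: smooth_continuous.
      by have [] := test_boxbump (U := Om) k qO.
    - by move=> x _; apply: cvgM; [exact: cvg_cst|exact: cvg_boxbump].
    - exact: L1_abs.
    - by move=> k x _; apply: dom; [exact: boxbump_ge0|exact: boxbump_le1].
  move: cv; under eq_fun do rewrite f0//.
  by move=> /(cvg_unique _ (cvg_cst 0)) <-.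
have real0 lo hi : box lo hi `<=` Om -> \int[mu]_(x in Om) (f x * \1_(box lo hi) x) = 0.
  move=> bO.
  have ratl (a : R) (k : nat) : exists q : rat, a < ratr q < a + k.+1%:R^-1.
    have [|q] := @rat_in_itvoo R a (a + k.+1%:R^-1); last by exists q.
    by rewrite ltrDl invr_gt0.
  have ratr' (a : R) (k : nat) : exists q : rat, a - k.+1%:R^-1 < ratr q < a.
    have [|q] := @rat_in_itvoo R (a - k.+1%:R^-1) a; last by exists q.
    by rewrite ltrBlDr ltrDl invr_gt0.
  have /choice[ql hl] : forall a : R * nat, exists q : rat, a.1 < ratr q < a.1 + a.2.+1%:R^-1.
    by move=> a; exact: ratl.
  have /choice[qr hr] : forall a : R * nat, exists q : rat, a.1 - a.2.+1%:R^-1 < ratr q < a.1.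
    by move=> a; exact: ratr'.
  (* Rational boxes that approach the given one from inside, with sides displaced by less than
     [k.+1%:R^-1]. *)
  pose Q k := ([ffun i => ql (lo i, k)], [ffun i => qr (hi i, k)]).
  have QO k : rbox (Q k) `<=` box lo hi.
    move=> x hx i; have := hx i; rewrite /= !ffunE => /andP[h1 h2].
    have /andP[h3 _] := hl (lo i, k); have /andP[_ h4] := hr (hi i, k).
    by rewrite (lt_trans h3 h1) (lt_trans h2 h4).
  have cv : (fun k => \int[mu]_(x in Om) (f x * \1_(rbox (Q k)) x)) @ \oo -->
      \int[mu]_(x in Om) (f x * \1_(box lo hi) x).
    apply: (Rdominated_cvg mOm (g := fun x => `|f x|)).
    - by move=> k; apply: mI; exact: box_measurable.
    - move=> x _; apply: cvgM; first exact: cvg_cst.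
      rewrite indicE; have [/set_mem bx|/negP nb] := boolP (x \in _).
        have /choice[N hN] : forall i, exists N, forall k, (N <= k)%N ->
            lo i + k.+1%:R^-1 < x ord0 i < hi i - k.+1%:R^-1.
          move=> i; have /andP[h1 h2] := bx i.
          have m0 : 0 < Num.min (x ord0 i - lo i) (hi i - x ord0 i).
            by rewrite lt_min !subr_gt0 h1.
          have [N] := ltr_add_invr m0; rewrite add0r lt_min => /andP[h3 h4].
          exists N => k Nk; have h5 : k.+1%:R^-1 <= N.+1%:R^-1 :> R.
            by rewrite lef_pV2 ?posrE// ler_nat ltnS.
          move: h3 h4 h5; move: (k.+1%:R^-1) (N.+1%:R^-1) => a b h3 h4 h5.
          by apply/andP; split; lra.
        apply: cvg_near_cst; exists (\max_i N i)%N => // k /= Nk.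
        rewrite indicE mem_set// => i.
        have /andP[h1 h2] := hN i k (leq_trans (leq_bigmax i) Nk).
        have /andP[_ h3] := hl (lo i, k); have /andP[h4 _] := hr (hi i, k).
        by rewrite /= !ffunE (lt_trans h3 h1) (lt_trans h2 h4).
      apply: cvg_near_cst; apply: nearW => k; rewrite indicE memNset//.
      by move=> /QO bx; apply: nb; exact/mem_set.
    - exact: L1_abs.
    - by move=> k x _; apply: dom; rewrite indicE; case: (_ \in _).
  move: cv; rewrite (_ : (fun k => _) = fun=> 0).
    by move=> /(cvg_unique _ (cvg_cst 0)) <-.
  by apply/funext => k; apply: rat0; exact: subset_trans bO.
have box0 q : rbox q `<=` Om -> {ae mu, forall x, rbox q x -> f x = 0}.
  move=> qO; have mq : measurable (rbox q) by exact: box_measurable.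
  have IB lo hi : box lo hi `<=` Om -> \int[mu]_(x in box lo hi) f x = 0.
    move=> bO; rewrite -(setIidr bO) Rintegral_mkcondr -[RHS](real0 lo hi bO).
    by apply: eq_Rintegral => x _; rewrite /patch indicE; case: ifP; rewrite ?mulr1 ?mulr0.
  apply: (ae0_pi_system mq setI_boxes measurable_boxes).
  - exact: (integrableS mOm mq qO If).
  - exact: IB.
  - move=> _ [lo [hi ->]]; rewrite box_setI; apply: IB.
    by rewrite -box_setI => x [/qO].
have : {ae mu, forall x, forall q, rbox q `<=` Om -> rbox q x -> f x = 0}.
  apply: ae_forall_count => q; have [/box0|nq] := pselect (rbox q `<=` Om).
    by apply: filterS => x h _.
  by apply: aeW => x /nq.
by apply: filterS => x h /rbox_nbhs[q [qx qO]]; exact: h qO qx.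
Qed.

End fundamental_lemma.

(** * The space H^1_0 *)

Lemma weighted_sum_lt {R : realFieldType} (a e A B : R) : 0 < e ->
  A < e / (4 * (a ^+ 2 + 1)) -> B < e / (4 * (a ^+ 2 + 1)) ->
  2 * (a * (a * A)) + 2 * B < e.
Proof.
move=> e0; have K1 : 0 < a ^+ 2 + 1 by rewrite ltr_wpDl// sqr_ge0.
rewrite !ltr_pdivlMr ?mulr_gt0// => h1 h2.
have h3 : (a * (a * A) + B) * (4 * (a ^+ 2 + 1)) < 2 * (a ^+ 2 + 1) * e.
  have := sqr_ge0 a; nra.
rewrite -(ltr_pM2r K1); nra.
Qed.

Section test_functions_lemmas.
Context {R : realType} {V : normedModType R}.
Implicit Types (U : set V) (f g : V -> R).

Lemma test_smooth U f : test_fun U f -> smooth f.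
Proof. by case. Qed.

Lemma test_continuous U f : test_fun U f -> continuous f.
Proof. by move=> /test_smooth/smooth_continuous. Qed.

Lemma test_derivable U f x v : test_fun U f -> derivable f x v.
Proof. by move=> /test_smooth; exact: smooth_derivable. Qed.

Lemma test_eq0 U f x : test_fun U f -> ~ U x -> f x = 0.
Proof.
move=> [_ _ fU] nU; apply/eqP/contraT => fx; exfalso; apply: nU; apply: fU.
exact: subset_closure.
Qed.

Lemma test_derive U f v : test_fun U f -> test_fun U ('D_v f).
Proof.
move=> [sf cf fU]; apply: (@test_funP _ V U (closure [set x | f x != 0]) _ _ cf _ fU).
  exact: smooth_derive.
move=> x; apply: contraPP => ncl; rewrite derive_eq0//; exact/negP/negPn/eqP.
Qed.

Lemma test_bounded U f : test_fun U f -> exists2 M, 0 <= M & forall x, `|f x| <= M.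
Proof.
move=> tf; have [sf cf fU] := tf.
have : compact (f @` closure [set x | f x != 0]).
  apply: continuous_compact => //; apply: continuous_subspaceT.
  exact: test_continuous tf.
move=> /compact_bounded/bounded_norm[M hM]; exists `|M| => // x.
have [->|fx] := eqVneq (f x) 0; first by rewrite normr0.
apply: le_trans (ler_norm M); apply: hM; exists x => //; exact: subset_closure.
Qed.

Lemma test_lin U a f g : test_fun U f -> test_fun U g ->
  test_fun U (fun x => a * f x + g x).
Proof.
move=> [sf cf fU] [sg cg gU].
apply: (@test_funP _ V U (closure [set x | f x != 0] `|` closure [set x | g x != 0])).
- apply: smooth_algP; apply: sa_add; last exact: sa_smooth.
  by apply: sa_mul; [exact: sa_cst|exact: sa_smooth].
- exact: compactU.
- move=> x h; have [fx|fx] := eqVneq (f x) 0; last by left; exact: subset_closure.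
  by right; apply: subset_closure; move: h; rewrite fx mulr0 add0r.
- by move=> x [/fU|/gU].
Qed.

End test_functions_lemmas.
Arguments test_derivable {R V U f} x v _.

Section sobolev.
Context {R : realType} {n : nat}.
Local Notation mu := (@lebesgue_rV R n.+1).
Local Notation E := 'rV[R]_n.+1.
Variable Om : set E.
Hypothesis oOm : open Om.
Hypothesis bOm : bounded_set Om.
Implicit Types (w v phi : E -> R) (g h : E -> E).

Let mOm : measurable Om. Proof. exact: open_rV_measurable. Qed.
Let Omoo : (mu Om < +oo)%E. Proof. exact: bounded_lty. Qed.
Let sL := ipL_semi mu mOm.
Let sVe := @ipV_semi _ _ R n.+1 mu Om mOm.
Let L2vD g h : L2v mu Om g -> L2v mu Om h -> L2v mu Om (g - h).
Proof. exact: (subspaceB (@L2v_subspace _ _ R n.+1 mu Om mOm)). Qed.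

Lemma test_L2 phi : test_fun Om phi -> L2 mu Om phi.
Proof.
move=> tphi; have [M _ hM] := test_bounded tphi.
apply: (L2_bnd mOm (C := M) Omoo); last by move=> x _; exact: hM.
by apply: measurable_funTS; apply: continuous_rV_measurable; exact: test_continuous tphi.
Qed.

Lemma test_L2v phi : test_fun Om phi -> L2v mu Om (cgrad phi).
Proof.
move=> tphi i; under eq_fun do rewrite mxE; apply: test_L2.
exact: test_derive.
Qed.

Lemma cgrad_lin a phi psi x : test_fun Om phi -> test_fun Om psi ->
  cgrad (fun x => a * phi x + psi x) x = a *: cgrad phi x + cgrad psi x.
Proof.
move=> t1 t2; apply/rowP => i; rewrite !mxE.
have d1 := test_derivable x (delta_mx ord0 i) t1.
have d2 := test_derivable x (delta_mx ord0 i) t2.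
by rewrite (deriveD (derivableZ d1) d2) deriveZ.
Qed.

Lemma Rintegral_test (f : E -> R) : (forall x, ~ Om x -> f x = 0) ->
  \int[mu]_(x in Om) f x = \int[mu]_x f x.
Proof.
move=> f0; rewrite Rintegral_mkcond; apply: eq_Rintegral => x _.
by rewrite /patch; case: ifPn => // /negP nO; rewrite f0// => Ox; apply: nO; exact/mem_set.
Qed.

Lemma test_Rintegral_derive phi (e : E) : test_fun Om phi ->
  \int[mu]_(x in Om) 'D_e phi x = 0.
Proof.
move=> tphi; rewrite Rintegral_test.
  apply: Rintegral_derive0.
  - exact: test_continuous tphi.
  - by move=> x; exact: test_derivable tphi.
  - exact: test_continuous (test_derive e tphi).
  - by case: tphi.
by move=> x; exact: test_eq0 (test_derive e tphi).
Qed.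

Lemma test_weak_grad phi : test_fun Om phi -> weak_grad Om phi (cgrad phi).
Proof.
move=> t1 psi t2 i; set e := delta_mx ord0 i.
have L1a := L2M mOm (test_L2 t1) (test_L2 (test_derive e t2)).
have L1b := L2M mOm (test_L2 t2) (test_L2 (test_derive e t1)).
have := test_Rintegral_derive e (test_funM (test_smooth t1) t2).
have -> : 'D_e (fun x => phi x * psi x) = fun x => phi x * 'D_e psi x + psi x * 'D_e phi x.
  apply/funext => x.
  exact: (deriveM (test_derivable x e t1) (test_derivable x e t2)).
rewrite RintegralD// => /eqP; rewrite addr_eq0 => /eqP ->.
by congr (- _); apply: eq_Rintegral => x _; rewrite mxE mulrC.
Qed.

(** Approximation in terms of squared distances below any [e], the form in which the semi-inner
    product arguments deliver it; a sequence is recovered from the values [k.+1%:R^-1 ^+ 2] of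
    [e]. *)
Lemma H10_gradP w g : H10_grad Om w g <->
  [/\ L2 mu Om w, L2v mu Om g, weak_grad Om w g & forall e, 0 < e ->
    exists2 phi, test_fun Om phi & ipL mu Om (w - phi) (w - phi) < e /\
    ipV mu Om (g - cgrad phi) (g - cgrad phi) < e].
Proof.
split=> [[w2 g2 wg [phi [tphi c1 c2]]]|[w2 g2 wg ap]].
  split => // e e0; have s0 : 0 < Num.sqrt e by rewrite sqrtr_gt0.
  move: c1 c2 => /cvgr0_norm_lt/(_ _ s0) c1 /cvgr0_norm_lt/(_ _ s0) c2.
  have [k []] := filter_ex (filterI c1 c2).
  have t2 := test_L2 (tphi k); have tg := test_L2v (tphi k).
  rewrite L2normE//; last exact: L2B.
  rewrite L2norm_enorm//; last exact: L2vD.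
  rewrite !ger0_norm ?sqrtr_ge0// !ltr_sqrt// => h1 h2.
  by exists (phi k).
split => //.
have /choice[phi hphi] : forall k : nat, exists phi, test_fun Om phi /\
    (ipL mu Om (w - phi) (w - phi) < k.+1%:R^-1 ^+ 2 /\
    ipV mu Om (g - cgrad phi) (g - cgrad phi) < k.+1%:R^-1 ^+ 2).
  move=> k; have k0 : 0 < k.+1%:R^-1 ^+ 2 :> R by rewrite exprn_gt0// invr_gt0.
  by have [phi ? ?] := ap _ k0; exists phi.
have sq (f : nat -> R) : (forall k, 0 <= f k) -> (forall k, f k < k.+1%:R^-1 ^+ 2) ->
    (fun k => Num.sqrt (f k)) @ \oo --> (0 : R).
  move=> f0 fk; apply: (@squeeze_cvgr _ _ _ _ (fun=> 0) (@harmonic R)).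
  - apply: nearW => k; rewrite sqrtr_ge0 /= -[leRHS](@ger0_norm _ (harmonic k)) ?harmonic_ge0//.
    by rewrite -sqrtr_sqr ler_sqrt ?exprn_ge0 ?harmonic_ge0// ltW.
  - exact: cvg_cst.
  - exact: cvg_harmonic.
exists phi; split; first by move=> k; case: (hphi k).
- under eq_fun => k.
    rewrite L2normE//; last by apply: L2B => //; apply: test_L2; case: (hphi k).
  over.
  apply: sq => k; last by case: (hphi k) => _ [].
  by apply: (ip_ge0 sL); apply: L2B => //; apply: test_L2; case: (hphi k).
- under eq_fun => k.
    rewrite L2norm_enorm//; last by apply: L2vD => //; apply: test_L2v; case: (hphi k).
  over.
  apply: sq => k; last by case: (hphi k) => _ [].
  by apply: (ip_ge0 sVe); apply: L2vD => //; apply: test_L2v; case: (hphi k).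
Qed.

Lemma test_H10 phi : test_fun Om phi -> H10_grad Om phi (cgrad phi).
Proof.
move=> tphi; apply/H10_gradP; split.
- exact: test_L2.
- exact: test_L2v.
- exact: test_weak_grad.
- move=> e e0; exists phi => //; rewrite !subrr.
  by rewrite (ip0l sL) ?(ip0l sVe)//; [exact: L2v_0|exact: L2_0].
Qed.

Lemma H10_lin a w v g h : H10_grad Om w g -> H10_grad Om v h ->
  H10_grad Om (fun x => a * w x + v x) (fun x => a *: g x + h x).
Proof.
move=> /H10_gradP[w2 g2 wg apw] /H10_gradP[v2 h2 vh apv]; apply/H10_gradP; split.
- exact: L2_lin.
- exact: L2v_lin.
- move=> phi tphi i; have tD := test_L2 (test_derive (delta_mx ord0 i) tphi).
  have tp := test_L2 tphi.
  have e1 : \int[mu]_(x in Om) ((a * w x + v x) * 'D_(delta_mx ord0 i) phi x) =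
     a * \int[mu]_(x in Om) (w x * 'D_(delta_mx ord0 i) phi x) +
     \int[mu]_(x in Om) (v x * 'D_(delta_mx ord0 i) phi x).
    by have [_ _ /(_ a w v _ w2 v2 tD)] := sL.
  have e2 : \int[mu]_(x in Om) ((a *: g x + h x) ord0 i * phi x) =
     a * \int[mu]_(x in Om) (g x ord0 i * phi x) +
     \int[mu]_(x in Om) (h x ord0 i * phi x).
    have [_ _ /(_ a (fun x => g x ord0 i) (fun x => h x ord0 i) _ (g2 i) (h2 i) tp) <- _] := sL.
    by apply: eq_Rintegral => x _; rewrite !mxE.
  by rewrite e1 e2 wg// vh//; ring.
- move=> e e0.
  have a0 : 0 < 4 * (a ^+ 2 + 1) by rewrite mulr_gt0// ltr_wpDl// sqr_ge0.
  have e1 : 0 < e / (4 * (a ^+ 2 + 1)) by rewrite divr_gt0.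
  have [phi tphi [p1 p2]] := apw _ e1; have [psi tpsi [q1 q2]] := apv _ e1.
  exists (fun x => a * phi x + psi x); first exact: test_lin.
  have bnd := weighted_sum_lt e0.
  split.
    rewrite (_ : _ - _ = a *: (w - phi) + (v - psi)); last first.
      by apply/funext => x; rewrite !fctE /GRing.scale /=; ring.
    have t1 := test_L2 tphi; have t2 := test_L2 tpsi.
    apply: le_lt_trans (ip_leD2 sL _ _) _; [exact: L2Z (L2B _ _ _)|exact: L2B|].
    have wp2 : L2 mu Om (w - phi) by exact: L2B.
    rewrite (ipZl sL) ?(ipZr sL)//; last exact: L2Z.
    move: (ipL _ _ (w - phi) _) (ipL _ _ (v - psi) _) p1 q1 => A B; exact: bnd.
  rewrite (_ : _ - _ = a *: (g - cgrad phi) + (h - cgrad psi)); last first.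
    apply/funext => x; rewrite !fctE /= cgrad_lin// scalerBr.
    by rewrite opprD addrACA.
  have t1 := test_L2v tphi; have t2 := test_L2v tpsi.
  have gp2 : L2v mu Om (g - cgrad phi) by exact: L2vD.
  have gp3 : L2v mu Om (a *: (g - cgrad phi)).
    exact: (subspaceZ a (@L2v_subspace _ _ R n.+1 mu Om mOm)).
  apply: le_lt_trans (ip_leD2 sVe gp3 (L2vD h2 t2)) _.
  rewrite (ipZl sVe a gp2 gp3) (ipZr sVe a gp2 gp2).
  move: (ipV _ _ (g - _) _) (ipV _ _ (h - _) _) p2 q2 => A B; exact: bnd.
Qed.

Lemma H10_grad0 : H10_grad Om (fun=> 0) (fun=> 0).
Proof.
apply/H10_gradP; split.
- exact: L2_0.
- exact: L2v_0.
- move=> phi _ i; rewrite -[LHS](_ : \int[mu]_(x in Om) 0 = _).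
    rewrite -[X in - X](_ : \int[mu]_(x in Om) 0 = _).
      by rewrite Rintegral_cst// mul0r oppr0.
    by apply: eq_Rintegral => x _; rewrite mxE mul0r.
  by apply: eq_Rintegral => x _; rewrite mul0r.
- have t0 : test_fun Om (fun=> 0 : R).
    apply: (@test_funP _ _ _ set0) => //.
    + by apply: smooth_algP; exact: sa_cst.
    + exact: compact0.
    + by move=> x; rewrite eqxx.
  move=> e e0; exists (fun=> 0) => //.
  have -> : cgrad (fun _ : E => 0 : R) = fun=> 0.
    by apply/funext => x; apply/rowP => i; rewrite !mxE derive_cst.
  rewrite !subrr.
  by rewrite (ip0l sL) ?(ip0l sVe)//; [exact: L2v_0|exact: L2_0].
Qed.

(** Corresponding components of the two gradients have the same integral against every bump, so the
    fundamental lemma applies to their difference. *)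
Lemma H10_grad_unique w w' g g' : H10_grad Om w g -> H10_grad Om w' g' ->
  {ae mu, forall x, Om x -> w x = w' x} -> {ae mu, forall x, Om x -> g x = g' x}.
Proof.
move=> [w2 g2 wg _] [w2' g2' wg' _] ww'.
have : {ae mu, forall x, forall i : 'I_n.+1, Om x -> g x ord0 i = g' x ord0 i}.
  apply: ae_forall_count => i.
  have I : L1 mu Om (fun x => g x ord0 i - g' x ord0 i).
    exact: (L1_finite_L2 mOm Omoo (L2B mOm (g2 i) (g2' i))).
  have : {ae mu, forall x, Om x -> g x ord0 i - g' x ord0 i = 0}.
    apply: (fundamental_ae0 oOm) => // q k qO.
    have tb := test_boxbump (U := Om) k qO.
    have e1 := wg _ tb i; have e2 := wg' _ tb i.
    have := test_L2 tb; have := test_L2 (test_derive (delta_mx ord0 i) tb).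
    move=> tD tp.
    have -> : \int[mu]_(x in Om) ((g x ord0 i - g' x ord0 i) * rbump q k x) =
        \int[mu]_(x in Om) (g x ord0 i * rbump q k x) - \int[mu]_(x in Om) (g' x ord0 i * rbump q k x).
      rewrite -RintegralB//; [|exact: L2M (g2 i) tp|exact: L2M (g2' i) tp].
      by apply: eq_Rintegral => x _; rewrite mulrBl.
    have : \int[mu]_(x in Om) (w x * 'D_(delta_mx ord0 i) (rbump q k) x) =
      \int[mu]_(x in Om) (w' x * 'D_(delta_mx ord0 i) (rbump q k) x).
      apply: (ipL_ae mOm) => //; by apply: aeW.
    by rewrite e1 e2 => /oppr_inj ->; rewrite subrr.
  by apply: filterS => x h /h /eqP; rewrite subr_eq0 => /eqP.
by apply: filterS => x h Ox; apply/rowP => i; exact: h.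
Qed.

(** The derivative of x_0 phi^2 in the direction of x_0 has integral 0, so phi^2 has the same
    integral as - 2 x_0 phi d phi. As |x_0| <= M on [Om], Young's inequality gives the constant 4
    M^2. *)
Lemma poincare_test : exists2 C, 0 <= C & forall phi, test_fun Om phi ->
  ipL mu Om phi phi <= C * ipV mu Om (cgrad phi) (cgrad phi).
Proof.
have [M0 hM0] := bounded_norm bOm.
pose M := `|M0|; have M_ge0 : 0 <= M by exact: normr_ge0.
have hM x : Om x -> `|x ord0 ord0| <= M.
  move=> /hM0 h; apply: le_trans (ler_norm _); apply: le_trans h.
  rewrite /Num.norm /= mx_normrE.
  exact: (le_bigmax _ (fun i : 'I_1 * 'I_n.+1 => `|x i.1 i.2|) (ord0, ord0)).
exists (4 * M ^+ 2); first by rewrite mulr_ge0// sqr_ge0.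
move=> phi tphi; set e : E := delta_mx ord0 ord0.
have t2 := test_L2 tphi; have tD2 := test_L2 (test_derive e tphi).
apply: le_trans (_ : 4 * M ^+ 2 * ipL mu Om ('D_e phi) ('D_e phi) <= _); last first.
  apply: ler_wpM2l; first by rewrite mulr_ge0// sqr_ge0.
  apply: le_trans (ipL_coord_le mOm ord0 (test_L2v tphi)).
  by rewrite le_eqVlt; apply/orP; left; apply/eqP; apply: eq_Rintegral => x _; rewrite !mxE.
have sx : smooth (fun x : E => x ord0 ord0).
  by apply: smooth_algP; apply: sa_lin; exact: linear_form_coord.
have tPhi : test_fun Om (fun x => x ord0 ord0 * (phi x * phi x)).
  exact: (test_funM sx (test_funM (test_smooth tphi) tphi)).
have := test_Rintegral_derive e tPhi.
have dx x : is_derive x e (fun x : E => x ord0 ord0) 1.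
  have := @is_derive_comp_lin R _ id (fun=> 1) (fun x : E => x ord0 ord0) 0 x e
    (linear_form_coord ord0) (is_derive_id _ _).
  rewrite mulr1 {1}/e mxE !eqxx mulr1n; congr (is_derive _ _ _ _).
  by apply/funext => y; rewrite addr0.
have -> : 'D_e (fun x : E => x ord0 ord0 * (phi x * phi x)) =
    fun x => phi x * phi x + 2 * x ord0 ord0 * (phi x * 'D_e phi x).
  apply/funext => x; have dphi := test_derivable x e tphi.
  have h1 := deriveM dphi dphi.
  have h2 := deriveM (@ex_derive _ _ _ _ _ _ _ (dx x)) (derivableM dphi dphi).
  etransitivity; first exact: h2.
  rewrite h1 (@derive_val _ _ _ _ _ _ _ (dx x)) !fctE /GRing.scale /=; ring.
have I1 := L2M mOm t2 t2; have I2 := L2M mOm tD2 tD2.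
have I3 : L1 mu Om (fun x => 2 * x ord0 ord0 * (phi x * 'D_e phi x)).
  have := L2M mOm (L2_bounded mOm (C := 2 * M) (b := fun x : E => 2 * x ord0 ord0) _ _ t2) tD2.
  rewrite (_ : (fun x : E => _ * (phi x * _)) =
    (fun x : E => 2 * x ord0 ord0 * phi x * 'D_e phi x)); last first.
    by apply/funext => x; rewrite mulrA.
  apply.
    apply: measurable_funTS; apply: measurable_funM => //; exact: measurable_mx_coord.
  by move=> x Ox; rewrite normrM ger0_norm// ler_pM2l// hM.
move=> e0.
(* Pointwise this expresses that half the square of phi + 2 x_0 d phi is nonnegative; the right-hand
   integral is 0 by [e0]. *)
have : \int[mu]_(x in Om) (2^-1 * (phi x * phi x) - 2 * M ^+ 2 * ('D_e phi x * 'D_e phi x))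
    <= \int[mu]_(x in Om) (phi x * phi x + 2 * x ord0 ord0 * (phi x * 'D_e phi x)).
  apply: le_Rintegral => //.
  - by apply: L1B => //; exact: L1Z.
  - exact: L1D.
  - move=> x Ox; have := hM _ Ox; rewrite ler_norml => /andP[h1 h2].
    move: (x ord0 ord0) (phi x) ('D_e phi x) h1 h2 => a p D h1 h2.
    have : a ^+ 2 * D ^+ 2 <= M ^+ 2 * D ^+ 2 by apply: ler_wpM2r; [exact: sqr_ge0|nra].
    have := sqr_ge0 (p + 2 * a * D); nra.
rewrite e0 RintegralB//; [|exact: L1Z|exact: L1Z].
rewrite !RintegralZl// -/(ipL mu Om phi phi) -/(ipL mu Om ('D_e phi) ('D_e phi)).
lra.
Qed.

Lemma poincare : exists2 C, 0 <= C & forall w g, H10_grad Om w g ->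
  ipL mu Om w w <= C * ipV mu Om g g.
Proof.
have [C C0 hC] := poincare_test; exists (4 * C); first by rewrite mulr_ge0.
move=> w g /H10_gradP[w2 g2 _ ap]; apply/ler_addgt0Pr => e e0.
(* Twice the error of the function and 4 C times the error of the gradient have to fit into [e]. *)
have e1 : 0 < e / (2 + 4 * C) by rewrite divr_gt0// ltr_pwDl// mulr_ge0.
have [phi tphi [h1 h2]] := ap _ e1.
have t1 := test_L2 tphi; have t2 := test_L2v tphi.
have wp2 : L2 mu Om (w - phi) by exact: L2B.
have gp2 : L2v mu Om (cgrad phi - g) by exact: L2vD.
have := ip_leD2 sL wp2 t1; rewrite subrK => hw.
have := ip_leD2 sVe gp2 g2; rewrite subrK => hg.
have h3 : ipV mu Om (cgrad phi - g) (cgrad phi - g) < e / (2 + 4 * C).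
  by rewrite (ip_subC sVe).
have := hC _ tphi; move: h1 h3; rewrite !ltr_pdivlMr; [|lra..].
nra.
Qed.

(** Both requirements survive limits in L^2: the weak gradient is tested against one fixed function
    at a time, and test functions near an approximant are near the limit. *)
Lemma H10_closed w g : L2 mu Om w -> L2v mu Om g ->
  (forall e, 0 < e -> exists w' g', H10_grad Om w' g' /\
    ipL mu Om (w - w') (w - w') < e /\ ipV mu Om (g - g') (g - g') < e) ->
  H10_grad Om w g.
Proof.
move=> w2 g2 ap; apply/H10_gradP; split => //.
  move=> phi tphi i; apply/eqP; rewrite -subr_eq0 opprK -normr_le0.
  apply/ler_addgt0Pr => e e0; rewrite add0r.
  have tp := test_L2 tphi; have tD := test_L2 (test_derive (delta_mx ord0 i) tphi).
  set Dp := 'D_(delta_mx ord0 i) phi in tD *.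
  pose K := Num.sqrt (ipL mu Om Dp Dp) + Num.sqrt (ipL mu Om phi phi) + 1.
  have K0 : 0 < K by rewrite ltr_wpDl// addr_ge0.
  have [w' [g' [[w2' g2' wg' _] [h1 h2]]]] := ap _ (exprn_gt0 2 (divr_gt0 e0 K0)).
  have dw : L2 mu Om (w - w') by exact: L2B.
  have dg : L2v mu Om (g - g') by exact: L2vD.
  have e1 : \int[mu]_(x in Om) (w x * Dp x) = ipL mu Om (w - w') Dp + \int[mu]_(x in Om) (w' x * Dp x).
    by rewrite (ipBl sL)// subrK.
  have e2 : \int[mu]_(x in Om) (g x ord0 i * phi x) =
      ipL mu Om (fun x => (g - g') x ord0 i) phi + \int[mu]_(x in Om) (g' x ord0 i * phi x).
    have -> : (fun x => (g - g') x ord0 i) = (fun x => g x ord0 i) - (fun x => g' x ord0 i).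
      by apply/funext => x; rewrite !fctE !mxE.
    by rewrite (ipBl sL (g2 i) (g2' i) tp) subrK.
  rewrite e1 e2 (wg' _ tphi i) addrACA addNr addr0.
  apply: le_trans (ler_normD _ _) _.
  have s1 : Num.sqrt (ipL mu Om (w - w') (w - w')) <= e / K.
    rewrite -(ger0_norm (ltW (divr_gt0 e0 K0))) -sqrtr_sqr ler_sqrt ?exprn_ge0 ?(ltW h1)//.
    exact: ltW (divr_gt0 _ _).
  have s2 : Num.sqrt (ipL mu Om (fun x => (g - g') x ord0 i) (fun x => (g - g') x ord0 i)) <= e / K.
    rewrite -(ger0_norm (ltW (divr_gt0 e0 K0))) -sqrtr_sqr ler_sqrt; last first.
      by rewrite exprn_ge0// ltW// divr_gt0.
    by apply: le_trans (ipL_coord_le mOm i dg) (ltW h2).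
  have := ip_le sL dw tD; have := ip_le sL (dg i) tp => b2 b1.
  apply: le_trans (lerD b1 b2) _.
  apply: le_trans (lerD (ler_wpM2r (sqrtr_ge0 _) s1) (ler_wpM2r (sqrtr_ge0 _) s2)) _.
  rewrite -mulrDr -[leRHS](divfK (lt0r_neq0 K0)) ler_pM2l ?divr_gt0//.
  by rewrite /K lerDl.
move=> e e0; have e4 : 0 < e / 4 by lra.
have [w' [g' [/H10_gradP[w2' g2' _ ap'] [h1 h2]]]] := ap _ e4.
have [phi tphi [p1 p2]] := ap' _ e4; exists phi => //.
have t1 := test_L2 tphi; have t2 := test_L2v tphi; split.
  have -> : w - phi = (w - w') + (w' - phi) by rewrite subrKA.
  apply: le_lt_trans (ip_leD2 sL _ _) _; [exact: L2B|exact: L2B|lra].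
have -> : g - cgrad phi = (g - g') + (g' - cgrad phi) by rewrite subrKA.
apply: le_lt_trans (ip_leD2 sVe _ _) _; [exact: L2vD|exact: L2vD|lra].
Qed.

(** A chosen gradient; uniqueness up to null sets makes [ipH] independent of the choice. *)
Definition gradH w : E -> E := xget (fun=> 0) [set g | H10_grad Om w g].

Lemma gradHP w : H10 Om w -> H10_grad Om w (gradH w).
Proof. by move=> [g hg]; exact: (xgetPex _ (ex_intro _ g hg)). Qed.

Definition ipH w v := ipV mu Om (gradH w) (gradH v).

Lemma ipHE w v g h : H10_grad Om w g -> H10_grad Om v h -> ipH w v = ipV mu Om g h.
Proof.
move=> hw hv; have gw := gradHP (ex_intro _ g hw); have gv := gradHP (ex_intro _ h hv).
have [_ ? _ _] := hw; have [_ ? _ _] := hv; have [_ ? _ _] := gw; have [_ ? _ _] := gv.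
apply: (ipV_ae mOm) => //; apply: H10_grad_unique; by [exact: gw|exact: hw|exact: gv|exact: hv|exact: aeW].
Qed.

Lemma H10_subspace : subspace (H10 Om : set (E -> R)).
Proof.
split; first by exists (fun=> 0); exact: H10_grad0.
by move=> a w v [g hg] [h hh]; exists (fun x => a *: g x + h x); exact: H10_lin.
Qed.

Lemma ipH_semi : semi_ip (H10 Om : set (E -> R)) ipH.
Proof.
split; first exact: H10_subspace.
- move=> w v [g hg] [h hh]; rewrite (ipHE hg hh) (ipHE hh hg).
  by apply: (ipC sVe); [case: hg|case: hh].
- move=> a w v z [g hg] [h hh] [k hk].
  rewrite (ipHE (H10_lin a hg hh) hk) (ipHE hg hk) (ipHE hh hk).
  have [_ _ h3 _] := sVe; apply: h3; by [case: hg|case: hh|case: hk].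
- move=> w [g hg]; rewrite (ipHE hg hg); apply: (ip_ge0 sVe); by case: hg.
Qed.

(** Poincare's inequality makes a sequence with Cauchy gradients Cauchy in L^2 as well, and
    [H10_closed] pairs the two limits. *)
Lemma ipH_complete : ip_complete (H10 Om : set (E -> R)) ipH.
Proof.
move=> u Hu cau; have [C C0 hC] := poincare.
have gu k := gradHP (Hu k).
have dif i j : H10_grad Om (u i - u j) (gradH (u i) - gradH (u j)).
  have := H10_lin (-1) (gu j) (gu i).
  congr (H10_grad Om _ _); apply/funext => x; rewrite !fctE /=; first by ring.
  by rewrite scaleN1r addrC.
have [|e e0|l l2 hl] := @ipL_complete _ _ R mu Om mOm u.
- by move=> k; case: (gu k).
- have e1 : 0 < e / (C + 1) by rewrite divr_gt0// ltr_wpDl.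
  have [N hN] := cau _ e1; exists N => i j Ni Nj.
  apply: le_lt_trans (hC _ _ (dif i j)) _.
  have := hN i j Ni Nj; rewrite (ipHE (dif i j) (dif i j)) ltr_pdivlMr ?ltr_wpDl// => h.
  have : 0 <= ipV mu Om (gradH (u i) - gradH (u j)) (gradH (u i) - gradH (u j)).
    by apply: (ip_ge0 sVe); case: (dif i j).
  nra.
have [|e e0|g g2 hg] := @ipV_complete _ _ R n.+1 mu Om mOm (fun k => gradH (u k)).
- by move=> k; case: (gu k).
- have [N hN] := cau _ e0; exists N => i j Ni Nj.
  by have := hN i j Ni Nj; rewrite (ipHE (dif i j) (dif i j)).
have lg : H10_grad Om l g.
  apply: H10_closed => // e e0; have [N1 h1] := hl _ e0; have [N2 h2] := hg _ e0.
  exists (u (maxn N1 N2)), (gradH (u (maxn N1 N2))); split => //; split.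
    by rewrite (ip_subC sL)//; [by apply: h1; exact: leq_maxl|by case: (gu (maxn N1 N2))].
  rewrite (ip_subC sVe)//; [by apply: h2; exact: leq_maxr|by case: (gu (maxn N1 N2))].
exists l; first by exists g.
move=> e e0; have [N hN] := hg _ e0; exists N => k Nk.
have := H10_lin (-1) lg (gu k).
have -> : (fun x => -1 * l x + u k x) = u k - l.
  by apply/funext => x; rewrite !fctE /=; ring.
have -> : (fun x => -1 *: g x + gradH (u k) x) = gradH (u k) - g.
  by apply/funext => x; rewrite !fctE /= scaleN1r addrC.
by move=> h; rewrite (ipHE h h); exact: hN.
Qed.

End sobolev.

(** * The space-time cylinder *)

Section cylinder.
Context {R : realType} {n : nat}.
Variables (T : R) (Om : set 'rV[R]_n).
Hypotheses (oOm : open Om) (bOm : bounded_set Om).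
Local Notation mu := (@lebesgue_rV R n).
Local Notation leb := (@lebesgue_measure R).
Local Notation pt := (measurableTypeR R * 'rV[R]_n)%type.
Local Notation J := (`]0, T[%classic : set (measurableTypeR R)).
Local Notation Q := (QT T Om : set pt).
Local Notation P := (@lebQ R n).
Implicit Types f : pt -> R.

Let mOm : measurable Om. Proof. exact: open_rV_measurable. Qed.
Let mJ : measurable J. Proof. exact: measurable_itv. Qed.

Lemma measurable_QT : measurable Q.
Proof. exact: measurableX. Qed.
Let mQ := measurable_QT.

Lemma lebesgue_itv_lty (a b : R) : (leb `]a, b[%classic < +oo)%E.
Proof. by rewrite lebesgue_measure_itv /=; case: ifP => _; rewrite -?EFinB ltry. Qed.

Lemma QT_lty : (P Q < +oo)%E.
Proof.
have -> : P Q = (leb `]0%R, T[%classic * mu Om)%E by exact: (product_measure1E _ _ mJ mOm).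
have [f1 f2] := (lebesgue_itv_lty 0 T, bounded_lty bOm mOm).
have g1 : leb `]0, T[%classic \is a fin_num by rewrite ge0_fin_numE.
have g2 : mu Om \is a fin_num by rewrite ge0_fin_numE.
by rewrite ltey_eq fin_numM.
Qed.

Lemma patch_QT (f : pt -> R) t x : J t -> (f \_ Q) (t, x) = ((fun x => f (t, x)) \_ Om) x.
Proof.
move=> Jt; rewrite /patch; have [xO|xO] := boolP (x \in Om).
  by rewrite ifT//; apply/mem_set; split => //; exact/set_mem.
rewrite ifF//; apply/negbTE; apply/negP => /set_mem[_ /= /mem_set]; exact/negP.
Qed.

Lemma patch_QTN (f : pt -> R) t x : ~ J t -> (f \_ Q) (t, x) = 0.
Proof. by move=> nJ; rewrite /patch memNset// => -[]. Qed.

Lemma L1_patch d (X : measurableType d) (m : {measure set X -> \bar R}) (D : set X) (f : X -> R) :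
  measurable D -> L1 m D f <-> m.-integrable setT (EFin \o (f \_ D)).
Proof. by move=> mD; rewrite -restrict_EFin; exact: integrable_mkcond. Qed.

Lemma ae_fiber_L1 f : L1 P Q f ->
  {ae leb, forall t : measurableTypeR R, J t -> L1 mu Om (fun x => f (t, x))}.
Proof.
move=> /(L1_patch _ _ mQ)/ae_integrable1; apply: filterS => t + Jt.
move=> h; apply/(L1_patch _ _ mOm); apply: eq_integrable h => // x _ /=.
by rewrite patch_QT.
Qed.

(** Fubini for the extension by 0. At exceptional times the inner integral is infinite and [fine]
    gives it a default value, so the real-valued iterated integral matches the extended one only
    almost everywhere. *)
Lemma fiber_integral f : L1 P Q f ->
  L1 leb J (fun t => \int[mu]_(x in Om) f (t, x)) /\
  \int[P]_(z in Q) f z = \int[leb]_(t in J) \int[mu]_(x in Om) f (t, x).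
Proof.
move=> /(L1_patch _ _ mQ) If; pose F := fubini_F mu (EFin \o (f \_ Q)).
have IF : leb.-integrable setT F by exact: integrable_fubini_F.
have FE t : J t -> \int[mu]_(x in Om) f (t, x) = fine (F t).
  move=> Jt; rewrite /Rintegral integral_mkcond restrict_EFin /F /fubini_F.
  by congr fine; apply: eq_integral => x _ /=; rewrite patch_QT.
have F0 t : ~ J t -> F t = 0%E.
  by move=> nJ; apply: integral0_eq => x _; rewrite /= patch_QTN.
have IFJ : leb.-integrable J F by apply: integrableS IF.
have mF : measurable_fun J F by exact: measurable_int IFJ.
have mfF : measurable_fun J (fun t => \int[mu]_(x in Om) f (t, x)).
  apply: (eq_measurable_fun (fine \o F)); first by move=> t /set_mem Jt; rewrite /= FE.
  by apply: measurableT_comp mF; exact: fine_measurable.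
have I1 : L1 leb J (fun t => \int[mu]_(x in Om) f (t, x)).
  apply: le_integrable IFJ => //; first exact/measurable_EFinP.
  move=> t Jt; rewrite /comp FE//; case: (F t) => [r| |] //=; rewrite normr0; exact: leey.
split=> //.
transitivity (fine (\int[P]_z (f \_ Q z)%:E)).
  by rewrite Rintegral_mkcond.
rewrite -integral12_prod_meas1//; congr fine.
rewrite -[LHS](_ : (\int[leb]_(t in J) F t = _)%E).
  apply: ae_eq_integral => //; first exact/measurable_EFinP.
  have := integrable_ae mJ IFJ; apply: filterS => t h Jt /=.
  by have := FE _ Jt; rewrite /Rintegral => ->; rewrite fineK// h.
rewrite integral_mkcond; apply: eq_integral => t _; rewrite /patch.
by case: ifPn => // /negP nJ; rewrite -/F F0// => Jt; apply: nJ; exact/mem_set.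
Qed.

Lemma ae_fiber (A : pt -> Prop) : {ae P, forall z, Q z -> A z} ->
  {ae leb, forall t : measurableTypeR R, J t -> {ae mu, forall x, Om x -> A (t, x)}}.
Proof.
move=> [N [mN N0 hN]].
have : (\int[leb]_t (mu \o xsection N) t = 0)%E by exact: N0.
have mx : measurable_fun setT (mu \o xsection N) by exact: measurable_fun_xsection.
have e : (\int[leb]_t `| (mu \o xsection N) t| = \int[leb]_t (mu \o xsection N) t)%E.
  by apply: eq_integral => t _; rewrite gee0_abs.
rewrite -e => /(ae_eq_integral_abs _ measurableT mx); apply: filterS => t /(_ I) /= h Jt.
exists (xsection N t); split => //; first exact: measurable_xsection.
move=> x /= /not_implyP[Ox nA]; rewrite /xsection /=; apply/mem_set; apply: hN => /=.
by move=> h'; apply: nA; apply: h'.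
Qed.

(** Integrability supplies the joint measurability that fibrewise vanishing lacks: the integral of
    the absolute value is computed fibre by fibre and is 0. *)
Lemma ae_cylinder0 f : L1 P Q f ->
  {ae leb, forall t : measurableTypeR R, J t -> {ae mu, forall x, Om x -> f (t, x) = 0}} ->
  {ae P, forall z, Q z -> f z = 0}.
Proof.
move=> If f0; have Ia := L1_abs If.
have : {ae P, forall z, Q z -> `|f z| = 0}.
  apply: (Rintegral_eq0_ae mQ Ia) => //.
  rewrite (fiber_integral Ia).2.
  transitivity (\int[leb]_(t in J) 0); last by rewrite Rintegral_cst// mul0r.
  apply: ae_eq_Rintegral => //; first exact: L1_measurable (fiber_integral Ia).1.
  have := ae_fiber_L1 If; apply: filterS2 f0 => t f0 IfF Jt.
  transitivity (\int[mu]_(x in Om) 0); last by rewrite Rintegral_cst// mul0r.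
  apply: ae_eq_Rintegral => //; first exact: L1_measurable (L1_abs (IfF Jt)).
  by apply: filterS (f0 Jt) => x h Ox; rewrite h// normr0.
by apply: filterS => z h /h /eqP; rewrite normr_eq0 => /eqP.
Qed.

Lemma L1_tensor (a : R -> R) (b : 'rV[R]_n -> R) : L1 leb J a -> L1 mu Om b ->
  L1 P Q (fun z => a z.1 * b z.2).
Proof.
move=> Ia Ib; apply/(L1_patch _ _ mQ).
have e : (fun z : pt => a z.1 * b z.2) \_ Q = fun z => (a \_ J) z.1 * (b \_ Om) z.2.
  apply/funext => -[t x] /=; have [Jt|nJ] := pselect (J t).
    rewrite patch_QT//= /patch (mem_set Jt); case: ifP => // _; exact: esym (mulr0 _).
  by rewrite patch_QTN// /patch (memNset nJ) mul0r.
have pa : leb.-integrable setT (EFin \o (a \_ J)) by apply/(L1_patch _ _ mJ).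
have pb : mu.-integrable setT (EFin \o (b \_ Om)) by apply/(L1_patch _ _ mOm).
rewrite e; apply/integrable12ltyP.
  apply/measurable_EFinP; apply: measurable_funM.
    by apply: measurableT_comp measurable_fst; apply/measurable_EFinP; exact: measurable_int pa.
  by apply: measurableT_comp measurable_snd; apply/measurable_EFinP; exact: measurable_int pb.
have [mpa ipa] := integrableP _ _ _ pa; have [mpb ipb] := integrableP _ _ _ pb.
rewrite (eq_integral (fun t => (\int[mu]_x `|((b \_ Om) x)%:E|) * `|((a \_ J) t)%:E|)%E); last first.
  move=> t _ /=; rewrite muleC -ge0_integralZl//.
  - by apply: eq_integral => x _; rewrite -EFinM normrM.
  - by apply/measurable_EFinP; apply: measurableT_comp => //; exact/measurable_EFinP.
rewrite ge0_integralZl//; last 2 first.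
- exact: measurableT_comp.
- exact: integral_ge0.
have f1 : (\int[leb]_t `|((a \_ J) t)%:E|)%E \is a fin_num.
  by rewrite ge0_fin_numE// integral_ge0.
have f2 : (\int[mu]_t `|((b \_ Om) t)%:E|)%E \is a fin_num.
  by rewrite ge0_fin_numE// integral_ge0.
by rewrite ltey_eq fin_numM.
Qed.

Lemma Rintegral_tensor (a : R -> R) (b : 'rV[R]_n -> R) : L1 leb J a -> L1 mu Om b ->
  \int[P]_(z in Q) (a z.1 * b z.2) = (\int[leb]_(t in J) a t) * \int[mu]_(x in Om) b x.
Proof.
move=> Ia Ib; rewrite (fiber_integral (L1_tensor Ia Ib)).2 /=.
under eq_Rintegral => t _ do rewrite RintegralZl//.
by under eq_Rintegral => t _ do rewrite mulrC; rewrite RintegralZl// mulrC.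
Qed.

Lemma L2_tensor (a : R -> R) (b : 'rV[R]_n -> R) : L2 leb J a -> L2 mu Om b ->
  L2 P Q (fun z => a z.1 * b z.2).
Proof.
move=> a2 b2; apply/(L2P _ mQ); split.
  have Ja : L1 leb J a by exact: L1_finite_L2 (lebesgue_itv_lty 0 T) a2.
  have Ob : L1 mu Om b by exact: L1_finite_L2 (bounded_lty bOm mOm) b2.
  exact: L1_measurable (L1_tensor Ja Ob).
under eq_fun do rewrite exprMn.
exact: (L1_tensor (a := fun t => a t ^+ 2) (b := fun x => b x ^+ 2) (L2_sqr mJ a2) (L2_sqr mOm b2)).
Qed.

Lemma measurable_time (th : R -> R) : measurable_fun J th -> measurable_fun Q (fun z => th z.1).
Proof.
move=> /(measurable_restrictT _ mJ) mth; apply: (eq_measurable_fun (fun z => (th \_ J) z.1)).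
  by move=> z /set_mem[Jz _]; rewrite /patch mem_set.
apply: measurable_funTS; exact: measurableT_comp mth measurable_fst.
Qed.

Lemma L2_time C (th : R -> R) f : measurable_fun J th -> (forall t, J t -> `|th t| <= C) ->
  L2 P Q f -> L2 P Q (fun z => th z.1 * f z).
Proof.
move=> mth bth; apply: (L2_bounded mQ (C := C)); first exact: measurable_time.
by move=> z [Jz _]; exact: bth.
Qed.

Lemma ae_fiber_measurable f : measurable_fun Q f -> forall t, J t ->
  measurable_fun Om (fun x : 'rV[R]_n => f (t, x)).
Proof.
move=> /(measurable_restrictT _ mQ) mf t Jt; apply/(measurable_restrictT _ mOm).
apply: (eq_measurable_fun (fun x => (f \_ Q) (t, x))); first by move=> x _; rewrite patch_QT.
exact: measurableT_comp mf (measurable_pair1 t).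
Qed.

Lemma ae_fiber_L2 f : L2 P Q f ->
  {ae leb, forall t : measurableTypeR R, J t -> L2 mu Om (fun x => f (t, x))}.
Proof.
move=> f2; have := ae_fiber_L1 (L2_sqr mQ f2); apply: filterS => t h Jt.
by apply/(L2P _ mOm); split; [exact: ae_fiber_measurable (L2_measurable mQ f2) _ Jt|exact: h].
Qed.

Lemma ae_fiber_L2v (g : pt -> 'rV[R]_n) : L2v P Q g ->
  {ae leb, forall t : measurableTypeR R, J t -> L2v mu Om (fun x => g (t, x))}.
Proof.
move=> g2; have : {ae leb, forall t : measurableTypeR R, forall i : 'I_n, J t ->
    L2 mu Om (fun x => g (t, x) ord0 i)}.
  by apply: ae_forall_count => i; exact: ae_fiber_L2 (g2 i).
by apply: filterS => t h Jt i; exact: h.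
Qed.

(** Bumps yield integral 0 over the intervals ]a, T[, which are the traces on ]0, T[ of the right
    half-lines, a generating pi-system. *)
Lemma ae_test_eq0 (f : R -> R) : L1 leb J f ->
  (forall phi, test_fun `]0, T[%classic phi -> \int[leb]_(t in J) (f t * phi t) = 0) ->
  {ae leb, forall t : measurableTypeR R, J t -> f t = 0}.
Proof.
move=> If f0; have mf := L1_measurable If.
have itv0 a : 0 <= a -> \int[leb]_(t in J) (f t * \1_(`]a, T[%classic) t) = 0.
  move=> a0; have aT : `]a, T[%classic `<=` `]0, T[%classic.
    by apply: subset_itvr; rewrite bnd_simp.
  have cv : (fun k => \int[leb]_(t in J) (f t * bump k a T t)) @ \oo -->
      \int[leb]_(t in J) (f t * \1_(`]a, T[%classic) t).
    apply: (Rdominated_cvg mJ (g := fun t => `|f t|)).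
    - move=> k; apply: measurable_funM => //; apply: measurable_funTS.
      apply: continuous_measurable_fun; apply: smooth_continuous.
      by have [] := test_bump k aT.
    - by move=> t _; apply: cvgM; [exact: cvg_cst|exact: cvg_bump].
    - exact: L1_abs.
    - by move=> k t _; rewrite normrM (ger0_norm (bump_ge0 _ _ _ _)) ler_piMr// bump_le1.
  move: cv; under eq_fun do rewrite (f0 _ (test_bump _ aT)).
  by move=> /(cvg_unique _ (cvg_cst 0)) <-.
have GI : setI_closed (@RGenOInfty.G R).
  move=> _ _ [a ->] [b ->]; exists (Num.max a b).
  apply/seteqP; split=> x; rewrite /= !in_itv /= !andbT gt_max; first by move=> [-> ->].
  by move=> /andP[].
apply: (ae0_pi_system mJ GI (RGenOInfty.measurableE R)).
- exact: If.
- rewrite -[RHS](itv0 0)//; apply: eq_Rintegral => t; rewrite indicE => ->; by rewrite mulr1.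
- move=> _ [a ->]; rewrite Rintegral_mkcondr -[RHS](itv0 (Num.max a 0)) ?le_max ?lexx ?orbT//.
  apply: eq_Rintegral => t /set_mem Jt; rewrite /patch indicE.
  have -> : (t \in `]a, +oo[%classic) = (t \in `](Num.max a 0), T[%classic).
    move: Jt; rewrite /= !in_itv /= => /andP[t0 tT]; apply/idP/idP; rewrite !inE /= !in_itv /= andbT.
      by rewrite gt_max t0 tT => ->.
    by rewrite gt_max => /andP[/andP[]].
  by case: ifP; rewrite ?mulr1 ?mulr0.
Qed.

End cylinder.

(** * Dual norms and the space X *)

Section dual_norm.
Context {R : realType} {A : Type}.
Variables (V : set (A -> R)) (ip : (A -> R) -> (A -> R) -> R) (nrm : (A -> R) -> R).
Hypothesis hip : semi_ip V ip.
Hypothesis nrmE : forall v, V v -> nrm v = Num.sqrt (ip v v).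
Implicit Types (l : (A -> R) -> R) (v w : A -> R).

Let V0 : V 0. Proof. by case: hip => -[]. Qed.
Let nrm0 : nrm 0 = 0. Proof. by rewrite nrmE// (ip0l hip)// sqrtr0. Qed.
Let nrmZ a v : V v -> nrm (a *: v) = `|a| * nrm v.
Proof.
move=> Vv; have Va : V (a *: v) by case: hip => sV _ _ _; exact: subspaceZ.
rewrite !nrmE// (ipZl hip)// (ipZr hip)// mulrA -expr2 sqrtrM ?sqr_ge0//.
by rewrite sqrtr_sqr.
Qed.

Lemma dual_lin l a v w : dual V nrm l -> V v -> V w -> l (a *: v + w) = a * l v + l w.
Proof. by move=> [h _]; exact: h. Qed.

Lemma dual0 l : dual V nrm l -> l 0 = 0.
Proof.
move=> hl; have := dual_lin 1 hl V0 V0; rewrite scaler0 addr0 mul1r.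
by move=> /eqP; rewrite -subr_eq0 opprD addNKr oppr_eq0 => /eqP.
Qed.

Lemma dualZ l a v : dual V nrm l -> V v -> l (a *: v) = a * l v.
Proof. by move=> hl Vv; have := dual_lin a hl Vv V0; rewrite (dual0 hl) !addr0. Qed.

Lemma dualD l v w : dual V nrm l -> V v -> V w -> l (v + w) = l v + l w.
Proof. by move=> hl Vv Vw; have := dual_lin 1 hl Vv Vw; rewrite scale1r mul1r. Qed.

Lemma dualB l v w : dual V nrm l -> V v -> V w -> l (v - w) = l v - l w.
Proof.
move=> hl Vv Vw; have := dual_lin (-1) hl Vw Vv.
by rewrite scaleN1r mulN1r addrC => ->; rewrite addrC.
Qed.

Lemma dualnorm_bnd l C : 0 <= C -> (forall v, V v -> `|l v| <= C * nrm v) ->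
  dualnorm V nrm l <= C.
Proof.
move=> C0 h; apply: ge_sup; first by exists `|l 0|, 0 => //; split => //; rewrite nrm0.
move=> _ [v [Vv v1] <-]; apply: le_trans (h v Vv) _; exact: ler_piMr.
Qed.

Let has_sup_dual l : (exists C, forall v, V v -> `|l v| <= C * nrm v) ->
  has_sup [set `|l v| | v in [set v | V v /\ nrm v <= 1]].
Proof.
move=> [C h]; split; first by exists `|l 0|, 0 => //; split => //; rewrite nrm0.
exists `|C| => _ [v [Vv v1] <-]; apply: le_trans (h v Vv) _.
have v0 : 0 <= nrm v by rewrite nrmE// sqrtr_ge0.
apply: le_trans (ler_wpM2r v0 (ler_norm C)) _; exact: ler_piMr.
Qed.

Lemma dualnorm_ge0 l : (exists C, forall v, V v -> `|l v| <= C * nrm v) ->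
  0 <= dualnorm V nrm l.
Proof.
move=> h; apply: le_trans (normr_ge0 (l 0)) _; apply: ub_le_sup.
  by case: (has_sup_dual h).
by exists 0 => //; split => //; rewrite nrm0.
Qed.

Lemma dualnorm_le l v : (forall a v, V v -> l (a *: v) = a * l v) ->
  (exists C, forall v, V v -> `|l v| <= C * nrm v) ->
  V v -> `|l v| <= dualnorm V nrm l * nrm v.
Proof.
move=> lZ h Vv; have v0 : 0 <= nrm v by rewrite nrmE// sqrtr_ge0.
move: v0; rewrite le_eqVlt => /orP[/eqP v0|v0].
  (* A vector of norm 0 cannot be normalised, but there the bound forces [l v = 0]. *)
  by have [C hC] := h; have := hC v Vv; rewrite -v0 !mulr0.
rewrite -ler_pdivrMr//.
have -> : `|l v| / nrm v = `|l ((nrm v)^-1 *: v)|.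
  by rewrite lZ// normrM gtr0_norm ?invr_gt0// mulrC.
apply: ub_le_sup; first by case: (has_sup_dual h).
have Vn : V ((nrm v)^-1 *: v) by case: hip => sV _ _ _; exact: subspaceZ.
exists ((nrm v)^-1 *: v) => //; split => //.
by rewrite nrmZ// gtr0_norm ?invr_gt0// mulVf// lt0r_neq0.
Qed.

Lemma dual_le l v : dual V nrm l -> V v -> `|l v| <= dualnorm V nrm l * nrm v.
Proof.
by move=> hl; apply: dualnorm_le; [move=> a w; exact: dualZ|case: hl].
Qed.

Lemma dual_norm_ge0 l : dual V nrm l -> 0 <= dualnorm V nrm l.
Proof. by move=> [_ h]; exact: dualnorm_ge0. Qed.

Lemma dual_comb a l l' : dual V nrm l -> dual V nrm l' ->
  dual V nrm (fun v => a * l v + l' v).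
Proof.
move=> [l1 [C hC]] [l2 [C' hC']]; split.
  by move=> b v w Vv Vw; rewrite l1// l2//; ring.
exists (`|a| * C + C') => v Vv; apply: le_trans (ler_normD _ _) _.
rewrite mulrDl lerD ?hC'// normrM -mulrA ler_wpM2l//; exact: hC.
Qed.

Lemma dual_riesz l : ip_complete V ip -> dual V nrm l ->
  exists2 w, V w & forall v, V v -> l v = ip w v.
Proof.
move=> cip [h [C hC]]; apply: (ip_riesz hip cip (C := C)) => //.
by move=> v Vv; rewrite -nrmE//; exact: hC.
Qed.

Lemma dual_ip w : V w -> dual V nrm (ip w).
Proof.
move=> Vw; have [sV sC sl _] := hip; split.
  move=> a v z Vv Vz; have Vs : V (fun x => a * v x + z x) by case: sV => _; exact.
  by rewrite (sC w)// sl// (sC v)// (sC z).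
by exists (Num.sqrt (ip w w)) => v Vv; rewrite nrmE//; exact: (ip_le hip).
Qed.

End dual_norm.

(** * A countable total family in H^1_0 *)

Section sobolev_separable.
Context {R : realType} {n : nat}.
Local Notation mu := (@lebesgue_rV R n.+1).
Variable Om : set 'rV[R]_n.+1.
Hypotheses (oOm : open Om) (bOm : bounded_set Om).
Let mOm : measurable Om. Proof. exact: open_rV_measurable. Qed.
Let Omoo : (mu Om < +oo)%E. Proof. exact: bounded_lty. Qed.
Let sVe := @ipV_semi _ _ R n.+1 mu Om mOm.

(* The Riesz representers of h |-> \int dh/dx_i phi, phi in a countable family
   of bumps, are total: a function orthogonal to all of them has gradient 0. *)
Lemma H10_separable : exists h : nat -> 'rV[R]_n.+1 -> R, (forall k, H10 Om (h k)) /\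
  forall g, H10 Om g -> (forall k, ipH Om g (h k) = 0) -> ipH Om g g = 0.
Proof.
pose I := (({ffun 'I_n.+1 -> rat} * {ffun 'I_n.+1 -> rat}) * nat * 'I_n.+1)%type.
(* Indices whose box is not contained in [Om] get the zero field, so that the whole countable type
   can serve as index set. *)
pose e (q : I) : 'rV[R]_n.+1 -> 'rV[R]_n.+1 :=
  fun x => (if `[< rbox q.1.1 `<=` Om >] then rbump q.1.1 q.1.2 x else 0) *: delta_mx ord0 q.2.
have e2 q : L2v mu Om (e q).
  move=> i; rewrite /e; case: asboolP => [h|nh]; last first.
    under eq_fun do rewrite !mxE mul0r; exact: L2_0.
  under eq_fun do rewrite !mxE mulrC.
  by apply: (L2Z mOm); apply: test_L2 => //; exact: test_boxbump h.
have /choice[h hh] : forall q, exists h, H10 Om h /\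
    forall g, H10 Om g -> ipV mu Om (e q) (gradH Om g) = ipH Om h g.
  move=> q; have [] := @ip_riesz R _ (H10 Om) (ipH Om) (ipH_semi oOm bOm)
    (ipH_complete oOm bOm) (fun g => ipV mu Om (e q) (gradH Om g)) (Num.sqrt (ipV mu Om (e q) (e q))).
  - move=> a v w Hv Hw; have gv := gradHP Hv; have gw := gradHP Hw.
    have gl := H10_lin oOm bOm a gv gw; have gl' := gradHP (ex_intro _ _ gl).
    have [_ gv2 _ _] := gv; have [_ gw2 _ _] := gw; have [_ gl2 _ _] := gl.
    have [_ gl2' _ _] := gl'.
    rewrite (ipV_ae mOm (e2 q) (e2 q) gl2' gl2) ; last 2 first.
    + exact: aeW.
    + by apply: (H10_grad_unique oOm bOm gl' gl); exact: aeW.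
    rewrite (ipC sVe (e2 q) gl2) (ipC sVe (e2 q) gv2) (ipC sVe (e2 q) gw2).
    by have [_ _ + _] := sVe; apply.
  - move=> v Hv; apply: (ip_le sVe (e2 q)); by case: (gradHP Hv).
  - by move=> w Hw hw; exists w.
pose h' k := if unpickle k is Some q then h q else fun=> 0.
exists h'; split.
  move=> k; rewrite /h'; case: unpickle => [q|]; first by case: (hh q).
  by exists (fun=> 0); exact: H10_grad0.
move=> g Hg h0; have gg := gradHP Hg; have [_ g2 _ _] := gg.
have h1 (q : I) : ipV mu Om (e q) (gradH Om g) = 0.
  have [Hq ->//] := hh q; rewrite (ipC (ipH_semi oOm bOm) Hq Hg).
  by have := h0 (pickle q); rewrite /h' pickleK.
have : {ae mu, forall x, forall i : 'I_n.+1, Om x -> gradH Om g x ord0 i = 0}.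
  apply: ae_forall_count => i; apply: (fundamental_ae0 oOm).
    exact: (L1_finite_L2 mOm Omoo (g2 i)).
  move=> q k qO; rewrite -[RHS](h1 (q, k, i)) /ipV; apply: eq_Rintegral => x _.
  rewrite /e (asboolT qO) dotvZl mulrC; congr (_ * _).
  rewrite /dotv (bigD1 i)//= big1 ?addr0 => [|j ji]; first by rewrite mxE !eqxx mul1r.
  by rewrite mxE (negbTE ji) andbF mul0r.
move=> ae0; rewrite /ipH (ipV_ae (g' := fun=> 0) (h' := fun=> 0) mOm) //.
- by rewrite (ip0l sVe)//; exact: L2v_0.
- exact: L2v_0.
- exact: L2v_0.
- by apply: filterS ae0 => x hx Ox; apply/rowP => i; rewrite hx// mxE.
- by apply: filterS ae0 => x hx Ox; apply/rowP => i; rewrite hx// mxE.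
Qed.

End sobolev_separable.

(** * The Hilbert space X *)

Section space_X.
Context {R : realType} {n : nat}.
Variables (T : R) (Om : set 'rV[R]_n.+1).
Hypotheses (oOm : open Om) (bOm : bounded_set Om).
Local Notation mu := (@lebesgue_rV R n.+1).
Local Notation leb := (@lebesgue_measure R).
Local Notation E := 'rV[R]_n.+1.
Local Notation pt := (measurableTypeR R * 'rV[R]_n.+1)%type.
Local Notation J := (`]0, T[%classic : set (measurableTypeR R)).
Local Notation Q := (QT T Om : set pt).
Local Notation P := (@lebQ R n.+1).
Implicit Types (v w : pt -> R) (g h : pt -> E).

Let mOm : measurable Om. Proof. exact: open_rV_measurable. Qed.
Let mJ : measurable J. Proof. exact: measurable_itv. Qed.
Let mQ : measurable Q. Proof. exact: measurable_QT. Qed.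
Let sVe := @ipV_semi _ _ R n.+1 mu Om mOm.
Let sVQ := @ipV_semi _ _ R n.+1 P Q mQ.
Let sLQ := @ipL_semi _ _ R P Q mQ.
Let L2vQB g h : L2v P Q g -> L2v P Q h -> L2v P Q (g - h).
Proof. exact: (subspaceB (@L2v_subspace _ _ R n.+1 P Q mQ)). Qed.

Lemma fiber_ipV g h : L2v P Q g -> L2v P Q h ->
  L1 leb J (fun t => ipV mu Om (fun x => g (t, x)) (fun x => h (t, x))) /\
  ipV P Q g h = \int[leb]_(t in J) ipV mu Om (fun x => g (t, x)) (fun x => h (t, x)).
Proof. by move=> g2 h2; exact: (fiber_integral oOm (L2v_dotv mQ g2 h2)). Qed.

Lemma fiber_ipL v w : L2 P Q v -> L2 P Q w ->
  L1 leb J (fun t => ipL mu Om (fun x => v (t, x)) (fun x => w (t, x))) /\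
  ipL P Q v w = \int[leb]_(t in J) ipL mu Om (fun x => v (t, x)) (fun x => w (t, x)).
Proof. by move=> v2 w2; exact: (fiber_integral oOm (L2M mQ v2 w2)). Qed.

Lemma L2v_time C (th : R -> R) g : measurable_fun J th -> (forall t, J t -> `|th t| <= C) ->
  L2v P Q g -> L2v P Q (fun z => th z.1 *: g z).
Proof.
move=> mth bth g2 i; under eq_fun do rewrite mxE; exact: (L2_time oOm mth bth (g2 i)).
Qed.

Lemma X_grad_lin a v w g h : X_grad T Om v g -> X_grad T Om w h ->
  X_grad T Om (fun z => a * v z + w z) (fun z => a *: g z + h z).
Proof.
move=> [v2 g2 vg] [w2 h2 wh]; split; [exact: L2_lin|exact: L2v_lin|].
by apply: filterS2 vg wh => t vg wh Jt; apply: H10_lin => //; [exact: vg|exact: wh].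
Qed.

Lemma X_grad0 : X_grad T Om (fun=> 0) (fun=> 0).
Proof.
by split; [exact: L2_0|exact: L2v_0|apply: aeW => t _; exact: H10_grad0].
Qed.

Lemma X_grad_unique v w g h : X_grad T Om v g -> X_grad T Om w h ->
  {ae P, forall z, Q z -> v z = w z} -> {ae P, forall z, Q z -> g z = h z}.
Proof.
move=> [v2 g2 vg] [w2 h2 wh] vw; have d2 := L2vQB g2 h2.
have Id := L2v_dotv mQ d2 d2.
have : {ae P, forall z, Q z -> dotv ((g - h) z) ((g - h) z) = 0}.
  apply: (ae_cylinder0 oOm Id); have := ae_fiber vw.
  apply: filterS3 vg wh => t vg wh vwt Jt.
  have := H10_grad_unique oOm bOm (vg Jt) (wh Jt) (vwt Jt).
  by apply: filterS => x e Ox; rewrite !fctE e// subrr dot0v.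
apply: filterS => z hz Qz; have := hz Qz => /dotv_eq0 /eqP; by rewrite !fctE subr_eq0 => /eqP.
Qed.

Lemma gradxP v : spX T Om v -> X_grad T Om v (gradx T Om v).
Proof. by move=> [g hg]; exact: (xgetPex _ (ex_intro _ g hg)). Qed.

Lemma spX_L2 v : spX T Om v -> L2 P Q v. Proof. by move=> /gradxP[]. Qed.

Lemma gradx_L2 v : spX T Om v -> L2v P Q (gradx T Om v). Proof. by move=> /gradxP[]. Qed.

Definition ipX v w := ipV P Q (gradx T Om v) (gradx T Om w).

Lemma gradx_ae v g : X_grad T Om v g -> {ae P, forall z, Q z -> gradx T Om v z = g z}.
Proof.
move=> hv; have gv := gradxP (ex_intro _ g hv).
by apply: (X_grad_unique gv hv); exact: aeW.
Qed.

Lemma ipXE v w g h : X_grad T Om v g -> X_grad T Om w h -> ipX v w = ipV P Q g h.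
Proof.
move=> hv hw; have gv := gradxP (ex_intro _ g hv); have gw := gradxP (ex_intro _ h hw).
have [_ ? _] := hv; have [_ ? _] := hw; have [_ ? _] := gv; have [_ ? _] := gw.
by apply: (ipV_ae mQ) => //; exact: gradx_ae.
Qed.

Lemma X_subspace : subspace (spX T Om : set (pt -> R)).
Proof.
split; first by exists (fun=> 0); exact: X_grad0.
by move=> a w v [g hg] [h hh]; exists (fun x => a *: g x + h x); exact: X_grad_lin.
Qed.

Lemma ipX_semi : semi_ip (spX T Om : set (pt -> R)) ipX.
Proof.
split; first exact: X_subspace.
- move=> w v [g hg] [h hh]; rewrite (ipXE hg hh) (ipXE hh hg).
  by apply: (ipC sVQ); [case: hg|case: hh].
- move=> a w v z [g hg] [h hh] [k hk].
  rewrite (ipXE (X_grad_lin a hg hh) hk) (ipXE hg hk) (ipXE hh hk).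
  have [_ _ h3 _] := sVQ; apply: h3; by [case: hg|case: hh|case: hk].
- move=> w [g hg]; rewrite (ipXE hg hg); apply: (ip_ge0 sVQ); by case: hg.
Qed.

Lemma normXE v : spX T Om v -> normX T Om v = Num.sqrt (ipX v v).
Proof. by move=> Xv; exact: (L2norm_enorm mQ (gradx_L2 Xv)). Qed.

Lemma normX_ge0 v : spX T Om v -> 0 <= normX T Om v.
Proof. by move=> Xv; rewrite normXE// sqrtr_ge0. Qed.

Lemma normX_sqr v : spX T Om v -> normX T Om v ^+ 2 = ipX v v.
Proof. by move=> Xv; rewrite normXE// sqr_sqrtr// (ip_ge0 ipX_semi). Qed.

Lemma normX_leD v w : spX T Om v -> spX T Om w ->
  normX T Om (v + w) <= normX T Om v + normX T Om w.
Proof.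
move=> Xv Xw; have Xvw : spX T Om (v + w) by exact: (subspaceD X_subspace).
by rewrite (normXE Xvw) (normXE Xv) (normXE Xw); exact: (ip_sqrt_leD ipX_semi).
Qed.

Lemma normX_subC v w : spX T Om v -> spX T Om w ->
  normX T Om (v - w) = normX T Om (w - v).
Proof.
move=> Xv Xw; have X1 : spX T Om (v - w) by exact: (subspaceB X_subspace).
have X2 : spX T Om (w - v) by exact: (subspaceB X_subspace).
by rewrite (normXE X1) (normXE X2) (ip_subC ipX_semi).
Qed.

Lemma poincareX : exists2 C, 0 <= C & forall v, spX T Om v -> ipL P Q v v <= C * ipX v v.
Proof.
have [C C0 hC] := poincare oOm bOm; exists C => // v Xv.
have [v2 g2 vg] := gradxP Xv.
have [I1 ->] := fiber_ipL v2 v2; have [I2 e] := fiber_ipV g2 g2; rewrite /ipX e.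
rewrite -RintegralZl//; apply: ae_le_Rintegral => //; first exact: L1Z.
by apply: filterS vg => t vg Jt; apply: hC; exact: vg.
Qed.

(** On the set where every [F k] is at least [e] the function [e] is dominated by all of them, so
    its integral there is below every bound and the set is null. This passes from small means to
    individual times without extracting subsequences. *)
Lemma ae_small_fiber (F : nat -> R -> R) : (forall k, L1 leb J (F k)) ->
  (forall k t, J t -> 0 <= F k t) ->
  (forall e, 0 < e -> exists k, \int[leb]_(t in J) F k t < e) ->
  {ae leb, forall t : measurableTypeR R, J t -> forall e, 0 < e -> exists k, F k t < e}.
Proof.
move=> IF F0 h.
suff : {ae leb, forall t : measurableTypeR R, forall j : nat, J t -> exists k, F k t < j.+1%:R^-1}.
  apply: filterS => t ht Jt e e0; have [j] := ltr_add_invr e0; rewrite add0r => je.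
  by have [k hk] := ht j Jt; exists k; exact: lt_trans hk je.
apply: ae_forall_count => j; set e := j.+1%:R^-1.
have e0 : 0 < e by rewrite invr_gt0.
pose N := J `&` \bigcap_k [set t | e <= F k t].
have mN : measurable (N : set (measurableTypeR R)).
  have -> : N = \bigcap_k (J `&` [set t | e <= F k t]).
    apply/seteqP; split=> [t [Jt h1] k _|t h1]; first by split => //; exact: h1.
    by split=> [|k _]; [case: (h1 0%N I)|case: (h1 k I)].
  apply: bigcap_measurable => [|k _]; first by exists 0%N.
  have -> : [set t | e <= F k t] = F k @^-1` `[e, +oo[%classic.
    by apply/seteqP; split=> t /=; rewrite in_itv /= andbT.
  exact: (L1_measurable (IF k) mJ (measurable_itv _)).
have IN : L1 leb J (fun t => e * \1_N t).
  apply: (L1Z mJ); apply: (L1_finite_L2 mJ (lebesgue_itv_lty 0 T)).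
  apply: (L2_bnd mJ (C := 1) (lebesgue_itv_lty 0 T)) => [|t _]; first exact: measurable_indic.
  by rewrite indicE; case: (_ \in _); rewrite ?normr1 ?normr0.
have IN0 : \int[leb]_(t in J) (e * \1_N t) = 0.
  apply/eqP; rewrite eq_le; apply/andP; split; last first.
    apply: (ae_Rintegral_ge0 mJ IN); apply: aeW => t _.
    by rewrite mulr_ge0 ?(ltW e0)// indicE; case: (_ \in _).
  apply/ler_addgt0Pr => d d0; rewrite add0r; have [k hk] := h _ d0.
  apply: le_trans (ltW hk); apply: (ae_le_Rintegral mJ IN (IF k)); apply: aeW => t Jt.
  rewrite indicE; have [/set_mem[_ /(_ k I) /= h1]|_] := boolP (t \in N); first by rewrite mulr1.
  by rewrite mulr0 F0.
have : {ae leb, forall t : measurableTypeR R, J t -> e * \1_N t = 0}.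
  apply: (Rintegral_eq0_ae mJ IN) => // t _.
  by rewrite mulr_ge0 ?(ltW e0)// indicE; case: (_ \in _).
apply: filterS => t ht Jt; apply: contrapT => nk.
have Nt : N t by split => // k _ /=; rewrite leNgt; apply/negP => hk; apply: nk; exists k.
have := ht Jt; rewrite indicE (mem_set Nt) mulr1 => ee; by move: e0; rewrite ee ltxx.
Qed.

(** At almost every time some approximants are arbitrarily close, in function and gradient together,
    on that fibre, so closedness of H^1_0 applies fibre by fibre. *)
Lemma X_closed v g : L2 P Q v -> L2v P Q g ->
  (forall e, 0 < e -> exists v' g', X_grad T Om v' g' /\
    ipL P Q (v - v') (v - v') < e /\ ipV P Q (g - g') (g - g') < e) ->
  X_grad T Om v g.
Proof.
move=> v2 g2 ap; split => //.
have /choice[v' hv'] : forall k : nat, exists v', exists g', X_grad T Om v' g' /\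
    ipL P Q (v - v') (v - v') < k.+1%:R^-1 /\ ipV P Q (g - g') (g - g') < k.+1%:R^-1.
  by move=> k; apply: ap; rewrite invr_gt0.
have /choice[g' hg'] := hv'.
have dv k : L2 P Q (v - v' k) by apply: L2B => //; have [[]] := hg' k.
have dg k : L2v P Q (g - g' k) by apply: L2vQB => //; have [[]] := hg' k.
pose F k t := ipL mu Om (fun x => (v - v' k) (t, x)) (fun x => (v - v' k) (t, x)) +
  ipV mu Om (fun x => (g - g' k) (t, x)) (fun x => (g - g' k) (t, x)).
have pos k t : 0 <= ipL mu Om (fun x => (v - v' k) (t, x)) (fun x => (v - v' k) (t, x)).
  by apply: Rintegral_ge0 => x _; rewrite -expr2 sqr_ge0.
have pos' k t : 0 <= ipV mu Om (fun x => (g - g' k) (t, x)) (fun x => (g - g' k) (t, x)).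
  by apply: Rintegral_ge0 => x _; exact: dotv_ge0.
have : {ae leb, forall t : measurableTypeR R, J t -> forall e, 0 < e -> exists k, F k t < e}.
  apply: ae_small_fiber.
  - by move=> k; apply: L1D => //; [exact: (fiber_ipL _ _).1|exact: (fiber_ipV _ _).1].
  - by move=> k t _; rewrite addr_ge0.
  - move=> e e0; have e2 : 0 < e / 2 by rewrite divr_gt0.
    have [k] := ltr_add_invr e2; rewrite add0r => ke; exists k.
    have [I1 e1] := fiber_ipL (dv k) (dv k); have [I2 e3] := fiber_ipV (dg k) (dg k).
    rewrite RintegralD// -e1 -e3; have [_ [h1 h2]] := hg' k; move: h1 h2 ke.
    move: (k.+1%:R^-1) (ipL _ _ _ _) (ipV _ _ _ _) => a b c; lra.
have hX : {ae leb, forall t : measurableTypeR R, forall k, J t ->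
    H10_grad Om (fun x => v' k (t, x)) (fun x => g' k (t, x))}.
  by apply: ae_forall_count => k; have [[]] := hg' k.
have := ae_fiber_L2v oOm g2; have := ae_fiber_L2 oOm v2.
move=> a1 a2 a3; apply: filterS2 (filterI a1 a2) (filterI a3 hX) => t [{}a1 {}a2] [{}a3 {}hX] Jt.
apply: (H10_closed oOm bOm (a1 Jt) (a2 Jt)) => e e0.
have [k hk] := a3 Jt e e0; exists (fun x => v' k (t, x)), (fun x => g' k (t, x)).
split; first exact: hX.
split; apply: le_lt_trans hk; [rewrite lerDl; exact: pos'|rewrite lerDr; exact: pos].
Qed.

Lemma ipX_complete : ip_complete (spX T Om : set (pt -> R)) ipX.
Proof.
move=> u Hu cau; have [C C0 hC] := poincareX.
have gu k := gradxP (Hu k).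
have dif i j : X_grad T Om (u i - u j) (gradx T Om (u i) - gradx T Om (u j)).
  have := X_grad_lin (-1) (gu j) (gu i).
  congr (X_grad T Om _ _); apply/funext => x; rewrite !fctE /=; first by ring.
  by rewrite scaleN1r addrC.
have [|e e0|l l2 hl] := @ipL_complete _ _ R P Q mQ u.
- by move=> k; case: (gu k).
- have e1 : 0 < e / (C + 1) by rewrite divr_gt0// ltr_wpDl.
  have [N hN] := cau _ e1; exists N => i j Ni Nj.
  have Xd : spX T Om (u i - u j) by exists (gradx T Om (u i) - gradx T Om (u j)).
  apply: le_lt_trans (hC _ Xd) _.
  have := hN i j Ni Nj; rewrite ltr_pdivlMr ?ltr_wpDl// => h.
  have := ip_ge0 ipX_semi Xd; move: h; move: (ipX _ _) => a; nra.
have [|e e0|g g2 hg] := @ipV_complete _ _ R n.+1 P Q mQ (fun k => gradx T Om (u k)).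
- by move=> k; case: (gu k).
- have [N hN] := cau _ e0; exists N => i j Ni Nj.
  by have := hN i j Ni Nj; rewrite (ipXE (dif i j) (dif i j)).
have lg : X_grad T Om l g.
  apply: X_closed => // e e0; have [N1 h1] := hl _ e0; have [N2 h2] := hg _ e0.
  have [u2 gu2 _] := gu (maxn N1 N2).
  exists (u (maxn N1 N2)), (gradx T Om (u (maxn N1 N2))); split => //; split.
    by rewrite (ip_subC sLQ)//; apply: h1; exact: leq_maxl.
  by rewrite (ip_subC sVQ)//; apply: h2; exact: leq_maxr.
exists l; first by exists g.
move=> e e0; have [N hN] := hg _ e0; exists N => k Nk.
have := X_grad_lin (-1) lg (gu k).
have -> : (fun x => -1 * l x + u k x) = u k - l.
  by apply/funext => x; rewrite !fctE /=; ring.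
have -> : (fun x => -1 *: g x + gradx T Om (u k) x) = gradx T Om (u k) - g.
  by apply/funext => x; rewrite !fctE /= scaleN1r addrC.
by move=> h; rewrite (ipXE h h); exact: hN.
Qed.

Lemma X_time C (th : R -> R) v g : measurable_fun J th -> (forall t, J t -> `|th t| <= C) ->
  X_grad T Om v g -> X_grad T Om (fun z => th z.1 * v z) (fun z => th z.1 *: g z).
Proof.
move=> mth bth [v2 g2 vg]; split; [exact: (L2_time oOm mth bth v2)|exact: (L2v_time mth bth g2)|].
apply: filterS vg => t vg Jt; have := H10_lin oOm bOm (th t) (vg Jt) (H10_grad0 oOm bOm).
by congr (H10_grad Om _ _); apply/funext => x; rewrite /= addr0.
Qed.

Lemma X_tensor (a : R -> R) (w : E -> R) (h : E -> E) : L2 leb J a -> H10_grad Om w h ->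
  X_grad T Om (fun z => a z.1 * w z.2) (fun z => a z.1 *: h z.2).
Proof.
move=> a2 wh; have [w2 h2 _ _] := wh; split.
- exact: L2_tensor.
- by move=> i; under eq_fun do rewrite mxE; exact: (L2_tensor oOm bOm a2 (h2 i)).
- apply: aeW => t _; have := H10_lin oOm bOm (a t) wh (H10_grad0 oOm bOm).
  by congr (H10_grad Om _ _); apply/funext => x; rewrite /= addr0.
Qed.

Lemma test_L2J (phi : R -> R) : test_fun `]0, T[%classic phi -> L2 leb J phi.
Proof.
move=> tphi; have [M _ hM] := test_bounded tphi.
apply: (L2_bnd mJ (C := M) (lebesgue_itv_lty 0 T)) => [|t _]; last exact: hM.
by apply: measurable_funTS; apply: continuous_measurable_fun; exact: (test_continuous tphi).
Qed.

Lemma ipX_tensor v (a : R -> R) (w : E -> R) : spX T Om v -> L2 leb J a -> H10 Om w ->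
  ipX v (fun z => a z.1 * w z.2) =
  \int[leb]_(t in J) (ipV mu Om (fun x => gradx T Om v (t, x)) (gradH Om w) * a t).
Proof.
move=> Xv a2 Hw; have gv := gradxP Xv; have [_ g2 _] := gv.
have tX := X_tensor a2 (gradHP Hw); have [_ t2 _] := tX.
rewrite (ipXE gv tX) (fiber_ipV g2 t2).2; apply: ae_eq_Rintegral => //.
- exact: (L1_measurable (fiber_ipV g2 t2).1).
- apply: measurable_funM; last exact: (L2_measurable mJ a2).
  have o2 : L2 leb J (fun=> 1).
    by apply: (L2_bnd mJ (C := 1) (lebesgue_itv_lty 0 T)) => // t _; rewrite normr1.
  have [_ t2' _] := X_tensor o2 (gradHP Hw).
  have := L1_measurable (fiber_ipV g2 t2').1; apply: eq_measurable_fun => t _ /=.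
  by apply: eq_Rintegral => x _; rewrite scale1r.
- have := ae_fiber_L2v oOm g2; apply: filterS => t h Jt.
  by rewrite mulrC -(ipZr sVe)//; [case: (gradHP Hw)|exact: h].
Qed.

(** Varying [phi] shows that, for each member of the countable total family, its product with the
    gradient of the fibre of [v] vanishes at almost every time; countability gives one null set for
    all members. *)
Lemma X_tensor_total v : spX T Om v ->
  (forall phi (w : E -> R), test_fun `]0, T[%classic phi -> H10 Om w ->
    ipX v (fun z => phi z.1 * w z.2) = 0) -> ipX v v = 0.
Proof.
move=> Xv h; have [v2 g2 vg] := gradxP Xv.
have [e [He etot]] := H10_separable oOm bOm.
have o2 : L2 leb J (fun=> 1).
  by apply: (L2_bnd mJ (C := 1) (lebesgue_itv_lty 0 T)) => // t _; rewrite normr1.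
have : {ae leb, forall t : measurableTypeR R, forall k, J t ->
    ipV mu Om (fun x => gradx T Om v (t, x)) (gradH Om (e k)) = 0}.
  apply: ae_forall_count => k; apply: ae_test_eq0 => [|phi tphi].
    have [_ t2 _] := X_tensor o2 (gradHP (He k)).
    have := (fiber_ipV g2 t2).1; congr (L1 _ _ _); apply/funext => t.
    by apply: eq_Rintegral => x _; rewrite scale1r.
  by rewrite -(ipX_tensor Xv (test_L2J tphi) (He k)) h.
move=> h0; rewrite /ipX (fiber_ipV g2 g2).2.
transitivity (\int[leb]_(t in J) 0); last by rewrite Rintegral_cst// mul0r.
apply: ae_eq_Rintegral => //; first exact: (L1_measurable (fiber_ipV g2 g2).1).
apply: filterS2 h0 vg => t h0 vg Jt.
have Ht : H10 Om (fun x => v (t, x)) by exists (fun x => gradx T Om v (t, x)); exact: vg.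
rewrite -(ipHE oOm bOm (vg Jt) (vg Jt)); apply: etot => // k.
by rewrite (ipHE oOm bOm (vg Jt) (gradHP (He k))) h0.
Qed.

(** The Riesz representer of the difference is orthogonal to all tensors, hence null. This makes the
    weak time derivative unique as a functional on X. *)
Lemma dual_tensor_eq D D' : dual (spX T Om) (normX T Om) D -> dual (spX T Om) (normX T Om) D' ->
  (forall phi (w : E -> R), test_fun `]0, T[%classic phi -> H10 Om w ->
    D (fun z => phi z.1 * w z.2) = D' (fun z => phi z.1 * w z.2)) ->
  forall v, spX T Om v -> D v = D' v.
Proof.
move=> hD hD' h.
have hd := dual_comb (-1) hD hD'.
have [w Xw hw] := dual_riesz ipX_semi normXE ipX_complete hd.
have w0 : ipX w w = 0.
  apply: X_tensor_total => // phi k tphi Hk.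
  have Xt : spX T Om (fun z => phi z.1 * k z.2).
    by exists (fun z => phi z.1 *: gradH Om k z.2); apply: X_tensor (test_L2J tphi) (gradHP Hk).
  by rewrite -hw// h//; ring.
move=> v Xv; have := hw v Xv; have := ip_sqr_le ipX_semi Xw Xv.
rewrite w0 mul0r real_exprn_even_le0 ?num_real//= => /eqP -> /eqP.
by rewrite mulN1r addrC subr_eq0 => /eqP.
Qed.

End space_X.

(** * Shifts in time *)

Section shifts.
Context {R : realType} {n : nat}.
Local Notation mu := (@lebesgue_rV R n).
Local Notation leb := (@lebesgue_measure R).
Local Notation pt := (measurableTypeR R * 'rV[R]_n)%type.
Local Notation P := (@lebQ R n).
Implicit Types (h : R) (f : pt -> R).

Lemma measurable_shift h : measurable_fun setT (fun t : measurableTypeR R => t - h : measurableTypeR R).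
Proof. by apply: measurable_funB. Qed.

Lemma lebesgue_shift h (A : set (measurableTypeR R)) : measurable A ->
  leb ((fun t : measurableTypeR R => t - h : measurableTypeR R) @^-1` A) = leb A.
Proof.
move=> mA; symmetry; apply: (@lebesgue_measure_unique R (pushforward leb (fun t : measurableTypeR R => t - h : measurableTypeR R))) => //.
  exact: measurable_shift.
move=> ? _ [[a b]] _ <-; rewrite /= /pushforward.
rewrite (_ : _ @^-1` _ = `]a + h, b + h]%classic); last first.
  by apply/seteqP; split=> t; rewrite /= !in_itv /= ltrBrDr lerBlDr.
rewrite !lebesgue_measure_itv /= !lte_fin ltrD2r.
by case: ifP => // _; rewrite -!EFinB; congr EFin; ring.
Qed.

Definition tshift h (z : pt) : pt := (z.1 - h, z.2).

Lemma measurable_tshift h : measurable_fun setT (tshift h).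
Proof.
apply: measurable_fun_pair; last exact: measurable_snd.
by apply: measurable_funB => //; exact: measurable_fst.
Qed.

Lemma lebQ_shift h (A : set pt) : measurable A -> P (tshift h @^-1` A) = P A.
Proof.
move=> mA; symmetry.
apply: (@product_measure_unique _ _ _ _ R leb mu (pushforward P (tshift h))) => //.
  exact: measurable_tshift.
move=> ? B C mB mC; rewrite /= /pushforward.
rewrite (_ : _ @^-1` _ = ((fun t : measurableTypeR R => t - h : measurableTypeR R) @^-1` B) `*` C)//.
have mB' : measurable ((fun t : measurableTypeR R => t - h : measurableTypeR R) @^-1` B).
  by rewrite -[X in measurable X]setTI; exact: measurable_shift.
by rewrite -(lebesgue_shift h mB); exact: (product_measure1E _ _ mB' mC).
Qed.

Lemma ae_shift h (A : R -> Prop) : {ae leb, forall t : measurableTypeR R, A t} ->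
  {ae leb, forall t : measurableTypeR R, A (t - h)}.
Proof.
move=> [N [mN N0 hN]]; exists ((fun t : measurableTypeR R => t - h : measurableTypeR R) @^-1` N).
split; last by move=> t; exact: hN.
- by rewrite -[X in measurable X]setTI; exact: measurable_shift.
- by rewrite lebesgue_shift.
Qed.

Lemma Rintegral_tshift h f : measurable_fun setT f -> P.-integrable setT (EFin \o f) ->
  P.-integrable setT (EFin \o (f \o tshift h)) /\ \int[P]_z f (tshift h z) = \int[P]_z f z.
Proof.
move=> mf If; have mEf : measurable_fun [set: pt] (EFin \o f) by exact/measurable_EFinP.
have e (g : pt -> \bar R) : measurable_fun setT g -> (forall z, 0 <= g z)%E ->
    (\int[P]_z g (tshift h z) = \int[P]_z g z)%E.
  move=> mg g0; have := @ge0_integral_pushforward _ _ _ _ R _ (measurable_tshift h) P setT g.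
  rewrite preimage_setT => /(_ measurableT mg (fun z _ => g0 z)) h1.
  rewrite -[LHS]/(\int[P]_z (g \o tshift h) z)%E -h1.
  apply: (@eq_measure_integral _ _ R setT P); first exact: measurable_tshift.
  by move=> ? A mA _; exact: lebQ_shift.
have Is : P.-integrable setT (EFin \o (f \o tshift h)).
  have [_ fi] := integrableP _ _ _ If.
  apply/integrableP; split; first exact: (measurableT_comp mEf (measurable_tshift h)).
  have := e (fun z => `|(EFin \o f) z|)%E; rewrite /= => -> //.
  by apply/measurable_EFinP; exact: measurableT_comp.
split => //.
have := @integral_pushforward _ _ _ _ R _ (measurable_tshift h) P setT (EFin \o f) mEf.
rewrite preimage_setT => /(_ Is measurableT) e1.
rewrite /Rintegral -[in LHS]/(fine (\int[P]_z (EFin \o f \o tshift h) z)%E) -e1.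
congr fine; apply: (@eq_measure_integral _ _ R setT P); first exact: measurable_tshift.
by move=> ? A mA _; exact: lebQ_shift.
Qed.

End shifts.

Lemma derive_shift {R : realType} {V : normedModType R} (f : V -> R) (c v x : V) :
  'D_v (fun y => f (y - c)) x = 'D_v f (x - c).
Proof.
have e : (fun h : R => h^-1 *: (f (h *: v + x - c) - f (x - c))) =
    (fun h => h^-1 *: (f (h *: v + (x - c)) - f (x - c))).
  by apply/funext => h; rewrite addrA.
by rewrite /derive e.
Qed.

Lemma derivable_shift {R : realType} {V : normedModType R} (f : V -> R) (c v x : V) :
  derivable f (x - c) v -> derivable (fun y => f (y - c)) x v.
Proof.
have e : (fun h : R => h^-1 *: (f (h *: v + x - c) - f (x - c))) =
    (fun h => h^-1 *: (f (h *: v + (x - c)) - f (x - c))).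
  by apply/funext => h; rewrite addrA.
by rewrite /derivable e.
Qed.

Lemma smooth_shift {R : realType} {V : normedModType R} (f : V -> R) (c : V) :
  smooth f -> smooth (fun y => f (y - c)).
Proof.
move=> sf vs; have e us : iter_derive us (fun y => f (y - c)) = fun y => iter_derive us f (y - c).
  by elim: us => //= u us IH; apply/funext => x; rewrite IH derive_shift.
rewrite e; have [cf df] := sf vs; split; last by move=> x v; apply: derivable_shift.
move=> x; apply: (@continuous_comp _ _ _ (fun y => y - c) (iter_derive vs f)); last exact: cf.
by apply: cvgB; [exact: cvg_id|exact: cvg_cst].
Qed.

(** * Shifts of functions supported away from the end times *)

Section time_shifts.
Context {R : realType} {n : nat}.
Variables (T : R) (Om : set 'rV[R]_n.+1).
Hypotheses (oOm : open Om) (bOm : bounded_set Om).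
Local Notation E := 'rV[R]_n.+1.
Local Notation pt := (measurableTypeR R * 'rV[R]_n.+1)%type.
Local Notation J := (`]0, T[%classic : set (measurableTypeR R)).
Local Notation Q := (QT T Om : set pt).
Local Notation P := (@lebQ R n.+1).
Implicit Types (v w f : pt -> R) (g : pt -> E) (a h : R).

Let mQ : measurable Q. Proof. exact: measurable_QT. Qed.

(** A shift by less than [a] then neither pushes the function out of the cylinder nor brings in
    values from outside. *)
Definition tsupp (V : zmodType) a (f : pt -> V) := forall z, ~~ (a <= z.1 <= T - a) -> f z = 0.

Lemma patch_tshift a h f : 0 < a -> `|h| < a -> tsupp a f ->
  (f \o tshift h) \_ Q = (f \_ Q) \o tshift h.
Proof.
move=> a0 ha fs; apply/funext => -[t x] /=.
have [tin|tout] := boolP (a <= t - h <= T - a).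
  have Jt : J t.
    by move: ha tin; rewrite ltr_norml /= in_itv /= => /andP[? ?] /andP[? ?]; apply/andP; split; lra.
  have Jth : J (t - h).
    by move: tin; rewrite /= in_itv /= => /andP[? ?]; apply/andP; split; lra.
  by rewrite patch_QT// /tshift /= patch_QT.
have f0 : f (t - h, x) = 0 by exact: fs.
by rewrite /patch /= /tshift /= f0; case: ifP => _; case: ifP.
Qed.

Lemma L1_tshift a h f : 0 < a -> `|h| < a -> tsupp a f -> L1 P Q f ->
  L1 P Q (f \o tshift h) /\ \int[P]_(z in Q) f (tshift h z) = \int[P]_(z in Q) f z.
Proof.
move=> a0 ha fs /(L1_patch _ _ mQ) If.
have mf : measurable_fun setT (f \_ Q) by apply/measurable_EFinP; exact: measurable_int If.
have [I1 e1] := Rintegral_tshift h mf If.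
split; first by apply/(L1_patch _ _ mQ); rewrite (patch_tshift a0 ha fs).
rewrite Rintegral_mkcond [RHS]Rintegral_mkcond -e1.
by apply: eq_Rintegral => z _; have := patch_tshift a0 ha fs => /(congr1 (@^~ z)).
Qed.

Lemma L2_tshift a h f : 0 < a -> `|h| < a -> tsupp a f -> L2 P Q f -> L2 P Q (f \o tshift h).
Proof.
move=> a0 ha fs f2; apply/(L2P _ mQ); split; last first.
  apply: (L1_tshift (f := fun z => f z ^+ 2) a0 ha _ (L2_sqr mQ f2)).1.
  by move=> z hz; rewrite fs// expr0n.
have /(measurable_restrictT _ mQ) mf := L2_measurable mQ f2.
apply/(measurable_restrictT _ mQ); rewrite (patch_tshift a0 ha fs).
exact: (measurableT_comp mf (measurable_tshift h)).
Qed.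

Lemma X_tshift a h v g : 0 < a -> `|h| < a -> tsupp a v -> tsupp a g -> X_grad T Om v g ->
  X_grad T Om (v \o tshift h) (g \o tshift h).
Proof.
move=> a0 ha vs gs [v2 g2 vg]; split.
- exact: (L2_tshift a0 ha vs v2).
- move=> i; apply: (L2_tshift a0 ha _ (g2 i)) => z hz; by rewrite gs// mxE.
- have := ae_shift h vg; apply: filterS => t hvg Jt /=.
  have [tin|tout] := boolP (a <= t - h <= T - a).
    apply: hvg; by move: tin; rewrite /= in_itv /= => /andP[? ?]; apply/andP; split; lra.
  have := H10_grad0 oOm bOm.
  by congr (H10_grad Om _ _); apply/funext => x; rewrite /tshift /= ?vs ?gs.
Qed.

Lemma ipV_tshift a h g g' : 0 < a -> `|h| < a -> tsupp a g ->
  L2v P Q g -> L2v P Q g' -> ipV P Q (g \o tshift h) (g' \o tshift h) = ipV P Q g g'.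
Proof.
move=> a0 ha gs g2 g2'; apply: (L1_tshift a0 ha _ (L2v_dotv mQ g2 g2')).2.
by move=> z hz; rewrite gs// dot0v.
Qed.

Lemma test_shift a h (phi : R -> R) : 0 < a -> `|h| < a -> smooth phi ->
  (forall t, ~~ (a <= t <= T - a) -> phi t = 0) ->
  test_fun `]0, T[%classic (fun t => phi (t - h)).
Proof.
move=> a0 ha sphi phi0; apply: (@test_funP _ _ _ `[a + h, T - a + h]%classic).
- exact: smooth_shift.
- exact: segment_compact.
- move=> t; apply: contraNP => nt; apply/eqP; apply: phi0; apply/negP => /andP[h1 h2].
  by apply: nt; rewrite /= in_itv /=; apply/andP; split; lra.
- move=> t; rewrite /= !in_itv /=; move: ha; rewrite ltr_norml => /andP[? ?] /andP[? ?].
  by apply/andP; split; lra.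
Qed.

Lemma test_tsupp (phi : R -> R) : test_fun `]0, T[%classic phi ->
  exists2 a, 0 < a & forall t, ~~ (a <= t <= T - a) -> phi t = 0.
Proof.
move=> [sp cp sup]; set K := closure _ in cp sup.
have [T0|T0] := leP T 0.
  exists 1 => // t _; apply/eqP/contraT => pt0.
  have := sup t (@subset_closure _ [set x | phi x != 0] t pt0); rewrite /= in_itv /= => /andP[? ?]; lra.
(* On the compact support t (T - t) is bounded away from 0, since its inverse is continuous there;
   as each factor is at most T, both end points keep a positive distance. *)
have ct : {within K, continuous (fun t : R => (t * (T - t))^-1)}.
  apply: continuous_in_subspaceT => t /set_mem /sup /=; rewrite in_itv /= => /andP[t0 tT].
  apply: cvgV; first by rewrite mulf_neq0//; lra.
  by apply: cvgM; [exact: cvg_id|apply: cvgB; [exact: cvg_cst|exact: cvg_id]].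
have := continuous_compact ct cp => /compact_bounded/bounded_norm[M hM].
have M0 : 0 < `|M| + 1 by rewrite ltr_wpDl.
exists ((T * (`|M| + 1))^-1); first by rewrite invr_gt0 mulr_gt0.
move=> t; apply: contraNeq => pt0; have Kt : K t by exact: (@subset_closure _ [set x | phi x != 0] t pt0).
have := sup t Kt; rewrite /= in_itv /= => /andP[t0 tT].
have := hM _ (ex_intro2 _ _ t Kt erefl) => h1.
have h2 : (t * (T - t))^-1 <= `|M| + 1.
  by apply: le_trans (ler_norm _) _; apply: le_trans h1 _; rewrite (le_trans (ler_norm M))// lerDl.
have tt : 0 < t * (T - t) by rewrite mulr_gt0//; lra.
have h3 : 1 <= (`|M| + 1) * (t * (T - t)) by rewrite -ler_pdivrMr// mul1r.
rewrite -[(T * _)^-1]mul1r.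
rewrite ler_pdivrMr ?mulr_gt0//; apply/andP; split; first by move: M0 h3; move: (`|M| + 1) => N; nra.
rewrite lerBrDr -lerBrDl ler_pdivrMr ?mulr_gt0//; move: M0 h3; move: (`|M| + 1) => N; nra.
Qed.

End time_shifts.

Lemma derive_lip {R : realType} (f df : R -> R) (K c a s t : R) :
  (forall x, `|x - c| <= a -> is_derive x (1 : R) f (df x)) ->
  (forall x, `|x - c| <= a -> `|df x| <= K) -> `|s - c| <= a -> `|t - c| <= a ->
  `|f s - f t| <= K * `|s - t|.
Proof.
move=> fd dfK; wlog st : s t / t <= s => [h sa ta|].
  have [ts|/ltW st] := leP t s; first exact: h.
  by rewrite distrC (distrC s); exact: h.
move=> sa ta; have /andP[s1 s2] : - a <= s - c <= a by rewrite -ler_norml.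
have /andP[t1 t2] : - a <= t - c <= a by rewrite -ler_norml.
have ina x : x \in `[t, s] -> `|x - c| <= a.
  by rewrite in_itv /= ler_norml => /andP[h1 h2]; apply/andP; split; lra.
have [||x xin ->] := @MVT_segment R f df t s st.
- by move=> x xts; apply: fd; apply: ina; exact: subset_itv_oo_cc xts.
- apply: derivable_within_continuous => x xts.
  by have [] := fd x (ina x xts).
- by rewrite normrM ler_wpM2r// dfK// ina.
Qed.

(** * Lipschitz and Taylor bounds for test functions of time *)

Section test_time.
Context {R : realType}.
Implicit Types (U : set R) (phi : R -> R).

Lemma smooth_is_derive phi (x : R) : smooth phi -> is_derive x (1 : R) phi (derive1 phi x).
Proof. by move=> tphi; rewrite derive1E; apply: DeriveDef => //; exact: smooth_derivable. Qed.

Lemma test_derive1 U phi : test_fun U phi -> test_fun U (derive1 phi).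
Proof.
by move=> /(test_derive (1 : R)); congr test_fun; apply/funext => x; rewrite derive1E.
Qed.

Lemma test_lip U phi : test_fun U phi ->
  exists2 K, 0 <= K & forall s t, `|phi s - phi t| <= K * `|s - t|.
Proof.
move=> tphi; have [K K0 hK] := test_bounded (test_derive1 tphi); exists K => // s t.
apply: (@derive_lip R phi (derive1 phi) K t `|s - t|) => //.
- by move=> x _; exact: (smooth_is_derive x (test_smooth tphi)).
- by rewrite subrr normr0.
Qed.

(** The function phi(x) - phi'(t) x has a derivative of size at most K |h| within distance |h| of t,
    by the Lipschitz bound for phi'. *)
Lemma test_taylor U phi : test_fun U phi ->
  exists2 K, 0 <= K & forall t h, `|phi (t - h) - phi t + h * derive1 phi t| <= K * h ^+ 2.
Proof.
move=> tphi; have [K K0 hK] := test_lip (test_derive1 tphi); exists K => // t h.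
pose f x := phi x - derive1 phi t * x; pose df x := derive1 phi x - derive1 phi t.
have fd (x : R) : is_derive x (1 : R) f (df x).
  have h1 := smooth_is_derive x (test_smooth tphi).
  apply: (is_deriveB h1); have := is_deriveZ (derive1 phi t) (is_derive_id x (1 : R)).
  by rewrite /GRing.scale /= mulr1.
have := @derive_lip R f df (K * `|h|) t `|h| (t - h) t (fun x _ => fd x).
rewrite addrC addKr normrN subrr normr0 => h1.
have {h1} := h1 _ (lexx _) (normr_ge0 _).
rewrite -mulrA -normrM -expr2 (ger0_norm (sqr_ge0 h)) => h2.
rewrite (_ : phi (t - h) - _ + _ = f (t - h) - f t); last by rewrite /f; ring.
by apply: h2 => x hx; rewrite /df; apply: le_trans (hK _ _) _; rewrite ler_wpM2l.
Qed.

End test_time.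

(** * Continuity of time shifts in L^2 *)

Section time_derivative.
Context {R : realType} {n : nat}.
Variables (T : R) (Om : set 'rV[R]_n.+1).
Hypotheses (oOm : open Om) (bOm : bounded_set Om).
Local Notation mu := (@lebesgue_rV R n.+1).
Local Notation leb := (@lebesgue_measure R).
Local Notation E := 'rV[R]_n.+1.
Local Notation pt := (measurableTypeR R * 'rV[R]_n.+1)%type.
Local Notation J := (`]0, T[%classic : set (measurableTypeR R)).
Local Notation Q := (QT T Om : set pt).
Local Notation P := (@lebQ R n.+1).
Implicit Types (v w f u : pt -> R) (D : (pt -> R) -> R) (g : E -> R) (a h : R).

Let mOm : measurable Om. Proof. exact: open_rV_measurable. Qed.
Let Omoo : (mu Om < +oo)%E. Proof. exact: bounded_lty. Qed.
Let mJ : measurable J. Proof. exact: measurable_itv. Qed.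
Let mQ : measurable Q. Proof. exact: measurable_QT. Qed.

Lemma test_measurable phi : test_fun `]0, T[%classic phi -> measurable_fun J phi.
Proof.
move=> tphi; apply: measurable_funTS; apply: continuous_measurable_fun.
exact: (test_continuous tphi).
Qed.

Lemma ipL_tensor w (a : R -> R) g : L2 P Q w -> L2 leb J a -> L2 mu Om g ->
  L1 leb J (fun t => ipL mu Om (fun x => w (t, x)) g) /\
  ipL P Q w (fun z => a z.1 * g z.2) =
  \int[leb]_(t in J) (ipL mu Om (fun x => w (t, x)) g * a t).
Proof.
move=> w2 a2 g2.
have o2 : L2 leb J (fun=> 1).
  by apply: (L2_bnd mJ (C := 1) (lebesgue_itv_lty 0 T)) => // t _; rewrite normr1.
have I1 := (fiber_ipL oOm w2 (L2_tensor oOm bOm o2 g2)).1.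
have I2 := fiber_ipL oOm w2 (L2_tensor oOm bOm a2 g2).
have I3 : L1 leb J (fun t => ipL mu Om (fun x => w (t, x)) g).
  by move: I1; congr (L1 _ _ _); apply/funext => t; apply: eq_Rintegral => x _; rewrite mul1r.
split => //; rewrite I2.2; apply: ae_eq_Rintegral => //.
- exact: (L1_measurable I2.1).
- by apply: measurable_funM; [exact: (L1_measurable I3)|exact: (L2_measurable mJ a2)].
- have := ae_fiber_L2 oOm w2; apply: filterS => t wt Jt.
  have sL := ipL_semi mu mOm.
  have := ipZr sL (a t) g2 (wt Jt); rewrite mulrC => <-.
  by apply: eq_Rintegral.
Qed.

(** The rational bumps are countably many, so almost every fibre is orthogonal to all of them at
    once. *)
Lemma L2_tensor_total w : L2 P Q w ->
  (forall phi g, test_fun `]0, T[%classic phi -> L2 mu Om g ->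
    ipL P Q w (fun z => phi z.1 * g z.2) = 0) -> {ae P, forall z, Q z -> w z = 0}.
Proof.
move=> w2 h.
pose I := (({ffun 'I_n.+1 -> rat} * {ffun 'I_n.+1 -> rat}) * nat)%type.
have ae1 : {ae leb, forall t : measurableTypeR R, forall q : I, J t -> rbox q.1 `<=` Om ->
    ipL mu Om (fun x => w (t, x)) (rbump q.1 q.2) = 0}.
  apply: ae_forall_count => q.
  have [qO|nq] := pselect (rbox q.1 `<=` Om); last by apply: aeW => t _ /nq.
  have t2 : L2 mu Om (rbump q.1 q.2) by apply: test_L2 => //; exact: (test_boxbump q.2 qO).
  have : {ae leb, forall t : measurableTypeR R, J t ->
      ipL mu Om (fun x => w (t, x)) (rbump q.1 q.2) = 0}.
    apply: ae_test_eq0 => [|phi tphi].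
      by have [] := ipL_tensor w2 (L2_0 leb mJ) t2.
    by have [_ <-] := ipL_tensor w2 (test_L2J tphi) t2; exact: h.
  by apply: filterS => t ht Jt _; exact: ht.
apply: (ae_cylinder0 oOm (L1_finite_L2 mQ (QT_lty T oOm bOm) w2)).
have := ae_fiber_L2 oOm w2; apply: filterS2 ae1 => t ae1 wt Jt.
apply: (fundamental_ae0 oOm) => [|q k qO]; first exact: (L1_finite_L2 mOm Omoo (wt Jt)).
exact: (ae1 (q, k) Jt qO).
Qed.

Lemma L2_test phi w : test_fun `]0, T[%classic phi -> L2 P Q w ->
  L2 P Q (fun z => phi z.1 * w z).
Proof.
move=> tphi; have [M M0 hM] := test_bounded tphi.
by apply: (L2_time oOm (C := M) (test_measurable tphi)) => t _.
Qed.

Lemma L2_test_le phi M w : test_fun `]0, T[%classic phi -> (forall t, `|phi t| <= M) ->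
  L2 P Q w -> ipL P Q (fun z => phi z.1 * w z) (fun z => phi z.1 * w z) <= M ^+ 2 * ipL P Q w w.
Proof.
move=> tphi hM w2; have pw2 := L2_test tphi w2.
rewrite /ipL -RintegralZl//; last exact: (L2M mQ w2 w2).
apply: le_Rintegral => //; first exact: (L2M mQ pw2 pw2).
  exact: (L1Z mQ _ (L2M mQ w2 w2)).
move=> z _; rewrite -!expr2 exprMn ler_wpM2r ?sqr_ge0//.
rewrite -[phi _ ^+ 2]ger0_norm ?sqr_ge0// normrX lerXn2r ?nnegrE//.
exact: le_trans (hM 0).
Qed.

(** Tensors have the property by the Lipschitz bound in time, and it is stable under linear
    combinations. It extends from this dense subspace because shifts are isometric on functions
    supported away from the end times. *)
Lemma shift_cvg w chi : test_fun `]0, T[%classic chi -> L2 P Q w ->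
  forall e, 0 < e -> exists2 del, 0 < del & forall h, `|h| < del ->
    let cw := fun z => chi z.1 * w z in
    ipL P Q ((cw \o tshift h) - cw) ((cw \o tshift h) - cw) < e.
Proof.
move=> tchi w2.
have [a a0 chi0] := test_tsupp tchi; have [M M0 hM] := test_bounded tchi.
have sL := ipL_semi P mQ.
pose c (u : pt -> R) : pt -> R := fun z => chi z.1 * u z.
have cL u : L2 P Q u -> L2 P Q (c u) by exact: L2_test.
have cS u h : L2 P Q u -> `|h| < a -> L2 P Q (c u \o tshift h).
  move=> u2 ha; have t1 : tsupp T a (c u) by move=> z hz; rewrite /c chi0// mul0r.
  have h1 := L2_tshift oOm a0 ha t1.
  exact: (h1 (cL _ u2)).
pose good u := L2 P Q u /\ forall e, 0 < e -> exists2 del, 0 < del & forall h, `|h| < del ->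
    ipL P Q ((c u \o tshift h) - c u) ((c u \o tshift h) - c u) < e.
have good0 : good (fun=> 0).
  split; first exact: L2_0.
  move=> e e0; exists 1 => // h _.
  rewrite (_ : _ - _ = 0); last by apply/funext => z; rewrite !fctE /c /= !mulr0 subrr.
  by rewrite (ip0l sL)//; exact: L2_0.
have goodl b u v : good u -> good v -> good (fun z => b * u z + v z).
  move=> [u2 gu] [v2 gv]; split; first exact: L2_lin.
  move=> e e0; have e1 : 0 < e / (4 * (b ^+ 2 + 1)).
    by rewrite divr_gt0// mulr_gt0// ltr_wpDl// sqr_ge0.
  have [d1 d10 h1] := gu _ e1; have [d2 d20 h2] := gv _ e1.
  exists (Num.min a (Num.min d1 d2)); first by rewrite !lt_min a0 d10.
  move=> h; rewrite !lt_min => /and3P[ha hd1 hd2].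
  set U := (c u \o tshift h) - c u; set V := (c v \o tshift h) - c v.
  have U2 : L2 P Q U by apply: L2B; [|exact: cS|exact: cL].
  have V2 : L2 P Q V by apply: L2B; [|exact: cS|exact: cL].
  rewrite (_ : _ - _ = b *: U + V); last first.
    by apply/funext => z; rewrite /U /V !fctE /c /GRing.scale /=; ring.
  apply: le_lt_trans (ip_leD2 sL (L2Z mQ b U2) V2) _.
  rewrite (ipZl sL b U2 (L2Z mQ b U2)) (ipZr sL b U2 U2).
  by apply: weighted_sum_lt => //; [exact: h1|exact: h2].
have goodt phi g : test_fun `]0, T[%classic phi -> L2 mu Om g -> good (fun z => phi z.1 * g z.2).
  move=> tphi g2; split; first exact: (L2_tensor oOm bOm (test_L2J tphi) g2).
  have tcp := test_funM (test_smooth tchi) tphi.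
  have [K K0 hK] := test_lip tcp.
  have o2 : L2 leb J (fun=> 1).
    by apply: (L2_bnd mJ (C := 1) (lebesgue_itv_lty 0 T)) => // t _; rewrite normr1.
  have G2 := L2_tensor oOm bOm o2 g2; set G := fun z => _ in G2.
  pose N := ipL P Q G G; have N0 : 0 <= N by exact: (ip_ge0 sL).
  move=> e e0; exists (Num.min a (Num.sqrt (e / (K ^+ 2 * N + 1)))).
    by rewrite lt_min a0 sqrtr_gt0 divr_gt0// ltr_wpDl// mulr_ge0// sqr_ge0.
  move=> h; rewrite lt_min => /andP[ha hd].
  have h2 : h ^+ 2 < e / (K ^+ 2 * N + 1).
    rewrite -[ltRHS]sqr_sqrtr; last by rewrite divr_ge0 ?(ltW e0)// addr_ge0 ?mulr_ge0 ?sqr_ge0.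
    by rewrite -[h ^+ 2]ger0_norm ?sqr_ge0// normrX ltrXn2r// ?nnegrE.
  set u : pt -> R := fun z => phi z.1 * g z.2.
  have u2 : L2 P Q u by exact: (L2_tensor oOm bOm (test_L2J tphi) g2).
  have U2 : L2 P Q ((c u \o tshift h) - c u) by apply: L2B; [|exact: cS|exact: cL].
  have h2K : h ^+ 2 * (K ^+ 2 * N) < e.
    move: h2; rewrite ltr_pdivlMr; last by rewrite ltr_wpDl// mulr_ge0// sqr_ge0.
    by apply: le_lt_trans; rewrite ler_wpM2l ?sqr_ge0// lerDl.
  apply: le_lt_trans h2K; rewrite mulrA /N /ipL -RintegralZl//; last exact: (L2M mQ G2 G2).
  apply: le_Rintegral => //; first exact: (L2M mQ U2 U2).
    exact: (L1Z mQ _ (L2M mQ G2 G2)).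
  move=> z _; rewrite !fctE /c /u /G /= mul1r -!expr2.
  apply: (@le_trans _ _ ((chi (z.1 - h) * phi (z.1 - h) - chi z.1 * phi z.1) ^+ 2 * g z.2 ^+ 2)).
    by rewrite -exprMn mulrBl !mulrA.
  apply: ler_wpM2r; first exact: sqr_ge0.
  rewrite -exprMn.
  rewrite -[leLHS]ger0_norm ?sqr_ge0// -[leRHS]ger0_norm ?sqr_ge0// !normrX.
  rewrite lerXn2r ?nnegrE//; apply: le_trans (hK _ _) _.
  by rewrite addrAC subrr add0r normrN mulrC normrM (ger0_norm K0).
have dens := @ip_dense _ _ _ _ sL (@ipL_complete _ _ R P Q mQ) good w _ _ w2.
(* The increment is A + B - C with A a shift of C, so its squared norm is at most 6 |C|^2 + 4 |B|^2,
   and the bounds e / 18 and e / 6 fit. The factor M^2 + 1 pays for the multiplication by [chi]. *)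
move=> e e0; pose e' := e / (18 * (M ^+ 2 + 1)).
have M1 : 0 < M ^+ 2 + 1 by rewrite ltr_wpDl// sqr_ge0.
have e'0 : 0 < e' by rewrite divr_gt0// mulr_gt0.
have [||| u [u2 gu] hu] := dens _ _ _ _ e'0.
- by split => // b u v gu gv; exact: goodl.
- by move=> u [].
- move=> v v2 hv; apply: (L2_eq0_ipL mQ v2); apply: (L2_tensor_total v2) => phi g tphi g2.
  by apply: hv; exact: goodt.
have e6 : 0 < e / 6 by rewrite divr_gt0.
have [d d0 hd] := gu _ e6; exists (Num.min a d); first by rewrite lt_min a0.
move=> h; rewrite lt_min => /andP[ha hdh] /=.
have wu2 : L2 P Q (w - u) by exact: L2B.
set A := c (w - u) \o tshift h; set B := (c u \o tshift h) - c u; set C := c (w - u).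
have A2 : L2 P Q A by exact: cS.
have B2 : L2 P Q B by apply: L2B; [|exact: cS|exact: cL].
have C2 : L2 P Q C by exact: cL.
rewrite (_ : _ - _ = (A + B) + (- 1) *: C); last first.
  by apply/funext => z; rewrite !fctE /A /B /C /c /GRing.scale /= !fctE; ring.
have Ce : ipL P Q C C < e / 18.
  apply: le_lt_trans (L2_test_le tchi hM wu2) _.
  have : (M ^+ 2 + 1) * ipL P Q (w - u) (w - u) < e / 18.
    rewrite -ltr_pdivlMl// mulrC -mulrA -invfM; exact: hu.
  by apply: le_lt_trans; rewrite ler_wpM2r ?(ip_ge0 sL)// lerDl.
have Ae : ipL P Q A A = ipL P Q C C.
  have := (L1_tshift oOm (f := fun z => C z * C z) a0 ha _ (L2M mQ C2 C2)).2; apply.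
  by move=> z hz; rewrite /C /c chi0// mul0r mul0r.
apply: le_lt_trans (ip_leD2 sL (L2D mQ A2 B2) (L2Z mQ (- 1) C2)) _.
rewrite (ipZl sL (- 1) C2 (L2Z mQ (- 1) C2)) (ipZr sL (- 1) C2 C2).
have := ip_leD2 sL A2 B2; have := hd h hdh; rewrite -/B Ae; move: Ce.
move: (ipL P Q C C) (ipL P Q B B) (ipL P Q (A + B) (A + B)) => x y z; lra.
Qed.

End time_derivative.

(** * The product rule for the weak time derivative *)

Lemma ler_eps {R : realFieldType} (x y c : R) : 0 <= c ->
  (forall e, 0 < e -> x <= y + c * e) -> x <= y.
Proof.
move=> c0 h; apply/ler_addgt0Pr => e e0.
have c1 : 0 < c + 1 by rewrite ltr_wpDl.
apply: le_trans (h (e / (c + 1)) (divr_gt0 e0 c1)) _.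
by rewrite lerD2l mulrCA ler_piMr ?(ltW e0)// ler_pdivrMr// mul1r lerDl.
Qed.

Lemma near_norm_lt {R : realType} (s a : R) : `|s| < a -> \forall r \near s, `|r| < a.
Proof.
move=> sa; apply/nbhs_ballP; exists (a - `|s|); first by rewrite /= subr_gt0.
move=> r; rewrite /ball /= => h; have := ler_normB s (s - r); rewrite opprB addrC subrK.
by move=> /le_lt_trans; apply; rewrite -ltrBrDl.
Qed.

Section product_rule.
Context {R : realType} {n : nat}.
Variables (T : R) (Om : set 'rV[R]_n.+1).
Hypotheses (oOm : open Om) (bOm : bounded_set Om).
Local Notation mu := (@lebesgue_rV R n.+1).
Local Notation leb := (@lebesgue_measure R).
Local Notation E := 'rV[R]_n.+1.
Local Notation pt := (measurableTypeR R * 'rV[R]_n.+1)%type.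
Local Notation J := (`]0, T[%classic : set (measurableTypeR R)).
Local Notation Q := (QT T Om : set pt).
Local Notation P := (@lebQ R n.+1).
Implicit Types (w f u : pt -> R) (g : E -> R) (a h : R).

Let mOm : measurable Om. Proof. exact: open_rV_measurable. Qed.
Let mJ : measurable J. Proof. exact: measurable_itv. Qed.
Let mQ : measurable Q. Proof. exact: measurable_QT. Qed.
Let sL := @ipL_semi _ _ R P Q mQ.
Let sX := @ipX_semi R n T Om oOm bOm.
Let sVQ := @ipV_semi _ _ R n.+1 P Q mQ.

(** The parameter enters through the smooth factor only, so a multiple of [|V|] dominates the
    derivative of the integrand. *)
Lemma param_derive (V th : R -> R) U (s : R) : L1 leb J V -> test_fun U th ->
  is_derive s (1 : R) (fun s => \int[leb]_(t in J) (V t * th (t - s)))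
    (- \int[leb]_(t in J) (V t * derive1 th (t - s))).
Proof.
move=> IV tth; pose F (s t : R) := V t * th (t - s).
have [K K0 hK] := test_bounded (test_derive1 tth).
have [M M0 hM] := test_bounded tth.
have mcont (f : R -> R) (r : R) : continuous f -> measurable_fun J (fun t => f (t - r)).
  move=> cf; apply: measurable_funTS; apply: continuous_measurable_fun => t.
  by apply: continuous_comp; [apply: cvgB; [exact: cvg_id|exact: cvg_cst]|exact: cf].
have mV := L1_measurable IV.
have dF (t r : R) : is_derive r (1 : R) (F ^~ t) (- (V t * derive1 th (t - r))).
  have l1 : linear_form (fun x : R => -1 * x).
    by apply: linear_formZ; exact: linear_form_id.
  have := @is_derive_comp_lin R _ th (derive1 th) (fun x : R => -1 * x) t r 1 l1
    (smooth_is_derive _ (test_smooth tth)).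
  have e1 x : -1 * x + t = t - x by ring.
  move=> /(is_deriveZ (V t)); rewrite e1.
  have -> : V t \*: (fun x : R => th (-1 * x + t)) = F ^~ t.
    by apply/funext => x; rewrite /F /= /GRing.scale /= e1.
  have -> // : V t *: (-1 * 1 * derive1 th (t - r)) = - (V t * derive1 th (t - r)).
  by rewrite /GRing.scale /=; ring.
have IF r : L1 leb J (F r).
  apply: (@L1_le _ _ _ leb J mJ _ (fun t => M * `|V t|)).
  - apply: measurable_funM => //; apply: mcont; exact: (test_continuous tth).
  - exact: (L1Z mJ M (L1_abs IV)).
  - by move=> t _; rewrite normrM mulrC ler_wpM2r.
have IG : L1 leb J (fun t => K * `|V t|) by exact: (L1Z mJ K (L1_abs IV)).
have ds : `](s - 1), (s + 1)[%classic s.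
  by rewrite /= in_itv /=; apply/andP; split; rewrite ?ltrBlDr ltrDl.
have d1 r t : partial1of2 F r t = - (V t * derive1 th (t - r)).
  by rewrite partial1of2E; have [_ ->] := dF t r.
have derF r t : derivable (F ^~ t) r 1 by have [] := dF t r.
have G0 t : 0 <= K * `|V t| by rewrite mulr_ge0.
have GF r t : `|partial1of2 F r t| <= K * `|V t|.
  by rewrite d1 normrN normrM mulrC ler_wpM2r.
have e1 := @differentiation_under_integral R _ _ leb F J mJ s (s - 1) (s + 1) ds
  (fun r _ => IF r) (fun r t _ _ => derF r t) _ G0 IG (fun r t _ _ => GF r t).
have e2 := @derivable_under_integral R _ _ leb F J mJ s (s - 1) (s + 1) ds
  (fun r _ => IF r) (fun r t _ _ => derF r t) _ G0 IG (fun r t _ _ => GF r t).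
apply: DeriveDef => //; rewrite -derive1E e1.
rewrite -[RHS]mulN1r -RintegralZl//.
  by apply: eq_Rintegral => t _; rewrite d1 mulN1r.
apply: (@L1_le _ _ _ leb J mJ _ (fun t => K * `|V t|)) => //.
- apply: measurable_funM => //; apply: (mcont (derive1 th)).
  exact: (test_continuous (test_derive1 tth)).
- by move=> t _; rewrite normrM mulrC ler_wpM2r.
Qed.

Lemma test_plateau a : 0 < a -> exists2 chi, test_fun `]0, T[%classic chi &
  forall t, a <= t <= T - a -> chi t = 1.
Proof.
move=> a0; have a2 : 0 < a / 2 by rewrite divr_gt0.
have [k] := ltr_add_invr a2; rewrite add0r => ka.
exists (bump k 0 T); first exact: test_bump.
move=> t /andP[h1 h2]; have k0 : 0 < k.+1%:R :> R by [].
have : 2 <= k.+1%:R * a.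
  by rewrite mulrC -ler_pdivrMr// ltW// -(ltr_pM2l (x := 2^-1))// mulrA mulVf// mul1r mulrC.
rewrite /bump; move: k0; move: (k.+1%:R) => K K0 Ka.
have h3 : K * a <= K * t by rewrite ler_wpM2l// ltW.
have h4 : K * a <= K * (T - t) by rewrite ler_wpM2l ?(ltW K0)//; lra.
rewrite mulrBr in h4.
by rewrite !step1 ?mulr1// ?mulNr; lra.
Qed.

Section derivative.
Variables (v : pt -> R) (D : (pt -> R) -> R).
Hypotheses (Xv : spX T Om v) (vD : is_dt T Om v D).

Let v2 : L2 P Q v. Proof. exact: spX_L2. Qed.
Let hD : dual (spX T Om) (normX T Om) D. Proof. by case: vD. Qed.

(** The factor [chi] moves the support away from the end times, so that small shifts stay in the
    cylinder. *)
Let cut (chi : R -> R) w : pt -> R := fun z => chi z.1 * w z.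
(** The derivative in [h] should be [D] at the shifted function: the minus sign in the definition of
    the weak derivative cancels the one from differentiating a function of t - h. *)
Let quo chi w h := \int[P]_(z in Q) (v z * (cut chi w (tshift h z) - cut chi w z)).

Let cutL chi w a h : test_fun `]0, T[%classic chi ->
  (forall t, ~~ (a <= t <= T - a) -> chi t = 0) -> 0 < a -> `|h| < a ->
  L2 P Q w -> L2 P Q (cut chi w \o tshift h).
Proof.
move=> tchi chi0 a0 ha w2; have t1 : tsupp T a (cut chi w).
  by move=> z hz; rewrite /cut chi0// mul0r.
by have h1 := L2_tshift oOm a0 ha t1; apply: h1; exact: L2_test.
Qed.

Let cutX chi w a h M : test_fun `]0, T[%classic chi ->
  (forall t, ~~ (a <= t <= T - a) -> chi t = 0) -> 0 < a -> `|h| < a ->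
  (forall t, `|chi t| <= M) -> spX T Om w ->
  spX T Om (cut chi w \o tshift h) /\ normX T Om (cut chi w \o tshift h) <= M * normX T Om w.
Proof.
move=> tchi chi0 a0 ha hM Xw; have gw := gradxP Xw; have [w2 g2 _] := gw.
have M0 : 0 <= M by exact: le_trans (hM 0).
have cg := X_time oOm bOm (test_measurable tchi) (fun t _ => hM t) gw.
have [_ cg2 _] := cg.
have t1 : tsupp T a (cut chi w) by move=> z hz; rewrite /cut chi0// mul0r.
have t2 : tsupp T a (fun z => chi z.1 *: gradx T Om w z) by move=> z hz; rewrite chi0// scale0r.
have sg := X_tshift oOm bOm a0 ha t1 t2 cg.
have Xs : spX T Om (cut chi w \o tshift h) by eexists; exact: sg.
split => //; rewrite !normXE// (ipXE oOm bOm sg sg).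
rewrite (ipV_tshift oOm a0 ha t2 cg2 cg2) (ipXE oOm bOm gw gw).
rewrite -[X in X * _](ger0_norm M0) -sqrtr_sqr -sqrtrM ?sqr_ge0//.
rewrite ler_sqrt; last by rewrite mulr_ge0 ?sqr_ge0// (ip_ge0 sVQ).
rewrite /ipV -RintegralZl//; last exact: (L2v_dotv mQ g2 g2).
apply: le_Rintegral => //; first exact: (L2v_dotv mQ cg2 cg2).
  exact: (L1Z mQ _ (L2v_dotv mQ g2 g2)).
move=> z _; rewrite dotvZl dotvZr mulrA -expr2 ler_wpM2r ?dotv_ge0//.
rewrite -[chi _ ^+ 2]ger0_norm ?sqr_ge0// normrX lerXn2r ?nnegrE//.
Qed.

Let quo_lin chi a h b w u : test_fun `]0, T[%classic chi ->
  (forall t, ~~ (a <= t <= T - a) -> chi t = 0) -> 0 < a -> `|h| < a ->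
  L2 P Q w -> L2 P Q u ->
  quo chi (fun z => b * w z + u z) h = b * quo chi w h + quo chi u h.
Proof.
move=> tchi chi0 a0 ha w2 u2.
pose A w : pt -> R := (cut chi w \o tshift h) - cut chi w.
have AL w' : L2 P Q w' -> L2 P Q (A w').
  by move=> w2'; apply: L2B; [|exact: (cutL tchi chi0 a0 ha w2')|exact: L2_test].
have e : A (fun z => b * w z + u z) = b *: A w + A u.
  by apply/funext => z; rewrite /A !fctE /cut /GRing.scale /=; ring.
have := ipDr sL (L2Z mQ b (AL _ w2)) (AL _ u2) v2.
by rewrite (ipZr sL b (AL _ w2) v2) => <-; rewrite -[_ *: _ + _]e.
Qed.

(* The difference quotients are controlled by D on the span of the tensors. *)
Let nice w := spX T Om w /\ forall chi a, test_fun `]0, T[%classic chi ->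
  (forall t, ~~ (a <= t <= T - a) -> chi t = 0) -> 0 < a -> forall s, `|s| < a ->
  is_derive s (1 : R) (quo chi w) (D (cut chi w \o tshift s)).

Let nice_tensor phi g : test_fun `]0, T[%classic phi -> H10 Om g ->
  nice (fun z => phi z.1 * g z.2).
Proof.
move=> tphi Hg; have [_ g2]: True /\ L2 mu Om g by split => //; have [dg []] := Hg.
have w2 : L2 P Q (fun z => phi z.1 * g z.2) by exact: (L2_tensor oOm bOm (test_L2J tphi) g2).
split; first by eexists; exact: (X_tensor oOm bOm (test_L2J tphi) (gradHP Hg)).
move=> chi a tchi chi0 a0 s sa.
pose th t := chi t * phi t.
have tth : test_fun `]0, T[%classic th by exact: (test_funM (test_smooth tchi) tphi).
have th0 t : ~~ (a <= t <= T - a) -> th t = 0 by move=> ht; rewrite /th chi0// mul0r.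
pose V t := ipL mu Om (fun x => v (t, x)) g.
have IV : L1 leb J V by exact: (ipL_tensor oOm bOm v2 (L2_0 leb mJ) g2).1.
have tsh r : `|r| < a -> test_fun `]0, T[%classic (fun t => th (t - r)).
  by move=> ra; exact: (test_shift a0 ra (test_smooth tth) th0).
have e r : `|r| < a -> quo chi (fun z => phi z.1 * g z.2) r =
    \int[leb]_(t in J) (V t * th (t - r)) - \int[leb]_(t in J) (V t * th t).
  move=> ra; have t1 := test_L2J (tsh _ ra); have t2 := test_L2J tth.
  have [_ <-] := ipL_tensor oOm bOm v2 t1 g2; have [_ <-] := ipL_tensor oOm bOm v2 t2 g2.
  rewrite -RintegralB//; last 2 first.
  - exact: (L2M mQ v2 (L2_tensor oOm bOm t1 g2)).
  - exact: (L2M mQ v2 (L2_tensor oOm bOm t2 g2)).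
  by apply: eq_Rintegral => z _; rewrite /cut /th /=; ring.
have De : D (cut chi (fun z => phi z.1 * g z.2) \o tshift s) =
    - \int[leb]_(t in J) (V t * derive1 th (t - s)).
  have [_ /(_ _ _ (tsh _ sa) Hg)] := vD.
  have -> : (fun z : R * E => th (z.1 - s) * g z.2) = cut chi (fun z => phi z.1 * g z.2) \o tshift s.
    by apply/funext => z; rewrite /cut /th /= mulrA.
  move=> ->; congr (- _).
  have t1 := test_L2J (test_derive1 (tsh _ sa)).
  have [_] := ipL_tensor oOm bOm v2 t1 g2.
  rewrite /ipL => h1; etransitivity; first (etransitivity; last exact: h1).
    by apply: eq_Rintegral => z _; rewrite -mulrA (mulrC (g _)).
  by apply: eq_Rintegral => t _; rewrite !derive1E derive_shift.
rewrite De; have d1 := param_derive s IV tth.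
have := is_deriveB d1 (is_derive_cst (\int[leb]_(t in J) (V t * th t)) s (1 : R)).
rewrite subr0; apply: near_eq_is_derive.
have : \forall r \near s, `|r| < a.
  exact: near_norm_lt.
by apply: filterS => r ra; rewrite e.
Qed.

Let nice_lin b w u : nice w -> nice u -> nice (fun z => b * w z + u z).
Proof.
move=> [Xw hw] [Xu hu]; split; first by case: sX => -[_ h] _ _ _; exact: h.
move=> chi a tchi chi0 a0 s sa.
have [M M0 hM] := test_bounded tchi.
have [Xws _] := cutX tchi chi0 a0 sa hM Xw; have [Xus _] := cutX tchi chi0 a0 sa hM Xu.
have := is_deriveD (is_deriveZ b (hw _ _ tchi chi0 a0 _ sa)) (hu _ _ tchi chi0 a0 _ sa).
have -> : b *: D (cut chi w \o tshift s) + D (cut chi u \o tshift s) =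
    D (cut chi (fun z => b * w z + u z) \o tshift s).
  have <- := dual_lin b hD Xws Xus.
  by congr D; apply/funext => z; rewrite !fctE /cut /GRing.scale /=; ring.
apply: near_eq_is_derive.
have : \forall r \near s, `|r| < a.
  exact: near_norm_lt.
apply: filterS => r ra; rewrite !fctE /=.
by rewrite (quo_lin b tchi chi0 a0 ra (spX_L2 Xw) (spX_L2 Xu)).
Qed.

Let nice_dense w : spX T Om w -> forall e, 0 < e ->
  exists u, nice u /\ spX T Om (w - u) /\ normX T Om (w - u) < e.
Proof.
move=> Xw e e0.
have n0 : nice 0.
  have t0 : test_fun (`]0, T[%classic : set R) (bump 0 0 T) by exact: test_bump.
  have := nice_tensor t0 (ex_intro _ _ (H10_grad0 oOm bOm)).
  by congr nice; apply/funext => z; rewrite mulr0.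
have e20 := exprn_gt0 2 e0.
have [| |u Xu hu|u nu hu] := @ip_dense R _ _ _ sX (ipX_complete oOm bOm) nice w _ _ Xw _ (e ^+ 2) e20.
- by split => // b u v0 nu nv; exact: nice_lin.
- by move=> u [].
- by apply: (X_tensor_total oOm bOm Xu) => phi g tphi Hg; apply: hu; exact: nice_tensor.
have Xwu : spX T Om (w - u) by case: sX => sV _ _ _; apply: subspaceB => //; case: nu.
exists u; split => //; split => //; rewrite normXE//.
by rewrite -(ger0_norm (ltW e0)) -sqrtr_sqr ltr_sqrt ?exprn_gt0.
Qed.

Let Dle : exists2 C, 0 <= C & forall w, spX T Om w -> `|D w| <= C * normX T Om w.
Proof.
exists (dualnorm (spX T Om) (normX T Om) D).
  exact: (dual_norm_ge0 sX (normXE oOm) hD).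
by move=> w Xw; exact: (dual_le sX (normXE oOm) hD Xw).
Qed.

Let quo0 chi w : quo chi w 0 = 0.
Proof.
rewrite /quo; transitivity (\int[P]_(z in Q) 0); last by rewrite Rintegral_cst// mul0r.
by apply: eq_Rintegral => -[t x] _; rewrite /tshift /= subr0 subrr mulr0.
Qed.

(** Where the derivative in [h] is known, the mean value inequality and the bound on [D] give the
    factor [|h|]; density carries the estimate to all of X at each fixed [h]. *)
Lemma quo_le chi a : test_fun `]0, T[%classic chi ->
  (forall t, ~~ (a <= t <= T - a) -> chi t = 0) -> 0 < a ->
  exists2 C, 0 <= C & forall w h, spX T Om w -> `|h| < a ->
    `|quo chi w h| <= C * normX T Om w * `|h| /\ `|D (cut chi w)| <= C * normX T Om w.
Proof.
move=> tchi chi0 a0; have [C C0 hC] := Dle; have [M M0 hM] := test_bounded tchi.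
have CM : 0 <= C * M by rewrite mulr_ge0.
exists (C * M) => // w h Xw ha.
have DM w' s : spX T Om w' -> `|s| < a -> `|D (cut chi w' \o tshift s)| <= C * M * normX T Om w'.
  move=> Xw' sa; have [Xs hs] := cutX tchi chi0 a0 sa hM Xw'.
  by apply: le_trans (hC _ Xs) _; rewrite -mulrA ler_wpM2l.
split; last first.
  have := DM _ 0 Xw; rewrite normr0 => /(_ a0); congr (`|D _| <= _).
  by apply/funext => -[t x]; rewrite /= /tshift /= subr0.
have nle u : nice u -> `|quo chi u h| <= C * M * normX T Om u * `|h|.
  move=> [Xu nu]; have := @derive_lip R (quo chi u) (fun s => D (cut chi u \o tshift s))
    (C * M * normX T Om u) 0 `|h| h 0.
  rewrite !subr0 quo0 subr0 normr0; apply => //.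
  - by move=> s; rewrite subr0 => sh; exact: (nu _ _ tchi chi0 a0 _ (le_lt_trans sh ha)).
  - by move=> s; rewrite subr0 => sh; apply: DM => //; exact: (le_lt_trans sh ha).
have [Cp Cp0 hCp] := poincareX T oOm bOm.
have vv0 : 0 <= Num.sqrt (ipL P Q v v) by exact: sqrtr_ge0.
pose B := 2 * (Num.sqrt (ipL P Q v v) * (M * Num.sqrt Cp)).
have B0 : 0 <= B by rewrite !mulr_ge0.
(* A crude bound without the factor [|h|], applied only to the approximation error, whose norm can
   be made arbitrarily small for the given [h]. *)
have rough u : spX T Om u -> `|quo chi u h| <= B * normX T Om u.
  move=> Xu; have u2 := spX_L2 Xu; have c2 := L2_test oOm tchi u2.
  have cs2 := cutL tchi chi0 a0 ha u2.
  have cut2 : L2 P Q (cut chi u) by exact: c2.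
  have d2 : L2 P Q ((cut chi u \o tshift h) - cut chi u) by exact: (L2B mQ cs2 cut2).
  apply: le_trans (ip_le sL v2 d2) _; rewrite /B -!mulrA mulrCA ler_wpM2l//.
  have cE : Num.sqrt (ipL P Q (cut chi u) (cut chi u)) <= M * (Num.sqrt Cp * normX T Om u).
    rewrite normXE// -sqrtrM// -[X in X * _](ger0_norm M0) -sqrtr_sqr -sqrtrM ?sqr_ge0//.
    rewrite ler_sqrt; last by rewrite !mulr_ge0 ?sqr_ge0// (ip_ge0 sX).
    apply: le_trans (L2_test_le oOm tchi hM u2) _.
    by rewrite ler_wpM2l ?sqr_ge0// hCp.
  have csE : ipL P Q (cut chi u \o tshift h) (cut chi u \o tshift h) = ipL P Q (cut chi u) (cut chi u).
    have := (L1_tshift oOm (f := fun z => cut chi u z * cut chi u z) a0 ha _ (L2M mQ cut2 cut2)).2.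
    by apply=> z hz; rewrite /cut chi0// mul0r mul0r.
  have N2 : L2 P Q (-1 *: cut chi u) by exact: (L2Z mQ).
  have := ip_sqrt_leD sL cs2 N2; rewrite scaleN1r => h1; apply: le_trans h1 _.
  rewrite -scaleN1r (ipZl sL (-1) cut2 N2) (ipZr sL (-1) cut2 cut2) mulN1r mulN1r opprK csE.
  by rewrite mulr2n mulrDl mul1r lerD.
have n0 : 0 <= normX T Om w by rewrite normXE// sqrtr_ge0.
apply: (@ler_eps _ _ _ (C * M * `|h| + B)); first by rewrite addr_ge0// mulr_ge0.
move=> e e0; have [u [nu [Xwu hu]]] := nice_dense Xw e0; have [Xu _] := nu.
have -> : quo chi w h = quo chi (fun z => 1 * (w - u) z + u z) h.
  by congr quo; apply/funext => z; rewrite !fctE mul1r subrK.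
rewrite (quo_lin 1 tchi chi0 a0 ha (spX_L2 Xwu) (spX_L2 Xu)) mul1r.
apply: le_trans (ler_normD _ _) _.
have h1 := rough _ Xwu; have h2 := nle _ nu.
have h3 : normX T Om u <= normX T Om w + e.
  have Xuw : spX T Om (u - w) by case: sX => sV _ _ _; exact: subspaceB.
  have := normX_leD oOm bOm Xuw Xw; rewrite subrK => /le_trans; apply.
  rewrite addrC lerD2l; apply: le_trans (ltW hu).
  by rewrite (normX_subC oOm bOm Xu Xw).
have h4 : C * M * normX T Om u * `|h| <= C * M * (normX T Om w + e) * `|h|.
  by rewrite ler_wpM2r// ler_wpM2l.
have h5 : B * normX T Om (w - u) <= B * e by rewrite ler_wpM2l// ltW.
apply: le_trans (lerD h1 h2) _; apply: le_trans (lerD h5 h4) _.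
by rewrite le_eqVlt; apply/orP; left; apply/eqP; ring.
Qed.

(** By [quo_le] the quotients are bounded by the norm of [w] uniformly in [h], so their convergence
    extends from the dense set. *)
Lemma quo_cvg chi w : test_fun `]0, T[%classic chi -> spX T Om w ->
  forall e, 0 < e -> exists2 del, 0 < del & forall h, h != 0 -> `|h| < del ->
    `|h^-1 * quo chi w h - D (cut chi w)| <= e.
Proof.
move=> tchi Xw e e0; have [a a0 chi0] := test_tsupp tchi.
have [C C0 hC] := quo_le tchi chi0 a0.
(* Two terms in [w - u] carry the factor [C], and the quotient of [u] contributes one more. *)
have e3 : 0 < e / (2 * C + 1) by rewrite divr_gt0// ltr_wpDl// mulr_ge0.
have [u [nu [Xwu hu]]] := nice_dense Xw e3; have [Xu hud] := nu.
have sh0 w' : cut chi w' \o tshift 0 = cut chi w'.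
  by apply/funext => -[t x]; rewrite /= /tshift /= subr0.
have z0 : `|0 : R| < a by rewrite normr0.
have [du dv] := hud _ _ tchi chi0 a0 0 z0; rewrite sh0 in dv.
have := du; rewrite /derivable => /cvgrPdist_lt/(_ _ e3).
rewrite -[lim _]/('D_1 (quo chi u) 0) dv /dnbhs /within /= => /nbhs_ballP[d /= d0 hd].
exists (Num.min a d); first by rewrite lt_min a0.
move=> h hn0; rewrite lt_min => /andP[ha hdd].
have hn : `|h| != 0 by rewrite normr_eq0.
have [q1 q2] := hC _ _ Xwu ha.
have [Xw2 Xu2] := (spX_L2 Xwu, spX_L2 Xu).
have e1 : quo chi w h = quo chi (w - u) h + quo chi u h.
  rewrite -[quo chi (w - u) h]mul1r -(quo_lin 1 tchi chi0 a0 ha Xw2 Xu2).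
  by congr quo; apply/funext => z; rewrite !fctE mul1r subrK.
have e2 : D (cut chi w) = D (cut chi (w - u)) + D (cut chi u).
  have c1 : spX T Om (cut chi (w - u)).
    have [M M0 hM] := test_bounded tchi.
    by have [] := cutX tchi chi0 a0 z0 hM Xwu; rewrite sh0.
  have c2 : spX T Om (cut chi u).
    have [M M0 hM] := test_bounded tchi.
    by have [] := cutX tchi chi0 a0 z0 hM Xu; rewrite sh0.
  rewrite -(dualD hD c1 c2); congr D.
  by apply/funext => z; rewrite /cut !fctE; ring.
have e4 : `|h^-1 * quo chi u h - D (cut chi u)| <= e / (2 * C + 1).
  have := hd h; rewrite /ball /= sub0r normrN => /(_ hdd hn0) /ltW.
  by rewrite quo0 subr0 addr0 distrC /GRing.scale /= mulr1.
have e5 : `|h^-1 * quo chi (w - u) h| <= C * (e / (2 * C + 1)).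
  rewrite normrM normfV ler_pdivrMl ?normr_gt0//; apply: le_trans q1 _.
  by rewrite mulrC ler_wpM2l// ler_wpM2l// ltW.
have e6 : `|D (cut chi (w - u))| <= C * (e / (2 * C + 1)).
  by apply: le_trans q2 _; rewrite ler_wpM2l// ltW.
rewrite e1 e2 (_ : _ - _ = h^-1 * quo chi (w - u) h - D (cut chi (w - u)) +
  (h^-1 * quo chi u h - D (cut chi u))); last by ring.
apply: le_trans (ler_normD _ _) _; apply: le_trans (lerD (ler_normB _ _) (lexx _)) _.
apply: le_trans (lerD (lerD e5 e6) e4) _.
have K0 : 0 < 2 * C + 1 by rewrite ltr_wpDl// mulr_ge0.
rewrite le_eqVlt; apply/orP; left; apply/eqP; field; exact: lt0r_neq0.
Qed.

(* Both one-sided quotients of the pairing of v with the shifts of phi v tend to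
   D (phi v); their sum only contains the increments of phi. *)
Lemma dt_mul_test phi : test_fun `]0, T[%classic phi ->
  2 * D (fun z => phi z.1 * v z) = - \int[P]_(z in Q) (derive1 phi z.1 * v z ^+ 2).
Proof.
move=> tphi; have tdphi := test_derive1 tphi.
have [a [a0 phi0 dphi0]] : exists a, [/\ 0 < a, forall t, ~~ (a <= t <= T - a) -> phi t = 0 &
    forall t, ~~ (a <= t <= T - a) -> derive1 phi t = 0].
  have [a1 a10 h1] := test_tsupp tphi; have [a2 a20 h2] := test_tsupp tdphi.
  exists (Num.min a1 a2); rewrite lt_min a10; split=> // t ht.
    by apply: h1; apply: contra ht => /andP[h3 h4]; rewrite ge_min h3 /=; 
       apply: le_trans h4 _; rewrite lerB// ge_min lexx.
  by apply: h2; apply: contra ht => /andP[h3 h4]; rewrite ge_min h3 orbT /=;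
       apply: le_trans h4 _; rewrite lerB// ge_min lexx orbT.
have b0 : 0 < a / 2 by rewrite divr_gt0.
(* [chi] is 1 on [a / 2, T - a / 2], so the truncated function [f] agrees with [v] at all times
   within [a / 2] of the support of [phi]. *)
have [chi tchi chi1] := test_plateau b0.
have [b' b'0 chi0] := test_tsupp tchi.
set f := cut chi v; have f2 : L2 P Q f by exact: L2_test.
have [K K0 hK] := test_lip tphi; have [K2 K20 hK2] := test_taylor tphi.
have v_in t x : phi t != 0 -> f (t, x) = v (t, x).
  move=> pt0; have : a <= t <= T - a by apply: contraNT pt0 => /phi0 ->.
  by move=> /andP[h1 h2]; rewrite /f /cut /= chi1 ?mul1r//; apply/andP; split; lra.
have v_near t h x : `|h| < a / 2 -> phi t != 0 -> f (t + h, x) = v (t + h, x).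
  move=> ha pt0; have : a <= t <= T - a by apply: contraNT pt0 => /phi0 ->.
  move: ha; rewrite ltr_norml => /andP[h3 h4] /andP[h1 h2].
  by rewrite /f /cut /= chi1 ?mul1r//; apply/andP; split; lra.
have dv_in t x : derive1 phi t != 0 -> f (t, x) = v (t, x).
  move=> pt0; have : a <= t <= T - a by apply: contraNT pt0 => /dphi0 ->.
  by move=> /andP[h1 h2]; rewrite /f /cut /= chi1 ?mul1r//; apply/andP; split; lra.
set N := ipL P Q f f; have N0 : 0 <= N by exact: (ip_ge0 sL).
set X := \int[P]_(z in Q) _; have XE : X = \int[P]_(z in Q) (derive1 phi z.1 * f z ^+ 2).
  apply: eq_Rintegral => -[t x] _ /=.
  by have [->|h] := eqVneq (derive1 phi t) 0; rewrite ?mul0r// dv_in.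
apply/eqP; rewrite -subr_eq0 opprK -normr_le0.
apply: (@ler_eps _ _ _ (2 + K * Num.sqrt N + K2 * N)).
  by rewrite !addr_ge0// mulr_ge0// sqrtr_ge0.
move=> e e0; rewrite add0r.
have [d1 d10 hd1] := quo_cvg tphi Xv e0.
have [d2 d20 hd2] := shift_cvg oOm bOm tchi v2 (exprn_gt0 2 e0).
pose m := Num.min (a / 2) (Num.min b' (Num.min d1 (Num.min d2 e))).
have m0 : 0 < m by rewrite !lt_min b0 b'0 d10 d20.
have hm : m / 2 < m by rewrite ltr_pdivrMr// ltr_pMr// ltr1n.
set h := m / 2 in hm; have h0 : 0 < h by rewrite divr_gt0.
have hh : `|h| = h by rewrite gtr0_norm.
move: hm; rewrite !lt_min => /and5P[ha hb hhd1 hhd2 he].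
have haa : h < a by lra.
have q1 := hd1 h (lt0r_neq0 h0); rewrite hh in q1; have {}q1 := q1 hhd1.
have hN0 : - h != 0 by rewrite oppr_eq0 lt0r_neq0.
have q2 := hd1 (- h) hN0; rewrite normrN hh in q2; have {}q2 := q2 hhd1.
have fs2 : L2 P Q (f \o tshift h).
  by apply: (cutL tchi chi0 b'0 _ v2); rewrite hh.
have c2 : L2 P Q (cut phi v) by exact: L2_test.
have pf2 : L2 P Q (fun z => phi z.1 * f z) by exact: L2_test.
have cp2 : L2 P Q (cut phi v \o tshift h) by apply: (cutL tphi phi0 a0 _ v2); rewrite hh.
have cm2 : L2 P Q (cut phi v \o tshift (- h)) by apply: (cutL tphi phi0 a0 _ v2); rewrite normrN hh.
(* The change of variable from t + h to t in the backward pairing produces the same product f(t) f(t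
   - h) as the forward one, and only the increment of [phi] is left. *)
have eqd : quo phi v h - quo phi v (- h) =
    \int[P]_(z in Q) (f z * f (tshift h z) * (phi (z.1 - h) - phi z.1)).
  pose k (z : pt) := f (tshift h z) * (phi z.1 * f z).
  have Ik : L1 P Q k by exact: (L2M mQ fs2 pf2).
  have ks : tsupp T a k by move=> z hz; rewrite /k phi0// mul0r mulr0.
  have hNa : `|- h| < a by rewrite normrN hh.
  have [Ik' ek] := L1_tshift oOm a0 hNa ks Ik.
  have I1 : L1 P Q (fun z => v z * (cut phi v (tshift h z))) by exact: (L2M mQ v2 cp2).
  have I2 : L1 P Q (fun z => v z * (cut phi v (tshift (- h) z))) by exact: (L2M mQ v2 cm2).
  have I0 : L1 P Q (fun z => v z * (cut phi v z)) by exact: (L2M mQ v2 c2).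
  have qE r : L1 P Q (fun z => v z * (cut phi v (tshift r z))) ->
      quo phi v r = \int[P]_(z in Q) (v z * (cut phi v (tshift r z))) - \int[P]_(z in Q) (v z * cut phi v z).
    by move=> Ir; rewrite -RintegralB//; apply: eq_Rintegral => z _; ring.
  rewrite (qE _ I1) (qE _ I2) opprB addrA subrK.
  have -> : \int[P]_(z in Q) (v z * (cut phi v (tshift (- h) z))) = \int[P]_(z in Q) k z.
    rewrite -ek; apply: eq_Rintegral => -[t x] _; rewrite /k /cut /tshift /= opprK addrK.
    have [->|pt0] := eqVneq (phi (t + h)) 0; first by rewrite !mul0r !mulr0.
    rewrite (v_in _ _ pt0); have := v_near (t + h) (- h) x; rewrite normrN hh addrK => ->//; ring.
  have -> : \int[P]_(z in Q) (v z * (cut phi v (tshift h z))) =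
      \int[P]_(z in Q) (f z * f (tshift h z) * phi (z.1 - h)).
    apply: eq_Rintegral => -[t x] _; rewrite /cut /tshift /=.
    have [->|pt0] := eqVneq (phi (t - h)) 0; first by rewrite !mul0r !mulr0.
    rewrite (v_in _ _ pt0); have := v_near (t - h) h x; rewrite hh subrK => ->//; ring.
  rewrite -RintegralB//; last first.
    move: I1; congr (L1 _ _ _); apply/funext => -[t x]; rewrite /cut /tshift /=.
    have [->|pt0] := eqVneq (phi (t - h)) 0; first by rewrite !mul0r !mulr0.
    rewrite (v_in _ _ pt0); have := v_near (t - h) h x; rewrite hh subrK => ->//; ring.
  by apply: eq_Rintegral => z _; rewrite /k; ring.
have mphi (r : R) : `|r| < a -> measurable_fun Q (fun z : pt => (fun t : R => phi (t - r)) z.1).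
  move=> ra; have m1 := test_measurable (test_shift a0 ra (test_smooth tphi) phi0).
  exact: (measurable_time (Om := Om) m1).
have mpd : measurable_fun Q (fun z => phi (z.1 - h) - phi z.1).
  apply: measurable_funB; first by apply: mphi; rewrite hh.
  by have := mphi 0; rewrite normr0 => /(_ a0); under eq_fun do rewrite subr0.
have mdp : measurable_fun Q (fun z : pt => (derive1 phi : R -> R) z.1).
  exact: (measurable_time (Om := Om) (test_measurable tdphi)).
have fd2 : L2 P Q ((f \o tshift h) - f) by exact: (L2B mQ fs2 f2).
have hph : forall z : pt, Q z -> `|phi (z.1 - h) - phi z.1| <= K * h.
  by move=> z _; apply: le_trans (hK _ _) _; rewrite addrAC subrr add0r normrN hh.
have hph2 : forall z : pt, Q z -> `|phi (z.1 - h) - phi z.1 + h * derive1 phi z.1| <= K2 * h ^+ 2.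
  by move=> z _; exact: hK2.
have g2 := L2_bounded mQ mpd hph f2.
have mpd2 : measurable_fun Q (fun z => phi (z.1 - h) - phi z.1 + h * derive1 phi z.1).
  by apply: measurable_funD => //; apply: measurable_funM.
have g3 := L2_bounded mQ mpd2 hph2 f2.
(* Replacing f(t - h) by f(t) costs a translation increment times [K * h], and replacing the
   increment of [phi] by its linear part costs [K2 * h ^+ 2]; both are o(h). *)
have sum0 : quo phi v h - quo phi v (- h) + h * X =
    ipL P Q (fun z => (phi (z.1 - h) - phi z.1) * f z) ((f \o tshift h) - f) +
    ipL P Q (fun z => (phi (z.1 - h) - phi z.1 + h * derive1 phi z.1) * f z) f.
  have IX : L1 P Q (fun z => derive1 phi z.1 * f z ^+ 2).
    have [M M0 hM] := test_bounded tdphi.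
    have := L2M mQ (L2_bounded mQ mdp (fun z _ => hM z.1) f2) f2.
    by congr (L1 _ _ _); apply/funext => z; ring.
  have IA := L2M mQ g2 fs2.
  rewrite XE -(RintegralZl _ _ IX)// eqd -RintegralD//; last 2 first.
  - by move: IA; congr (L1 _ _ _); apply/funext => z /=; ring.
  - exact: (L1Z mQ h IX).
  rewrite /ipL -RintegralD//; last 2 first.
  - exact: (L2M mQ g2 fd2).
  - exact: (L2M mQ g3 f2).
  by apply: eq_Rintegral => z _; rewrite !fctE /=; ring.
have sN (g : pt -> R) C : L2 P Q g -> 0 <= C -> (forall z, Q z -> `|g z| <= C * `|f z|) ->
    Num.sqrt (ipL P Q g g) <= C * Num.sqrt N.
  move=> gg C0 gC; rewrite -[X in X * _](ger0_norm C0) -sqrtr_sqr -sqrtrM ?sqr_ge0//.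
  rewrite ler_sqrt ?mulr_ge0 ?sqr_ge0// /N /ipL -RintegralZl//; last exact: (L2M mQ f2 f2).
  apply: le_Rintegral => //; first exact: (L2M mQ gg gg).
    exact: (L1Z mQ _ (L2M mQ f2 f2)).
  move=> z Qz; rewrite -!expr2 -exprMn -[leLHS]ger0_norm ?sqr_ge0// -[leRHS]ger0_norm ?sqr_ge0//.
  by rewrite !normrX lerXn2r ?nnegrE// normrM (ger0_norm C0) gC.
have b1 : `|ipL P Q (fun z => (phi (z.1 - h) - phi z.1) * f z) ((f \o tshift h) - f)| <=
    K * h * Num.sqrt N * e.
  apply: le_trans (ip_le sL g2 fd2) _; apply: ler_pM; rewrite ?sqrtr_ge0//.
    apply: sN => //; first by rewrite mulr_ge0// ltW.
    by move=> z Qz; rewrite normrM ler_wpM2r// hph.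
  rewrite -(ger0_norm (ltW e0)) -sqrtr_sqr ler_sqrt ?sqr_ge0//.
  by have := hd2 h; rewrite hh => /(_ hhd2) /ltW.
have b2 : `|ipL P Q (fun z => (phi (z.1 - h) - phi z.1 + h * derive1 phi z.1) * f z) f| <=
    K2 * h ^+ 2 * N.
  apply: le_trans (ip_le sL g3 f2) _; rewrite -/N -[leRHS](_ : K2 * h ^+ 2 * Num.sqrt N * Num.sqrt N = _).
    apply: ler_wpM2r; rewrite ?sqrtr_ge0//; apply: sN => //; first by rewrite mulr_ge0// sqr_ge0.
    by move=> z Qz; rewrite normrM ler_wpM2r// hph2.
  by rewrite -mulrA -expr2 sqr_sqrtr.
have b3 : `|h^-1 * (quo phi v h - quo phi v (- h) + h * X)| <= (K * Num.sqrt N + K2 * N) * e.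
  rewrite normrM gtr0_norm ?invr_gt0// ler_pdivrMl// sum0.
  apply: le_trans (ler_normD _ _) _; apply: le_trans (lerD b1 b2) _.
  have h3 : K2 * N * h <= K2 * N * e by rewrite ler_wpM2l ?mulr_ge0// ltW.
  have h4 : h * (K2 * N * h) <= h * (K2 * N * e) by rewrite ler_wpM2l// ltW.
  move: h4; move: (Num.sqrt N) => r; rewrite expr2; lra.
have -> : 2 * D (fun z => phi z.1 * v z) + X =
   h^-1 * (quo phi v h - quo phi v (- h) + h * X)
   - (h^-1 * quo phi v h - D (cut phi v)) - ((- h)^-1 * quo phi v (- h) - D (cut phi v)).
  by rewrite /cut invrN; field; exact: lt0r_neq0.
apply: le_trans (ler_normB _ _) _; apply: le_trans (lerD (ler_normB _ _) (lexx _)) _.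
apply: le_trans (lerD (lerD b3 q1) q2) _.
by rewrite le_eqVlt; apply/orP; left; apply/eqP; ring.
Qed.

End derivative.
End product_rule.

(** * Weak derivatives in one variable *)

Section primitive.
Context {R : realType}.
Variable T : R.
Hypothesis T_gt0 : 0 < T.
Local Notation leb := (@lebesgue_measure R).
Local Notation J := (`]0, T[%classic : set (measurableTypeR R)).
Implicit Types (k f th dth phi : R -> R).

Let mJ : measurable J. Proof. exact: measurable_itv. Qed.

Definition prim k (t : R) := \int[leb]_(s in `]0, t[) k s.

Let Isub k (r t : R) : L1 leb J k -> 0 <= r -> t <= T -> leb.-integrable `]r, t[ (EFin \o k).
Proof.
move=> Ik r0 tT; apply: (integrableS mJ _ _ Ik) => //.
move=> s; rewrite /= !in_itv /= => /andP[h1 h2].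
by rewrite (le_lt_trans r0 h1) (lt_le_trans h2 tT).
Qed.

Lemma prim0 k : prim k 0 = 0.
Proof. by rewrite /prim set_itvoo0 Rintegral_set0. Qed.

Lemma primT k : prim k T = \int[leb]_(s in J) k s. Proof. by []. Qed.

Lemma primB k r t : L1 leb J k -> 0 <= r -> r <= t -> t <= T ->
  prim k t - prim k r = \int[leb]_(s in `]r, t[) k s.
Proof.
move=> Ik r0; rewrite le_eqVlt => /predU1P[<- _|rt tT].
  by rewrite subrr set_itvoo0 Rintegral_set0.
rewrite -(@Rintegral_itvB R k (BRight 0) (BLeft t) r).
- congr (_ - _); rewrite /prim; apply: Rintegral_itv_bndo_bndc.
  by apply: Isub => //; exact: le_trans (ltW rt) tT.
- exact: Isub.
- by rewrite bnd_simp.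
- by rewrite bnd_simp.
Qed.

Lemma prim_lin a k f t : L1 leb J k -> L1 leb J f -> t <= T ->
  prim (fun s => a * k s + f s) t = a * prim k t + prim f t.
Proof.
move=> Ik If tT; have I1 := Isub Ik (lexx 0) tT; have I2 := Isub If (lexx 0) tT.
have I3 := @L1Z _ _ R leb `]0, t[%classic (measurable_itv _) a k I1.
have mt : measurable (`]0, t[%classic : set (measurableTypeR R)) by exact: measurable_itv.
by rewrite /prim RintegralD// RintegralZl.
Qed.

(** Absolute continuity of the integral, uniform in the position of the window. *)
Lemma window_small k : L1 leb J k -> forall e, 0 < e -> exists2 del, 0 < del &
  forall r t, 0 <= r -> t <= T -> t - r < del -> \int[leb]_(s in `]r, t[) `|k s| < e.
Proof.
move=> Ik e e0; have /(L1_patch _ _ mJ) IkT := Ik.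
have [d [d0 hd]] := integral_normr_continuous IkT e0; exists d => // r t r0 tT rt.
have [tr|rt'] := leP t r.
  by rewrite set_itv_ge ?Rintegral_set0// bnd_simp -leNgt.
have le : (leb `]r, t[%classic < d%:E)%E.
  by rewrite lebesgue_measure_itv /= lte_fin rt' -EFinB lte_fin.
have := hd _ (measurable_itv _) le; congr (_ < _); apply: eq_Rintegral => s; rewrite inE /= in_itv /= => /andP[h1 h2].
by rewrite /patch mem_set//= in_itv /= (le_lt_trans r0 h1) (lt_le_trans h2 tT).
Qed.

Lemma prim_cvg k : L1 leb J k -> forall e, 0 < e -> exists2 del, 0 < del &
  forall r t, 0 <= r <= T -> 0 <= t <= T -> `|t - r| < del -> `|prim k t - prim k r| < e.
Proof.
move=> Ik e e0; have [d d0 hd] := window_small Ik e0; exists d => // r t.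
wlog rt : r t / r <= t => [h hr ht|].
  by have [rt|/ltW tr] := leP r t; [exact: h|rewrite distrC (distrC (prim k t)); exact: h].
move=> /andP[r0 rT] /andP[t0 tT] trd; rewrite primB//.
apply: le_lt_trans (le_normr_Rintegral _ _) _ => //; first exact: Isub.
by apply: hd => //; apply: le_lt_trans trd; exact: ler_norm.
Qed.

Lemma L1_cont f : continuous f -> L1 leb J f.
Proof.
move=> cf; apply: (@integrableS _ _ _ leb `[0, T]) => //.
  by apply: subset_itvScc; rewrite bnd_simp.
by apply: continuous_compact_integrable; [exact: segment_compact|exact: continuous_subspaceT].
Qed.

Lemma bounded_cont f : continuous f -> exists2 M, 0 <= M & forall t, J t -> `|f t| <= M.
Proof.
move=> cf; have : compact (f @` `[0, T]%classic).
  by apply: continuous_compact; [exact: continuous_subspaceT|exact: segment_compact].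
move=> /compact_bounded/bounded_norm[M hM]; exists `|M| => // t Jt.
apply: le_trans (ler_norm M); apply: hM; exists t => //.
by move: Jt; rewrite /= !in_itv /= => /andP[/ltW -> /ltW ->].
Qed.

Lemma FTC_itv th dth r t : (forall x : R, is_derive x (1 : R) th (dth x)) -> continuous dth ->
  r <= t -> \int[leb]_(s in `]r, t[) dth s = th t - th r.
Proof.
move=> hd cd; rewrite le_eqVlt => /predU1P[->|rt].
  by rewrite set_itvoo0 Rintegral_set0 subrr.
have cth : continuous th.
  by move=> x; apply: differentiable_continuous; apply/derivable1_diffP; case: (hd x).
have h : (\int[leb]_(x in `[r, t]) (dth x)%:E = (th t)%:E - (th r)%:E)%E.
  apply: continuous_FTC2 => //.
  - exact: continuous_subspaceT.
  - split; first by move=> x _; case: (hd x).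
    + exact: cvg_at_right_filter (cth r).
    + exact: cvg_at_left_filter (cth t).
  - by move=> x _; rewrite derive1E; case: (hd x).
have Ic : leb.-integrable `[r, t] (EFin \o dth).
  by apply: continuous_compact_integrable; [exact: segment_compact|exact: continuous_subspaceT].
rewrite Rintegral_itv_bndo_bndc; last first.
  by apply: integrableS Ic => //; apply: subset_itvScc; rewrite bnd_simp.
rewrite Rintegral_itv_obnd_cbnd; last first.
  by apply: integrableS Ic => //; apply: subset_itvScc; rewrite bnd_simp.
by rewrite /Rintegral h.
Qed.

(** Fubini for k(s) th'(t) on the triangle s < t: integrating in t first gives k(s) (th(T) - th(s)),
    integrating in s first gives the primitive of k times th'. *)
Lemma prim_parts k th dth : L1 leb J k ->
  (forall x : R, is_derive x (1 : R) th (dth x)) -> continuous dth ->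
  \int[leb]_(t in J) (prim k t * dth t) = th T * prim k T - \int[leb]_(s in J) (k s * th s).
Proof.
move=> Ik hd cd.
have cth : continuous th.
  by move=> x; apply: differentiable_continuous; apply/derivable1_diffP; case: (hd x).
have [M M0 hM] := bounded_cont cd; have [N N0 hN] := bounded_cont cth.
have /(L1_patch _ _ mJ) IkT := Ik.
have mkT := L1_measurable IkT.
have mth f : continuous f -> measurable_fun J f.
  by move=> cf; apply: measurable_funTS; exact: continuous_measurable_fun.
have mdT : measurable_fun setT (dth \_ J) by apply/(measurable_restrictT _ mJ); exact: mth.
pose F (z : measurableTypeR R * measurableTypeR R) : R :=
  if z.1 < z.2 then (k \_ J) z.1 * (dth \_ J) z.2 else 0.
have mF : measurable_fun setT F.
  apply: measurable_fun_ifT => //.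
    exact: measurable_fun_ltr.
  apply: measurable_funM; first exact: measurableT_comp mkT measurable_fst.
  exact: measurableT_comp mdT measurable_snd.
have Jlt : (leb J < +oo)%E by exact: lebesgue_itv_lty.
have IF : (leb \x leb)%E.-integrable setT (EFin \o F).
  apply/integrable12ltyP; first exact/measurable_EFinP.
  have [_ ikT] := integrableP _ _ _ IkT.
  have lJ : leb J \is a fin_num by rewrite ge0_fin_numE.
  apply: (@le_lt_trans _ _ (\int[leb]_s (`|(k \_ J) s|%:E * (M%:E * leb J)))%E); last first.
    rewrite ge0_integralZr//; last 2 first.
    - by apply/measurable_EFinP; exact: measurableT_comp.
    - by rewrite mule_ge0// lee_fin.
    have f1 : (\int[leb]_t `|(k \_ J) t|%:E)%E \is a fin_num.
      by rewrite ge0_fin_numE// integral_ge0.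
    by rewrite ltey_eq !fin_numM.
  apply: ge0_le_integral => //.
  - by move=> s _; exact: integral_ge0.
  - apply: (measurable_fun_fubini_tonelli_F (fun z => `|(EFin \o F) z|)%E) => //.
    by apply/measurable_EFinP; exact: measurableT_comp.
  - apply: emeasurable_funM; last exact: measurable_cst.
    by apply/measurable_EFinP; exact: measurableT_comp.
  - move=> s _; rewrite -(fineK lJ) -EFinM.
    rewrite [leRHS](_ : _ = \int[leb]_(t in J) (`|(k \_ J) s| * M)%:E)%E; last first.
      by rewrite integral_cst// -[X in (_ * X)%E](fineK lJ) -!EFinM mulrA.
    rewrite [leRHS]integral_mkcond; apply: ge0_le_integral => //.
    + apply/measurable_EFinP; apply: measurableT_comp => //.
      exact: measurableT_comp mF (measurable_pair1 s).
    + by apply: (measurable_restrictT _ _).1 => //; exact: measurable_cst.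
    + move=> t _; rewrite /F /= /patch.
      case: ifPn => [_|_]; last by case: ifP => _; rewrite ?normr0 ?lee_fin ?mulr_ge0.
      have [Jt|nJ] := pselect (J t); last first.
        by rewrite (memNset nJ) [_ * _]mulr0 normr0.
      rewrite (mem_set Jt).
      by rewrite lee_fin normrM ler_wpM2l// hM.
have FE := Fubini IF.
have E1 s : J s -> (\int[leb]_t (EFin \o F) (s, t) = (k s * (th T - th s))%:E)%E.
  move=> Js; have /andP[s0 sT] : 0 < s < T by move: Js; rewrite /= in_itv.
  have Is : leb.-integrable `]s, T[ (EFin \o dth).
    by apply: Isub (L1_cont cd) _ _ => //; exact: ltW.
  have mst : measurable (`]s, T[%classic : set (measurableTypeR R)) by exact: measurable_itv.
  rewrite -(FTC_itv hd cd (ltW sT)) -RintegralZl//.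
  rewrite /Rintegral fineK; last first.
    by apply: integrable_fin_num => //; exact: (L1Z mst (k s) Is).
  rewrite [RHS]integral_mkcond; apply: eq_integral => t _.
  rewrite /F /= /patch (mem_set Js); have [st|ts] := ltP s t.
    have -> : (t \in `]s, T[%classic) = (t \in J).
      by apply/idP/idP; rewrite !inE /= !in_itv /= => /andP[h1 h2]; rewrite h2 ?st// (lt_trans s0 st).
    by case: ifP => //; rewrite mulr0.
  by rewrite memNset//= in_itv /= ltNge ts.
have E1' s : ~ J s -> (\int[leb]_t (EFin \o F) (s, t) = 0)%E.
  move=> nJ; apply: integral0_eq => t _; rewrite /F /= /patch memNset// mul0r.
  by case: ifP.
have E2 t : J t -> (\int[leb]_s (EFin \o F) (s, t) = (prim k t * dth t)%:E)%E.
  move=> Jt; have /andP[t0 tT] : 0 < t < T by move: Jt; rewrite /= in_itv.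
  have It := Isub Ik (lexx 0) (ltW tT).
  have mst : measurable (`]0, t[%classic : set (measurableTypeR R)) by exact: measurable_itv.
  rewrite /prim -RintegralZr//.
  rewrite /Rintegral fineK; last first.
    apply: integrable_fin_num => //; have := L1Z mst (dth t) It.
    by congr integrable; apply/funext => s /=; rewrite mulrC.
  rewrite [RHS]integral_mkcond; apply: eq_integral => s _.
  rewrite /F /= /patch (mem_set Jt); have [st|ts] := ltP s t.
    have -> : (s \in `]0%R, t[%classic) = (s \in J).
      by apply/idP/idP; rewrite !inE /= !in_itv /= => /andP[h1 h2]; rewrite h1 ?st// (lt_trans h2 tT).
    by case: ifP => //; rewrite mul0r.
  by rewrite memNset//= in_itv /= [s < t]ltNge ts andbF.
have E2' t : ~ J t -> (\int[leb]_s (EFin \o F) (s, t) = 0)%E.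
  move=> nJ; apply: integral0_eq => s _; rewrite /F /= /patch [t \in _]memNset// mulr0.
  by case: ifP.
have L : (\int[leb]_s \int[leb]_t (EFin \o F) (s, t) =
    \int[leb]_(s in J) (k s * (th T - th s))%:E)%E.
  rewrite [RHS]integral_mkcond; apply: eq_integral => s _; rewrite /patch.
  by case: ifPn => [/set_mem/E1//|/negP nJ]; apply: E1' => Js; apply: nJ; exact/mem_set.
have L2 : (\int[leb]_t \int[leb]_s (EFin \o F) (s, t) =
    \int[leb]_(t in J) (prim k t * dth t)%:E)%E.
  rewrite [RHS]integral_mkcond; apply: eq_integral => s _; rewrite /patch.
  by case: ifPn => [/set_mem/E2//|/negP nJ]; apply: E2' => Js; apply: nJ; exact/mem_set.
have Ikth : L1 leb J (fun s => k s * th s).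
  apply: (@L1_le _ _ _ leb J mJ _ (fun s => N * `|k s|)).
  - by apply: measurable_funM; [exact: L1_measurable Ik|exact: mth].
  - exact: (L1Z mJ N (L1_abs Ik)).
  - by move=> s Js; rewrite normrM mulrC ler_wpM2r// hN.
rewrite /Rintegral -L2 -FE L primT -/(Rintegral _ _ _).
rewrite -[fine _]/(\int[leb]_(s in J) (k s * (th T - th s))).
rewrite -RintegralZl// -RintegralB//; last exact: (L1Z mJ _ Ik).
by apply: eq_Rintegral => s _; ring.
Qed.

Lemma smooth_primitive phi eta : (forall x : R, is_derive x (1 : R) phi (eta x)) ->
  smooth eta -> smooth phi.
Proof.
move=> hd se; have df x : differentiable phi x by apply/derivable1_diffP; case: (hd x).
have De (v : R) : 'D_v phi = fun x => v * eta x.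
  apply/funext => x; rewrite deriveE// -[v in LHS]mulr1 -[v * 1]/(v *: (1 : R)) linearZ /=.
  by rewrite -deriveE//; have [_ ->] := hd x.
have sm (v : R) : smooth (fun x => v * eta x).
  by apply: smoothM se; apply: smooth_algP; exact: sa_cst.
(* The last direction of the list is the innermost derivative, so directions are removed from the
   end. *)
move=> vs; elim/last_ind: vs => [|vs v _] /=.
  by split=> [x|x v]; [exact: differentiable_continuous|exact: diff_derivable].
have -> : iter_derive (rcons vs v) phi = iter_derive vs ('D_v phi).
  by elim: vs => //= w vs ->.
by rewrite De; exact: sm.
Qed.

Lemma test_primitive eta : test_fun `]0, T[%classic eta -> \int[leb]_(t in J) eta t = 0 ->
  exists2 phi, test_fun `]0, T[%classic phi & forall t, derive1 phi t = eta t.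
Proof.
move=> teta eta0; have [a a0 h0] := test_tsupp teta.
have ceta := test_continuous teta.
have Ia (r t : R) : leb.-integrable `[r, t] (EFin \o eta).
  by apply: continuous_compact_integrable; [exact: segment_compact|exact: continuous_subspaceT].
(* The lower limit lies to the left of the support, so the fundamental theorem applies at every
   point from [a] on. *)
pose phi t := \int[leb]_(s in `[-1, t]) eta s.
have phi0 t : t < a -> phi t = 0.
  move=> ta; rewrite /phi -[RHS](_ : \int[leb]_(s in `[-1, t]) 0 = _); last first.
    by rewrite Rintegral_cst ?mul0r//; exact: measurable_itv.
  apply: eq_Rintegral => s; rewrite inE /= in_itv /= => /andP[_ st].
  by apply: h0; rewrite negb_and -ltNge (le_lt_trans st ta).
have dphi (x : R) : is_derive x (1 : R) phi (eta x).
  have [xa|ax] := ltP x a.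
    rewrite h0 ?negb_and -?ltNge ?xa//.
    have := is_derive_cst (0 : R) x (1 : R); apply: near_eq_is_derive.
    apply/nbhs_ballP; exists (a - x); first by rewrite /= subr_gt0.
    by move=> y; rewrite /ball /= ltr_norml => /andP[h1 _]; rewrite phi0//; lra.
  have x1 : x < x + 1 by rewrite ltrDl.
  have [] := @continuous_FTC1_closed R eta (-1) x (x + 1) x1 (Ia _ _) _ (ceta x).
    by apply: lt_le_trans ax; rewrite (lt_trans _ a0)// ltrN10.
  by move=> d1 d2; apply: DeriveDef; [exact: d1|rewrite -derive1E].
exists phi; last by move=> t; rewrite derive1E; have [_ ->] := dphi t.
apply: (@test_funP _ _ _ `[a, T - a]%classic).
- exact: smooth_primitive dphi (test_smooth teta).
- exact: segment_compact.
- move=> t; apply: contraNP; rewrite /= in_itv /= => /negP; rewrite negb_and -!ltNge.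
  move=> /orP[/phi0 ->//|tT]; apply/eqP.
  (* Beyond T - a the integral has collected the whole support, and the total is 0. *)
  rewrite -eta0 /phi Rintegral_mkcond [RHS]Rintegral_mkcond; apply: eq_Rintegral => s _.
  rewrite /patch; have [sin|sout] := boolP (a <= s <= T - a).
    have /andP[h1 h2] := sin; rewrite !mem_set//= in_itv /=.
      by rewrite (lt_le_trans a0 h1) (le_lt_trans h2)// ltrBlDr ltrDl.
    by rewrite (le_trans h2 (ltW tT)) andbT (le_trans _ h1)// (le_trans _ (ltW a0))// lerN10.
  by rewrite h0//; case: ifP; case: ifP.
- move=> t; rewrite /= !in_itv /= => /andP[h1 h2].
  by rewrite (lt_le_trans a0 h1) (le_lt_trans h2)// ltrBlDr ltrDl.
Qed.

Lemma L1_test f phi : test_fun `]0, T[%classic phi -> L1 leb J f -> L1 leb J (fun t => f t * phi t).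
Proof.
move=> tphi If; have [M M0 hM] := test_bounded tphi.
apply: (@L1_le _ _ _ leb J mJ _ (fun s => M * `|f s|)).
- by apply: measurable_funM; [exact: L1_measurable If|exact: (test_measurable tphi)].
- exact: (L1Z mJ M (L1_abs If)).
- by move=> s Js; rewrite normrM mulrC ler_wpM2r.
Qed.

Let L1c c : L1 leb J (fun=> c).
Proof.
apply: (L1_finite_L2 mJ (lebesgue_itv_lty 0 T)).
by apply: (L2_bnd mJ (C := `|c|) (lebesgue_itv_lty 0 T)).
Qed.

Lemma L1_testJ phi : test_fun `]0, T[%classic phi -> L1 leb J phi.
Proof. by move=> tphi; have := L1_test tphi (L1c 1); congr (L1 _ _ _); apply/funext => t; rewrite mul1r. Qed.

Lemma leb_J_neq0 : leb J <> 0%E.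
Proof.
rewrite lebesgue_measure_itv /= lte_fin T_gt0 -EFinB subr0 => -[/eqP].
by rewrite gt_eqF.
Qed.

Lemma ae_J_ex (A : R -> Prop) : {ae leb, forall t : measurableTypeR R, J t -> A t} ->
  exists t, J t /\ A t.
Proof.
move=> [N [mN N0 hN]]; apply: contrapT => h; apply: leb_J_neq0.
apply/eqP; rewrite eq_le measure_ge0 andbT -N0 le_measure ?inE//.
by move=> t Jt; apply: hN => /= h'; apply: h; exists t; split => //; exact: h'.
Qed.

(** Test functions with integral 0 are derivatives of test functions, so [f] annihilates them; any
    other test function becomes one of these after subtracting a multiple of a fixed [rho], which
    identifies the constant. *)
Lemma weak_const f : L1 leb J f ->
  (forall phi, test_fun `]0, T[%classic phi -> \int[leb]_(t in J) (f t * derive1 phi t) = 0) ->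
  exists c, {ae leb, forall t : measurableTypeR R, J t -> f t = c}.
Proof.
move=> If h.
(* Otherwise the constant 1 would vanish almost everywhere on an interval of positive length. *)
have [rho trho rho0] : exists2 rho, test_fun `]0, T[%classic rho & \int[leb]_(t in J) rho t <> 0.
  apply: contrapT => nr; have [t [_ /eqP]] : exists t, J t /\ (1 : R) = 0.
    apply: ae_J_ex; apply: ae_test_eq0; first exact: L1c.
    move=> phi tphi; apply: contrapT => np; apply: nr; exists phi => //.
    by move: np; under eq_Rintegral do rewrite mul1r.
  by rewrite oner_eq0.
set m := \int[leb]_(t in J) rho t in rho0; have /eqP m0 := rho0.
pose c := (\int[leb]_(t in J) (f t * rho t)) / m; exists c.
suff : {ae leb, forall t : measurableTypeR R, J t -> f t - c = 0}.
  by apply: filterS => t ht Jt; apply/eqP; rewrite -subr_eq0 ht.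
apply: ae_test_eq0; first exact: (L1B mJ If (L1c c)).
move=> psi tpsi; pose b := - ((\int[leb]_(t in J) psi t) / m).
have teta : test_fun `]0, T[%classic (fun t => b * rho t + psi t) by exact: test_lin.
have [|phi tphi dphi] := test_primitive teta.
  rewrite RintegralD//; last 2 first.
  - exact: (L1Z mJ b (L1_testJ trho)).
  - exact: L1_testJ.
  by rewrite RintegralZl//; [rewrite /b mulNr divfK// addNr|exact: L1_testJ].
have := h _ tphi; under eq_Rintegral do rewrite dphi.
have -> : \int[leb]_(t in J) (f t * (b * rho t + psi t)) =
    \int[leb]_(t in J) (b * (f t * rho t) + f t * psi t).
  by apply: eq_Rintegral => t _; ring.
have I1 := L1_test trho If; have I2 := L1_test tpsi If.
rewrite RintegralD//; last exact: (L1Z mJ b I1).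
rewrite RintegralZl// => h1.
rewrite (_ : \int[leb]_(t in J) _ = \int[leb]_(t in J) (f t * psi t - c * psi t)); last first.
  by apply: eq_Rintegral => t _; ring.
have I3 := L1_testJ tpsi.
rewrite RintegralB//; last exact: (L1Z mJ c I3).
rewrite RintegralZl//; etransitivity; last exact: h1.
by rewrite /b /c; ring.
Qed.

Lemma prim_L1 k : L1 leb J k -> L1 leb J (prim k).
Proof.
move=> Ik; apply: (@L1_le _ _ _ leb J mJ _ (fun=> \int[leb]_(s in J) `|k s|)).
- apply: subspace_continuous_measurable_fun => //.
  apply: continuous_in_subspaceT => t /set_mem Jt; apply/cvgrPdist_lt => e e0.
  have [d d0 hd] := prim_cvg Ik e0; apply/nbhs_ballP.
  move: Jt; rewrite /= in_itv /= => /andP[t0 tT].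
  have m0 : 0 < Num.min d (Num.min t (T - t)) by rewrite !lt_min d0 t0 subr_gt0.
  exists (Num.min d (Num.min t (T - t))) => // s.
  rewrite /ball /= !lt_min => /and3P[h1 h2 h3].
  have /andP[h4 h5] : - t < t - s < t by rewrite -ltr_norml.
  have /andP[h6 h7] : - (T - t) < t - s < T - t by rewrite -ltr_norml.
  by apply: hd => //; apply/andP; split; lra.
- exact: L1c.
- move=> t; rewrite /= in_itv /= => /andP[t0 tT].
  have It := Isub Ik (lexx 0) (ltW tT).
  apply: le_trans (le_normr_Rintegral _ _) _ => //.
  rewrite -(setIidr (_ : `]0, t[%classic `<=` J)); last first.
    by move=> s; rewrite /= !in_itv /= => /andP[-> h2]; rewrite (lt_trans h2 tT).
  rewrite Rintegral_mkcondr; apply: le_Rintegral => //.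
  + apply/(L1_patch _ _ mJ).
    have mt : measurable (`]0, t[%classic : set (measurableTypeR R)) by exact: measurable_itv.
    have := (L1_patch leb (fun s => `|k s|) mt).1 (L1_abs It).
    congr integrable; apply/funext => s; rewrite /patch /=; congr EFin.
    have [st|st] := pselect (`]0, t[%classic s); last by rewrite (memNset st); case: ifP.
    rewrite (mem_set st) mem_set//.
    by move: st; rewrite /= !in_itv /= => /andP[-> h2]; rewrite (lt_trans h2 tT).
  + exact: (L1_abs Ik).
  + by move=> s _; rewrite /patch; case: ifP => [_|_] /=; [exact: lexx|exact: normr_ge0].
Qed.

Lemma weak_derivative_prim f k : L1 leb J f -> L1 leb J k ->
  (forall phi, test_fun `]0, T[%classic phi ->
    \int[leb]_(t in J) (f t * derive1 phi t) = - \int[leb]_(t in J) (k t * phi t)) ->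
  exists c, {ae leb, forall t : measurableTypeR R, J t -> f t = c + prim k t}.
Proof.
move=> If Ik h; have Ip := prim_L1 Ik.
have [|phi tphi|c hc] := @weak_const (fun t => f t - prim k t).
- exact: (L1B mJ If Ip).
- have td := test_derive1 tphi.
  rewrite -[LHS](_ : \int[leb]_(t in J) (f t * derive1 phi t - prim k t * derive1 phi t) = _); last first.
    by apply: eq_Rintegral => t _; ring.
  rewrite RintegralB//; [|exact: L1_test|exact: L1_test].
  rewrite h// (prim_parts Ik (fun x => smooth_is_derive x (test_smooth tphi))); last first.
    exact: (test_continuous td).
  rewrite (test_eq0 tphi (x := T)); first by ring.
  by rewrite /= in_itv /= ltxx andbF.
by exists c; apply: filterS hc => t ht Jt; rewrite -(ht Jt) subrK.
Qed.

End primitive.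

(** * Existence of traces *)

Section time_window.
Context {R : realFieldType}.
Variables (T t0 d : R).
Hypotheses (T_gt0 : 0 < T) (t0T : 0 <= t0 <= T) (d_gt0 : 0 < d).
Local Notation a := (Num.max 0 (t0 - d)).
Local Notation b := (Num.min T (t0 + d)).

Lemma window_lt : a < b.
Proof.
move: t0T => /andP[h1 h2]; rewrite gt_max !lt_min T_gt0 /=.
have h3 : 0 < t0 + d by exact: ltr_wpDl.
have h4 : t0 - d < T by apply: lt_le_trans h2; rewrite ltrBlDr ltrDl.
have h5 : t0 - d < t0 + d by apply: (@lt_trans _ _ t0); rewrite ?ltrBlDr ltrDl.
by rewrite h3 h4 h5.
Qed.

Lemma window_ge0 : 0 <= a. Proof. by rewrite le_max lexx. Qed.

Lemma window_leT : b <= T. Proof. by rewrite ge_min lexx. Qed.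

Lemma window_size : b - a <= 2 * d.
Proof.
have h1 : t0 - d <= a by rewrite le_max lexx orbT.
have h2 : b <= t0 + d by rewrite ge_min lexx orbT.
by move: h1 h2; move: a b => x y; lra.
Qed.

Lemma window_near t : a < t -> t < b -> `|t - t0| < d.
Proof.
rewrite gt_max lt_min => /andP[_ h1] /andP[_ h2]; rewrite ltr_norml.
by apply/andP; split; lra.
Qed.

Lemma window_in t : 0 <= t <= T -> `|t - t0| < d -> a <= t <= b.
Proof.
move=> /andP[h1 h2]; rewrite ltr_norml => /andP[h3 h4]; rewrite ge_max le_min h1 h2 /=.
by apply/andP; split; lra.
Qed.

End time_window.

Section numeric_facts.
Context {R : realFieldType}.

Lemma sub_le_sub (x y z u : R) : 0 <= y - x -> 0 <= u - z -> z - y <= u - x.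
Proof. by move=> h1 h2; lra. Qed.

Lemma lin_diff (a x1 x2 x3 x4 x5 x6 : R) :
  a * x1 + x2 - ((a * x3 + x4) - (a * x5 + x6)) = a * (x1 - (x3 - x5)) + (x2 - (x4 - x6)).
Proof. ring. Qed.

Lemma cross_abs (x y z : R) : 0 <= x + 2 * y + z -> 0 <= x - 2 * y + z -> `|2 * y| <= x + z.
Proof. by move=> h1 h2; rewrite ler_norml; apply/andP; split; lra. Qed.

Lemma near_num (p q e a b c d i : R) : `|p| <= a -> `|2 * q| <= i -> i <= b + d -> d <= c ->
  a < e -> b < e -> c < e -> p - 2 * q < 3 * e.
Proof.
move=> h1 h2 h3 h4 h5 h6 h7; have := ler_norm p; have := ler_norm (- (2 * q)).
by rewrite normrN => h8 h9; lra.
Qed.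

Lemma tri_num (x y e : R) : 0 < e -> x < 3 * (e / 16) -> y < 3 * (e / 16) -> 2 * x + 2 * y < e.
Proof. by move=> h0 h1 h2; lra. Qed.

End numeric_facts.

Lemma RintegralD_cst {R : realType} (a b : R) (k : R -> R) (c : R) :
  L1 lebesgue_measure `]a, b[%classic k ->
  \int[lebesgue_measure]_(s in `]a, b[) (k s + c) =
  \int[lebesgue_measure]_(s in `]a, b[) k s + fine (lebesgue_measure `]a, b[%classic) * c.
Proof.
move=> Ik; have mab : measurable (`]a, b[%classic : set (measurableTypeR R)) by exact: measurable_itv.
have Ic : L1 lebesgue_measure `]a, b[%classic (fun=> c).
  apply: (L1_finite_L2 mab (lebesgue_itv_lty a b)).
  by apply: (L2_bnd mab (C := `|c|) (lebesgue_itv_lty a b)).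
by rewrite RintegralD// Rintegral_cst// mulrC.
Qed.

Lemma ae_itv_ex {R : realType} (T a b : R) (A : R -> Prop) : a < b -> 0 <= a -> b <= T ->
  {ae lebesgue_measure, forall t : measurableTypeR R, `]0, T[%classic t -> A t} -> exists t, [/\ a < t, t < b & A t].
Proof.
move=> ab a0 bT [M [mM M0 hM]]; apply: contrapT => hn.
have : lebesgue_measure (`]a, b[%classic : set (measurableTypeR R)) = 0%E.
  apply/eqP; rewrite eq_le measure_ge0 andbT -M0 le_measure ?inE//.
  move=> t; rewrite /= in_itv /= => /andP[at' tb]; apply: hM => /= h'; apply: hn.
  exists t; split => //; apply: h'; rewrite in_itv /=.
  by rewrite (le_lt_trans a0 at') (lt_le_trans tb bT).
rewrite lebesgue_measure_itv /= lte_fin ab -EFinB => -[/eqP].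
by rewrite subr_eq0 gt_eqF.
Qed.

Section trace_existence.
Context {R : realType} {n : nat}.
Variables (T : R) (Om : set 'rV[R]_n.+1).
Hypotheses (T_gt0 : 0 < T) (oOm : open Om) (bOm : bounded_set Om).
Local Notation mu := (@lebesgue_rV R n.+1).
Local Notation leb := (@lebesgue_measure R).
Local Notation E := 'rV[R]_n.+1.
Local Notation pt := (measurableTypeR R * 'rV[R]_n.+1)%type.
Local Notation J := (`]0, T[%classic : set (measurableTypeR R)).
Local Notation Q := (QT T Om : set pt).
Local Notation P := (@lebQ R n.+1).
Local Notation gx := (gradx T Om).
Local Notation gH := (gradH Om).
Implicit Types (t s r : R) (g : E -> R).

Let mOm : measurable Om. Proof. exact: open_rV_measurable. Qed.
Let Omoo : (mu Om < +oo)%E. Proof. exact: bounded_lty. Qed.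
Let mJ : measurable J. Proof. exact: measurable_itv. Qed.
Let mQ : measurable Q. Proof. exact: measurable_QT. Qed.
Let sL := @ipL_semi _ _ R mu Om mOm.
Let sV := @ipV_semi _ _ R n.+1 mu Om mOm.
Let sH := @ipH_semi R n Om oOm bOm.
Let sX := @ipX_semi R n T Om oOm bOm.

Definition fib {V : Type} (f : pt -> V) t : E -> V := fun x => f (t, x).

Section fixed.
Variables (v w : pt -> R) (D : (pt -> R) -> R).
Hypotheses (Xv : spX T Om v) (vD : is_dt T Om v D) (Xw : spX T Om w).
Hypothesis Dw : forall z, spX T Om z -> D z = ipX T Om w z.

Let nn t := ipL mu Om (fib v t) (fib v t).
Let al t := ipV mu Om (fib (gx w) t) (fib (gx v) t).
Let ge g t := ipV mu Om (fib (gx w) t) (gH g).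

Let I_nn : L1 leb J nn.
Proof. exact: (fiber_ipL oOm (spX_L2 Xv) (spX_L2 Xv)).1. Qed.
Let I_al : L1 leb J al.
Proof. exact: (fiber_ipV oOm (gradx_L2 Xw) (gradx_L2 Xv)).1. Qed.
Let o2 : L2 leb J (fun=> 1).
Proof. by apply: (L2_bnd mJ (C := 1) (lebesgue_itv_lty 0 T)) => // t _; rewrite normr1. Qed.
Let I_ge g : H10 Om g -> L1 leb J (ge g).
Proof.
move=> Hg; have [_ t2 _] := X_tensor oOm bOm o2 (gradHP Hg).
have := (fiber_ipV oOm (gradx_L2 Xw) t2).1; congr (L1 _ _ _); apply/funext => t.
by apply: eq_Rintegral => x _; rewrite scale1r.
Qed.
Let I_vg g : L2 mu Om g -> L1 leb J (fun t => ipL mu Om (fib v t) g).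
Proof. by move=> g2; exact: (ipL_tensor oOm bOm (spX_L2 Xv) o2 g2).1. Qed.

Lemma dt_time (th : R -> R) C : measurable_fun J th -> (forall t, J t -> `|th t| <= C) ->
  D (fun z => th z.1 * v z) = \int[leb]_(t in J) (al t * th t).
Proof.
move=> mth bth; have gv := gradxP Xv; have gt := X_time oOm bOm mth bth gv.
have [_ t2 _] := gt.
rewrite Dw; last by exists (fun z => th z.1 *: gx v z).
rewrite (ipXE oOm bOm (gradxP Xw) gt) (fiber_ipV oOm (gradx_L2 Xw) t2).2.
have [I1 _] := fiber_ipV oOm (gradx_L2 Xw) t2.
apply: ae_eq_Rintegral => //; first exact: L1_measurable I1.
  by apply: measurable_funM => //; exact: L1_measurable I_al.
have := ae_fiber_L2v oOm (gradx_L2 Xv); have := ae_fiber_L2v oOm (gradx_L2 Xw).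
by apply: filterS2 => t h1 h2 Jt; rewrite mulrC -(ipZr sV (th t) (h2 Jt) (h1 Jt)).
Qed.

(** The product rule [dt_mul_test] says that [2 * al] is the weak derivative of the squared norm of
    the fibres. *)
Lemma energy_ae : exists c, {ae leb, forall t : measurableTypeR R, J t ->
  nn t = c + prim (fun s => 2 * al s) t}.
Proof.
apply: (weak_derivative_prim T_gt0 I_nn (L1Z mJ 2 I_al)) => phi tphi.
have := dt_mul_test oOm bOm Xv vD tphi.
have [M _ hM] := test_bounded tphi.
rewrite (dt_time (test_measurable tphi) (fun t _ => hM t)).
have dphi := test_derive1 tphi; have v2 := spX_L2 Xv.
rewrite (_ : \int[P]_(z in Q) _ = ipL P Q (fun z => derive1 phi z.1 * v z) v); last first.
  by apply: eq_Rintegral => z _; ring.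
have [I1 ->] := fiber_ipL oOm (L2_test oOm dphi v2) v2.
rewrite (_ : \int[leb]_(t in J) ipL _ _ _ _ = \int[leb]_(t in J) (nn t * derive1 phi t)); last first.
  apply: ae_eq_Rintegral => //; first exact: L1_measurable I1.
    by apply: measurable_funM; [exact: L1_measurable I_nn|exact: (test_measurable dphi)].
  have := ae_fiber_L2 oOm v2; apply: filterS => t h Jt.
  by rewrite mulrC -(ipZl sL (derive1 phi t) (h Jt) (h Jt)).
move=> /(congr1 (fun x => - x)); rewrite opprK => <-; congr (- _).
rewrite -RintegralZl//; last exact: (L1_test tphi I_al).
by apply: eq_Rintegral => t _; ring.
Qed.

Lemma pairing_ae g : H10 Om g -> exists c, {ae leb, forall t : measurableTypeR R, J t ->
  ipL mu Om (fib v t) g = c + prim (ge g) t}.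
Proof.
move=> Hg; have [_ g2] : True /\ L2 mu Om g by split => //; have [dg []] := Hg.
apply: (weak_derivative_prim T_gt0 (I_vg g2) (I_ge Hg)) => phi tphi.
have [_ /(_ _ _ tphi Hg)] := vD; have dphi := test_derive1 tphi.
have p2 := test_L2J tphi.
rewrite Dw; last by eexists; exact: (X_tensor oOm bOm p2 (gradHP Hg)).
rewrite (ipX_tensor oOm bOm Xw p2 Hg) => ->; rewrite opprK.
have [_ <-] := ipL_tensor oOm bOm (spX_L2 Xv) (test_L2J dphi) g2.
by apply: eq_Rintegral => z _; ring.
Qed.

Let Isub k a b : L1 leb J k -> 0 <= a -> b <= T -> leb.-integrable `]a, b[ (EFin \o k).
Proof.
move=> Ik a0 bT; apply: (integrableS mJ _ _ Ik) => // s; rewrite /= !in_itv /= => /andP[h1 h2].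
by rewrite (le_lt_trans a0 h1) (lt_le_trans h2 bT).
Qed.

Let prim_window k a b r t : L1 leb J k -> 0 <= a -> b <= T -> a <= r <= b -> a <= t <= b ->
  `|prim k t - prim k r| <= \int[leb]_(s in `]a, b[) `|k s|.
Proof.
move=> Ik a0 bT; wlog rt : r t / r <= t => [h hr ht|].
  by have [rt|/ltW tr] := leP r t; [exact: h|rewrite distrC; exact: h].
move=> /andP[ar rb] /andP[at' tb]; have Ia := L1_abs Ik.
have r0 : 0 <= r by exact: le_trans ar.
have tT : t <= T by exact: le_trans bT.
rewrite (primB Ik r0 rt tT); apply: le_trans (le_normr_Rintegral _ _) _ => //.
  exact: (Isub Ik r0 tT).
rewrite -(primB Ia r0 rt tT) -(primB Ia a0 (le_trans ar rb) bT).
have h3 : 0 <= \int[leb]_(s in `]a, r[) `|k s| by apply: Rintegral_ge0 => s _.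
have h4 : 0 <= \int[leb]_(s in `]t, b[) `|k s| by apply: Rintegral_ge0 => s _.
rewrite -(primB Ia a0 ar (le_trans rt tT)) in h3.
rewrite -(primB Ia (le_trans r0 rt) tb bT) in h4.
move: h3 h4; set p := prim _; move: (p a) (p r) (p t) (p b) => x y z u h3 h4.
exact: sub_le_sub.
Qed.

Let ge_lin a g h : H10 Om g -> H10 Om h -> {ae leb, forall s : measurableTypeR R, J s ->
  ge (fun x => a * g x + h x) s = a * ge g s + ge h s}.
Proof.
move=> Hg Hh; have gg := gradHP Hg; have gh := gradHP Hh.
have gl := H10_lin oOm bOm a gg gh; have gl' := gradHP (ex_intro _ _ gl).
have [_ g2 _ _] := gg; have [_ h2 _ _] := gh; have [_ l2 _ _] := gl; have [_ l2' _ _] := gl'.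
have := ae_fiber_L2v oOm (gradx_L2 Xw); apply: filterS => s hs Js; have ws := hs Js.
rewrite /ge (ipV_ae mOm ws ws l2' l2); last 2 first.
- exact: aeW.
- by apply: (H10_grad_unique oOm bOm gl' gl); exact: aeW.
have ag2 : L2v mu Om (a *: gH g) by exact: (subspaceZ a (@L2v_subspace _ _ R n.+1 mu Om mOm)).
by rewrite -(ipZr sV a g2 ws) -(ipDr sV ag2 h2 ws).
Qed.

Let N f t := ipV mu Om (fib (gx f) t) (fib (gx f) t).
Let I_N f : spX T Om f -> L1 leb J (N f).
Proof. by move=> Xf; exact: (fiber_ipV oOm (gradx_L2 Xf) (gradx_L2 Xf)).1. Qed.
Let N_ge0 f t : 0 <= N f t. Proof. by apply: Rintegral_ge0 => x _; exact: dotv_ge0. Qed.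

Let prim_ae k k' t : L1 leb J k -> L1 leb J k' -> t <= T ->
  {ae leb, forall s : measurableTypeR R, J s -> k s = k' s} -> prim k t = prim k' t.
Proof.
move=> Ik Ik' tT h; have mt : measurable (`]0, t[%classic : set (measurableTypeR R)) by exact: measurable_itv.
apply: ae_eq_Rintegral => //.
- exact: (L1_measurable (Isub Ik (lexx 0) tT)).
- exact: (L1_measurable (Isub Ik' (lexx 0) tT)).
- apply: filterS h => s hs; rewrite /= in_itv /= => /andP[s0 st]; apply: hs.
  by rewrite /= in_itv /= s0 (lt_le_trans st tT).
Qed.

Section good_times.
Variables (h : nat -> E -> R) (Hh : forall k, H10 Om (h k)).
Hypothesis htot : forall g, H10 Om g -> (forall k, ipH Om g (h k) = 0) -> ipH Om g g = 0.
Variables (c0 : R) (ck : nat -> R).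

Let good t := [/\ J t, H10_grad Om (fib v t) (fib (gx v) t),
  nn t = c0 + prim (fun s => 2 * al s) t &
  forall k, ipL mu Om (fib v t) (h k) = ck k + prim (ge (h k)) t].

Let good_L2 t : good t -> L2 mu Om (fib v t).
Proof. by move=> [_ []]. Qed.

(* The error in the integrated equation is a bounded functional of the element
   of H^1_0; it vanishes on a total family. *)
Let pairing_good t r g : good t -> good r -> H10 Om g ->
  ipL mu Om (fib v t - fib v r) g = prim (ge g) t - prim (ge g) r.
Proof.
move=> gt gr; have t2 := good_L2 gt; have r2 := good_L2 gr.
have [Jt _ _ ht] := gt; have [Jr _ _ hr] := gr.
have /andP[t0 tT] : 0 < t < T by move: Jt; rewrite /= in_itv.
have /andP[r0 rT] : 0 < r < T by move: Jr; rewrite /= in_itv.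
pose l g := ipL mu Om (fib v t - fib v r) g - (prim (ge g) t - prim (ge g) r).
have d2 : L2 mu Om (fib v t - fib v r) by exact: (L2B mOm).
have gL g' : H10 Om g' -> L2 mu Om g' by move=> [dg []].
have llin a g1 g2 : H10 Om g1 -> H10 Om g2 -> l (a *: g1 + g2) = a * l g1 + l g2.
  move=> H1 H2; have [[_ sub] _ _ _] := sH; have Hl := sub a _ _ H1 H2.
  have I1 := I_ge H1; have I2 := I_ge H2; have Il := I_ge Hl.
  have I3 := L1_lin mJ a I1 I2.
  have p s : s <= T -> prim (ge (a *: g1 + g2)) s = a * prim (ge g1) s + prim (ge g2) s.
    move=> sT; rewrite -(prim_lin a I1 I2 sT); apply: prim_ae => //; exact: (ge_lin a H1 H2).
  have e1 := ipDr sL (L2Z mOm a (gL _ H1)) (gL _ H2) d2.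
  have e2 := ipZr sL a (gL _ H1) d2.
  have e3 : ipL mu Om (fib v t - fib v r) (a *: g1 + g2) =
      a * ipL mu Om (fib v t - fib v r) g1 + ipL mu Om (fib v t - fib v r) g2.
    exact: etrans e1 (congr1 (+%R^~ _) e2).
  have e4 := congr1 (fun z => - z) (f_equal2 (fun x y => x - y) (p _ (ltW tT)) (p _ (ltW rT))).
  by apply: etrans (f_equal2 +%R e3 e4) _; exact: lin_diff.
have [C C0 hC] := poincare oOm bOm.
have IN1 : L1 leb J (fun s => 1 + N w s).
  by apply: (L1D mJ); [exact: (L1_finite_L2 mJ (lebesgue_itv_lty 0 T) o2)|exact: I_N].
(* By Cauchy-Schwarz [ge g' s] is bounded by the root of [N w s] times the norm of [g'], and this
   root is at most the integrable [1 + N w s]. *)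
pose B := Num.sqrt (ipL mu Om (fib v t - fib v r) (fib v t - fib v r)) * Num.sqrt C +
  \int[leb]_(s in J) (1 + N w s).
have lbnd g' : H10 Om g' -> `|l g'| <= B * Num.sqrt (ipH Om g' g').
  move=> Hg; have gg := gradHP Hg; have [_ dg2 _ _] := gg.
  apply: le_trans (ler_normB _ _) _; rewrite mulrDl lerD//.
    apply: le_trans (ip_le sL d2 (gL _ Hg)) _; rewrite -mulrA ler_wpM2l//.
    by rewrite -sqrtrM// ler_sqrt ?mulr_ge0 ?(ip_ge0 sH)// hC.
  have := prim_window (I_ge Hg) (lexx 0) (lexx T) (r := r) (t := t).
  rewrite !(ltW r0, ltW rT, ltW t0, ltW tT) => /(_ isT isT) /le_trans; apply.
  have IR := L1Z mJ (Num.sqrt (ipH Om g' g')) IN1.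
  rewrite mulrC -RintegralZl//; apply: ae_le_Rintegral => //; first exact: (L1_abs (I_ge Hg)).
  have := ae_fiber_L2v oOm (gradx_L2 Xw); apply: filterS => s hs Js.
  apply: le_trans (ip_le sV (hs Js) dg2) _; rewrite mulrC ler_wpM2l//.
  rewrite -[ipV _ _ _ _]/(N w s); have := N_ge0 w s; move: (N w s) => x x0.
  rewrite -(@ler_pXn2r _ 2) ?nnegrE ?addr_ge0// sqr_sqrtr//; nra.
have [hs Hs lE] := ip_riesz sH (ipH_complete oOm bOm) llin lbnd.
have l0 k : l (h k) = 0.
  rewrite /l (ipBl sL t2 r2 (gL _ (Hh k))) ht hr; ring.
have hs0 : ipH Om hs hs = 0 by apply: htot => // k; rewrite -lE// l0.
move=> Hg; apply/eqP; rewrite -subr_eq0 -/(l g); rewrite lE//.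
have := ip_sqr_le sH Hs Hg; rewrite hs0 mul0r => h1.
by rewrite -sqrf_eq0 eq_le h1 sqr_ge0.
Qed.

Hypothesis good_ae : {ae leb, forall t : measurableTypeR R, J t -> good t}.

(** A function cannot exceed its mean at almost every point. The lemma supplies a reference time at
    which the gradient is under control. *)
Let exists_le_mean k (a b : R) : L1 leb J k -> a < b -> 0 <= a -> b <= T ->
  exists r, [/\ a < r, r < b, good r & (b - a) * k r <= \int[leb]_(s in `]a, b[) k s].
Proof.
move=> Ik ab a0 bT; apply: contrapT => hn.
have mab : measurable (`]a, b[%classic : set (measurableTypeR R)) by exact: measurable_itv.
pose m := (\int[leb]_(s in `]a, b[) k s) / (b - a).
have ba : 0 < b - a by rewrite subr_gt0.
have I1 := Isub Ik a0 bT; have Im : L1 leb `]a, b[%classic (fun=> m).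
  apply: (L1_finite_L2 mab (lebesgue_itv_lty a b)).
  by apply: (L2_bnd mab (C := `|m|) (lebesgue_itv_lty a b)).
have I2 : L1 leb `]a, b[%classic (fun s => k s - m) by exact: (L1B mab I1 Im).
have lab : fine (leb `]a, b[%classic) = b - a by rewrite lebesgue_measure_itv /= lte_fin ab.
have e0 : \int[leb]_(s in `]a, b[) (k s - m) = 0.
  by rewrite RintegralB// Rintegral_cst// lab divfK ?subrr// lt0r_neq0.
have pos : {ae leb, forall s : measurableTypeR R, `]a, b[%classic s -> 0 < k s - m}.
  apply: filterS good_ae => s gs sab.
  have := sab; rewrite /= in_itv /= => /andP[as' sb].
  have Js : J s by rewrite /= in_itv /= (le_lt_trans a0 as') (lt_le_trans sb bT).
  rewrite subr_gt0 ltNge; apply/negP => ks; apply: hn; exists s; split => //; first exact: gs.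
  by rewrite mulrC -ler_pdivlMr.
have e1 : \int[leb]_(s in `]a, b[) `|k s - m| = 0.
  rewrite -e0; apply: ae_eq_Rintegral => //.
  - exact: (L1_measurable (L1_abs I2)).
  - exact: (L1_measurable I2).
  - by apply: filterS pos => s hs sab; rewrite gtr0_norm// hs.
have e2 := Rintegral_eq0_ae mab (L1_abs I2) (fun s _ => normr_ge0 _) e1.
have [t [at' tb]] : exists t, [/\ a < t, t < b & `]a, b[%classic t -> False].
  apply: ae_itv_ex => //; apply: filterS2 e2 pos => s h1 h2 _ sab.
  by have := h2 sab; have := h1 sab => /eqP; rewrite normr_eq0 => /eqP ->; rewrite ltxx.
by apply; rewrite /= in_itv /= at'.
Qed.

(** For a reference time r, |v(t) - v(r)|^2 is |v(t)|^2 - |v(r)|^2 minus twice (v(t) - v(r), v(r)).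
    The first difference is small by the energy identity. The pairing is the integrated equation
    tested with v(r), whose gradient may be large; hence r is chosen with squared gradient norm at
    most its mean over the window. *)
Let cauchy_good t0 : 0 <= t0 <= T -> forall e, 0 < e -> exists2 del, 0 < del &
  forall t s, good t -> good s -> `|t - t0| < del -> `|s - t0| < del ->
    ipL mu Om (fib v t - fib v s) (fib v t - fib v s) < e.
Proof.
move=> /andP[t00 t0T] e e0; have e8 : 0 < e / 16 by rewrite divr_gt0.
have I2al := L1Z mJ 2 I_al.
have [d1 d10 h1] := window_small I2al e8.
have [d2 d20 h2] := window_small (I_N Xw) e8.
have [d3 d30 h3] := window_small (I_N Xv) e8.
pose d := Num.min d1 (Num.min d2 d3) / 2.
have m0 : 0 < Num.min d1 (Num.min d2 d3) by rewrite !lt_min d10 d20.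
have d0 : 0 < d by rewrite divr_gt0.
have t0T' : 0 <= t0 <= T by rewrite t00.
have d4 : 0 < d / 2 by rewrite divr_gt0.
exists (d / 2) => //.
pose a' := Num.max 0 (t0 - d / 2); pose b' := Num.min T (t0 + d / 2).
have a'0 : 0 <= a' by exact: window_ge0.
have b'T : b' <= T by exact: window_leT.
have a'b' : a' < b' by exact: window_lt.
have [r [a'r rb' gr hr]] := exists_le_mean (I_N Xv) a'b' a'0 b'T.
have len : b' - a' < Num.min d1 (Num.min d2 d3).
  apply: le_lt_trans (window_size _ _ _) _.
  by rewrite [2 * _]mulrC divfK// /d ltr_pdivrMr// ltr_pMr// ltr1n.
have w1 : \int[leb]_(s in `]a', b'[) `|2 * al s| < e / 16.
  by apply: h1 => //; apply: lt_le_trans len _; rewrite ge_min lexx.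
have w2 : \int[leb]_(s in `]a', b'[) `|N w s| < e / 16.
  by apply: h2 => //; apply: lt_le_trans len _; rewrite !ge_min lexx orbT.
have w3 : \int[leb]_(s in `]a', b'[) `|N v s| < e / 16.
  by apply: h3 => //; apply: lt_le_trans len _; rewrite !ge_min lexx !orbT.
have nabs f : \int[leb]_(s in `]a', b'[) `|N f s| = \int[leb]_(s in `]a', b'[) N f s.
  by apply: eq_Rintegral => s _; rewrite ger0_norm.
rewrite nabs in w2; rewrite nabs in w3.
have r2 := good_L2 gr; have [_ gHr nr _] := gr.
have mab : measurable (`]a', b'[%classic : set (measurableTypeR R)) by exact: measurable_itv.
have Hr : H10 Om (fib v r) by exists (fib (gx v) r).
have near t : good t -> `|t - t0| < d / 2 -> ipL mu Om (fib v t - fib v r) (fib v t - fib v r) < 3 * (e / 16).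
  move=> gt td.
  have t2 := good_L2 gt; have [Jt _ nt _] := gt.
  have /andP[t_0 t_T] : 0 < t < T by move: Jt; rewrite /= in_itv.
  have tin : a' <= t <= b'.
    by apply: window_in => //; rewrite (ltW t_0) (ltW t_T).
  have rin : a' <= r <= b' by rewrite (ltW a'r) (ltW rb').
  have p1 := prim_window I2al a'0 b'T rin tin.
  have I2g := L1Z mJ 2 (I_ge Hr).
  have p2 := prim_window I2g a'0 b'T rin tin.
  (* Young's inequality; over the window the constant [N v r] contributes at most the integral of
     [N v], by the choice of [r]. *)
  have p3 : \int[leb]_(s in `]a', b'[) `|2 * ge (fib v r) s| <= \int[leb]_(s in `]a', b'[) (N w s + N v r).
    have Ic : L1 leb `]a', b'[%classic (fun=> N v r).
      apply: (L1_finite_L2 mab (lebesgue_itv_lty a' b')).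
      by apply: (L2_bnd mab (C := `|N v r|) (lebesgue_itv_lty a' b')).
    apply: ae_le_Rintegral => //.
    - exact: (L1_abs (Isub I2g a'0 b'T)).
    - exact: (L1D mab (Isub (I_N Xw) a'0 b'T) Ic).
    - have := ae_fiber_L2v oOm (gradx_L2 Xw); apply: filterS => s hs.
      rewrite /= in_itv /= => /andP[as' sb].
      have Js : J s by rewrite /= in_itv /= (le_lt_trans a'0 as') (lt_le_trans sb b'T).
      have ws := hs Js; have gHH := gradHP Hr; have [_ gg2 _ _] := gHH.
      have -> : N v r = ipV mu Om (gH (fib v r)) (gH (fib v r)).
        by rewrite /N -(ipHE oOm bOm gHr gHr).
      have q1 := ip_ge0 sV (subspaceD (@L2v_subspace _ _ R n.+1 mu Om mOm) ws gg2).
      have q2 := ip_ge0 sV (subspaceB (@L2v_subspace _ _ R n.+1 mu Om mOm) ws gg2).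
      rewrite (ip_sqrB sV ws gg2) in q2.
      have := ip_sqrD sV 1 ws gg2; rewrite scale1r expr1n !mul1r mulr1 => q3.
      rewrite q3 in q1; exact: cross_abs q1 q2.
  have lab : fine (leb `]a', b'[%classic) = b' - a' by rewrite lebesgue_measure_itv /= lte_fin a'b'.
  have e1 := etrans (RintegralD_cst (k := N w) (N v r) (Isub (I_N Xw) a'0 b'T))
    (congr1 (fun x => \int[leb]_(s in `]a', b'[) N w s + x * N v r) lab).
  have {}p3 := le_trans p3 (eq_ind _ (fun x => x <= _) (lexx _) _ (esym e1)).
  have pg := pairing_good gt gr Hr.
  have e2 : prim (fun s => 2 * ge (fib v r) s) t - prim (fun s => 2 * ge (fib v r) s) r =
      2 * ipL mu Om (fib v t - fib v r) (fib v r).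
    have pz s : s <= T -> prim (fun s => 2 * ge (fib v r) s) s = 2 * prim (ge (fib v r)) s.
      move=> sT; rewrite /prim RintegralZl//.
      exact: (Isub (I_ge Hr) (lexx 0) sT).
    rewrite pg (pz _ (ltW t_T)) pz ?mulrBr//; apply: le_trans (ltW rb') b'T.
  rewrite e2 in p2.
  have e3 : ipL mu Om (fib v t - fib v r) (fib v t - fib v r) =
      (prim (fun s => 2 * al s) t - prim (fun s => 2 * al s) r) - 2 * ipL mu Om (fib v t - fib v r) (fib v r).
    rewrite (ip_sqrB sL t2 r2) (ipBl sL t2 r2 r2) -[ipL _ _ (fib v t) (fib v t)]/(nn t).
    by rewrite -[ipL _ _ (fib v r) (fib v r)]/(nn r) nt nr; ring.
  rewrite e3; exact: near_num (le_trans p1 _) p2 p3 hr w1 w2 w3.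
move=> t s gt gs td sd; have n1 := near t gt td; have n2 := near s gs sd.
have t2 := good_L2 gt; have s2 := good_L2 gs.
have -> : fib v t - fib v s = (fib v t - fib v r) + (fib v r - fib v s) by rewrite subrKA.
apply: le_lt_trans (ip_leD2 sL (L2B mOm t2 r2) (L2B mOm r2 s2)) _.
by rewrite (ip_subC sL r2 s2); exact: tri_num.
Qed.

(** Good times accumulate at every point of [0, T], end points included, and the Cauchy property
    makes the limit independent of the approach. This is how traces at 0 and T arise. *)
Let limit_good t0 : 0 <= t0 <= T -> exists2 W0, L2 mu Om W0 &
  forall e, 0 < e -> exists2 del, 0 < del & forall t, good t -> `|t - t0| < del ->
    ipL mu Om (fib v t - W0) (fib v t - W0) < e.
Proof.
move=> t0T; have /andP[t00 t0T'] := t0T.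
have near_good d : 0 < d -> exists t, good t /\ `|t - t0| < d.
  move=> d0; have [t [at' tb gt]] := ae_itv_ex (window_lt T_gt0 t0T d0) (window_ge0 _ _) (window_leT _ _ _) good_ae.
  by exists t; split => //; exact: window_near at' tb.
have /choice[tk htk] : forall k : nat, exists t, good t /\ `|t - t0| < k.+1%:R^-1.
  by move=> k; apply: near_good; rewrite invr_gt0.
have far d : 0 < d -> exists M, forall k, (M <= k)%N -> `|tk k - t0| < d.
  move=> d0; have [M] := ltr_add_invr d0; rewrite add0r => Md; exists M => k Mk.
  have [_ h1] := htk k; apply: lt_trans h1 _; apply: le_lt_trans Md.
  by rewrite lef_pV2 ?posrE// ler_nat ltnS.
have u2 k : L2 mu Om (fib v (tk k)) by apply: good_L2; case: (htk k).
have [|W0 W2 hW] := @ipL_complete _ _ R mu Om mOm (fun k => fib v (tk k)) u2.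
  move=> e e0; have [d d0 hd] := cauchy_good t0T e0; have [M hM] := far _ d0.
  by exists M => i j Mi Mj; apply: hd; rewrite ?hM//; [case: (htk i)|case: (htk j)].
exists W0 => // e e0; have e4 : 0 < e / 4 by rewrite divr_gt0.
have [d d0 hd] := cauchy_good t0T e4; have [M hM] := far _ d0; have [K hK] := hW _ e4.
exists d => // t gt td; pose k := maxn M K.
have gk : good (tk k) by case: (htk k).
have -> : fib v t - W0 = (fib v t - fib v (tk k)) + (fib v (tk k) - W0) by rewrite subrKA.
apply: le_lt_trans (ip_leD2 sL (L2B mOm (good_L2 gt) (u2 k)) (L2B mOm (u2 k) W2)) _.
have := hd _ _ gt gk td (hM _ (leq_maxl _ _)); have := hK k (leq_maxr _ _); lra.
Qed.

Lemma crep_good : exists W, is_crep T Om v W.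
Proof.
have /choice[W hW] : forall t0, exists W0, L2 mu Om W0 /\ (0 <= t0 <= T ->
    forall e, 0 < e -> exists2 del, 0 < del & forall t, good t -> `|t - t0| < del ->
    ipL mu Om (fib v t - W0) (fib v t - W0) < e).
  move=> t0; have [tin|tout] := boolP (0 <= t0 <= T).
    by have [W0 h1 h2] := limit_good tin; exists W0.
  by exists (fun=> 0); split; [exact: L2_0|].
exists W; split.
- by move=> t _; case: (hW t).
- move=> t0 t0T e e0; have t0T' : 0 <= t0 <= T by move: t0T; rewrite /= in_itv.
  have [W02 h0] := hW t0; have e4 : 0 < e ^+ 2 / 4 by rewrite divr_gt0// exprn_gt0.
  have [d d0 hd] := h0 t0T' _ e4; exists d => // t tT td.
  have tT' : 0 <= t <= T by move: tT; rewrite /= in_itv.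
  have [Wt2 ht] := hW t; have [d' d'0 hd'] := ht tT' _ e4.
  (* A good time this close to [t] has its fibre near [W t] and is still within [d] of [t0]. *)
  pose m := Num.min d' (d - `|t - t0|).
  have m0 : 0 < m by rewrite lt_min d'0 subr_gt0.
  have [s [as' sb gs]] := ae_itv_ex (window_lt T_gt0 tT' m0) (window_ge0 _ _) (window_leT _ _ _) good_ae.
  have sm := window_near as' sb.
  have h1 : ipL mu Om (fib v s - W t) (fib v s - W t) < e ^+ 2 / 4.
    by apply: hd' => //; apply: lt_le_trans sm _; rewrite ge_min lexx.
  have h2 : `|s - t0| < d.
    have -> : s - t0 = (s - t) + (t - t0) by rewrite subrKA.
    apply: le_lt_trans (ler_normD _ _) _; rewrite -ltrBrDr.
    by apply: lt_le_trans sm _; rewrite ge_min lexx orbT.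
  have h3 := hd s gs h2; have s2 := good_L2 gs.
  rewrite (L2normE mOm); last exact: (L2B mOm).
  rewrite -(ger0_norm (ltW e0)) -sqrtr_sqr ltr_sqrt ?exprn_gt0//.
  rewrite -[X in ipL _ _ X _]/(W t - W t0) -[X in ipL _ _ _ X]/(W t - W t0).
  have -> : W t - W t0 = (W t - fib v s) + (fib v s - W t0) by rewrite subrKA.
  apply: le_lt_trans (ip_leD2 sL (L2B mOm Wt2 s2) (L2B mOm s2 W02)) _.
  by rewrite (ip_subC sL Wt2 s2); lra.
- apply: filterS good_ae => t gt Jt; have {}gt := gt Jt.
  have tT : 0 <= t <= T by move: Jt; rewrite /= in_itv /= => /andP[/ltW -> /ltW ->].
  have [Wt2 ht] := hW t; have t2 := good_L2 gt.
  have d2 : L2 mu Om (fib v t - W t) by exact: (L2B mOm).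
  have : ipL mu Om (fib v t - W t) (fib v t - W t) = 0.
    apply/eqP; rewrite eq_le (ip_ge0 sL d2) andbT; apply/ler_addgt0Pr => e e0; rewrite add0r.
    have [d d0 hd] := ht tT _ e0; apply: ltW; apply: hd => //.
    by rewrite subrr normr0.
  move=> /(ipL_eq0 mOm d2); apply: filterS => x h1 Ox; apply/eqP; rewrite eq_sym -subr_eq0.
  by have := h1 Ox => /eqP.
Qed.

End good_times.

Lemma crep_exists : exists W, is_crep T Om v W.
Proof.
have [h [Hh htot]] := H10_separable oOm bOm.
have [c0 hc0] := energy_ae.
have /choice[ck hck] : forall k, exists c, {ae leb, forall t : measurableTypeR R, J t ->
  ipL mu Om (fib v t) (h k) = c + prim (ge (h k)) t} by move=> k; exact: pairing_ae.
apply: (crep_good Hh htot (c0 := c0) (ck := ck)).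
have [_ _ vg] := gradxP Xv.
have := ae_forall_count hck => hall.
apply: filterS3 hc0 vg hall => t h1 h2 h3 Jt.
by split; [exact: Jt|exact: (h2 Jt)|exact: (h1 Jt)|move=> k; exact: (h3 k Jt)].
Qed.

End fixed.
End trace_existence.

(** * Integration by parts in time *)

Lemma sqr_near {R : realFieldType} (x y s e : R) : x < 1 -> x * (2 * s + 1) < e ->
  `|y| <= x * s -> 0 <= x -> 0 <= s -> `|x ^+ 2 + 2 * y| < e.
Proof.
move=> h1 h2 h3 x0 s0; apply: le_lt_trans (ler_normD _ _) _.
rewrite [`|x ^+ 2|]ger0_norm ?sqr_ge0// [`|2 * y|]normrM [`|2|]ger0_norm//; apply: le_lt_trans h2.
have : x ^+ 2 <= x by rewrite expr2 ler_piMr// ltW.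
by lra.
Qed.

(** * Continuity and uniqueness of representatives *)

Section crep_continuity.
Context {R : realType} {n : nat}.
Variables (T : R) (Om : set 'rV[R]_n.+1).
Hypotheses (T_gt0 : 0 < T) (oOm : open Om).
Local Notation mu := (@lebesgue_rV R n.+1).
Local Notation leb := (@lebesgue_measure R).
Local Notation E := 'rV[R]_n.+1.
Local Notation J := (`]0, T[%classic : set (measurableTypeR R)).
Implicit Types (f g : R -> R).

Let mOm : measurable Om. Proof. exact: open_rV_measurable. Qed.
Let sL := @ipL_semi _ _ R mu Om mOm.

Definition itv_continuous f := forall t0, 0 <= t0 <= T -> forall e, 0 < e ->
  exists2 d, 0 < d & forall t, 0 <= t <= T -> `|t - t0| < d -> `|f t - f t0| < e.

Lemma itv_continuous_prim k : L1 leb J k -> itv_continuous (prim k).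
Proof.
move=> Ik t0 t0T e e0; have [d d0 hd] := prim_cvg Ik e0.
by exists d => // t tT; apply: hd.
Qed.

Lemma itv_continuousB f g : itv_continuous f -> itv_continuous g -> itv_continuous (fun t => f t - g t).
Proof.
move=> cf cg t0 t0T e e0; have e2 : 0 < e / 2 by rewrite divr_gt0.
have [d d0 hd] := cf _ t0T _ e2; have [d' d'0 hd'] := cg _ t0T _ e2.
exists (Num.min d d') => [|t tT]; first by rewrite lt_min d0.
rewrite lt_min => /andP[h1 h2]; rewrite [e]splitr.
rewrite (_ : _ - _ = (f t - f t0) - (g t - g t0)); last by ring.
by apply: le_lt_trans (ler_normB _ _) _; apply: ltrD; [exact: hd|exact: hd'].
Qed.

Lemma itv_continuousDl c f : itv_continuous f -> itv_continuous (fun t => c + f t).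
Proof.
move=> cf t0 t0T e e0; have [d d0 hd] := cf _ t0T _ e0; exists d => // t tT td.
by rewrite opprD addrACA subrr add0r hd.
Qed.

Lemma itv_continuous_ae0 f : itv_continuous f ->
  {ae leb, forall t : measurableTypeR R, J t -> f t = 0} -> forall t, 0 <= t <= T -> f t = 0.
Proof.
move=> cf f0 t0 t0T; apply/eqP; rewrite -normr_eq0 eq_le normr_ge0 andbT.
apply/ler_addgt0Pr => e e0; rewrite add0r; have [d d0 hd] := cf _ t0T _ e0.
have [s [as' sb fs]] := ae_itv_ex (window_lt T_gt0 t0T d0) (window_ge0 _ _) (window_leT _ _ _) f0.
have sT : 0 <= s <= T.
  by rewrite (le_trans (window_ge0 t0 d) (ltW as')) (le_trans (ltW sb) (window_leT T t0 d)).
by have := hd s sT (window_near as' sb); rewrite fs sub0r normrN => /ltW.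
Qed.

Lemma itv_continuous_ae f g : itv_continuous f -> itv_continuous g ->
  {ae leb, forall t : measurableTypeR R, J t -> f t = g t} -> forall t, 0 <= t <= T -> f t = g t.
Proof.
move=> cf cg fg t tT; apply/eqP; rewrite -subr_eq0; apply/eqP.
apply: (itv_continuous_ae0 (itv_continuousB cf cg)) tT.
by apply: filterS fg => s h Js; rewrite h// subrr.
Qed.

Lemma crep_small v W : is_crep T Om v W -> forall t0, 0 <= t0 <= T -> forall e, 0 < e ->
  exists2 d, 0 < d & forall t, 0 <= t <= T -> `|t - t0| < d ->
    Num.sqrt (ipL mu Om (W t - W t0) (W t - W t0)) < e.
Proof.
move=> [W2 cW _] t0 t0T e e0; have t0T' : `[0, T]%classic t0 by rewrite /= in_itv.
have [d d0 hd] := cW _ t0T' _ e0; exists d => // t tT td.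
have tT' : `[0, T]%classic t by rewrite /= in_itv.
have := hd _ tT' td; rewrite (L2normE mOm)//.
by apply: (L2B mOm); apply: W2.
Qed.

Lemma crep_cont_ip v W (g : E -> R) : is_crep T Om v W -> L2 mu Om g ->
  itv_continuous (fun t => ipL mu Om (W t) g).
Proof.
move=> cr g2 t0 t0T e e0; have [W2 _ _] := cr; set s := Num.sqrt (ipL mu Om g g).
have s1 : 0 < s + 1 by rewrite ltr_wpDl// sqrtr_ge0.
have es : 0 < e / (s + 1) by rewrite divr_gt0.
have [d d0 hd] := crep_small cr t0T es; exists d => // t tT td.
have Wt : L2 mu Om (W t) by apply: W2; rewrite /= in_itv.
have W0 : L2 mu Om (W t0) by apply: W2; rewrite /= in_itv.
rewrite -(ipBl sL Wt W0 g2); apply: le_lt_trans (ip_le sL (L2B mOm Wt W0) g2) _.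
have := hd t tT td; rewrite ltr_pdivlMr// => h; apply: le_lt_trans h.
by rewrite ler_wpM2l ?sqrtr_ge0// lerDl.
Qed.

Lemma crep_cont_sqr v W : is_crep T Om v W -> itv_continuous (fun t => ipL mu Om (W t) (W t)).
Proof.
move=> cr t0 t0T e e0; have [W2 _ _] := cr; pose s := Num.sqrt (ipL mu Om (W t0) (W t0)).
have s0 : 0 <= s by rewrite sqrtr_ge0.
have s1 : 0 < 2 * s + 1 by rewrite ltr_wpDl// mulr_ge0.
have es : 0 < Num.min 1 (e / (2 * s + 1)) by rewrite lt_min ltr01 divr_gt0.
have [d d0 hd] := crep_small cr t0T es; exists d => // t tT td.
have Wt : L2 mu Om (W t) by apply: W2; rewrite /= in_itv.
have W0 : L2 mu Om (W t0) by apply: W2; rewrite /= in_itv.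
have D2 := L2B mOm Wt W0; have Z2 := L2Z mOm 1 D2.
have := ip_sqrD sL 1 D2 W0; rewrite scale1r subrK expr1n !mul1r mulr1 => ->.
rewrite addrK; have := hd t tT td; rewrite lt_min ltr_pdivlMr// => /andP[h1 h2].
have h3 := ip_le sL D2 W0; rewrite -/s in h3.
have h4 := ip_ge0 sL D2; rewrite -{1}(sqr_sqrtr h4).
exact: sqr_near h1 h2 h3 (sqrtr_ge0 _) s0.
Qed.

Lemma crep_lin a v w V W : is_crep T Om v V -> is_crep T Om w W ->
  is_crep T Om (fun z => a * v z + w z) (fun t x => a * V t x + W t x).
Proof.
move=> cV cW; have [V2 _ Vv] := cV; have [W2 _ Ww] := cW.
split.
- by move=> t tT; apply: (L2_lin mOm); [exact: V2|exact: W2].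
- move=> t0 t0T e e0; have t0T' : 0 <= t0 <= T by move: t0T; rewrite /= in_itv.
  have e2 : 0 < e / 2 by rewrite divr_gt0.
  have a1 : 0 < `|a| + 1 by rewrite ltr_wpDl.
  have ea : 0 < e / 2 / (`|a| + 1) by rewrite divr_gt0.
  have [d d0 hd] := crep_small cV t0T' ea; have [d' d'0 hd'] := crep_small cW t0T' e2.
  exists (Num.min d d') => [|t tT]; first by rewrite lt_min d0.
  have tT' : 0 <= t <= T by move: tT; rewrite /= in_itv.
  rewrite lt_min => /andP[h1 h2].
  have D1 : L2 mu Om (V t - V t0) by apply: (L2B mOm); apply: V2.
  have D2 : L2 mu Om (W t - W t0) by apply: (L2B mOm); apply: W2.
  have -> : (fun x => a * V t x + W t x - (a * V t0 x + W t0 x)) = a *: (V t - V t0) + (W t - W t0).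
    by apply/funext => x; rewrite !fctE /GRing.scale/=; ring.
  have D3 : L2 mu Om (a *: (V t - V t0)) by exact: (L2Z mOm).
  rewrite (L2normE mOm); last exact: (L2D mOm).
  apply: le_lt_trans (ip_sqrt_leD sL D3 D2) _; rewrite [e]splitr; apply: ltrD; last exact: hd'.
  rewrite (ipZl sL a D1 D3) (ipZr sL a D1 D1) mulrA -expr2 sqrtrM ?sqr_ge0// sqrtr_sqr.
  have := hd t tT' h1; rewrite ltr_pdivlMr// => h3; apply: le_lt_trans h3.
  by rewrite mulrC ler_wpM2l ?sqrtr_ge0// lerDl.
- apply: filterS2 Vv Ww => t h1 h2 Jt; apply: filterS2 (h1 Jt) (h2 Jt) => x h3 h4 Ox.
  by rewrite h3// h4.
Qed.

(** The squared norm of the difference is continuous on [0, T] and 0 at almost every time, hence 0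
    at every time including the end points. *)
Lemma crep_unique v V W : is_crep T Om v V -> is_crep T Om v W ->
  forall t, 0 <= t <= T -> {ae mu, forall x, Om x -> V t x = W t x}.
Proof.
move=> cV cW t tT; have cr := crep_lin (-1) cV cW; have [U2 _ Uv] := cr.
have tT' : `[0, T]%classic t by rewrite /= in_itv.
have := itv_continuous_ae0 (crep_cont_sqr cr) _ tT => /=.
move=> h; have {h} : {ae mu, forall x, Om x -> -1 * V t x + W t x = 0}.
  apply: (ipL_eq0 mOm (U2 t tT')); apply: h.
  apply: filterS Uv => s hs Js; apply: (L2_eq0_ipL mOm).
    by apply: U2; move: Js; rewrite /= !in_itv /= => /andP[/ltW -> /ltW ->].
  by apply: filterS (hs Js) => x hx Ox; rewrite hx//; ring.
by apply: filterS => x h Ox; apply/eqP; rewrite eq_sym -subr_eq0 -(h Ox); apply/eqP; ring.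
Qed.

End crep_continuity.

Section integration_by_parts.
Context {R : realType} {n : nat}.
Variables (T : R) (Om : set 'rV[R]_n.+1).
Hypotheses (T_gt0 : 0 < T) (oOm : open Om) (bOm : bounded_set Om).
Local Notation mu := (@lebesgue_rV R n.+1).
Local Notation leb := (@lebesgue_measure R).
Local Notation E := 'rV[R]_n.+1.
Local Notation pt := (measurableTypeR R * 'rV[R]_n.+1)%type.
Local Notation J := (`]0, T[%classic : set (measurableTypeR R)).
Local Notation Q := (QT T Om : set pt).
Local Notation P := (@lebQ R n.+1).
Implicit Types (v w : pt -> R) (th dth : R -> R) (D : (pt -> R) -> R).

Let mOm : measurable Om. Proof. exact: open_rV_measurable. Qed.
Let mJ : measurable J. Proof. exact: measurable_itv. Qed.
Let sL := @ipL_semi _ _ R mu Om mOm.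
Let sX := @ipX_semi R n T Om oOm bOm.

Lemma cont_measurable th : continuous th -> measurable_fun J th.
Proof. by move=> cth; apply: measurable_funTS; exact: continuous_measurable_fun. Qed.

Lemma is_derive_continuous th dth : (forall x : R, is_derive x (1 : R) th (dth x)) -> continuous th.
Proof.
by move=> h x; apply: differentiable_continuous; apply/derivable1_diffP; case: (h x).
Qed.

Lemma L2J_cont th : continuous th -> L2 leb J th.
Proof.
move=> cth; have [M M0 hM] := bounded_cont T cth.
by apply: (L2_bnd mJ (C := M) (lebesgue_itv_lty 0 T)) => //; exact: cont_measurable.
Qed.

Lemma X_time_cont v th : continuous th -> spX T Om v -> spX T Om (fun z => th z.1 * v z).
Proof.
move=> cth Xv; have [M _ hM] := bounded_cont T cth.
by exists (fun z => th z.1 *: gradx T Om v z);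
  exact: (X_time oOm bOm (cont_measurable cth) hM (gradxP Xv)).
Qed.

Lemma X_tensor_cont (g : E -> R) th : continuous th -> H10 Om g ->
  spX T Om (fun z => th z.1 * g z.2).
Proof.
move=> cth Hg; exists (fun z => th z.1 *: gradH Om g z.2).
exact: (X_tensor oOm bOm (L2J_cont cth) (gradHP Hg)).
Qed.

Variables (v : pt -> R) (D : (pt -> R) -> R) (W : R -> E -> R).
Hypotheses (Xv : spX T Om v) (vD : is_dt T Om v D) (vW : is_crep T Om v W).

Let hw : exists2 w, spX T Om w & forall z, spX T Om z -> D z = ipX T Om w z.
Proof. exact: (dual_riesz sX (@normXE _ _ T Om oOm) (ipX_complete oOm bOm) vD.1). Qed.

Let t_in0 : 0 <= (0 : R) <= T. Proof. by rewrite lexx (ltW T_gt0). Qed.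
Let t_inT : 0 <= T <= T. Proof. by rewrite lexx (ltW T_gt0). Qed.

(** The squared norm of [W] and the primitive of the energy identity are continuous and agree almost
    everywhere, so they agree at 0 and T; the rest is integration by parts for a primitive. *)
Lemma time_parts th dth : (forall x : R, is_derive x (1 : R) th (dth x)) -> continuous dth ->
  2 * D (fun z => th z.1 * v z) + \int[P]_(z in Q) (dth z.1 * (v z * v z)) =
  th T * ipL mu Om (W T) (W T) - th 0 * ipL mu Om (W 0) (W 0).
Proof.
move=> hth cdth; have cth := is_derive_continuous hth.
have [M _ hM] := bounded_cont T cth; have [w Xw Dw] := hw.
rewrite (dt_time oOm bOm Xv Xw Dw (cont_measurable cth) hM).
have [c hc] := energy_ae T_gt0 oOm bOm Xv vD Xw Dw.
have v2 := spX_L2 Xv; have [M' _ hM'] := bounded_cont T cdth.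
have I_al := (fiber_ipV oOm (gradx_L2 Xw) (gradx_L2 Xv)).1.
set al := fun t => ipV mu Om (fib (gradx T Om w) t) (fib (gradx T Om v) t).
have I2 := L1Z mJ 2 I_al; rewrite -/(fib _) in I2.
have [_ _ Wv] := vW.
have NW : forall t, 0 <= t <= T -> ipL mu Om (W t) (W t) = c + prim (fun s => 2 * al s) t.
  apply: (itv_continuous_ae T_gt0).
  - exact: (crep_cont_sqr oOm vW).
  - exact: itv_continuousDl (itv_continuous_prim I2).
  - have := ae_fiber_L2 oOm v2; have [W2 _ _] := vW.
    apply: filterS3 hc Wv => t h1 h2 h3 Jt; rewrite -(h1 Jt).
    have Wt : L2 mu Om (W t).
      by apply: W2; move: Jt; rewrite /= !in_itv /= => /andP[/ltW -> /ltW ->].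
    exact: (ipL_ae mOm Wt (h3 Jt) Wt (h3 Jt) (h2 Jt) (h2 Jt)).
rewrite (NW _ t_in0) (NW _ t_inT) prim0 addr0.
have -> : \int[P]_(z in Q) (dth z.1 * (v z * v z)) = \int[leb]_(t in J) ((c + prim (fun s => 2 * al s) t) * dth t).
  rewrite (_ : \int[P]_(z in Q) _ = ipL P Q (fun z => dth z.1 * v z) v); last first.
    by apply: eq_Rintegral => z _; ring.
  have v2' := L2_time oOm (cont_measurable cdth) hM' v2.
  have [I1 ->] := fiber_ipL oOm v2' v2.
  apply: ae_eq_Rintegral => //; first exact: L1_measurable I1.
    apply: measurable_funM; last exact: (cont_measurable cdth).
    by apply: measurable_funD; [exact: measurable_cst|exact: (L1_measurable (prim_L1 I2))].
  have := ae_fiber_L2 oOm v2; apply: filterS2 hc => t h1 h Jt.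
  by rewrite -(h1 Jt) mulrC; exact: (ipZl sL (dth t) (h Jt) (h Jt)).
have I3 := L1_cont T cdth.
have I4 : L1 leb J (fun t => prim (fun s => 2 * al s) t * dth t).
  have IP := prim_L1 I2; apply: (L1_le mJ (g := fun t => M' * `|prim (fun s => 2 * al s) t|)).
  - by apply: measurable_funM; [exact: L1_measurable IP|exact: cont_measurable].
  - by apply: L1Z => //; exact: L1_abs.
  - by move=> t Jt; rewrite normrM mulrC ler_wpM2r// hM'.
have -> : \int[leb]_(t in J) ((c + prim (fun s => 2 * al s) t) * dth t) =
    c * \int[leb]_(t in J) dth t + \int[leb]_(t in J) (prim (fun s => 2 * al s) t * dth t).
  rewrite -RintegralZl// -RintegralD//; last exact: (L1Z mJ c I3).
  by apply: eq_Rintegral => t _; rewrite mulrDl.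
rewrite (FTC_itv hth cdth (ltW T_gt0)) (prim_parts I2 hth cdth).
have -> : \int[leb]_(s in J) (2 * al s * th s) = 2 * \int[leb]_(t in J) (al t * th t).
  rewrite -RintegralZl//; first by apply: eq_Rintegral => t _; rewrite mulrA.
  apply: (L1_le mJ (g := fun t => M * `|al t|)).
  - by apply: measurable_funM; [exact: L1_measurable I_al|exact: cont_measurable].
  - by apply: L1Z => //; exact: L1_abs.
  - by move=> t Jt; rewrite normrM mulrC ler_wpM2r// hM.
by move: (\int[leb]_(t in J) _) (prim _ T) => x y; ring.
Qed.

Lemma tensor_parts (g : E -> R) th dth : H10 Om g ->
  (forall x : R, is_derive x (1 : R) th (dth x)) -> continuous dth ->
  D (fun z => th z.1 * g z.2) + \int[P]_(z in Q) (dth z.1 * (v z * g z.2)) =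
  th T * ipL mu Om (W T) g - th 0 * ipL mu Om (W 0) g.
Proof.
move=> Hg hth cdth; have cth := is_derive_continuous hth.
have [w Xw Dw] := hw.
rewrite (Dw _ (X_tensor_cont cth Hg)) (ipX_tensor oOm bOm Xw (L2J_cont cth) Hg).
have [c hc] := pairing_ae T_gt0 oOm bOm Xv vD Xw Dw Hg.
have [M' _ hM'] := bounded_cont T cdth; have [M _ hM] := bounded_cont T cth.
have v2 := spX_L2 Xv; have g2 : L2 mu Om g by have [dg []] := Hg.
have [_ dg2 _ _] := gradHP Hg.
pose ge t := ipV mu Om (fib (gradx T Om w) t) (gradH Om g).
have I_ge : L1 leb J ge.
  have [_ t2 _] := X_tensor oOm bOm (L2J_cont (th := fun=> 1) (@cst_continuous _ _ (1 : R))) (gradHP Hg).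
  have := (fiber_ipV oOm (gradx_L2 Xw) t2).1; congr (L1 _ _ _); apply/funext => t.
  by apply: eq_Rintegral => x _; rewrite scale1r.
have [_ _ Wv] := vW.
have NW : forall t, 0 <= t <= T -> ipL mu Om (W t) g = c + prim ge t.
  apply: (itv_continuous_ae T_gt0).
  - exact: (crep_cont_ip oOm vW g2).
  - exact: itv_continuousDl (itv_continuous_prim I_ge).
  - have := ae_fiber_L2 oOm v2; have [W2 _ _] := vW.
    apply: filterS3 hc Wv => t h1 h2 h3 Jt; rewrite -(h1 Jt).
    have Wt : L2 mu Om (W t).
      by apply: W2; move: Jt; rewrite /= !in_itv /= => /andP[/ltW -> /ltW ->].
    by apply: (ipL_ae mOm Wt (h3 Jt) g2 g2 (h2 Jt)); exact: aeW.
rewrite (NW _ t_in0) (NW _ t_inT) prim0 addr0.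
have -> : \int[P]_(z in Q) (dth z.1 * (v z * g z.2)) = \int[leb]_(t in J) ((c + prim ge t) * dth t).
  have [I1 e1] := ipL_tensor oOm bOm v2 (L2J_cont cdth) g2.
  rewrite (_ : \int[P]_(z in Q) _ = ipL P Q v (fun z => dth z.1 * g z.2)); last first.
    by apply: eq_Rintegral => z _; ring.
  rewrite e1; apply: ae_eq_Rintegral => //.
  - by apply: measurable_funM; [exact: L1_measurable I1|exact: cont_measurable].
  - apply: measurable_funM; last exact: (cont_measurable cdth).
    by apply: measurable_funD; [exact: measurable_cst|exact: (L1_measurable (prim_L1 I_ge))].
  - by apply: filterS hc => t h1 Jt; rewrite -(h1 Jt).
have I3 := L1_cont T cdth.
have I4 : L1 leb J (fun t => prim ge t * dth t).
  have IP := prim_L1 I_ge; apply: (L1_le mJ (g := fun t => M' * `|prim ge t|)).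
  - by apply: measurable_funM; [exact: L1_measurable IP|exact: cont_measurable].
  - by apply: L1Z => //; exact: L1_abs.
  - by move=> t Jt; rewrite normrM mulrC ler_wpM2r// hM'.
have -> : \int[leb]_(t in J) ((c + prim ge t) * dth t) =
    c * \int[leb]_(t in J) dth t + \int[leb]_(t in J) (prim ge t * dth t).
  rewrite -RintegralZl// -RintegralD//; last exact: (L1Z mJ c I3).
  by apply: eq_Rintegral => t _; rewrite mulrDl.
rewrite (FTC_itv hth cdth (ltW T_gt0)) (prim_parts I_ge hth cdth).
by rewrite -/ge; move: (\int[leb]_(t in J) _) (prim _ T) => x y; ring.
Qed.

End integration_by_parts.

(** * The space Y *)

Lemma lin_sum3 {R : comRingType} (a x1 x2 x3 y1 y2 y3 : R) :
  a * x1 + y1 + (a * x2 + y2) + (a * x3 + y3) = a * (x1 + x2 + x3) + (y1 + y2 + y3).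
Proof. ring. Qed.

Section space_Y.
Context {R : realType} {n : nat}.
Variables (T : R) (Om : set 'rV[R]_n.+1).
Hypotheses (T_gt0 : 0 < T) (oOm : open Om) (bOm : bounded_set Om).
Local Notation mu := (@lebesgue_rV R n.+1).
Local Notation E := 'rV[R]_n.+1.
Local Notation pt := (measurableTypeR R * 'rV[R]_n.+1)%type.
Local Notation J := (`]0, T[%classic : set (measurableTypeR R)).
Local Notation Q := (QT T Om : set pt).
Local Notation P := (@lebQ R n.+1).
Local Notation VX := (spX T Om).
Local Notation VY := (spY T Om).
Local Notation nX := (normX T Om).
Local Notation dtv := (dt T Om).
Local Notation tr := (trace T Om).
Implicit Types (v w : pt -> R) (th dth : R -> R) (D : (pt -> R) -> R).

Let mOm : measurable Om. Proof. exact: open_rV_measurable. Qed.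
Let mQ : measurable Q. Proof. exact: measurable_QT. Qed.
Let sL := @ipL_semi _ _ R mu Om mOm.
Let sLQ := @ipL_semi _ _ R P Q mQ.
Let sX := @ipX_semi R n T Om oOm bOm.
Let nXE := @normXE _ _ T Om oOm.

Let itv0 : `[0, T]%classic 0. Proof. by rewrite /= in_itv /= lexx ltW. Qed.
Let itvT : `[0, T]%classic T. Proof. by rewrite /= in_itv /= lexx ltW. Qed.

Lemma Y_X v : VY v -> VX v. Proof. by case. Qed.

Lemma dtP v : VY v -> is_dt T Om v (dtv v).
Proof. by move=> [_ [D hD]]; exact: (xgetPex _ (ex_intro _ D hD)). Qed.

Lemma dt_dual v : VY v -> dual VX nX (dtv v).
Proof. by move=> /dtP[]. Qed.

Lemma dt_unique v D (z : pt -> R) : VY v -> is_dt T Om v D -> VX z -> dtv v z = D z.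
Proof.
move=> Yv [hD eD]; have [hD' eD'] := dtP Yv; apply: (dual_tensor_eq oOm bOm) => // phi w tphi Hw.
by rewrite eD// eD'.
Qed.

Lemma is_dt_lin a v w D D' : VX v -> VX w -> is_dt T Om v D -> is_dt T Om w D' ->
  is_dt T Om (fun z => a * v z + w z) (fun z => a * D z + D' z).
Proof.
move=> Xv Xw [hD eD] [hD' eD']; split; first exact: (dual_comb a hD hD').
move=> phi g tphi Hg; rewrite eD// eD'//; have [dg [g2 _ _ _]] := Hg.
have p2 := L2_tensor oOm bOm (test_L2J (test_derive1 tphi)) g2.
have e f : \int[P]_(z in Q) (f z * g z.2 * derive1 phi z.1) =
    ipL P Q f (fun z => derive1 phi z.1 * g z.2).
  by apply: eq_Rintegral => z _; ring.
rewrite !e.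
have v2 := spX_L2 Xv; have w2 := spX_L2 Xw.
have av2 := L2Z mQ a v2.
rewrite [ipL _ _ (fun z => _ + _) _](ipDl sLQ av2 w2 p2) [ipL _ _ (fun x => a * v x) _](ipZl sLQ a v2 p2).
ring.
Qed.

Lemma Y_subspace : subspace (VY : set (pt -> R)).
Proof.
have X0 : VX 0 by case: sX => -[].
split.
  split=> //; exists (fun=> 0); split.
    split; first by move=> *; rewrite mulr0 addr0.
    by exists 0 => v _; rewrite normr0 mul0r.
  move=> phi w _ _; rewrite (_ : \int[P]_(z in Q) _ = 0) ?oppr0//.
  rewrite (@eq_Rintegral _ _ _ P Q (fun=> 0)) ?Rintegral_cst ?mul0r//.
  by move=> z _; rewrite /= -[X in X * _ * _]/(0 : R) !mul0r.
move=> a v w Yv Yw; split.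
  have [[_ s] _ _ _] := sX; exact: s (Y_X Yv) (Y_X Yw).
by eexists; exact: (is_dt_lin a (Y_X Yv) (Y_X Yw) (dtP Yv) (dtP Yw)).
Qed.

Lemma Y_B v w : VY v -> VY w -> VY (v - w).
Proof. by move=> Yv Yw; exact: subspaceB Y_subspace Yv Yw. Qed.

Lemma dt_lin a v w (z : pt -> R) : VY v -> VY w -> VX z ->
  dtv (fun x => a * v x + w x) z = a * dtv v z + dtv w z.
Proof.
move=> Yv Yw Xz; apply: (dt_unique (D := fun z => a * dtv v z + dtv w z)) => //.
  have [_ s] := Y_subspace; exact: s.
exact: (is_dt_lin a (Y_X Yv) (Y_X Yw) (dtP Yv) (dtP Yw)).
Qed.

Lemma dtB v w (z : pt -> R) : VY v -> VY w -> VX z -> dtv (fun x => v x - w x) z = dtv v z - dtv w z.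
Proof.
move=> Yv Yw Xz; have := dt_lin (-1) Yw Yv Xz.
rewrite (_ : (fun x => -1 * w x + v x) = (fun x => v x - w x)); last by apply/funext => x; ring.
by move=> ->; ring.
Qed.

Lemma traceP v : VY v -> is_crep T Om v (tr v).
Proof.
move=> Yv; have [w Xw Dw] := dual_riesz sX nXE (ipX_complete oOm bOm) (dt_dual Yv).
have [W hW] := crep_exists T_gt0 oOm bOm (Y_X Yv) (dtP Yv) Xw Dw.
exact: (xgetPex _ (ex_intro _ W hW)).
Qed.

Lemma trace0_L2 v : VY v -> L2 mu Om (tr v 0).
Proof. by move=> /traceP[h _ _]; exact: h. Qed.

Lemma traceT_L2 v : VY v -> L2 mu Om (tr v T).
Proof. by move=> /traceP[h _ _]; exact: h. Qed.

Lemma trace_lin a v w t : VY v -> VY w -> 0 <= t <= T ->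
  {ae mu, forall x, Om x -> tr (fun z => a * v z + w z) t x = a * tr v t x + tr w t x}.
Proof.
move=> Yv Yw tT; have [_ s] := Y_subspace; have Yl := s a _ _ Yv Yw.
exact: (crep_unique T_gt0 oOm (traceP Yl) (crep_lin oOm a (traceP Yv) (traceP Yw)) tT).
Qed.

Lemma traceB v w t : VY v -> VY w -> 0 <= t <= T ->
  {ae mu, forall x, Om x -> tr (fun z => v z - w z) t x = tr v t x - tr w t x}.
Proof.
move=> Yv Yw tT; have := trace_lin (-1) Yw Yv tT.
rewrite (_ : (fun x => -1 * w x + v x) = (fun x => v x - w x)); last by apply/funext => x; ring.
by apply: filterS => x h /h ->; ring.
Qed.

Definition riesz D : pt -> R :=
  xget 0 [set w | VX w /\ forall z, VX z -> D z = ipX T Om w z].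

Lemma rieszP D : dual VX nX D -> VX (riesz D) /\ forall z, VX z -> D z = ipX T Om (riesz D) z.
Proof.
move=> hD; have [w Xw Dw] := dual_riesz sX nXE (ipX_complete oOm bOm) hD.
by rewrite /riesz; case: xgetP => [y -> //|/(_ w) []].
Qed.

Lemma dualnorm_riesz D : dual VX nX D -> dualnorm VX nX D ^+ 2 = D (riesz D).
Proof.
move=> hD; have [Xr hr] := rieszP hD; have d0 := dual_norm_ge0 sX nXE hD.
have N2 := normX_sqr oOm bOm Xr; rewrite -(hr _ Xr) in N2; rewrite -N2; congr (_ ^+ 2).
have N0 := normX_ge0 oOm Xr; apply/eqP; rewrite eq_le; apply/andP; split.
  apply: (dualnorm_bnd sX nXE) => // z Xz; rewrite (hr _ Xz) !nXE//.
  exact: (ip_le sX).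
have := dual_le sX nXE hD Xr; rewrite -N2 ger0_norm ?sqr_ge0//.
have [N1|N1] := ltP 0 (nX (riesz D)); last by move=> _; exact: le_trans N1 d0.
by rewrite expr2 ler_pM2r.
Qed.

(** The first term is the inner product of the Riesz representers of the time derivatives; it makes
    [normY] the norm of a semi-inner product. *)
Definition ipY v w := dtv v (riesz (dtv w)) + ipX T Om v w + ipL mu Om (tr v T) (tr w T).

Lemma ipY_semi : semi_ip (VY : set (pt -> R)) ipY.
Proof.
split; first exact: Y_subspace.
- move=> v w Yv Yw; rewrite /ipY; have [Xv hv] := rieszP (dt_dual Yv).
  have [Xw hw] := rieszP (dt_dual Yw).
  rewrite (hv _ Xw) (hw _ Xv) (ipC sX Xv Xw) (ipC sX (Y_X Yv) (Y_X Yw)).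
  by rewrite (ipC sL (traceT_L2 Yv) (traceT_L2 Yw)).
- move=> a u v w Yu Yv Yw; rewrite /ipY; have [Xw _] := rieszP (dt_dual Yw).
  have [[_ s] _ lX _] := sX; have [_ _ lL _] := sL.
  have [_ sY] := Y_subspace; have Yl := sY a _ _ Yu Yv.
  have tu := traceT_L2 Yu; have tv := traceT_L2 Yv; have tw := traceT_L2 Yw.
  have tl := traceT_L2 Yl; have tl' := L2_lin mOm a tu tv.
  have e1 := dt_lin a Yu Yv Xw; have e2 := lX a _ _ _ (Y_X Yu) (Y_X Yv) (Y_X Yw).
  have e3 := lL a _ _ _ tu tv tw.
  have tT : 0 <= T <= T by rewrite lexx ltW.
  have e4 := ipL_ae mOm tl tl' tw tw (trace_lin a Yu Yv tT) (aeW _ (fun x _ => erefl)).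
  have e5 := etrans e4 e3.
  exact: etrans (f_equal2 +%R (f_equal2 +%R e1 e2) e5) (lin_sum3 _ _ _ _ _ _ _).
- move=> v Yv; rewrite /ipY -(dualnorm_riesz (dt_dual Yv)).
  by rewrite !addr_ge0 ?sqr_ge0 ?(ip_ge0 sX (Y_X Yv)) ?(ip_ge0 sL (traceT_L2 Yv)).
Qed.

Lemma normYE v : VY v -> normY T Om v = Num.sqrt (ipY v v).
Proof.
move=> Yv; rewrite /normY (dualnorm_riesz (dt_dual Yv)) (normX_sqr oOm bOm (Y_X Yv)).
by rewrite (L2norm_sqr mOm (traceT_L2 Yv)).
Qed.

Lemma normY_ge0 v : 0 <= normY T Om v. Proof. exact: sqrtr_ge0. Qed.

Lemma normY_sqr v : VY v -> normY T Om v ^+ 2 =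
  dualnorm VX nX (dtv v) ^+ 2 + nX v ^+ 2 + ipL mu Om (tr v T) (tr v T).
Proof.
move=> Yv; rewrite /normY (L2norm_sqr mOm (traceT_L2 Yv)) sqr_sqrtr//.
by rewrite !addr_ge0 ?sqr_ge0 ?(ip_ge0 sL (traceT_L2 Yv)).
Qed.

Lemma ler_sqrt_sum (a x y z : R) : 0 <= a -> 0 <= z -> x = a ^+ 2 -> 0 <= y ->
  a <= Num.sqrt (y + x + z).
Proof.
move=> a0 z0 -> y0; rewrite -[leLHS](ger0_norm a0) -sqrtr_sqr ler_wsqrtr//.
by rewrite -addrA addrC -addrA lerDl addr_ge0.
Qed.

Lemma normX_leY v : VY v -> nX v <= normY T Om v.
Proof.
move=> Yv; rewrite /normY ler_sqrt_sum// ?sqr_ge0//; exact: (normX_ge0 oOm (Y_X Yv)).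
Qed.

Lemma dt_leY v : VY v -> dualnorm VX nX (dtv v) <= normY T Om v.
Proof.
move=> Yv; rewrite /normY [_ + nX v ^+ 2]addrC ler_sqrt_sum ?sqr_ge0//.
exact: (dual_norm_ge0 sX nXE (dt_dual Yv)).
Qed.

Lemma traceT_leY v : VY v -> L2norm mu Om (tr v T) <= normY T Om v.
Proof.
move=> Yv; have h := L2norm_ge0 mOm (traceT_L2 Yv).
rewrite -[leLHS](ger0_norm h) -sqrtr_sqr ler_wsqrtr// lerDr.
by rewrite addr_ge0 ?sqr_ge0.
Qed.

Lemma ipX_time_le th M v : continuous th -> (forall t, J t -> `|th t| <= M) -> VX v ->
  ipX T Om (fun z => th z.1 * v z) (fun z => th z.1 * v z) <= M ^+ 2 * ipX T Om v v.
Proof.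
move=> cth hM Xv; have gv := gradxP Xv; have mth : measurable_fun J th by exact: cont_measurable.
have gt := X_time oOm bOm mth hM gv; rewrite (ipXE oOm bOm gt gt).
have [_ t2 _] := gt; have g2 := gradx_L2 Xv; rewrite /ipX /ipV -RintegralZl//.
  apply: ae_le_Rintegral => //; first exact: (L2v_dotv mQ t2 t2).
    exact: (L1Z mQ _ (L2v_dotv mQ g2 g2)).
  apply: aeW => z [Jz _]; rewrite dotvZl dotvZr mulrA -expr2.
  by rewrite ler_wpM2r ?dotv_ge0// -real_normK ?num_real// lerXn2r ?nnegrE ?(le_trans _ (hM _ Jz))// hM.
exact: (L2v_dotv mQ g2 g2).
Qed.

Lemma normX_time_le th M v : continuous th -> (forall t, J t -> `|th t| <= M) -> 0 <= M -> VX v ->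
  nX (fun z => th z.1 * v z) <= M * nX v.
Proof.
move=> cth hM M0 Xv; rewrite (nXE (X_time_cont oOm bOm cth Xv)) (nXE Xv).
rewrite -[X in X * _](ger0_norm M0) -sqrtr_sqr -sqrtrM ?sqr_ge0// ler_wsqrtr//.
exact: ipX_time_le.
Qed.

Lemma Y_parts v th dth : VY v -> (forall x : R, is_derive x (1 : R) th (dth x)) -> continuous dth ->
  2 * dtv v (fun z => th z.1 * v z) + \int[P]_(z in Q) (dth z.1 * (v z * v z)) =
  th T * ipL mu Om (tr v T) (tr v T) - th 0 * ipL mu Om (tr v 0) (tr v 0).
Proof. by move=> Yv; exact: (time_parts T_gt0 oOm bOm (Y_X Yv) (dtP Yv) (traceP Yv)). Qed.

Lemma Y_tensor_parts v (g : E -> R) th dth : VY v -> H10 Om g ->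
  (forall x : R, is_derive x (1 : R) th (dth x)) -> continuous dth ->
  dtv v (fun z => th z.1 * g z.2) + \int[P]_(z in Q) (dth z.1 * (v z * g z.2)) =
  th T * ipL mu Om (tr v T) g - th 0 * ipL mu Om (tr v 0) g.
Proof. by move=> Yv; exact: (tensor_parts T_gt0 oOm bOm (Y_X Yv) (dtP Yv) (traceP Yv)). Qed.

Lemma Y_energy v : VY v ->
  2 * dtv v v = ipL mu Om (tr v T) (tr v T) - ipL mu Om (tr v 0) (tr v 0).
Proof.
move=> Yv; have h (x : R) : is_derive x (1 : R) (fun=> 1 : R) (0 : R) by exact: is_derive_cst.
have := Y_parts Yv h (@cst_continuous _ _ (0 : R)).
rewrite (_ : (fun z => 1 * v z) = v); last by apply/funext => z; rewrite mul1r.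
rewrite !mul1r (_ : \int[P]_(z in Q) _ = 0) ?addr0//.
rewrite (@eq_Rintegral _ _ _ P Q (fun=> 0)) ?Rintegral_cst ?mul0r//.
by move=> z _; rewrite /= mul0r.
Qed.

Lemma two_mul_le (x y : R) : 2 * (x * y) <= x ^+ 2 + y ^+ 2.
Proof. by have := sqr_ge0 (x - y); nra. Qed.

(** By the energy identity |v(0)|^2 is |v(T)|^2 minus twice the pairing of the derivative with v,
    and the pairing is absorbed by the two other squares in the norm of Y. *)
Lemma trace0_leY v : VY v -> L2norm mu Om (tr v 0) <= normY T Om v.
Proof.
move=> Yv; rewrite -(@ler_pXn2r _ 2) ?nnegrE ?(L2norm_ge0 mOm (trace0_L2 Yv)) ?normY_ge0//.
rewrite (L2norm_sqr mOm (trace0_L2 Yv)) (normY_sqr Yv).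
have e := Y_energy Yv; have := dual_le sX nXE (dt_dual Yv) (Y_X Yv).
have := two_mul_le (dualnorm VX nX (dtv v)) (nX v).
move: e; move: (ipL _ _ (tr v 0) _) (ipL _ _ (tr v T) _) (dtv v v) (dualnorm _ _ _) (nX v).
move=> a b c d e h1 h2; rewrite ler_norml => /andP[h3 h4]; lra.
Qed.

(** Integration by parts with the weight t, whose derivative is 1 and which vanishes at 0, gives the
    explicit factor T. *)
Lemma L2_leY v : VY v -> ipL P Q v v <= T * normY T Om v ^+ 2.
Proof.
move=> Yv; have h (x : R) : is_derive x (1 : R) id (1 : R) by exact: is_derive_id.
have := Y_parts Yv h (@cst_continuous _ _ (1 : R)); rewrite mul0r subr0.
have -> : \int[P]_(z in Q) (1 * (v z * v z)) = ipL P Q v v.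
  by apply: eq_Rintegral => z _; rewrite mul1r.
have hb t : J t -> `|id t : R| <= T.
  by rewrite /= in_itv /= => /andP[t0 tT]; rewrite ger0_norm ltW.
have ci : continuous (id : R -> R) by move=> x; exact: cvg_id.
have := normX_time_le ci hb (ltW T_gt0) (Y_X Yv).
have := dual_le sX nXE (dt_dual Yv) (X_time_cont oOm bOm ci (Y_X Yv)).
have := two_mul_le (dualnorm VX nX (dtv v)) (nX v).
have := dual_norm_ge0 sX nXE (dt_dual Yv); rewrite (normY_sqr Yv) /=.
move: (ipL _ _ (tr v T) _) (ipL P _ _ _) (dtv v _) (dualnorm _ _ _) (nX v) (nX (fun z => z.1 * v z)).
move=> a b c d e f d0 h1 h2 h3 h4.
have h5 : d * f <= d * (T * e) by rewrite ler_wpM2l.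
have h6 : T * (2 * (d * e)) <= T * (d ^+ 2 + e ^+ 2) by rewrite ler_pM2l.
by move: h2; rewrite ler_norml => /andP[h2 _]; lra.
Qed.

Lemma Y0_Y v : spY0 T Om v -> VY v. Proof. by case. Qed.

Lemma Y0_trace v : spY0 T Om v -> ipL mu Om (tr v 0) (tr v 0) = 0.
Proof. by move=> [Yv h]; exact: (L2_eq0_ipL mOm (trace0_L2 Yv) h). Qed.

Lemma Y0_subspace : subspace (spY0 T Om : set (pt -> R)).
Proof.
have t0 : 0 <= (0 : R) <= T by rewrite lexx ltW.
have [Y0 s] := Y_subspace; split.
  split=> //; have := trace_lin (-1) Y0 Y0 t0.
  rewrite (_ : (fun z => _) = 0); last by apply/funext => z; rewrite -[LHS]/(-1 * 0 + 0 : R) mulr0 addr0.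
  by apply: filterS => x h Ox; rewrite (h Ox); ring.
move=> a v w [Yv hv] [Yw hw]; split; first exact: s.
apply: filterS3 hv hw (trace_lin a Yv Yw t0) => x h1 h2 h3 Ox.
by apply: etrans (h3 Ox) _; rewrite h1// h2// mulr0 addr0.
Qed.

Lemma ipY0_semi : semi_ip (spY0 T Om : set (pt -> R)) ipY.
Proof.
have [_ h1 h2 h3] := ipY_semi; split; first exact: Y0_subspace.
- by move=> v w /Y0_Y Yv /Y0_Y Yw; exact: h1.
- by move=> a u v w /Y0_Y Yu /Y0_Y Yv /Y0_Y Yw; exact: h2.
- by move=> v /Y0_Y Yv; exact: h3.
Qed.

Lemma normY0E v : spY0 T Om v -> normY T Om v = Num.sqrt (ipY v v).
Proof. by move=> /Y0_Y; exact: normYE. Qed.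

End space_Y.

(** * Drift operators *)

Section numeric_drift.
Context {R : realType}.

(** The first term absorbs the transport term into half of the diffusion by Young's inequality; the
    summand 1 leaves the L^2 norm of v on the controlled side. *)
Definition drift_rate (nu L : R) := L ^+ 2 / nu + 1.

Lemma drift_pointwise (nu L e th x y a : R) : 0 < nu -> 0 <= e -> e <= th -> 0 <= x ->
  `|y| <= L * x ->
  e * (a * a + nu * (x * x)) <= drift_rate nu L * (th * a * a) + 2 * (th * (nu * (x * x) + a * y)).
Proof.
move=> nu0 e0 eth x0 yb; have th0 := le_trans e0 eth.
have h1 : 0 <= nu * (x * x) + 2 * (a * y) + L ^+ 2 / nu * (a * a).
  have e1 : nu * (nu * (x * x) + 2 * (a * y) + L ^+ 2 / nu * (a * a)) =
      (nu * x) ^+ 2 + 2 * nu * (a * y) + (L * a) ^+ 2 by field; rewrite lt0r_neq0.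
  rewrite -(pmulr_rge0 _ nu0) e1.
  have h2 : - (`|a| * (L * x)) <= a * y.
    apply: le_trans (lerNnormlW (lexx _)); rewrite lerN2 normrM; exact: ler_wpM2l.
  have h3 : 0 <= (nu * x - L * `|a|) ^+ 2 by rewrite sqr_ge0.
  have h4 : (L * a) ^+ 2 = (L * `|a|) ^+ 2 by rewrite !exprMn real_normK// num_real.
  rewrite h4; have h5 : 0 <= nu * (a * y + `|a| * (L * x)) by apply: mulr_ge0; [exact: ltW|lra].
  by nra.
have h2 : 0 <= a * a + nu * (x * x) by rewrite -!expr2 addr_ge0 ?sqr_ge0// mulr_ge0 ?sqr_ge0 ?(ltW nu0).
apply: le_trans (_ : th * (a * a + nu * (x * x)) <= _); first exact: ler_wpM2r.
rewrite /drift_rate -subr_ge0 (_ : _ - _ = th * (nu * (x * x) + 2 * (a * y) + L ^+ 2 / nu * (a * a))) ?mulr_ge0//.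
ring.
Qed.

(** [e] is the least value of the weight exp (- lam t) on [0, T], and [2 / (e * nu)] comes from
    absorbing the product 2 K X into half of the diffusion. *)
Definition energy_const1 (nu L T : R) :=
  let e := expR (- drift_rate nu L * T) in (1 + 2 / (e * nu)) / e.

(** The first three summands bound the time derivative through D^2 <= 3 (K^2 + nu^2 X^2 + L^2 I),
    the fourth bounds the gradient and the last one the final value. *)
Definition energy_const (nu L T : R) :=
  let C := energy_const1 nu L T in
  Num.sqrt (3 + 6 * nu * C + 3 * L ^+ 2 * C + 2 * C / nu + C).

Lemma energy_const1_gt0 nu L T : 0 < nu -> 0 < energy_const1 nu L T.
Proof.
move=> nu0; rewrite /energy_const1; set e := expR _; have e0 : 0 < e by exact: expR_gt0.
by rewrite divr_gt0// addr_gt0// divr_gt0// mulr_gt0.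
Qed.

Lemma energy_collect (D X N K b c p q x C s : R) : D <= 3 * K + b + c -> X <= x * s -> N <= C * s ->
  b <= p * s -> c <= q * s -> K <= s -> D + X + N <= (3 + p + q + x + C) * s.
Proof. by move=> *; rewrite !mulrDl; lra. Qed.

Lemma energy_numeric (nu L T K t0 X N I D : R) : 0 < nu -> 0 <= L -> 0 <= K -> 0 <= t0 ->
  0 <= X -> 0 <= N -> 0 <= I -> 0 <= D ->
  expR (- drift_rate nu L * T) * (N + I + nu * X ^+ 2) <= t0 ^+ 2 + 2 * (K * X) ->
  D <= K + nu * X + L * Num.sqrt I ->
  Num.sqrt (D ^+ 2 + X ^+ 2 + N) <= energy_const nu L T * (K + t0).
Proof.
move=> nu0 L0 K0 t00 X0 N0 I0 D0; have C0 := energy_const1_gt0 L T nu0.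
rewrite /energy_const; move: C0; rewrite /energy_const1; set e := expR _.
have e0 : 0 < e by exact: expR_gt0.
set C := (_ / _) => C0 h1 h2; pose S := K + t0; have S0 : 0 <= S by rewrite addr_ge0.
have KS : K ^+ 2 <= S ^+ 2 by rewrite lerXn2r ?nnegrE// lerDl.
have tS : t0 ^+ 2 <= S ^+ 2 by rewrite lerXn2r ?nnegrE// lerDr.
(* Young's inequality, weighted so that half of the diffusion remains after division by [e]. *)
have k1 : 2 * (K * X) <= e * nu / 2 * X ^+ 2 + 2 * K ^+ 2 / (e * nu).
  rewrite -subr_ge0 (_ : _ - _ = (e * nu * X - 2 * K) ^+ 2 / (2 * (e * nu))).
    by rewrite divr_ge0 ?sqr_ge0// mulr_ge0// mulr_ge0 ?ltW.
  by field; rewrite !lt0r_neq0.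
have k2 : N + I + nu / 2 * X ^+ 2 <= C * S ^+ 2.
  rewrite /C [leRHS]mulrAC ler_pdivlMr//.
  have k3 : 2 * K ^+ 2 / (e * nu) <= 2 / (e * nu) * S ^+ 2.
    by rewrite mulrAC ler_wpM2l// divr_ge0// mulr_ge0// ltW.
  rewrite [leRHS]mulrDl mul1r; move: k1 k3 h1 tS.
  move: (2 * K ^+ 2 / (e * nu)) (2 / (e * nu) * S ^+ 2) => p q k1 k3 h1 tS.
  by nra.
have X2 := sqr_ge0 X.
have k4 : X ^+ 2 <= 2 * C / nu * S ^+ 2.
  rewrite mulrAC ler_pdivlMr//.
  have : nu / 2 * X ^+ 2 <= C * S ^+ 2 by apply: le_trans k2; rewrite lerDr addr_ge0.
  by move: (C * S ^+ 2) => q; lra.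
have k5 : N <= C * S ^+ 2 /\ I <= C * S ^+ 2.
  have : 0 <= nu / 2 * X ^+ 2 by rewrite mulr_ge0// divr_ge0// ltW.
  by move: k2; move: (C * S ^+ 2) (nu / 2 * X ^+ 2) => p q; split; lra.
have [k6 k7] := k5.
have D2 : D ^+ 2 <= 3 * K ^+ 2 + 3 * nu ^+ 2 * X ^+ 2 + 3 * L ^+ 2 * I.
  have sI := sqr_sqrtr I0; rewrite -sI; have sI0 := sqrtr_ge0 I.
  move: (Num.sqrt I) sI0 h2 => s s0 h2.
  apply: (@le_trans _ _ ((K + nu * X + L * s) ^+ 2)).
    by rewrite lerXn2r// nnegrE !addr_ge0 ?mulr_ge0// ltW.
  rewrite -subr_ge0 (_ : _ - _ = (K - nu * X) ^+ 2 + (K - L * s) ^+ 2 + (nu * X - L * s) ^+ 2); last by ring.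
  by rewrite !addr_ge0 ?sqr_ge0.
have k8 : 3 * nu ^+ 2 * X ^+ 2 <= 6 * nu * C * S ^+ 2.
  have h : 3 * nu ^+ 2 * X ^+ 2 <= 3 * nu ^+ 2 * (2 * C / nu * S ^+ 2).
    by rewrite ler_wpM2l// mulr_ge0// sqr_ge0.
  by apply: le_trans h _; rewrite le_eqVlt; apply/orP; left; apply/eqP; field; rewrite lt0r_neq0.
have k9 : 3 * L ^+ 2 * I <= 3 * L ^+ 2 * (C * S ^+ 2) by rewrite ler_wpM2l// mulr_ge0// sqr_ge0.
rewrite -[X in _ * X](ger0_norm S0) -sqrtr_sqr -sqrtrM; last first.
  have nu1 := ltW nu0; have C1 := ltW C0; have L2 := sqr_ge0 L; have e1 := ltW e0.
  by rewrite !(addr_ge0, mulr_ge0, invr_ge0)// ?invr_ge0.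
apply: ler_wsqrtr; have e2 : 3 * L ^+ 2 * (C * S ^+ 2) = 3 * L ^+ 2 * C * S ^+ 2 by ring.
rewrite e2 in k9.
exact: energy_collect D2 k4 k6 k8 k9 KS.
Qed.

Lemma energy_combine (e I X l t B D NT N0 K : R) : e * (I + X) <= l * t + 2 * B ->
  D + B <= K -> 2 * D + - l * t = e * NT - N0 -> e * (NT + I + X) <= N0 + 2 * K.
Proof. by move=> h1 h2 h3; rewrite -addrA mulrDr; lra. Qed.

End numeric_drift.

Lemma is_derive_exp {R : realType} (c x : R) : is_derive x (1 : R) (fun t => expR (c * t)) (c * expR (c * x)).
Proof. 
have h : is_derive x (1 : R) (fun t => c * t) c.
  by apply: is_derive_eq; rewrite /GRing.scale /= mulr1.
have := @is_derive1_comp _ expR (fun t => c * t) x _ _ (is_derive_expR _) h.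
by rewrite mulrC.
 Qed.

Lemma cont_exp {R : realType} (c : R) : continuous (fun t : R => expR (c * t)).
Proof. exact: is_derive_continuous (is_derive_exp c). Qed.

Lemma cont_exp' {R : realType} (c : R) : continuous (fun t : R => c * expR (c * t)).
Proof. by move=> x; apply: cvgM; [exact: cvg_cst|exact: cont_exp]. Qed.

Section drift.
Context {R : realType} {n : nat}.
Variables (T : R) (Om : set 'rV[R]_n.+1).
Hypotheses (T_gt0 : 0 < T) (oOm : open Om) (bOm : bounded_set Om).
Local Notation mu := (@lebesgue_rV R n.+1).
Local Notation E := 'rV[R]_n.+1.
Local Notation pt := (measurableTypeR R * 'rV[R]_n.+1)%type.
Local Notation J := (`]0, T[%classic : set (measurableTypeR R)).
Local Notation Q := (QT T Om : set pt).
Local Notation P := (@lebQ R n.+1).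
Local Notation VX := (spX T Om).
Local Notation VY := (spY T Om).
Local Notation nX := (normX T Om).
Local Notation dtv := (dt T Om).
Local Notation tr := (trace T Om).
Local Notation gx := (gradx T Om).
Implicit Types (v w : pt -> R) (th dth : R -> R) (D : (pt -> R) -> R).

Let mOm : measurable Om. Proof. exact: open_rV_measurable. Qed.
Let mQ : measurable Q. Proof. exact: measurable_QT. Qed.
Let sL := @ipL_semi _ _ R mu Om mOm.
Let sLQ := @ipL_semi _ _ R P Q mQ.
Let sVQ := @ipV_semi _ _ R n.+1 P Q mQ.
Let sX := @ipX_semi R n T Om oOm bOm.
Let nXE := @normXE _ _ T Om oOm.

Variables (nu L : R) (beta : pt -> E).
Hypotheses (nu_gt0 : 0 < nu) (L_ge0 : 0 <= L).
Hypothesis mbeta : forall i, measurable_fun Q (fun z => beta z ord0 i).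
Hypothesis hbeta : forall z, Q z -> enorm (beta z) <= L.

Let L2v_beta v : L2 P Q v -> L2v P Q (fun z => v z *: beta z).
Proof.
move=> v2 i; rewrite (_ : (fun z => _) = (fun z => beta z ord0 i * v z)); last first.
  by apply/funext => z; rewrite mxE mulrC.
apply: (L2_bounded mQ (C := L)) => // z Qz; exact: le_trans (coord_le_enorm _ _) (hbeta Qz).
Qed.

Let ipV_beta v : L2 P Q v ->
  ipV P Q (fun z => v z *: beta z) (fun z => v z *: beta z) <= L ^+ 2 * ipL P Q v v.
Proof.
move=> v2; have b2 := L2v_beta v2; rewrite /ipL -RintegralZl//; last exact: L2M.
apply: ae_le_Rintegral => //; first exact: (L2v_dotv mQ b2 b2).
  by apply: L1Z => //; exact: L2M.
apply: aeW => z Qz; rewrite dotvZl dotvZr mulrA mulrC ler_wpM2r -?expr2 ?sqr_ge0//.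
by rewrite -enorm_sqr lerXn2r ?nnegrE ?enorm_ge0// hbeta.
Qed.

Definition flux v : pt -> E := fun z => nu *: gx v z + v z *: beta z.

Lemma flux_L2 v : VX v -> L2v P Q (flux v).
Proof.
by move=> Xv; exact: (L2v_lin mQ nu (gradx_L2 Xv) (L2v_beta (spX_L2 Xv))).
Qed.

(** Weak form of - nu Laplace v - div (beta v). *)
Definition drift v w := ipV P Q (flux v) (gx w).

Lemma drift_linr v a w1 w2 : VX v -> VX w1 -> VX w2 ->
  drift v (fun z => a * w1 z + w2 z) = a * drift v w1 + drift v w2.
Proof.
move=> Xv X1 X2; have f2 := flux_L2 Xv; have g1 := gradx_L2 X1; have g2 := gradx_L2 X2.
have gl := X_grad_lin oOm bOm a (gradxP X1) (gradxP X2); have [_ gl2 _] := gl.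
have Xl : VX (fun z => a * w1 z + w2 z) by eexists; exact: gl.
have ag1 := subspaceZ a (@L2v_subspace _ _ R n.+1 P Q mQ) g1.
rewrite /drift -(ipZr sVQ a g1 f2) -(ipDr sVQ ag1 g2 f2).
apply: (ipV_ae mQ f2 f2 (gradx_L2 Xl) gl2); first exact: aeW.
exact: (gradx_ae oOm bOm gl).
Qed.

Lemma drift_linl a v1 v2 w : VX v1 -> VX v2 -> VX w ->
  drift (fun z => a * v1 z + v2 z) w = a * drift v1 w + drift v2 w.
Proof.
move=> X1 X2 Xw; have f1 := flux_L2 X1; have f2 := flux_L2 X2; have g2 := gradx_L2 Xw.
have gl := X_grad_lin oOm bOm a (gradxP X1) (gradxP X2); have [_ gl2 _] := gl.
have Xl : VX (fun z => a * v1 z + v2 z) by eexists; exact: gl.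
have af1 := subspaceZ a (@L2v_subspace _ _ R n.+1 P Q mQ) f1.
rewrite /drift -(ipZl sVQ a f1 g2) -(ipDl sVQ af1 f2 g2).
apply: (ipV_ae mQ (flux_L2 Xl) _ g2 g2); last exact: aeW.
  exact: subspaceD (@L2v_subspace _ _ R n.+1 P Q mQ) af1 f2.
apply: filterS (gradx_ae oOm bOm gl) => z h Qz; rewrite /flux h// !fctE /flux.
by rewrite !scalerDr !scalerDl !scalerA [nu * a]mulrC addrACA.
Qed.

Lemma flux_le v : VX v ->
  Num.sqrt (ipV P Q (flux v) (flux v)) <= nu * nX v + L * Num.sqrt (ipL P Q v v).
Proof.
move=> Xv; have g2 := gradx_L2 Xv; have v2 := spX_L2 Xv.
have ng2 := subspaceZ nu (@L2v_subspace _ _ R n.+1 P Q mQ) g2.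
apply: le_trans (ip_sqrt_leD sVQ ng2 (L2v_beta v2)) _; rewrite lerD//.
  rewrite (ipZl sVQ nu g2 ng2) (ipZr sVQ nu g2 g2) mulrA -expr2 sqrtrM ?sqr_ge0// sqrtr_sqr.
  by rewrite gtr0_norm// nXE.
rewrite -[X in X * _](ger0_norm L_ge0) -sqrtr_sqr -sqrtrM ?sqr_ge0// ler_wsqrtr//.
exact: ipV_beta.
Qed.

Lemma drift_le v w : VX v -> VX w ->
  `|drift v w| <= (nu * nX v + L * Num.sqrt (ipL P Q v v)) * nX w.
Proof.
move=> Xv Xw; apply: le_trans (ip_le sVQ (flux_L2 Xv) (gradx_L2 Xw)) _.
by rewrite -/(ipX T Om w w) -nXE// ler_wpM2r ?(normX_ge0 oOm Xw)// flux_le.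
Qed.

Lemma drift_dual v : VX v -> dual VX nX (drift v).
Proof.
move=> Xv; split; first by move=> a w1 w2 X1 X2; exact: drift_linr.
by exists (nu * nX v + L * Num.sqrt (ipL P Q v v)) => w Xw; exact: drift_le.
Qed.

Lemma drift_dualr w : VX w -> dual VX nX (drift^~ w).
Proof.
move=> Xw; split; first by move=> a v1 v2 X1 X2; exact: drift_linl.
have [C C0 hC] := poincareX T oOm bOm; exists ((nu + L * Num.sqrt C) * nX w) => v Xv.
apply: le_trans (drift_le Xv Xw) _; rewrite mulrAC ler_wpM2r ?(normX_ge0 oOm Xw)//.
by rewrite mulrDl lerD// -mulrA ler_wpM2l// nXE// -sqrtrM// ler_wsqrtr// hC.
Qed.

Let X_tc th v (cth : continuous th) (Xv : VX v) : VX (fun z => th z.1 * v z) := X_time_cont oOm bOm cth Xv.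

Lemma gradx_time th v : continuous th -> VX v ->
  {ae P, forall z, Q z -> gx (fun z => th z.1 * v z) z = th z.1 *: gx v z}.
Proof.
move=> cth Xv; have [M _ hM] := bounded_cont T cth.
by apply: (gradx_ae oOm bOm); exact: (X_time oOm bOm (cont_measurable cth) hM (gradxP Xv)).
Qed.

Let L2v_time th (g : pt -> E) : continuous th -> L2v P Q g -> L2v P Q (fun z => th z.1 *: g z).
Proof.
by move=> cth g2; have [M _ hM] := bounded_cont T cth; exact: (L2v_time oOm (cont_measurable cth) hM).
Qed.

Lemma drift_time th v w : continuous th -> VX v -> VX w ->
  drift v (fun z => th z.1 * w z) = \int[P]_(z in Q) (th z.1 * dotv (flux v z) (gx w z)).
Proof.
move=> cth Xv Xw; have f2 := flux_L2 Xv; have tg := L2v_time cth (gradx_L2 Xw).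
transitivity (ipV P Q (flux v) (fun z => th z.1 *: gx w z)).
  apply: (ipV_ae mQ f2 f2 (gradx_L2 (X_tc cth Xw)) tg); first exact: aeW.
  exact: gradx_time.
by apply: eq_Rintegral => z _; rewrite dotvZr.
Qed.

Lemma drift_timel th v w : continuous th -> VX v -> VX w ->
  drift (fun z => th z.1 * v z) w = drift v (fun z => th z.1 * w z).
Proof.
move=> cth Xv Xw; have f2 := L2v_time cth (flux_L2 Xv); have Xt := X_tc cth Xv.
rewrite drift_time//; transitivity (ipV P Q (fun z => th z.1 *: flux v z) (gx w)).
  apply: (ipV_ae mQ (flux_L2 Xt) f2 (gradx_L2 Xw) (gradx_L2 Xw)); last exact: aeW.
  apply: filterS (gradx_time cth Xv) => z h Qz; rewrite /flux h//.
  by rewrite scalerDr !scalerA [nu * _]mulrC.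
by apply: eq_Rintegral => z _; rewrite dotvZl.
Qed.

Let I_time th v w : continuous th -> L2 P Q v -> L2 P Q w ->
  L1 P Q (fun z => th z.1 * v z * w z).
Proof.
move=> cth v2 w2; have [M _ hM] := bounded_cont T cth.
exact: (L2M mQ (L2_time oOm (cont_measurable cth) hM v2) w2).
Qed.

Lemma drift_coercive th e v : continuous th -> 0 <= e -> (forall t, J t -> e <= th t) -> VX v ->
  e * (ipL P Q v v + nu * ipX T Om v v) <=
  drift_rate nu L * \int[P]_(z in Q) (th z.1 * v z * v z) + 2 * drift v (fun z => th z.1 * v z).
Proof.
move=> cth e0 eth Xv; have v2 := spX_L2 Xv; have g2 := gradx_L2 Xv; have f2 := flux_L2 Xv.
rewrite drift_time//; have I1 := I_time cth v2 v2.
have I2 : L1 P Q (fun z => th z.1 * dotv (flux v z) (gx v z)).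
  have := L2v_dotv mQ f2 (L2v_time cth g2); congr (L1 _ _ _); apply/funext => z.
  by rewrite dotvZr.
have I3 := L2M mQ v2 v2; have I4 := L2v_dotv mQ g2 g2; have I5 := L1Z mQ nu I4.
rewrite /ipX /ipV /ipL -(RintegralZl nu mQ I4) -(RintegralD mQ I3 I5).
have I6 : L1 P Q (fun z => v z * v z + nu * dotv (gx v z) (gx v z)) by exact: L1D.
rewrite -(RintegralZl e mQ I6) -(RintegralZl (drift_rate nu L) mQ I1) -(RintegralZl 2 mQ I2).
have I7 := L1Z mQ (drift_rate nu L) I1; have I8 := L1Z mQ 2 I2.
rewrite -(RintegralD mQ I7 I8); apply: ae_le_Rintegral => //.
- exact: L1Z.
- exact: L1D.
- apply: aeW => z Qz; rewrite /flux dotvDl !dotvZl.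
  rewrite -enorm_sqr expr2; apply: drift_pointwise => //; first by apply: eth; case: Qz.
    exact: enorm_ge0.
  by apply: le_trans (dotv_le _ _) _; rewrite ler_wpM2r ?enorm_ge0// hbeta.
Qed.

Definition driftop v w := dtv v w + drift v w.

Lemma driftop_dual v : VY v -> dual VX nX (driftop v).
Proof.
move=> Yv; have := dual_comb 1 (dt_dual Yv) (drift_dual (Y_X Yv)).
by congr (dual _ _ _); apply/funext => w; rewrite mul1r.
Qed.

Lemma driftop_lin a v1 v2 w : VY v1 -> VY v2 -> VX w ->
  driftop (fun z => a * v1 z + v2 z) w = a * driftop v1 w + driftop v2 w.
Proof.
move=> Y1 Y2 Xw; have e1 := dt_lin oOm bOm a Y1 Y2 Xw.
have e2 := drift_linl a (Y_X Y1) (Y_X Y2) Xw.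
by apply: etrans (f_equal2 +%R e1 e2) _; rewrite /driftop; ring.
Qed.

Let lam := drift_rate nu L.

Let lam_ge0 : 0 <= lam.
Proof. by rewrite addr_ge0// divr_ge0 ?sqr_ge0// ltW. Qed.

(** The derivative of the weight produces exactly the multiple of the weighted square of v that
    [drift_coercive] requires. The norm of the time derivative is then recovered from the equation,
    as [driftop v] minus [drift v]. *)
Lemma energy_estimate v K : VY v -> 0 <= K -> (forall w, VX w -> `|driftop v w| <= K * nX w) ->
  normY T Om v <= energy_const nu L T * (K + L2norm mu Om (tr v 0)).
Proof.
move=> Yv K0 hK; have Xv := Y_X Yv; have v2 := spX_L2 Xv.
pose th t := expR (- lam * t).
have e1 := Y_parts T_gt0 oOm bOm Yv (is_derive_exp (- lam)) (@cont_exp' _ (- lam)).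
rewrite mulr0 expR0 mul1r in e1.
have eth t : J t -> expR (- lam * T) <= th t.
  by rewrite /= in_itv /= => /andP[t0 tT]; rewrite ler_expR ler_wnM2l ?oppr_le0// ltW.
have th1 t : J t -> `|th t| <= 1.
  rewrite /= in_itv /= => /andP[t0 tT]; rewrite ger0_norm ?expR_ge0// -expR0 ler_expR.
  by rewrite mulNr oppr_le0 mulr_ge0// ltW.
have h1 := drift_coercive (@cont_exp _ (- lam)) (expR_ge0 _) eth Xv.
have Xt := X_tc (@cont_exp _ (- lam)) Xv.
have h2 := le_trans (hK _ Xt) (ler_wpM2l K0 (normX_time_le oOm bOm (@cont_exp _ (- lam)) th1 ler01 Xv)).
rewrite mul1r in h2.
have e2 : \int[P]_(z in Q) (- lam * expR (- lam * z.1) * (v z * v z)) =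
    - lam * \int[P]_(z in Q) (expR (- lam * z.1) * v z * v z).
  rewrite -RintegralZl//; last exact: (I_time (@cont_exp _ (- lam)) v2 v2).
  by apply: eq_Rintegral => z _; rewrite !mulrA.
rewrite e2 in e1; rewrite /normY (L2norm_sqr mOm (traceT_L2 T_gt0 oOm bOm Yv)).
have hD := dt_dual Yv.
apply: (energy_numeric (I := ipL P Q v v)) => //.
- exact: (L2norm_ge0 mOm (trace0_L2 T_gt0 oOm bOm Yv)).
- exact: (normX_ge0 oOm).
- exact: (ip_ge0 sL (traceT_L2 T_gt0 oOm bOm Yv)).
- exact: (ip_ge0 sLQ).
- exact: (dual_norm_ge0 sX nXE).
- rewrite (L2norm_sqr mOm (trace0_L2 T_gt0 oOm bOm Yv)) (normX_sqr oOm bOm Xv).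
  move: h1 h2 e1; rewrite /driftop -/lam => h1; rewrite ler_norml => /andP[_ h2] e1.
  exact: energy_combine h1 h2 e1.
- apply: (dualnorm_bnd sX nXE).
    by rewrite !addr_ge0 ?mulr_ge0 ?sqrtr_ge0 ?(normX_ge0 oOm Xv)// ltW.
  move=> w Xw; rewrite (_ : dtv v w = driftop v w - drift v w); last by rewrite /driftop addrK.
  apply: le_trans (ler_normB _ _) _; rewrite -addrA mulrDl.
  exact: lerD (hK _ Xw) (drift_le Xv Xw).
Qed.

End drift.

Lemma annihilator_numeric {R : realFieldType} (I X l t B N nu : R) : I + nu * X <= l * t + 2 * B ->
  2 * B + l * t = - N -> 0 <= I -> 0 <= N -> nu * X <= 0.
Proof. by move=> h1 h2 h3 h4; move: (nu * X) (l * t) h1 h2 => a b; lra. Qed.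

(** * Products of functions of time and space in Y_0 *)

Section tensor_Y0.
Context {R : realType} {n : nat}.
Variables (T : R) (Om : set 'rV[R]_n.+1).
Hypotheses (T_gt0 : 0 < T) (oOm : open Om) (bOm : bounded_set Om).
Local Notation mu := (@lebesgue_rV R n.+1).
Local Notation leb := (@lebesgue_measure R).
Local Notation E := 'rV[R]_n.+1.
Local Notation pt := (measurableTypeR R * 'rV[R]_n.+1)%type.
Local Notation J := (`]0, T[%classic : set (measurableTypeR R)).
Local Notation Q := (QT T Om : set pt).
Local Notation P := (@lebQ R n.+1).
Local Notation VX := (spX T Om).
Local Notation nX := (normX T Om).
Implicit Types (v w : pt -> R) (th dth : R -> R) (g : E -> R).

Let mOm : measurable Om. Proof. exact: open_rV_measurable. Qed.
Let Omoo : (mu Om < +oo)%E. Proof. exact: bounded_lty. Qed.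
Let mJ : measurable J. Proof. exact: measurable_itv. Qed.
Let mQ : measurable Q. Proof. exact: measurable_QT. Qed.
Let sL := @ipL_semi _ _ R mu Om mOm.
Let sLQ := @ipL_semi _ _ R P Q mQ.
Let nXE := @normXE _ _ T Om oOm.

Lemma H10_L2 g : H10 Om g -> L2 mu Om g.
Proof. by move=> [dg []]. Qed.

Lemma ipL_dual f : L2 P Q f -> dual VX nX (ipL P Q f).
Proof.
move=> f2; split.
  move=> a v w /spX_L2 v2 /spX_L2 w2.
  by rewrite -(ipZr sLQ a v2 f2) -(ipDr sLQ (L2Z mQ a v2) w2 f2).
have [C C0 hC] := poincareX T oOm bOm.
exists (Num.sqrt (ipL P Q f f) * Num.sqrt C) => v Xv.
apply: le_trans (ip_le sLQ f2 (spX_L2 Xv)) _; rewrite -mulrA ler_wpM2l ?sqrtr_ge0//.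
by rewrite nXE// -sqrtrM// ler_wsqrtr// hC.
Qed.

Lemma parts_test th dth phi : (forall x : R, is_derive x (1 : R) th (dth x)) -> continuous dth ->
  test_fun `]0, T[%classic phi ->
  \int[leb]_(t in J) (dth t * phi t) = - \int[leb]_(t in J) (th t * derive1 phi t).
Proof.
move=> hth cdth tphi; have cth := is_derive_continuous hth.
have cp := test_continuous tphi; have dp := test_derive1 tphi; have cdp := test_continuous dp.
have c1 : continuous (fun t => dth t * phi t) by move=> x; apply: cvgM; [exact: cdth|exact: cp].
have c2 : continuous (fun t => th t * derive1 phi t) by move=> x; apply: cvgM; [exact: cth|exact: cdp].
have hd (x : R) : is_derive x (1 : R) (fun t => th t * phi t) (dth x * phi x + th x * derive1 phi x).
  have h1 := hth x; have h2 := smooth_is_derive x (test_smooth tphi).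
  apply: is_derive_eq; rewrite /GRing.scale /=; ring.
have cd : continuous (fun x => dth x * phi x + th x * derive1 phi x).
  by move=> x; apply: cvgD; [exact: c1|exact: c2].
have := FTC_itv hd cd (ltW T_gt0).
rewrite (test_eq0 (x := T) tphi) ?(test_eq0 (x := 0) tphi); last 2 first.
- by rewrite /= in_itv /= ltxx.
- by rewrite /= in_itv /= ltxx andbF.
rewrite !mulr0 subrr RintegralD//; [|exact: (L1_cont T c1)|exact: (L1_cont T c2)].
by move/eqP; rewrite addr_eq0 => /eqP.
Qed.

Lemma tensor_is_dt th dth g : (forall x : R, is_derive x (1 : R) th (dth x)) -> continuous dth ->
  H10 Om g -> is_dt T Om (fun z => th z.1 * g z.2) (ipL P Q (fun z => dth z.1 * g z.2)).
Proof.
move=> hth cdth Hg; have cth := is_derive_continuous hth; have g2 := H10_L2 Hg.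
have d2 := L2_tensor oOm bOm (L2J_cont T cdth) g2; split; first exact: ipL_dual.
move=> phi h tphi /H10_L2 h2.
have I1 : L1 leb J (fun t => dth t * phi t) by exact: (L2M mJ (L2J_cont T cdth) (test_L2J tphi)).
have I2 : L1 leb J (fun t => th t * derive1 phi t).
  exact: (L2M mJ (L2J_cont T cth) (test_L2J (test_derive1 tphi))).
have I3 := L2M mOm g2 h2.
transitivity (\int[P]_(z in Q) ((dth z.1 * phi z.1) * (g z.2 * h z.2))).
  by apply: eq_Rintegral => z _; ring.
rewrite (Rintegral_tensor oOm I1 I3) (parts_test hth cdth tphi) mulNr; congr (- _).
rewrite -(Rintegral_tensor oOm I2 I3).
by apply: eq_Rintegral => z _; ring.
Qed.

Lemma tensor_is_crep th g : continuous th -> H10 Om g ->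
  is_crep T Om (fun z => th z.1 * g z.2) (fun t x => th t * g x).
Proof.
move=> cth Hg; have g2 := H10_L2 Hg; split.
- by move=> t _; exact: (L2Z mOm (th t) g2).
- move=> t0 _ e e0; set s := Num.sqrt (ipL mu Om g g).
  have s1 : 0 < s + 1 by rewrite ltr_wpDl// sqrtr_ge0.
  have es : 0 < e / (s + 1) by rewrite divr_gt0.
  have /cvgrPdist_lt/(_ _ es)/nbhs_ballP[d /= d0 hd] := cth t0.
  exists d => // t _ td; have {}hd : `|th t0 - th t| < e / (s + 1).
    by apply: hd; rewrite /ball /= distrC.
  have -> : (fun x => th t * g x - th t0 * g x) = (th t - th t0) *: g.
    by apply/funext => x; rewrite !fctE /GRing.scale /= mulrBl.
  have z2 := L2Z mOm (th t - th t0) g2.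
  rewrite (L2normE mOm z2) (ipZl sL _ g2 z2) (ipZr sL _ g2 g2) mulrA -expr2 sqrtrM ?sqr_ge0//.
  rewrite sqrtr_sqr distrC; move: hd; rewrite ltr_pdivlMr// => hd; apply: le_lt_trans hd.
  by rewrite ler_wpM2l// lerDl.
- by apply: aeW => t _; exact: aeW.
Qed.

Lemma tensor_Y0 th dth g : (forall x : R, is_derive x (1 : R) th (dth x)) -> continuous dth ->
  H10 Om g -> th 0 = 0 -> spY0 T Om (fun z => th z.1 * g z.2).
Proof.
move=> hth cdth Hg th0; have cth := is_derive_continuous hth.
have Yt : spY T Om (fun z => th z.1 * g z.2).
  split; first exact: (X_tensor_cont T oOm bOm cth Hg).
  by eexists; exact: tensor_is_dt hth cdth Hg.
split => //; have t0 : 0 <= (0 : R) <= T by rewrite lexx ltW.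
have := crep_unique T_gt0 oOm (traceP T_gt0 oOm bOm Yt) (tensor_is_crep cth Hg) t0.
by apply: filterS => x h /h ->; rewrite th0 mul0r.
Qed.

Lemma H10_orth0 f : L2 mu Om f -> (forall g, H10 Om g -> ipL mu Om f g = 0) -> ipL mu Om f f = 0.
Proof.
move=> f2 h; apply: (L2_eq0_ipL mOm f2); apply: (fundamental_ae0 oOm (L1_finite_L2 mOm Omoo f2)).
move=> q k qO; apply: h; exists (cgrad (rbump q k)); apply: (test_H10 oOm bOm).
exact: test_boxbump.
Qed.

End tensor_Y0.

(** * Density of the range of the drift operator *)

Section drift_dense.
Context {R : realType} {n : nat}.
Variables (T : R) (Om : set 'rV[R]_n.+1).
Hypotheses (T_gt0 : 0 < T) (oOm : open Om) (bOm : bounded_set Om).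
Local Notation mu := (@lebesgue_rV R n.+1).
Local Notation E := 'rV[R]_n.+1.
Local Notation pt := (measurableTypeR R * 'rV[R]_n.+1)%type.
Local Notation J := (`]0, T[%classic : set (measurableTypeR R)).
Local Notation Q := (QT T Om : set pt).
Local Notation P := (@lebQ R n.+1).
Local Notation VX := (spX T Om).
Local Notation VY0 := (spY0 T Om).
Local Notation nX := (normX T Om).
Local Notation tr := (trace T Om).
Implicit Types (v w : pt -> R).

Let mOm : measurable Om. Proof. exact: open_rV_measurable. Qed.
Let mQ : measurable Q. Proof. exact: measurable_QT. Qed.
Let sL := @ipL_semi _ _ R mu Om mOm.
Let sLQ := @ipL_semi _ _ R P Q mQ.
Let sX := @ipX_semi R n T Om oOm bOm.
Let nXE := @normXE _ _ T Om oOm.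

Variables (nu L : R) (beta : pt -> E).
Hypotheses (nu_gt0 : 0 < nu) (L_ge0 : 0 <= L).
Hypothesis mbeta : forall i, measurable_fun Q (fun z => beta z ord0 i).
Hypothesis hbeta : forall z, Q z -> enorm (beta z) <= L.
Local Notation dr := (drift T Om nu beta).
Local Notation A := (driftop T Om nu beta).

(* An element orthogonal to the range solves the adjoint backward problem with
   zero final value, so the energy identity makes it vanish. *)
Lemma driftop_annihilator w : VX w -> (forall v, VY0 v -> A v w = 0) -> ipX T Om w w = 0.
Proof.
move=> Xw hw; have w2 := spX_L2 Xw.
have dw := drift_dualr oOm bOm nu_gt0 L_ge0 mbeta hbeta Xw.
have key (th dth : R -> R) (g : E -> R) : (forall x : R, is_derive x (1 : R) th (dth x)) -> continuous dth ->
    H10 Om g -> th 0 = 0 ->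
    ipL P Q (fun z => dth z.1 * g z.2) w + dr (fun z => th z.1 * g z.2) w = 0.
  move=> hth cdth Hg th0; have Y0t := tensor_Y0 T_gt0 oOm bOm hth cdth Hg th0.
  rewrite -(hw _ Y0t) /driftop; congr (_ + _).
  by rewrite (dt_unique oOm bOm (Y0_Y Y0t) (tensor_is_dt T_gt0 oOm bOm hth cdth Hg) Xw).
(* Weights compactly supported in ]0, T[ turn the orthogonality into the definition of the weak
   derivative, which puts [w] into Y. *)
have wD : is_dt T Om w (dr^~ w).
  split=> // phi g tphi Hg; have p0 : phi 0 = 0.
    by apply: (test_eq0 tphi); rewrite /= in_itv /= ltxx.
  have := key _ _ g (fun x => smooth_is_derive x (test_smooth tphi)) (test_continuous (test_derive1 tphi)) Hg p0.
  move/eqP; rewrite addrC addr_eq0 => /eqP ->; congr (- _).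
  by apply: eq_Rintegral => z _; ring.
have Yw : spY T Om w by split=> //; exists (dr^~ w).
have dtw z : VX z -> dt T Om w z = dr z w by move=> Xz; exact: (dt_unique oOm bOm Yw wD Xz).
(* The weight [id] is admissible since it vanishes at 0; comparing with integration by parts leaves
   T times the pairing of the final value with [g]. *)
have wT : ipL mu Om (tr w T) (tr w T) = 0.
  apply: (H10_orth0 oOm bOm (traceT_L2 T_gt0 oOm bOm Yw)) => g Hg.
  have hid (x : R) : is_derive x (1 : R) id (1 : R) by exact: is_derive_id.
  have c1 : continuous (fun _ : R => 1 : R) by move=> x; exact: cvg_cst.
  have k1 := key id _ g hid c1 Hg erefl.
  have k2 := Y_tensor_parts T_gt0 oOm bOm Yw Hg hid c1.
  rewrite mul0r subr0 (dtw _ (X_tensor_cont T oOm bOm (is_derive_continuous hid) Hg)) in k2.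
  have e : \int[P]_(z in Q) (1 * (w z * g z.2)) = ipL P Q (fun z => 1 * g z.2) w.
    by apply: eq_Rintegral => z _; ring.
  rewrite e addrC k1 in k2; apply/eqP; move/esym/eqP: k2.
  by rewrite mulf_eq0 (gt_eqF T_gt0).
(* The adjoint equation runs backwards, so the weight exp (lam t) increases; it is at least 1, and
   the boundary term at T is already known to vanish. *)
pose lam := drift_rate nu L; have lam0 : 0 <= lam.
  by rewrite addr_ge0// divr_ge0 ?sqr_ge0// ltW.
have hd := is_derive_exp lam; have cd := @cont_exp' _ lam; have ce := @cont_exp _ lam.
have e1 := Y_parts T_gt0 oOm bOm Yw hd cd.
rewrite wT mulr0 mulr0 expR0 mul1r sub0r in e1.
have eth t : J t -> 1 <= expR (lam * t).
  rewrite /= in_itv /= => /andP[t0 _]; rewrite -expR0 ler_expR mulr_ge0// ltW//.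
have h1 := drift_coercive oOm bOm nu_gt0 mbeta hbeta ce ler01 eth Xw.
rewrite (dtw _ (X_time_cont oOm bOm ce Xw)) in e1.
rewrite (drift_timel oOm bOm nu mbeta hbeta ce Xw Xw) in e1.
have [M _ hM] := bounded_cont T ce.
have e2 : \int[P]_(z in Q) (lam * expR (lam * z.1) * (w z * w z)) =
    lam * \int[P]_(z in Q) (expR (lam * z.1) * w z * w z).
  rewrite -RintegralZl//; last exact: (L2M mQ (L2_time oOm (cont_measurable ce) hM w2) w2).
  by apply: eq_Rintegral => z _; rewrite !mulrA.
rewrite e2 in e1; rewrite mul1r in h1.
have X0 := ip_ge0 sX Xw; have L0 := ip_ge0 sLQ w2.
have N0 := ip_ge0 sL (trace0_L2 T_gt0 oOm bOm Yw).
apply/eqP; rewrite eq_le X0 andbT -(pmulr_rle0 _ nu_gt0).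
exact: annihilator_numeric h1 e1 L0 N0.
Qed.

(** The representers of the functionals [A v] form a subspace whose orthogonal complement is null,
    so they come close to the representer of [l]; by Cauchy-Schwarz this is closeness of
    functionals. *)
Lemma driftop_dense l : dual VX nX l -> forall e, 0 < e ->
  exists2 v, VY0 v & forall w, VX w -> `|A v w - l w| <= e * nX w.
Proof.
move=> hl e e0; have [Xr hr] := rieszP oOm bOm hl.
pose M : set (pt -> R) := [set m | VX m /\ exists2 v, VY0 v & forall w, VX w -> A v w = ipX T Om m w].
have [[X0 s] _ lX _] := sX; have [Y00 sY0] := Y0_subspace T_gt0 oOm bOm.
have sM : subspace M.
  have lin a m m' : M m -> M m' -> M (a *: m + m').
    move=> [Xm [v Yv hv]] [Xm' [v' Yv' hv']]; split; first exact: s.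
    exists (fun z => a * v z + v' z); first exact: sY0.
    move=> w Xw; have := driftop_lin oOm bOm nu mbeta hbeta a (Y0_Y Yv) (Y0_Y Yv') Xw.
    by move=> ->; rewrite hv// hv'// lX.
  split=> //; split=> //.
  (* Zero is written as a combination of itself so that linearity of the operator gives the value
     0. *)
  exists (fun z => -1 * (0 : pt -> R) z + (0 : pt -> R) z); first exact: (sY0 (-1) _ _ Y00 Y00).
  move=> w Xw; rewrite (ip0l sX Xw).
  rewrite (driftop_lin oOm bOm nu mbeta hbeta (-1) (Y0_Y Y00) (Y0_Y Y00) Xw).
  by rewrite mulN1r addNr.
have MX : M `<=` VX by move=> m [].
have e2 : 0 < e ^+ 2 by rewrite exprn_gt0.
have [|m [Xm [v Yv hv]] hm] := ip_dense sX (ipX_complete oOm bOm) sM MX Xr _ e2.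
  move=> w Xw hM; apply: (driftop_annihilator Xw) => v Yv.
  have [Xm hm] := rieszP oOm bOm (driftop_dual oOm bOm nu_gt0 L_ge0 mbeta hbeta (Y0_Y Yv)).
  rewrite hm// (ipC sX Xm Xw); apply: hM; split=> //; by exists v.
exists v => // w Xw; rewrite hv// hr// -(ipBl sX Xm Xr Xw).
apply: le_trans (ip_le sX (subspaceB (conj X0 s) Xm Xr) Xw) _.
have h1 : Num.sqrt (ipX T Om (riesz T Om l - m) (riesz T Om l - m)) <= e.
  by rewrite -[leRHS](ger0_norm (ltW e0)) -sqrtr_sqr ler_wsqrtr// ltW.
have h2 := le_trans (eq_ind _ (fun x => Num.sqrt x <= _) (lexx _) _ (ip_subC sX Xr Xm)) h1.
by apply: le_trans (ler_wpM2r (sqrtr_ge0 _) h2) _; rewrite (nXE Xw).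
Qed.

End drift_dense.

(** * Hamiltonians *)

Section enorm_bound.
Context {R : realType} {n : nat}.
Implicit Types p q : 'rV[R]_n.

Lemma enorm_le_max p N : 0 <= N -> (forall i, `|p ord0 i| <= N) -> enorm p <= Num.sqrt n%:R * N.
Proof.
move=> N0 h; rewrite -[X in _ * X](ger0_norm N0) -sqrtr_sqr -sqrtrM// ler_wsqrtr//.
apply: (@le_trans _ _ (\sum_(i < n) N ^+ 2)).
  by apply: ler_sum => i _; rewrite -expr2 -real_normK ?num_real// lerXn2r ?nnegrE.
by rewrite sumr_const card_ord mulr_natl.
Qed.

Lemma coord_le_norm p i : `|p ord0 i| <= `|p|.
Proof.
rewrite [leRHS]/Num.norm /= mx_normrE.
exact: (le_bigmax _ (fun i : 'I_1 * 'I_n => `|p i.1 i.2|) (ord0, i)).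
Qed.

Lemma enorm_le_norm p : enorm p <= Num.sqrt n%:R * `|p|.
Proof. by apply: enorm_le_max => // i; exact: coord_le_norm. Qed.

Lemma enormB p q : enorm (p - q) = enorm (q - p).
Proof. by rewrite /enorm (ip_subC dotv_semi). Qed.

Lemma enorm_leD p q : enorm (p + q) <= enorm p + enorm q.
Proof. exact: (ip_sqrt_leD dotv_semi). Qed.

Lemma measurable_enorm d (X : measurableType d) (D : set X) (g : X -> 'rV[R]_n) :
  (forall i, measurable_fun D (fun x => g x ord0 i)) -> measurable_fun D (fun x => enorm (g x)).
Proof.
move=> mg; apply: (measurableT_comp measurable_sqrt); apply: measurable_sum => i.
exact: measurable_funM.
Qed.

Lemma rat_dense p e : 0 < e -> exists q : 'rV[rat]_n, enorm (p - map_mx ratr q) < e.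
Proof.
move=> e0; pose s := Num.sqrt n%:R + 1 : R; have s0 : 0 < s by rewrite ltr_wpDl.
have es : 0 < e / s by rewrite divr_gt0.
have /choice[q hq] : forall i, exists r : rat, `|p ord0 i - ratr r| < e / s.
  move=> i; have h : p ord0 i - e / s < p ord0 i + e / s by rewrite ltrBlDr -addrA ltrDl addr_gt0.
  have [r] := rat_in_itvoo h.
  rewrite in_itv /= => /andP[h1 h2]; exists r; rewrite ltr_norml; apply/andP; split; lra.
exists (\row_i q i); apply: le_lt_trans (enorm_le_max (ltW es) _) _.
  by move=> i; rewrite !mxE ltW.
by rewrite mulrCA gtr_pMr// ltr_pdivrMr// mul1r ltrDl.
Qed.

End enorm_bound.

(** * Convex functions with Lipschitz gradient *)

Section smooth_convex.
Context {R : realType} {n : nat}.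
Implicit Types p q v : 'rV[R]_n.
Variable h : 'rV[R]_n -> R.
Hypothesis dh : forall p, differentiable h p.

Lemma derive_cgrad p v : 'D_v h p = dotv (cgrad h p) v.
Proof.
rewrite deriveE// {1}(row_sum_delta v) linear_sum /dotv; apply: eq_bigr => i _.
by rewrite linearZ /= mxE deriveE// mulrC.
Qed.

Lemma derive_cvg p v :
  (fun k : nat => k.+1%:R * (h (k.+1%:R^-1 *: v + p) - h p)) @ \oo --> dotv (cgrad h p) v.
Proof.
rewrite -derive_cgrad; have hd : derivable h p v by exact: diff_derivable.
have c : (@harmonic R) @ \oo --> (0 : R)^'.
  move=> B hB; have := @cvg_harmonic R _ hB; rewrite /nbhs /=.
  by apply: filterS => k; apply; rewrite invr_eq0 pnatr_eq0.
have := cvg_comp _ _ c hd; rewrite -/('D_v h p); apply: cvg_trans.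
apply: near_eq_cvg; near=> k; rewrite /= invrK /GRing.scale /=.
by [].
Unshelve. all: end_near. Qed.

Lemma derive_le p v C : (forall t, 0 < t <= 1 -> h (t *: v + p) - h p <= t * C) ->
  dotv (cgrad h p) v <= C.
Proof.
move=> hC; rewrite -(cvg_lim (@Rhausdorff R) (@derive_cvg p v)).
apply: limr_le; last first.
  apply: nearW => k; rewrite mulrC -ler_pdivlMr ?ltr0n// mulrC; apply: hC.
  by rewrite invr_gt0 ltr0n /= invf_le1// ler1n.
by apply/cvg_ex; eexists; exact: derive_cvg.
Qed.

(** The derivative in the direction of the gradient itself is the square of its norm. *)
Lemma lipschitz_cgrad L p : 0 <= L -> (forall p q, `|h p - h q| <= L * enorm (p - q)) -> enorm (cgrad h p) <= L.
Proof.
move=> L0 hL; have := @derive_le p (cgrad h p) (L * enorm (cgrad h p)).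
rewrite -enorm_sqr => hd.
have [e0|e0] := leP (enorm (cgrad h p)) 0; first exact: le_trans e0 L0.
rewrite -(ler_pM2r e0) -expr2; apply: hd => t /andP[t0 t1].
apply: le_trans (ler_norm _) _; apply: le_trans (hL _ _) _.
by rewrite addrK enormZ gtr0_norm// mulrCA.
Qed.

Hypothesis ch : forall p q t, 0 <= t <= 1 -> h (t *: q + (1 - t) *: p) <= t * h q + (1 - t) * h p.

Lemma convex_cgrad p q : h p + dotv (cgrad h p) (q - p) <= h q.
Proof.
rewrite -lerBrDl; apply: derive_le => t /andP[t0 t1].
have := ch p q (t := t); rewrite (ltW t0) t1 => /(_ isT).
rewrite (_ : t *: q + _ = t *: (q - p) + p); first by lra.
by rewrite scalerBr scalerBl scale1r addrCA addrC.
Qed.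

Variable L : R.
Hypothesis L_gt0 : 0 < L.
Hypothesis gL : forall p q, enorm (cgrad h p - cgrad h q) <= L * enorm (p - q).

(** The tangent inequality at [q] replaces integration along the segment. The price is the constant
    L instead of L / 2, which is why [cocoercive] has the factor 4. *)
Let descent p q : h q <= h p + dotv (cgrad h p) (q - p) + L * dotv (q - p) (q - p).
Proof.
have := convex_cgrad q p; have := dotv_le (cgrad h q - cgrad h p) (q - p).
have h1 := ler_wpM2r (enorm_ge0 (q - p)) (gL q p).
have : dotv (cgrad h q) (p - q) = - dotv (cgrad h q) (q - p).
  by rewrite -opprB -scaleN1r dotvZr mulN1r.
rewrite dotvBl ler_norml => e /andP[_ h2]; rewrite e.
rewrite -enorm_sqr expr2 mulrA; lra.
Qed.

(* Compare the descent inequality for the step of length 1/(2L) from q along the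
   gradient difference with the tangent plane at p. *)
Lemma cocoercive p q : dotv (cgrad h q - cgrad h p) (cgrad h q - cgrad h p) <=
  4 * L * (h q - h p - dotv (cgrad h p) (q - p)).
Proof.
set g := cgrad h q - cgrad h p; pose y := q - (2 * L)^-1 *: g.
have h1 := convex_cgrad p y; have h2 := descent q y.
have e1 : y - q = (- (2 * L)^-1) *: g by rewrite /y addrC addKr scaleNr.
have e2 : y - p = (q - p) + (- (2 * L)^-1) *: g by rewrite /y addrAC scaleNr.
rewrite e1 !dotvZr dotvZl in h2; rewrite e2 dotvDr dotvZr in h1.
have e3 : dotv g g = dotv (cgrad h q) g - dotv (cgrad h p) g by rewrite -dotvBl.
move: h1 h2; rewrite e3; move: (dotv (cgrad h q) g) (dotv (cgrad h p) g) (dotv (cgrad h p) (q - p)).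
move: (h y) (h p) (h q) => a b c x z w h1 h2.
have e4 : L * (- (2 * L)^-1 * (- (2 * L)^-1 * (x - z))) = (4 * L)^-1 * (x - z).
  by field; rewrite lt0r_neq0.
have e5 : (2 * L)^-1 = 2 * (4 * L)^-1 by field; rewrite lt0r_neq0.
rewrite e4 e5 in h2; rewrite e5 in h1.
have L4 : 0 < 4 * L by rewrite mulr_gt0.
rewrite -ler_pdivrMl//; lra.
Qed.

End smooth_convex.

Section uniform_bound.
Context {R : realType} {M A : pseudoMetricType R} {W : normedModType R}.

Lemma unif_continuous_bounded (K : set M) (h : M -> A -> W) : compact K -> compact [set: A] ->
  unif_continuous_on K h -> exists C, forall z a, K z -> `|h z a| <= C.
Proof.
move=> cK cA uh.
have : compact ((fun za => h za.1 za.2) @` (K `*` [set: A])).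
  apply: continuous_compact; last exact: compact_setX.
  apply/subspace_continuousP => -[z a] [/= Kz _]; apply/cvgrPdist_lt => e e0.
  have [d d0 hd] := uh _ e0; rewrite near_withinE; apply/nbhs_ballP; exists d => //= -[z' a'] [/= bz ba] [Kz' _].
  exact: hd.
move=> /compact_bounded/bounded_norm[C hC]; exists C => z a Kz; apply: hC.
by exists (z, a).
Qed.

End uniform_bound.

(** * Regularity and measurability of the Hamiltonian *)

Section hamiltonian.
Context {R : realType} {n : nat}.
Variables (T : R) (Om : set 'rV[R]_n).
Hypotheses (oOm : open Om) (bOm : bounded_set Om).
Local Notation E := 'rV[R]_n.
Local Notation pt := (measurableTypeR R * 'rV[R]_n)%type.
Local Notation Q := (QT T Om : set pt).
Variable (A : pseudoMetricType R).
Variables (b : R * E -> A -> E) (f : R * E -> A -> R) (LH : R).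
Hypotheses (cA : compact [set: A]) (A0 : [set: A] !=set0).
Hypotheses (ub : unif_continuous_on (QTbar T Om) b) (uf : unif_continuous_on (QTbar T Om) f).
Hypothesis hLH : LH = sup [set enorm (b z a) | z in QTbar T Om & a in [set: A]].

Lemma open_QT : open (QT T Om : set (R * E)).
Proof.
rewrite (_ : QT T Om = fst @^-1` `]0, T[%classic `&` snd @^-1` Om); last by apply/seteqP; split.
apply: openI; apply: open_comp => //; first by move=> z _; exact: cvg_fst.
by move=> z _; exact: cvg_snd.
Qed.

Lemma Q_QTbar z : Q z -> QTbar T Om z.
Proof. exact: subset_closure. Qed.

Let cQ : compact (QTbar T Om).
Proof.
have [M hM] := bounded_norm bOm.
pose K : set (R * E) := `[0, T]%classic `*` [set x | `|x| <= M].
have cK : compact K.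
  apply: compact_setX; first exact: segment_compact.
  apply: bounded_closed_compact.
    by exists M; split; [exact: num_real|move=> x Mx y /= yM; exact: le_trans yM (ltW Mx)].
  rewrite (_ : [set x | _] = (fun x : E => `|x|) @^-1` [set r | r <= M])//.
  by apply: closed_comp; [move=> x _; exact: norm_continuous|exact: closed_le].
apply: (subclosed_compact _ cK); first exact: closed_closure.
have -> : K = closure K by apply/closure_id; apply: compact_closed => //; exact: norm_hausdorff.
apply: closure_subset => -[t x] [/= Jt Ox]; split => /=; last exact: hM.
by move: Jt; rewrite !in_itv /= => /andP[/ltW -> /ltW ->].
Qed.

Lemma b_le z a : QTbar T Om z -> enorm (b z a) <= LH.
Proof.
move=> Qz; rewrite hLH; apply: ub_le_sup; last by exists z => //; exists a.
have [C hC] := unif_continuous_bounded cQ cA ub.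
exists (Num.sqrt n%:R * C) => _ [y Qy [a' _ <-]].
by apply: le_trans (enorm_le_norm _) _; rewrite ler_wpM2l// hC.
Qed.

Lemma LH_ge0 z : QTbar T Om z -> 0 <= LH.
Proof. by move=> Qz; have [a _] := A0; exact: le_trans (enorm_ge0 _) (b_le a Qz). Qed.

Local Notation H := (Ham b f).

Let val z p a := dotv (b z a) p - f z a.

Let H_ub z p : QTbar T Om z -> has_ubound [set val z p a | a in [set: A]].
Proof.
move=> Qz; have [C hC] := unif_continuous_bounded cQ cA uf.
exists (LH * enorm p + C) => _ [a _ <-]; rewrite lerD//.
  apply: le_trans (ler_norm _) _; apply: le_trans (dotv_le _ _) _.
  by rewrite ler_wpM2r ?enorm_ge0// b_le.
by apply: le_trans (ler_norm _) _; rewrite normrN hC.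
Qed.

Let H_ge z p a : QTbar T Om z -> val z p a <= H z p.
Proof. by move=> Qz; apply: ub_le_sup; [exact: H_ub|exists a]. Qed.

Let H_le z p C : (forall a, val z p a <= C) -> H z p <= C.
Proof.
move=> h; have [a0 _] := A0; apply: ge_sup; first by exists (val z p a0), a0.
by move=> _ [a _ <-]; exact: h.
Qed.

Lemma Ham_lipschitz z p q : QTbar T Om z -> `|H z p - H z q| <= LH * enorm (p - q).
Proof.
move=> Qz; have h p' q' : H z p' <= H z q' + LH * enorm (p' - q').
  apply: H_le => a; apply: (@le_trans _ _ (val z q' a + dotv (b z a) (p' - q'))).
    by rewrite /val dotvBr; lra.
  rewrite lerD ?H_ge//; apply: le_trans (ler_norm _) _; apply: le_trans (dotv_le _ _) _.
  by rewrite ler_wpM2r ?enorm_ge0// b_le.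
rewrite ler_norml; have := h q p; have := h p q; rewrite (enormB q p).
by move=> h1 h2; apply/andP; split; lra.
Qed.

Lemma Ham0_bounded : exists C, forall z, QTbar T Om z -> `|H z 0| <= C.
Proof.
have [C hC] := unif_continuous_bounded cQ cA uf; exists C => z Qz; have [a _] := A0.
have v0 a' : val z 0 a' = - f z a' by rewrite /val dotvC dot0v sub0r.
rewrite ler_norml; apply/andP; split.
  apply: le_trans (H_ge 0 a Qz); rewrite v0 lerN2; exact: le_trans (ler_norm _) (hC _ _ Qz).
apply: H_le => a'; rewrite v0; apply: le_trans (ler_norm _) _; rewrite normrN; exact: hC.
Qed.

Lemma Ham_convex z p q t : QTbar T Om z -> 0 <= t <= 1 ->
  H z (t *: q + (1 - t) *: p) <= t * H z q + (1 - t) * H z p.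
Proof.
move=> Qz /andP[t0 t1]; apply: H_le => a; rewrite /val dotvDr !dotvZr.
have h1 := ler_wpM2l t0 (H_ge q a Qz).
have s0 : 0 <= 1 - t by rewrite subr_ge0.
have h2 := ler_wpM2l s0 (H_ge p a Qz).
by move: h1 h2; rewrite /val; move: (dotv _ _) (dotv _ _) (f _ _) (H z p) (H z q) => x y w u v; lra.
Qed.

(** The functions under the supremum are equicontinuous in [z], uniformly in the control. *)
Lemma Ham_continuous p : {in (QT T Om : set (R * E)), continuous (H^~ p)}.
Proof.
move=> z; rewrite inE => Qz; apply/cvgrPdist_lt => e e0.
pose c := Num.sqrt n%:R * enorm p + 1; have c0 : 0 < c.
  by rewrite ltr_wpDl// mulr_ge0// enorm_ge0.
have ec : 0 < e / 2 / c by rewrite !divr_gt0.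
have [d d0 hd] := ub ec; have [d' d'0 hd'] := uf ec.
have nQ : nbhs z (QT T Om) by apply: open_nbhs_nbhs; split => //; exact: open_QT.
have key z1 z2 : QTbar T Om z1 -> QTbar T Om z2 -> ball z1 d z2 -> ball z1 d' z2 ->
    H z1 p <= H z2 p + e / 2.
  move=> Q1 Q2 b1 b2; apply: H_le => a; have aa r : 0 < r -> ball a r a by exact: ballxx.
  have h1 := hd _ _ _ _ Q1 Q2 b1 (aa _ d0); have h2 := hd' _ _ _ _ Q1 Q2 b2 (aa _ d'0).
  have h3 := H_ge p a Q2.
  have h4 : dotv (b z1 a - b z2 a) p <= Num.sqrt n%:R * (e / 2 / c) * enorm p.
    apply: le_trans (ler_norm _) _; apply: le_trans (dotv_le _ _) _.
    rewrite ler_wpM2r ?enorm_ge0//; apply: le_trans (enorm_le_norm _) _.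
    by rewrite ler_wpM2l// ltW.
  have h5 : f z2 a - f z1 a <= e / 2 / c.
    by apply: ltW; apply: le_lt_trans (ler_norm _) _; rewrite distrC.
  have h6 : Num.sqrt n%:R * (e / 2 / c) * enorm p + e / 2 / c = e / 2.
    rewrite mulrAC -[X in _ + X]mul1r -mulrDl -/c [c * _]mulrC divfK// lt0r_neq0//.
  by move: h3; rewrite /val dotvBl in h4 *; lra.
have nB : nbhs z (QT T Om `&` (ball z d `&` ball z d')).
  by apply: filterI => //; apply: filterI; exact: nbhsx_ballx.
apply: filterS nB => z' [Qz' [b1 b2]].
have k1 := key _ _ (subset_closure Qz) (subset_closure Qz') b1 b2.
have k2 := key _ _ (subset_closure Qz') (subset_closure Qz) (ball_sym b1) (ball_sym b2).
apply: (@le_lt_trans _ _ (e / 2)); last by rewrite ltr_pdivrMr// ltr_pMr// ltr1n.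
by rewrite ler_norml; apply/andP; split; lra.
Qed.

Lemma Ham_measurable p : measurable_fun Q (H^~ p).
Proof.
apply: continuous_prod_measurable; first exact: open_QT.
exact: Ham_continuous.
Qed.

(* A Lipschitz function is the infimum of the cones centred at rational points. *)
Lemma Ham_comp_measurable (g : pt -> E) : (forall i, measurable_fun Q (fun z => g z ord0 i)) ->
  measurable_fun Q (fun z => H z (g z)).
Proof.
move=> mg; have mQ : measurable Q by exact: measurable_QT.
(* An enumeration of the rational points; numbers that are not codes give the point 0. *)
pose pk (k : nat) : E := if unpickle k is Some q then map_mx ratr (q : 'rV[rat]_n) else 0.
pose cone k z := H z (pk k) + LH * enorm (g z - pk k).
have cone_ge k z : Q z -> H z (g z) <= cone k z.
  move=> Qz; have := Ham_lipschitz (g z) (pk k) (Q_QTbar Qz).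
  by rewrite /cone ler_norml => /andP[_]; lra.
have lb z : Q z -> has_lbound (range (cone ^~ z)).
  by move=> Qz; exists (H z (g z)) => _ [k _ <-]; exact: cone_ge.
have mc k : measurable_fun Q (cone k).
  apply: measurable_funD; first exact: Ham_measurable.
  apply: measurable_funM => //; apply: measurable_enorm => i.
  rewrite (_ : (fun x => _) = (fun x => g x ord0 i - pk k ord0 i)); last first.
    by apply/funext => x; rewrite !mxE.
  exact: measurable_funB.
have := measurable_fun_infs 0 lb mc; apply: eq_measurable_fun => z; rewrite inE => Qz.
apply/eqP; rewrite eq_le; apply/andP; split; last first.
  apply: lb_le_inf; first by exists (cone 0 z), 0.
  by move=> _ [k _ <-]; exact: cone_ge.
apply/ler_addgt0Pr => e e0; have L0 := LH_ge0 (Q_QTbar Qz).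
have L1 : 0 < 2 * LH + 1 by rewrite ltr_wpDl// mulr_ge0.
(* A cone exceeds [H z (g z)] by at most 2 LH times the distance from its centre to [g z]. *)
have eL : 0 < e / (2 * LH + 1) by rewrite divr_gt0.
have [q hq] := rat_dense (g z) eL.
have pq : pk (pickle q) = map_mx ratr q by rewrite /pk pickleK.
apply: (@le_trans _ _ (cone (pickle q) z)).
  apply: ge_inf; last by exists (pickle q).
  by exists (H z (g z)) => _ [k _ <-]; exact: cone_ge.
have := Ham_lipschitz (map_mx ratr q) (g z) (Q_QTbar Qz).
rewrite /cone pq (enormB (map_mx _ _)) ler_norml => /andP[_ h1].
move: hq; rewrite ltr_pdivlMr//; have := enorm_ge0 (g z - map_mx ratr q); move: (enorm _) h1 => x h1 x0 h2.
have h3 : 2 * (LH * x) <= e by apply: le_trans (ltW h2); nra.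
by lra.
Qed.

Hypothesis dH : forall z p, QTbar T Om z -> differentiable (H z) p.

Lemma Hp_measurable (g : pt -> E) i : (forall i, measurable_fun Q (fun z => g z ord0 i)) ->
  measurable_fun Q (fun z => Hp H z (g z) ord0 i).
Proof.
move=> mg; have mQ : measurable Q by exact: measurable_QT.
(* A partial derivative is the limit of these quotients, each of them measurable as a combination of
   compositions with H. *)
pose F (k : nat) z := k.+1%:R * (H z (k.+1%:R^-1 *: delta_mx ord0 i + g z) - H z (g z)).
apply: (@measurable_fun_cvg _ _ _ _ F).
  move=> k; apply: measurable_funM => //; apply: measurable_funB; last exact: Ham_comp_measurable.
  apply: Ham_comp_measurable => j.
  rewrite (_ : (fun x => _) = (fun x => (k.+1%:R^-1 *: delta_mx ord0 i : E) ord0 j + g x ord0 j)).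
    exact: measurable_funD.
  by apply/funext => x; rewrite mxE.
move=> z Qz; have := @derive_cvg _ _ (H z) (fun p => dH p (Q_QTbar Qz)) (g z) (delta_mx ord0 i).
by rewrite -derive_cgrad ?/Hp ?mxE// => p; exact: dH (Q_QTbar Qz).
Qed.

Lemma Hp_le z p : QTbar T Om z -> enorm (Hp H z p) <= LH.
Proof.
move=> Qz; apply: lipschitz_cgrad => [p'||p' q]; [exact: dH|exact: LH_ge0 Qz|exact: Ham_lipschitz].
Qed.

Lemma Hp_convex z p q : QTbar T Om z -> H z p + dotv (Hp H z p) (q - p) <= H z q.
Proof.
by move=> Qz; apply: convex_cgrad => [p'|p' q' t]; [exact: dH|exact: Ham_convex].
Qed.

Lemma Hp_cocoercive L z p q : QTbar T Om z -> 0 < L ->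
  (forall p q, enorm (Hp H z p - Hp H z q) <= L * enorm (p - q)) ->
  dotv (Hp H z q - Hp H z p) (Hp H z q - Hp H z p) <=
  4 * L * (H z q - H z p - dotv (Hp H z p) (q - p)).
Proof.
move=> Qz L0 hL; apply: cocoercive => //; first by move=> p'; exact: dH.
by move=> p' q' t; exact: Ham_convex.
Qed.

End hamiltonian.

(** * The error system *)

Section numeric_error.
Context {R : realFieldType}.

Lemma residual1_numeric (nu s U k k' Y W a b c d e : R) : `|a| <= U * W -> `|b| <= nu * U * W ->
  `|c| <= s * U * W -> `|d| <= k * Y * W -> `|e| <= k' * Y * W ->
  `|a + b + c - d - e| <= ((1 + nu + s) * U + (k + k') * Y) * W.
Proof.
move=> h1 h2 h3 h4 h5; apply: le_trans (ler_normB _ _) _.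
apply: le_trans (lerD (ler_normB _ _) (lexx _)) _.
have := ler_normD (a + b) c; have := ler_normD a b.
have -> : ((1 + nu + s) * U + (k + k') * Y) * W =
  U * W + nu * U * W + s * U * W + k * Y * W + k' * Y * W by ring.
by lra.
Qed.

Lemma residual2_numeric (nu s Y q W a b c : R) : `|a| <= Y * W -> `|b| <= nu * Y * W ->
  `|c| <= (q + s * Y) * W -> `|a + b + c| <= ((1 + nu + s) * Y + q) * W.
Proof.
move=> h1 h2 h3; apply: le_trans (ler_normD _ _) _.
have := ler_normD a b.
have -> : ((1 + nu + s) * Y + q) * W = Y * W + nu * Y * W + (q + s * Y) * W by ring.
by lra.
Qed.

Lemma lin_diff2 (a b c x y : R) : a - b + c * (x - y) = a + c * x - (b + c * y).
Proof. ring. Qed.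

(** In the limit U^2 <= C k U, and a positive factor U cancels. *)
Lemma duality_numeric (U C k : R) : 0 <= U -> 0 <= C -> 0 <= k ->
  (forall e, 0 < e -> U ^+ 2 <= C * k * (U + e) + e * U) -> U <= C * k.
Proof.
move=> U0 C0 k0 h; have Ck0 := mulr_ge0 C0 k0.
have h1 : U ^+ 2 <= C * k * U.
  apply: (@ler_eps _ _ _ (C * k + U)); first by rewrite addr_ge0.
  by move=> e e0; apply: le_trans (h e e0) _; lra.
have [U1|U1] := ltP 0 U; last exact: le_trans U1 Ck0.
by rewrite expr2 ler_pM2r in h1.
Qed.

Lemma duality_step (U C e kf ks Y r W x y z : R) : W <= C * (U + e) ->
  `|x + y + z - U ^+ 2| <= e * U -> `|x| <= r * W -> `|y| <= kf * Y * W -> `|z| <= ks * Y * W ->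
  0 <= (kf + ks) * Y + r -> U ^+ 2 <= C * ((kf + ks) * Y + r) * (U + e) + e * U.
Proof.
move=> h1 h2 h3 h4 h5 h0; have h6 := ler_wpM2l h0 h1.
have -> : C * ((kf + ks) * Y + r) * (U + e) = ((kf + ks) * Y + r) * (C * (U + e)) by ring.
have h7 : ((kf + ks) * Y + r) * W = kf * Y * W + ks * Y * W + r * W by ring.
move: h2 (ler_norm x) (ler_norm y) (ler_norm z); rewrite ler_norml => /andP[h2 _].
by move: h6; rewrite h7; lra.
Qed.

(** [a] and [b] stand for the two densities: the cocoercivity bound is multiplied by [a] and the
    tangent inequality by [b]. *)
Lemma coercive_pointwise (L a b h1 h2 x y s : R) : 0 < L -> 0 <= a -> 0 <= b ->
  s <= 4 * L * (h2 - h1 - - x) -> h2 + y <= h1 ->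
  a * s <= 4 * L * (a * x - b * y - (h1 - h2) * (a - b)).
Proof.
move=> L0 a0 b0 h3 h4; have h5 := ler_wpM2l a0 h3.
have h6 : 0 <= 4 * L * (b * (h1 - h2 - y)).
  by apply: mulr_ge0; [rewrite mulr_ge0// ltW|apply: mulr_ge0 => //; lra].
by lra.
Qed.

(** The suffix y marks contributions of the admissible test function and z those of the correction,
    which add up to the density error. Subtracting the residual identities leaves the coupling terms
    at y; monotonicity bounds them by the coupling terms at z, which are small. *)
Lemma gap_numeric (l1y l2u A a B b hy hz fy fz sy sz V e r1 r2 U Y C N W kf ks s : R) :
  l1y = A + a + hy - fy - sy -> l2u = B + b + V -> 0 <= (fy + fz) + (sy + sz) ->
  `|A + a - (B + b)| <= e * U -> `|l1y| <= r1 * N -> `|l2u| <= r2 * U ->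
  `|hz| <= s * U * W -> `|fz| <= kf * Y * W -> `|sz| <= ks * Y * W -> W <= C -> N <= Y + C ->
  0 <= r1 -> 0 <= kf * Y -> 0 <= ks * Y -> 0 <= s * U ->
  V - (hy + hz) <= (r2 + e) * U + r1 * (Y + C) + ((kf + ks) * Y + s * U) * C.
Proof.
move=> e1 e2 m g1 g2 g3 g4 g5 g6 g7 g8 r0 k0 k1 s0.
have j1 := ler_wpM2l r0 g8; have j2 := ler_wpM2l k0 g7; have j3 := ler_wpM2l k1 g7.
have j4 := ler_wpM2l s0 g7.
have -> : V - (hy + hz) = l2u - l1y + (A + a - (B + b)) - (fy + sy) - hz by rewrite e1 e2; ring.
have := ler_norm (A + a - (B + b)); have := ler_norm l2u; have := ler_norm (- l1y).
have := ler_norm (- hz); have := ler_norm fz; have := ler_norm sz; rewrite !normrN.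
move: g1; move: (A + a - (B + b)) => G g1 i1 i2 i3 i4 i5 i6.
have -> : (r2 + e) * U + r1 * (Y + C) + ((kf + ks) * Y + s * U) * C =
  r2 * U + e * U + r1 * (Y + C) + kf * Y * C + ks * Y * C + s * U * C by ring.
by lra.
Qed.

End numeric_error.

(** * Difference quotients as transport fields *)

Section direction.
Context {R : realType} {n : nat}.
Implicit Types (p q : 'rV[R]_n).

(* At d = 0 the division by zero gives the zero vector. *)
Definition slope (c : R) (d : 'rV[R]_n) := (c / dotv d d) *: d.

Lemma slope_dot L c d : `|c| <= L * enorm d -> dotv (slope c d) d = c.
Proof.
move=> h; rewrite /slope dotvZl; have [e|ne] := eqVneq (dotv d d) 0; last by rewrite divfK.
rewrite e mulr0; move: h; rewrite /enorm e sqrtr0 mulr0 normr_le0 => /eqP ->.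
by [].
Qed.

Lemma slope_le L c d : 0 <= L -> `|c| <= L * enorm d -> enorm (slope c d) <= L.
Proof.
move=> L0 h; rewrite /slope enormZ; have [e|ne] := eqVneq (dotv d d) 0.
  by rewrite e invr0 mulr0 normr0 mul0r.
have d0 : 0 < enorm d by rewrite sqrtr_gt0 lt_def ne dotv_ge0.
rewrite normrM normfV [`|dotv d d|]ger0_norm ?dotv_ge0// -enorm_sqr.
by rewrite expr2 invfM mulrA -[X in X <= _]mulrA mulVf ?lt0r_neq0// mulr1 ler_pdivrMr.
Qed.

Lemma measurable_slope dd (X : measurableType dd) (D : set X) (c : X -> R) (g : X -> 'rV[R]_n) i :
  measurable_fun D c -> (forall j, measurable_fun D (fun x => g x ord0 j)) ->
  measurable_fun D (fun x => slope (c x) (g x) ord0 i).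
Proof.
move=> mc mg; have mdot : measurable_fun D (fun x => dotv (g x) (g x)).
  by apply: measurable_sum => j; exact: measurable_funM.
(* On nonnegative numbers, 0 included, the inverse is the real power -1, which is a measurable
   function. *)
rewrite (_ : (fun x => _) = (fun x => c x * (dotv (g x) (g x)) `^ (-1) * g x ord0 i)).
  by apply: measurable_funM => //; apply: measurable_funM => //; exact: (measurableT_comp (measurable_powR _)).
by apply/funext => x; rewrite mxE powR_inv1 ?dotv_ge0.
Qed.

End direction.

(** * Estimates for the error system *)

Section error_system.
Context {R : realType} {n : nat}.
Variables (T : R) (Om : set 'rV[R]_n.+1).
Hypotheses (T_gt0 : 0 < T) (oOm : open Om) (bOm : bounded_set Om).
Local Notation mu := (@lebesgue_rV R n.+1).
Local Notation E := 'rV[R]_n.+1.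
Local Notation pt := (measurableTypeR R * 'rV[R]_n.+1)%type.
Local Notation Q := (QT T Om : set pt).
Local Notation P := (@lebQ R n.+1).
Local Notation VX := (spX T Om).
Local Notation VY := (spY T Om).
Local Notation VY0 := (spY0 T Om).
Local Notation nX := (normX T Om).
Local Notation nY := (normY T Om).
Local Notation dtv := (dt T Om).
Local Notation tr := (trace T Om).
Local Notation gx := (gradx T Om).
Implicit Types (v w : pt -> R) (g : pt -> E).

Let mOm : measurable Om. Proof. exact: open_rV_measurable. Qed.
Let mQ : measurable Q. Proof. exact: measurable_QT. Qed.
Let Qoo : (P Q < +oo)%E. Proof. exact: QT_lty. Qed.
Let sL := @ipL_semi _ _ R mu Om mOm.
Let sLQ := @ipL_semi _ _ R P Q mQ.
Let sVQ := @ipV_semi _ _ R n.+1 P Q mQ.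
Let sX := @ipX_semi R n T Om oOm bOm.
Let nXE := @normXE _ _ T Om oOm.

Lemma ipX_le v w : VX v -> VX w -> `|ipX T Om v w| <= nX v * nX w.
Proof. by move=> Xv Xw; rewrite (nXE Xv) (nXE Xw); exact: (ip_le sX Xv Xw). Qed.

Lemma L2v_scale (c : R) (b : pt -> E) v : (forall i, measurable_fun Q (fun z => b z ord0 i)) ->
  (forall z, Q z -> enorm (b z) <= c) -> L2 P Q v -> L2v P Q (fun z => v z *: b z).
Proof.
move=> mb hb v2 i; rewrite (_ : (fun z => _) = (fun z => b z ord0 i * v z)); last first.
  by apply/funext => z; rewrite mxE mulrC.
apply: (L2_bounded mQ (C := c)) => // z Qz; exact: le_trans (coord_le_enorm _ _) (hb _ Qz).
Qed.

Lemma drift_split nu L (b : pt -> E) v w : (forall i, measurable_fun Q (fun z => b z ord0 i)) ->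
  (forall z, Q z -> enorm (b z) <= L) -> VX v -> VX w ->
  drift T Om nu b v w = nu * ipX T Om v w + ipV P Q (fun z => v z *: b z) (gx w).
Proof.
move=> mb hb Xv Xw; have gv := gradx_L2 Xv; have gw := gradx_L2 Xw.
have v2 := L2v_scale mb hb (spX_L2 Xv).
have nv := subspaceZ nu (@L2v_subspace _ _ R n.+1 P Q mQ) gv.
by rewrite -(ipZl sVQ nu gv gw) -(ipDl sVQ nv v2 gw).
Qed.

Lemma gradxB v w : VX v -> VX w ->
  {ae P, forall z, Q z -> gx (fun z => v z - w z) z = gx v z - gx w z}.
Proof.
move=> Xv Xw; have := gradx_ae oOm bOm (X_grad_lin oOm bOm (-1) (gradxP Xw) (gradxP Xv)).
rewrite (_ : (fun z => -1 * w z + v z) = (fun z => v z - w z)); last by apply/funext => z; ring.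
by apply: filterS => z h /h ->; rewrite scaleN1r addrC.
Qed.

Lemma L2_cst (c : R) : L2 P Q (fun=> c).
Proof. by apply: (L2_bnd mQ (C := `|c|) Qoo). Qed.

Lemma L2_growth (C L : R) (h : pt -> R) g : 0 <= C -> 0 <= L -> measurable_fun Q h -> L2v P Q g ->
  (forall z, Q z -> `|h z| <= C + L * enorm (g z)) -> L2 P Q h.
Proof.
move=> C0 L0 mh g2 hh.
apply: (L2_le mQ mh (L2_lin mQ L (L2_enorm mQ g2) (L2_cst C))) => z Qz.
apply: le_trans (hh _ Qz) _; rewrite addrC; exact: ler_norm.
Qed.

Lemma ipV_coef_le (c : R) g v : (forall i, measurable_fun Q (fun z => g z ord0 i)) -> 0 <= c ->
  (forall z, Q z -> enorm (g z) <= c) -> L2 P Q v ->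
  ipV P Q (fun z => v z *: g z) (fun z => v z *: g z) <= c ^+ 2 * ipL P Q v v.
Proof.
move=> mg c0 hg v2; have vg2 := L2v_scale mg hg v2.
rewrite /ipL -RintegralZl//; last exact: L2M.
apply: ae_le_Rintegral => //; first exact: (L2v_dotv mQ vg2 vg2).
  by apply: L1Z => //; exact: L2M.
apply: aeW => z Qz; rewrite dotvZl dotvZr mulrA mulrC ler_wpM2r -?expr2 ?sqr_ge0//.
by rewrite -enorm_sqr lerXn2r ?nnegrE ?enorm_ge0// hg.
Qed.

Variables (nu LH L M : R) (H : pt -> E -> R) (DH : pt -> E -> E).
Hypotheses (nu_gt0 : 0 < nu) (LH_ge0 : 0 <= LH) (L_gt0 : 0 < L) (M_ge0 : 0 <= M).
Hypothesis mH : forall g, (forall i, measurable_fun Q (fun z => g z ord0 i)) ->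
  measurable_fun Q (fun z => H z (g z)).
Hypothesis mDH : forall g, (forall i, measurable_fun Q (fun z => g z ord0 i)) ->
  forall i, measurable_fun Q (fun z => DH z (g z) ord0 i).
Hypothesis H_lip : forall z p q, Q z -> `|H z p - H z q| <= LH * enorm (p - q).
Hypothesis DH_le : forall z p, Q z -> enorm (DH z p) <= LH.
Hypothesis DH_lip : forall z p q, Q z -> enorm (DH z p - DH z q) <= L * enorm (p - q).
Hypothesis H_convex : forall z p q, Q z -> H z p + dotv (DH z p) (q - p) <= H z q.
Hypothesis H_coc : forall z p q, Q z -> dotv (DH z q - DH z p) (DH z q - DH z p) <=
  4 * L * (H z q - H z p - dotv (DH z p) (q - p)).

Variables (u ub m mb : pt -> R).
Hypotheses (Xu : VX u) (Xub : VX ub) (Ym : VY m) (Ymb : VY mb).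
Hypothesis m_ge0 : {ae P, forall z, Q z -> 0 <= m z}.
Hypothesis mb_ge0 : {ae P, forall z, Q z -> 0 <= mb z}.
Hypothesis m_le : {ae P, forall z, Q z -> `|m z| <= M}.

Local Notation eu := (fun z : pt => u z - ub z).
Local Notation em := (fun z : pt => m z - mb z).

Definition dH : pt -> R := fun z => H z (gx u z) - H z (gx ub z).
Definition dP : pt -> E := fun z => DH z (gx u z) - DH z (gx ub z).
Definition mdP : pt -> E := fun z => m z *: DH z (gx u z) - mb z *: DH z (gx ub z).

Let Xeu : VX eu. Proof. by have [s _ _ _] := sX; exact: (subspaceB s Xu Xub). Qed.
Let Yem : VY em. Proof. exact: (Y_B oOm bOm Ym Ymb). Qed.
Let Xem : VX em. Proof. exact: Y_X. Qed.

Let mgx v i : VX v -> measurable_fun Q (fun z => gx v z ord0 i).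
Proof. by move=> Xv; exact: (L2_measurable mQ (gradx_L2 Xv i)). Qed.

Let d := fun z => gx u z - gx ub z.

Let d2 : L2v P Q d.
Proof. exact: (subspaceB (@L2v_subspace _ _ R n.+1 P Q mQ) (gradx_L2 Xu) (gradx_L2 Xub)). Qed.

Let d_ae : {ae P, forall z, Q z -> gx eu z = d z}.
Proof. exact: gradxB. Qed.

Let ipVd g : L2v P Q g -> ipV P Q g (gx eu) = ipV P Q g d.
Proof. by move=> g2; apply: (ipV_ae mQ g2 g2 (gradx_L2 Xeu) d2) => //; exact: aeW. Qed.

Let mdH : measurable_fun Q dH.
Proof. by apply: measurable_funB; apply: mH => i; exact: mgx. Qed.

Let dH_le z : Q z -> `|dH z| <= LH * enorm (d z).
Proof. exact: H_lip. Qed.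

Let dH2 : L2 P Q dH.
Proof.
by apply: (L2_growth (lexx 0) LH_ge0 mdH d2) => z Qz; rewrite add0r dH_le.
Qed.

Let eu_sqr : ipV P Q d d = nX eu ^+ 2.
Proof. by rewrite (normX_sqr oOm bOm Xeu); symmetry; apply: (ipV_ae mQ (gradx_L2 Xeu) d2 (gradx_L2 Xeu) d2). Qed.

Lemma dH_norm : Num.sqrt (ipL P Q dH dH) <= LH * nX eu.
Proof.
rewrite -[leRHS]ger0_norm ?mulr_ge0 ?(normX_ge0 oOm Xeu)// -sqrtr_sqr ler_wsqrtr// exprMn -eu_sqr.
rewrite /ipL /ipV -RintegralZl//; last exact: (L2v_dotv mQ d2 d2).
apply: ae_le_Rintegral => //; first exact: L2M.
  by apply: L1Z => //; exact: (L2v_dotv mQ d2 d2).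
apply: aeW => z Qz; rewrite -expr2 -real_normK ?num_real// -enorm_sqr -exprMn.
by rewrite lerXn2r ?nnegrE ?mulr_ge0 ?enorm_ge0// dH_le.
Qed.

Let mP v i : VX v -> measurable_fun Q (fun z => DH z (gx v z) ord0 i).
Proof. by move=> Xv; apply: mDH => j; exact: mgx. Qed.

Let mdPi i : measurable_fun Q (fun z => dP z ord0 i).
Proof.
rewrite (_ : (fun z => _) = (fun z => DH z (gx u z) ord0 i - DH z (gx ub z) ord0 i)).
  by apply: measurable_funB; exact: mP.
by apply/funext => z; rewrite !mxE.
Qed.

Let dP_le z : Q z -> enorm (dP z) <= 2 * LH.
Proof.
move=> Qz; apply: le_trans (enorm_leD _ _) _; rewrite mulr_natl mulr2n lerD ?DH_le//.
by rewrite -(sub0r (DH _ _)) enormB subr0 DH_le.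
Qed.

Let dP2 : L2v P Q dP.
Proof.
have -> : dP = fun z => 1 *: dP z by apply/funext => z; rewrite scale1r.
exact: (L2v_scale mdPi dP_le (L2_cst 1)).
Qed.

Let m2 : L2 P Q m. Proof. exact: spX_L2 (Y_X Ym). Qed.
Let mb2 : L2 P Q mb. Proof. exact: spX_L2 (Y_X Ymb). Qed.
Let em2 : L2 P Q em. Proof. exact: (L2B mQ m2 mb2). Qed.

Let mdPm2 : L2v P Q (fun z => m z *: dP z). Proof. exact: (L2v_scale mdPi dP_le m2). Qed.

Let emP2 : L2v P Q (fun z => em z *: DH z (gx ub z)).
Proof. by apply: (L2v_scale (c := LH) _ _ em2) => [i|z Qz]; [exact: mP|exact: DH_le]. Qed.

Let mdPE : mdP = (fun z => m z *: dP z) + (fun z => em z *: DH z (gx ub z)).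
Proof.
apply/funext => z; rewrite fctE /mdP /dP scalerBr scalerBl addrA.
by rewrite subrK.
Qed.

Let mdP2 : L2v P Q mdP.
Proof. by rewrite mdPE; exact: (subspaceD (@L2v_subspace _ _ R n.+1 P Q mQ) mdPm2 emP2). Qed.

Variables (kF kS : R) (dF : (pt -> R) -> R) (dS : E -> R) (l1 l2 : (pt -> R) -> R).
Hypotheses (kF_ge0 : 0 <= kF) (kS_ge0 : 0 <= kS).
Hypothesis dF_dual : dual VX nX dF.
Hypothesis dF_le : forall v, VX v -> `|dF v| <= kF * nY em * nX v.
Hypothesis dS2 : L2 mu Om dS.
Hypothesis dS_le : Num.sqrt (ipL mu Om dS dS) <= kS * nY em.
Hypothesis E1 : forall v, VY0 v -> l1 v = dtv v eu + nu * ipX T Om eu v + ipL P Q dH v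
  - dF v - ipL mu Om dS (tr v T).
Hypothesis E2 : forall w, VX w -> l2 w = dtv em w + nu * ipX T Om em w + ipV P Q mdP (gx w).

Let dS_tr v : VY v -> `|ipL mu Om dS (tr v T)| <= kS * nY em * nY v.
Proof.
move=> Yv; have t2 := traceT_L2 T_gt0 oOm bOm Yv.
apply: le_trans (ip_le sL dS2 t2) _.
apply: ler_pM; rewrite ?sqrtr_ge0//; rewrite -(L2normE mOm t2); exact: (traceT_leY T_gt0 oOm bOm).
Qed.

Let dF_Y v : VY v -> `|dF v| <= kF * nY em * nY v.
Proof.
move=> Yv; apply: le_trans (dF_le (Y_X Yv)) _; rewrite ler_wpM2l ?mulr_ge0 ?(normY_ge0 T Om)//.
exact: (normX_leY oOm).
Qed.

Let dH_Y v : VY v -> `|ipL P Q dH v| <= LH * Num.sqrt T * nX eu * nY v.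
Proof.
move=> Yv; have v2 := spX_L2 (Y_X Yv); apply: le_trans (ip_le sLQ dH2 v2) _.
rewrite -mulrA mulrACA; apply: ler_pM; rewrite ?sqrtr_ge0//; first exact: dH_norm.
rewrite -[X in _ * X](ger0_norm (normY_ge0 T Om v)) -sqrtr_sqr -sqrtrM ?(ltW T_gt0)// ler_wsqrtr//.
exact: (L2_leY T_gt0 oOm bOm).
Qed.

(** Every term of the identity [E1] is bounded by an error norm times the norm of the test function
    in Y; the L^2 norm of the test function costs sqrt T. *)
Lemma residual1_le v : VY0 v -> `|l1 v| <=
  ((1 + nu + LH * Num.sqrt T) * nX eu + (kF + kS) * nY em) * nY v.
Proof.
move=> Y0v; have Yv := Y0_Y Y0v; have Xv := Y_X Yv; rewrite (E1 Y0v).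
have h1 : `|dtv v eu| <= nX eu * nY v.
  apply: le_trans (dual_le sX nXE (dt_dual Yv) Xeu) _; rewrite mulrC ler_wpM2l ?(normX_ge0 oOm Xeu)//.
  exact: (dt_leY oOm bOm).
have h2 : `|nu * ipX T Om eu v| <= nu * nX eu * nY v.
  rewrite normrM gtr0_norm// -mulrA ler_wpM2l ?(ltW nu_gt0)//; apply: le_trans (ipX_le Xeu Xv) _.
  rewrite ler_wpM2l ?(normX_ge0 oOm Xeu)//; exact: (normX_leY oOm).
exact: residual1_numeric h1 h2 (dH_Y Yv) (dF_Y Yv) (dS_tr Yv).
Qed.

Let mdPm_norm : ipV P Q (fun z => m z *: dP z) (fun z => m z *: dP z) <= (M * L * nX eu) ^+ 2.
Proof.
rewrite exprMn -eu_sqr /ipV -RintegralZl//; last exact: (L2v_dotv mQ d2 d2).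
apply: ae_le_Rintegral => //; first exact: (L2v_dotv mQ mdPm2 mdPm2).
  by apply: L1Z => //; exact: (L2v_dotv mQ d2 d2).
apply: filterS m_le => z h Qz; rewrite -!enorm_sqr enormZ -exprMn.
rewrite lerXn2r ?nnegrE ?mulr_ge0 ?enorm_ge0 ?(ltW L_gt0)//.
by rewrite -mulrA; apply: ler_pM; rewrite ?enorm_ge0 ?DH_lip ?h.
Qed.

(** The flux difference is estimated through the splitting [mdPE]: Lipschitz continuity of the
    gradient of H is paired with the bound on [m], and the bound on that gradient with the density
    error. *)
Lemma residual2_le w : VX w -> `|l2 w| <=
  ((1 + nu + LH * Num.sqrt T) * nY em + M * L * nX eu) * nX w.
Proof.
move=> Xw; rewrite (E2 Xw); have W0 := normX_ge0 oOm Xw; have gw := gradx_L2 Xw.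
have h1 : `|dtv em w| <= nY em * nX w.
  apply: le_trans (dual_le sX nXE (dt_dual Yem) Xw) _; rewrite ler_wpM2r//.
  exact: (dt_leY oOm bOm).
have h2 : `|nu * ipX T Om em w| <= nu * nY em * nX w.
  rewrite normrM gtr0_norm// -mulrA ler_wpM2l ?(ltW nu_gt0)//; apply: le_trans (ipX_le Xem Xw) _.
  rewrite ler_wpM2r//; exact: (normX_leY oOm).
have h3 : `|ipV P Q mdP (gx w)| <= (M * L * nX eu + LH * Num.sqrt T * nY em) * nX w.
  apply: le_trans (ip_le sVQ mdP2 gw) _; rewrite -/(ipX T Om w w) -nXE// ler_wpM2r// mdPE.
  apply: le_trans (ip_sqrt_leD sVQ mdPm2 emP2) _; apply: lerD.
    rewrite -[leRHS]ger0_norm ?mulr_ge0 ?(normX_ge0 oOm Xeu) ?(ltW L_gt0)//.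
    by rewrite -sqrtr_sqr ler_wsqrtr.
  rewrite -[leRHS]ger0_norm ?mulr_ge0 ?sqrtr_ge0 ?(normY_ge0 T Om)// -sqrtr_sqr ler_wsqrtr//.
  apply: le_trans (ipV_coef_le (fun i => mP i Xub) LH_ge0 (fun z Qz => DH_le _ Qz) em2) _.
  rewrite !exprMn -mulrA ler_wpM2l ?sqr_ge0// sqr_sqrtr ?(ltW T_gt0)//.
  exact: (L2_leY T_gt0 oOm bOm).
exact: residual2_numeric h1 h2 h3.
Qed.

Variables (rho0 rho1 rho2 : R).
Hypotheses (rho1_ge0 : 0 <= rho1) (rho2_ge0 : 0 <= rho2).
Hypothesis l1_le : forall v, VY0 v -> `|l1 v| <= rho1 * nY v.
Hypothesis l2_le : forall w, VX w -> `|l2 w| <= rho2 * nX w.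
Hypothesis l0_le : L2norm mu Om (tr em 0) <= rho0.
Hypothesis monotone : 0 <= dF em + ipL mu Om dS (tr em T).

Let rho0_ge0 : 0 <= rho0.
Proof. exact: le_trans (L2norm_ge0 mOm (trace0_L2 T_gt0 oOm bOm Yem)) l0_le. Qed.

(* Duality with the drift problem whose transport field is the difference
   quotient of the Hamiltonian along the gradient error. *)
Lemma value_error : nX eu <= energy_const nu LH T * ((kF + kS) * nY em + rho1).
Proof.
pose b z := slope (dH z) (d z).
have mb' i : measurable_fun Q (fun z => b z ord0 i).
  by apply: measurable_slope => // j; exact: (L2_measurable mQ (d2 j)).
have hb z : Q z -> enorm (b z) <= LH by move=> Qz; exact: slope_le (dH_le Qz).
have U0 := normX_ge0 oOm Xeu; set U := nX eu.
set kap := (kF + kS) * nY em + rho1.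
have k0 : 0 <= kap by rewrite addr_ge0 ?mulr_ge0 ?addr_ge0 ?(normY_ge0 T Om).
have C0 : 0 <= energy_const nu LH T by exact: sqrtr_ge0.
apply: duality_numeric => // e e0.
(* The target functional is the inner product with the value error, since its value there is the
   square of the norm to be bounded. *)
have hd := dual_ip sX nXE Xeu.
have [v Y0v hv] := driftop_dense T_gt0 oOm bOm nu_gt0 LH_ge0 mb' hb hd e0.
have Yv := Y0_Y Y0v; have Xv := Y_X Yv.
have b2 := L2v_scale mb' hb (spX_L2 Xv).
have e1 : driftop T Om nu b v eu = l1 v + dF v + ipL mu Om dS (tr v T).
  rewrite /driftop (drift_split nu mb' hb Xv Xeu) (ipVd b2).
  have -> : ipV P Q (fun z => v z *: b z) d = ipL P Q dH v.
    by apply: eq_Rintegral => z; rewrite inE => Qz; rewrite dotvZl (slope_dot (dH_le Qz)) mulrC.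
  by rewrite (E1 Y0v) (ipC sX Xv Xeu); ring.
have hA w : VX w -> `|driftop T Om nu b v w| <= (U + e) * nX w.
  move=> Xw; have W0 := normX_ge0 oOm Xw.
  have -> : driftop T Om nu b v w = (driftop T Om nu b v w - ipX T Om eu w) + ipX T Om eu w.
    by rewrite subrK.
  apply: le_trans (ler_normD _ _) _; rewrite mulrDl addrC lerD ?hv//.
  exact: ipX_le.
have hn := energy_estimate T_gt0 oOm bOm nu_gt0 LH_ge0 mb' hb Yv (addr_ge0 U0 (ltW e0)) hA.
have t0 : L2norm mu Om (tr v 0) = 0.
  by rewrite (L2normE mOm (trace0_L2 T_gt0 oOm bOm Yv)) (Y0_trace T_gt0 oOm bOm Y0v) sqrtr0.
rewrite t0 addr0 in hn.
have := hv _ Xeu; rewrite e1 -(normX_sqr oOm bOm Xeu) -/U => h1.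
exact: duality_step hn h1 (l1_le Y0v) (dF_Y Yv) (dS_tr Yv) k0.
Qed.

Local Notation DD := (ipV P Q (fun z => m z *: dP z) dP).

Lemma gap_ge0 : 0 <= DD.
Proof.
apply: ae_Rintegral_ge0 => //; first exact: (L2v_dotv mQ mdPm2 dP2).
by apply: filterS m_ge0 => z h Qz; rewrite dotvZl mulr_ge0 ?dotv_ge0// h.
Qed.

(** The right-hand side is the combination produced by testing each error identity with the other
    error and subtracting; [coercive_pointwise] bounds it from below under the integral. *)
Let DD_le : DD <= 4 * L * (ipV P Q mdP (gx eu) - ipL P Q dH em).
Proof.
rewrite (ipVd mdP2); have I1 := L2v_dotv mQ mdP2 d2; have I2 := L2M mQ dH2 em2.
rewrite /ipV /ipL -RintegralB// -RintegralZl//; last exact: L1B.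
apply: ae_le_Rintegral => //; first exact: (L2v_dotv mQ mdPm2 dP2).
  by apply: L1Z => //; exact: L1B.
apply: filterS2 m_ge0 mb_ge0 => z h1 h2 Qz; have {}h1 := h1 Qz; have {}h2 := h2 Qz.
have h3 := H_coc (gx u z) (gx ub z) Qz; have h4 := H_convex (gx ub z) (gx u z) Qz.
rewrite /mdP dotvBl !dotvZl.
have e1 : dotv (dP z) (dP z) = dotv (DH z (gx ub z) - DH z (gx u z)) (DH z (gx ub z) - DH z (gx u z)).
  exact: (ip_subC dotv_semi).
have e2 : dotv (DH z (gx u z)) (gx ub z - gx u z) = - dotv (DH z (gx u z)) (d z).
  by rewrite -opprB -scaleN1r dotvZr mulN1r.
rewrite e2 -e1 in h3; rewrite /dH.
exact: coercive_pointwise L_gt0 h1 h2 h3 h4.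
Qed.

Let zero_drift_m i : measurable_fun Q (fun z : pt => (0 : E) ord0 i).
Proof. exact: measurable_cst. Qed.

Let zero_drift_le (z : pt) : Q z -> enorm (0 : E) <= (0 : R).
Proof. by rewrite /enorm dot0v sqrtr0. Qed.

Let heat v w : VX v -> VX w ->
  driftop T Om nu (fun=> 0) v w = dtv v w + nu * ipX T Om v w.
Proof.
move=> Xv Xw; rewrite /driftop (drift_split nu zero_drift_m zero_drift_le Xv Xw); congr (_ + _).
rewrite (_ : (fun z => _) = 0); last by apply/funext => z; rewrite scaler0.
by rewrite (ip0l sVQ (gradx_L2 Xw)) addr0.
Qed.

(* The density error is not an admissible test function for the first equation;
   it is replaced by an element of Y_0 with almost the same heat operator. *)
Lemma duality_gap e : 0 < e -> DD <= 4 * L * ((rho2 + e) * nX eu +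
  rho1 * (nY em + energy_const nu 0 T * (e + rho0)) +
  ((kF + kS) * nY em + LH * Num.sqrt T * nX eu) * (energy_const nu 0 T * (e + rho0))).
Proof.
(* The heat operator, with transport field 0, suffices here; hence [energy_const nu 0 T]. *)
move=> e0; have hd := driftop_dual oOm bOm nu_gt0 (lexx 0) zero_drift_m zero_drift_le Yem.
have [y Y0y hy] := driftop_dense T_gt0 oOm bOm nu_gt0 (lexx 0) zero_drift_m zero_drift_le hd e0.
have Yy := Y0_Y Y0y; have Xy := Y_X Yy.
(* [z] has an almost vanishing heat operator and the initial value of the density error, so its norm
   is controlled by [e + rho0]. *)
pose z : pt -> R := fun x => em x - y x.
have Yz : VY z by exact: (Y_B oOm bOm Yem Yy).
have Xz := Y_X Yz; have z2 := spX_L2 Xz; have y2 := spX_L2 Xy.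
have tT : 0 <= T <= T by rewrite lexx ltW.
have t0 : 0 <= (0 : R) <= T by rewrite lexx ltW.
have hz w : VX w -> `|driftop T Om nu (fun=> 0) z w| <= e * nX w.
  move=> Xw; have := hy w Xw; rewrite distrC !heat// (dtB oOm bOm Yem Yy Xw).
  rewrite [ipX T Om z w](ipBl sX Xem Xy Xw); apply: le_trans.
  by rewrite lin_diff2.
have nz : nY z <= energy_const nu 0 T * (e + rho0).
  have := energy_estimate T_gt0 oOm bOm nu_gt0 (lexx 0) zero_drift_m zero_drift_le Yz (ltW e0) hz.
  move=> /le_trans; apply; rewrite ler_wpM2l ?sqrtr_ge0// lerD2l; apply: le_trans l0_le.
  have a2 := trace0_L2 T_gt0 oOm bOm Yz; have b2 := trace0_L2 T_gt0 oOm bOm Yem.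
  rewrite (L2normE mOm a2) (L2normE mOm b2) le_eqVlt; apply/orP; left; apply/eqP; congr Num.sqrt.
  have ez : {ae mu, forall x, Om x -> tr z 0 x = tr em 0 x}.
    have [_ hy0] := Y0y; apply: filterS2 (traceB T_gt0 oOm bOm Yem Yy t0) hy0 => x h1 h2 Ox.
    by rewrite (h1 Ox) (h2 Ox) subr0.
  exact: (ipL_ae mOm a2 b2 a2 b2 ez ez).
have ny : nY y <= nY em + energy_const nu 0 T * (e + rho0).
  apply: le_trans (lerD (lexx _) nz).
  rewrite (normYE T_gt0 oOm bOm Yy) (normYE T_gt0 oOm bOm Yem) (normYE T_gt0 oOm bOm Yz).
  have sY := ipY_semi T_gt0 oOm bOm.
  have [sYs _ _ _] := sY.
  have Ymz : VY (- z) by rewrite -scaleN1r; exact: subspaceZ.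
  have := ip_sqrt_leD sY Yem Ymz.
  have -> : (em : pt -> R) + - z = y.
    by apply/funext => x; rewrite !fctE /z opprB addrC subrK.
  move=> /le_trans; apply; rewrite lerD2l le_eqVlt; apply/orP; left; apply/eqP; congr Num.sqrt.
  by rewrite -scaleN1r (ipZl sY (-1) Yz (subspaceZ (-1) sYs Yz)) (ipZr sY (-1) Yz Yz); ring.
have s1 : ipL P Q dH em = ipL P Q dH y + ipL P Q dH z.
  rewrite -(ipDr sLQ y2 z2 dH2); congr (ipL _ _ _ _).
  by apply/funext => x; rewrite fctE /z addrC subrK.
have s2 : dF em = dF y + dF z.
  rewrite -(dualD dF_dual Xy Xz); congr dF.
  by apply/funext => x; rewrite fctE /z addrC subrK.
have s3 : ipL mu Om dS (tr em T) = ipL mu Om dS (tr y T) + ipL mu Om dS (tr z T).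
  have ty := traceT_L2 T_gt0 oOm bOm Yy; have tz := traceT_L2 T_gt0 oOm bOm Yz.
  have te := traceT_L2 T_gt0 oOm bOm Yem.
  rewrite -(ipDr sL ty tz dS2); apply: (ipL_ae mOm dS2 dS2 te (L2D mOm ty tz)); first exact: aeW.
  apply: filterS (traceB T_gt0 oOm bOm Yem Yy tT) => x h Ox.
  by have := h Ox => h'; rewrite -[RHS]/(tr y T x + tr z T x) h' addrC subrK.
have hyu := hy _ Xeu; rewrite !heat// in hyu.
have E1y := E1 Y0y; have E2u := E2 Xeu.
rewrite (ipC sX Xeu Xy) in E1y.
have k0 : 0 <= kF * nY em by rewrite mulr_ge0 ?(normY_ge0 T Om).
have k1 : 0 <= kS * nY em by rewrite mulr_ge0 ?(normY_ge0 T Om).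
have k2 : 0 <= LH * Num.sqrt T * nX eu by rewrite !mulr_ge0 ?sqrtr_ge0 ?(normX_ge0 oOm Xeu).
apply: le_trans DD_le _; rewrite ler_wpM2l ?mulr_ge0 ?(ltW L_gt0)// s1.
have mono := monotone; rewrite s2 s3 in mono.
exact: gap_numeric E1y E2u mono hyu (l1_le Y0y) (l2_le Xeu) (dH_Y Yz) (dF_Y Yz) (dS_tr Yz) nz ny
  rho1_ge0 k0 k1 k2.
Qed.

(** The source is measured through |m (p - p')|^2 <= M m |p - p'|^2, which trades one factor of the
    density for its bound and leaves the gap. *)
Lemma density_error : nY em <= energy_const nu LH T * (rho2 + Num.sqrt (M * DD) + rho0).
Proof.
have C0 : 0 <= energy_const nu LH T by exact: sqrtr_ge0.
have hK w : VX w -> `|driftop T Om nu (fun z => DH z (gx ub z)) em w| <= (rho2 + Num.sqrt (M * DD)) * nX w.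
  move=> Xw; have gw := gradx_L2 Xw.
  have -> : driftop T Om nu (fun z => DH z (gx ub z)) em w = l2 w - ipV P Q (fun z => m z *: dP z) (gx w).
    rewrite /driftop (drift_split nu (fun i => mP i Xub) (fun z Qz => DH_le _ Qz) Xem Xw) (E2 Xw).
    by rewrite mdPE (ipDl sVQ mdPm2 emP2 gw); ring.
  apply: le_trans (ler_normB _ _) _; rewrite mulrDl lerD ?l2_le//.
  apply: le_trans (ip_le sVQ mdPm2 gw) _; rewrite -/(ipX T Om w w) -nXE//.
  rewrite ler_wpM2r ?(normX_ge0 oOm Xw)// ler_wsqrtr//.
  have I1 := L2v_dotv mQ mdPm2 dP2; rewrite /ipV -RintegralZl//.
  apply: ae_le_Rintegral => //; [exact: (L2v_dotv mQ mdPm2 mdPm2)|exact: L1Z|].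
  apply: filterS2 m_ge0 m_le => z h1 h2 Qz; rewrite dotvZr ler_wpM2r//.
    by rewrite dotvZl mulr_ge0 ?dotv_ge0// h1.
  exact: le_trans (ler_norm _) (h2 Qz).
apply: le_trans (energy_estimate T_gt0 oOm bOm nu_gt0 LH_ge0 (fun i => mP i Xub) (fun z Qz => DH_le _ Qz) Yem _ hK) _.
  by rewrite addr_ge0 ?sqrtr_ge0.
by rewrite ler_wpM2l// lerD2l.
Qed.

End error_system.

(** * Constants and the main theorem *)

Lemma hjb_numeric {R : comRingType} (Fm Fb tu tb nu xu xb hu hb Sm Sb : R) :
  tu + (nu * xu + hu) = Fm + Sm ->
  Fb + Sb - (tb + (nu * xb + hb)) =
  tu - tb + nu * (xu - xb) + (hu - hb) - (Fm - Fb) - (Sm - Sb).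
Proof.
move=> e; transitivity (tu + (nu * xu + hu) - (Fm + Sm) + (Fb + Sb - (tb + (nu * xb + hb)))).
  by rewrite e subrr add0r.
ring.
Qed.

Lemma kfp_numeric {R : comRingType} (g tm tb nu xm xb pm pb : R) :
  tm + (nu * xm + pm) = g ->
  g - tb - (nu * xb + pb) = tm - tb + nu * (xm - xb) + (pm - pb).
Proof. by move=> <-; ring. Qed.

Lemma lin5 {R : comRingType} (a nu x1 x2 x3 x4 x5 y1 y2 y3 y4 y5 : R) :
  a * x1 + y1 + nu * (a * x2 + y2) + (a * x3 + y3) - (a * x4 + y4) - (a * x5 + y5) =
  a * (x1 + nu * x2 + x3 - x4 - x5) + (y1 + nu * y2 + y3 - y4 - y5).
Proof. ring. Qed.

(** * The explicit constants and the closing quadratic inequality *)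

Section constants.
Context {R : realType}.

(** The coefficients of both error norms in the three residual bounds, added up. *)
Definition lower_const (nu k s L M : R) := 2 * (1 + nu + s) + k + M * L + 1.

Lemma lower_numeric (nu k s L M U Y r0 r1 r2 : R) : 0 <= nu -> 0 <= k -> 0 <= s -> 0 <= L -> 0 <= M ->
  0 <= U -> 0 <= Y -> r1 <= (1 + nu + s) * U + k * Y -> r2 <= (1 + nu + s) * Y + M * L * U ->
  r0 <= Y -> r1 + r2 + r0 <= lower_const nu k s L M * (U + Y).
Proof.
move=> h1 h2 h3 h4 h5 U0 Y0 h6 h7 h8; rewrite /lower_const.
have p1 := mulr_ge0 h1 U0; have p2 := mulr_ge0 h1 Y0; have p3 := mulr_ge0 h2 U0.
have p4 := mulr_ge0 h3 U0; have p5 := mulr_ge0 h3 Y0; have p6 := mulr_ge0 (mulr_ge0 h5 h4) Y0.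
have -> : (2 * (1 + nu + s) + k + M * L + 1) * (U + Y) =
  ((1 + nu + s) * U + k * Y) + ((1 + nu + s) * Y + M * L * U) + Y +
  (nu * U + nu * Y + k * U + s * U + s * Y + M * L * Y + 2 * U + Y) by ring.
by lra.
Qed.

Definition value_const (Ce k : R) := Ce * (k + 1).

(** The value A + B + 1 for the inequality y^2 <= A r^2 + B r y solved by [quadratic_root], with y
    the density error and r the total residual. *)
Definition density_const (Ce C0 k s L M : R) :=
  let c := (1 + s * C0) * value_const Ce k in
  2 * Ce ^+ 2 * (1 + 4 * L * M * (c + C0)) + 2 * Ce ^+ 2 * (4 * L * M * (c + 1 + k * C0)) + 1.

Definition upper_const (Ce C0 k s L M : R) :=
  value_const Ce k * (density_const Ce C0 k s L M + 1) + density_const Ce C0 k s L M.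

(** If y exceeded (A + B + 1) r it would also be at least r, and then A r^2 + B r y <= (A + B) r y <
    y^2. *)
Lemma quadratic_root (A B r y : R) : 0 <= A -> 0 <= B -> 0 <= r -> 0 <= y ->
  y ^+ 2 <= A * r ^+ 2 + B * (r * y) -> y <= (A + B + 1) * r.
Proof.
move=> A0 B0 r0 y0 h; rewrite leNgt; apply/negP => hy.
have ry : r <= y.
  by apply: le_trans (ltW hy); rewrite ler_peMl// lerDr addr_ge0.
have yp : 0 < y by apply: le_lt_trans hy; rewrite mulr_ge0// !addr_ge0.
have h1 : (A + B + 1) * r * y < y * y by rewrite ltr_pM2r.
have h2 : A * (r * r) <= A * (r * y) by rewrite !ler_wpM2l.
have h3 : 0 <= r * y by rewrite mulr_ge0.
by move: h h1; rewrite !expr2; lra.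
Qed.

Lemma upper_numeric (Ce C0 k s L M U Y D r0 r1 r2 : R) : 0 <= Ce -> 0 <= C0 -> 0 <= k -> 0 <= s ->
  0 <= L -> 0 <= M -> 0 <= U -> 0 <= Y -> 0 <= D -> 0 <= r0 -> 0 <= r1 -> 0 <= r2 ->
  U <= Ce * (k * Y + r1) ->
  (forall e, 0 < e -> D <= 4 * L * ((r2 + e) * U + r1 * (Y + C0 * (e + r0)) +
    (k * Y + s * U) * (C0 * (e + r0)))) ->
  Y <= Ce * (r2 + Num.sqrt (M * D) + r0) ->
  U + Y <= upper_const Ce C0 k s L M * (r1 + r2 + r0).
Proof.
move=> Ce0 C00 k0 s0 L0 M0 U0 Y0 D0 r00 r10 r20 hU hD hY.
set r := r1 + r2 + r0; have r_ge0 : 0 <= r by rewrite !addr_ge0.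
pose c := value_const Ce k; have c0 : 0 <= c by rewrite mulr_ge0// addr_ge0.
have U1 : U <= c * (Y + r).
  apply: le_trans hU _; rewrite /c /value_const -mulrA ler_wpM2l//.
  have p1 := mulr_ge0 k0 r_ge0; have rr : r1 <= r by rewrite /r -addrA lerDl addr_ge0.
  rewrite mulrDl mul1r; lra.
(* The approximation parameter [e] tends to 0. *)
have D1 : D <= 4 * L * (r2 * U + r1 * (Y + C0 * r0) + (k * Y + s * U) * (C0 * r0)).
  apply: (@ler_eps _ _ _ (4 * L * (U + r1 * C0 + (k * Y + s * U) * C0))).
    by rewrite !(mulr_ge0, addr_ge0).
  by move=> e e0; apply: le_trans (hD e e0) _; rewrite le_eqVlt; apply/orP; left; apply/eqP; ring.
(* Coefficients after eliminating the value error with [U1] and replacing each single residual by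
   the total [r]. *)
pose al := (1 + s * C0) * c + 1 + k * C0; pose ga := (1 + s * C0) * c + C0.
have D2 : D <= 4 * L * (r * (al * Y + ga * r)).
  apply: le_trans D1 _; rewrite ler_wpM2l ?mulr_ge0//.
  have q1 : r2 * U <= r * U by rewrite ler_wpM2r// /r addrAC lerDr addr_ge0.
  have q2 : r1 * (Y + C0 * r0) <= r * (Y + C0 * r).
    apply: ler_pM => //; first by rewrite addr_ge0// mulr_ge0.
      by rewrite /r -addrA lerDl addr_ge0.
    by rewrite lerD2l ler_wpM2l// /r lerDr addr_ge0.
  have q3 : (k * Y + s * U) * (C0 * r0) <= (k * Y + s * U) * (C0 * r).
    rewrite ler_wpM2l ?addr_ge0 ?mulr_ge0// ler_wpM2l// /r lerDr addr_ge0//.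
  apply: le_trans (lerD (lerD q1 q2) q3) _.
  have -> : r * U + r * (Y + C0 * r) + (k * Y + s * U) * (C0 * r) =
    r * ((1 + s * C0) * U + (1 + k * C0) * Y + C0 * r) by ring.
  rewrite ler_wpM2l//.
  have q4 : (1 + s * C0) * U <= (1 + s * C0) * (c * (Y + r)).
    by rewrite ler_wpM2l// addr_ge0// mulr_ge0.
  have -> : al * Y + ga * r = (1 + s * C0) * (c * (Y + r)) + (1 + k * C0) * Y + C0 * r.
    by rewrite /al /ga; ring.
  by rewrite !lerD2r.
have al0 : 0 <= al by rewrite /al; rewrite !(addr_ge0, mulr_ge0).
have ga0 : 0 <= ga by rewrite /ga; rewrite !(addr_ge0, mulr_ge0).
have MD0 : 0 <= M * D by rewrite mulr_ge0.
(* Squaring removes the root over the gap, and inserting [D2] gives the quadratic inequality. *)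
have Y2 : Y ^+ 2 <= 2 * Ce ^+ 2 * (1 + 4 * L * M * ga) * r ^+ 2 + 2 * Ce ^+ 2 * (4 * L * M * al) * (r * Y).
  have q1 : Y <= Ce * (r + Num.sqrt (M * D)).
    apply: le_trans hY _; rewrite ler_wpM2l// addrAC lerD2r /r -addrA lerDr//.
  have q2 : Y ^+ 2 <= (Ce * (r + Num.sqrt (M * D))) ^+ 2.
    by rewrite lerXn2r ?nnegrE ?mulr_ge0 ?addr_ge0 ?sqrtr_ge0.
  apply: le_trans q2 _; rewrite exprMn.
  have q3 : (r + Num.sqrt (M * D)) ^+ 2 <= 2 * (r ^+ 2 + M * D).
    rewrite -[in leRHS](sqr_sqrtr MD0); move: (Num.sqrt _) => x.
    rewrite -subr_ge0 (_ : _ - _ = (r - x) ^+ 2) ?sqr_ge0//; ring.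
  have q4 : M * D <= M * (4 * L * (r * (al * Y + ga * r))) by rewrite ler_wpM2l.
  apply: le_trans (ler_wpM2l (sqr_ge0 Ce) q3) _.
  have -> : 2 * Ce ^+ 2 * (1 + 4 * L * M * ga) * r ^+ 2 + 2 * Ce ^+ 2 * (4 * L * M * al) * (r * Y) =
    Ce ^+ 2 * (2 * (r ^+ 2 + M * (4 * L * (r * (al * Y + ga * r))))) by ring.
  by rewrite ler_wpM2l ?sqr_ge0// ler_wpM2l// lerD2l.
have LM : 0 <= 4 * L * M by rewrite !mulr_ge0.
have Y3 : Y <= density_const Ce C0 k s L M * r.
  apply: quadratic_root => //; rewrite !(mulr_ge0, addr_ge0, sqr_ge0)//.
have Y4 : c * (Y + r) <= c * ((density_const Ce C0 k s L M + 1) * r).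
  by rewrite ler_wpM2l// mulrDl mul1r lerD2r.
rewrite /upper_const -/c mulrDl -mulrA; exact: lerD (le_trans U1 Y4) Y3.
Qed.

Lemma lower_const_gt0 (nu k s L M : R) : 0 <= nu -> 0 <= k -> 0 <= s -> 0 <= L -> 0 <= M ->
  0 < lower_const nu k s L M.
Proof. by move=> *; rewrite /lower_const ltr_wpDl// !(addr_ge0, mulr_ge0). Qed.

Lemma upper_const_gt0 (Ce C0 k s L M : R) : 0 <= Ce -> 0 <= C0 -> 0 <= k -> 0 <= s ->
  0 <= L -> 0 <= M -> 0 < upper_const Ce C0 k s L M.
Proof.
move=> h1 h2 h3 h4 h5 h6; have d0 : 0 < density_const Ce C0 k s L M.
  by rewrite /density_const /value_const ltr_wpDl// !(addr_ge0, mulr_ge0, sqr_ge0).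
have v0 : 0 <= value_const Ce k by rewrite /value_const mulr_ge0// addr_ge0.
have d1 := ltW d0.
by rewrite /upper_const ltr_wpDl// mulr_ge0// addr_ge0.
Qed.

End constants.

(** * The error system of the mean field game *)

Section mean_field_game.
Context {R : realType} {d : nat}.
Variables (nu LH LHp LF LS Minf T CY : R).
Hypotheses (nu_gt0 : 0 < nu) (T_gt0 : 0 < T).
Variable Om : set 'rV[R]_d.+1.
Hypotheses (Om_nonempty : Om !=set0) (oOm : open Om) (bOm : bounded_set Om).
Local Notation mu := (@lebesgue_rV R d.+1).
Local Notation E := 'rV[R]_d.+1.
Local Notation pt := (measurableTypeR R * 'rV[R]_d.+1)%type.
Local Notation Q := (QT T Om : set pt).
Local Notation P := (@lebQ R d.+1).
Local Notation VX := (spX T Om).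
Local Notation VY := (spY T Om).
Local Notation VY0 := (spY0 T Om).
Local Notation nX := (normX T Om).
Local Notation nY := (normY T Om).
Local Notation dtv := (dt T Om).
Local Notation tr := (trace T Om).
Local Notation gx := (gradx T Om).
Variable A : pseudoMetricType R.
Hypotheses (A_compact : compact [set: A]) (A_nonempty : [set: A] !=set0).
Variables (b : R * E -> A -> E) (f : R * E -> A -> R).
Hypotheses (b_cont : unif_continuous_on (QTbar T Om) b) (f_cont : unif_continuous_on (QTbar T Om) f).
Hypothesis b_norm : LH = sup [set enorm (b z a) | z in QTbar T Om & a in [set: A]].
Hypothesis H_diff : forall z p, QTbar T Om z -> differentiable (Ham b f z) p.
Hypothesis Hp_lipschitz : forall z p q, QTbar T Om z ->
  enorm (Hp (Ham b f) z p - Hp (Ham b f) z q) <= LHp * enorm (p - q).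
Variables (Z : normedModType R) (iota : (R * E -> R) -> Z).
Hypothesis iota_linear : forall a v w, VX v -> VX w ->
  iota (fun z => a * v z + w z) = a *: iota v + iota w.
Hypothesis iota_Y : forall v, VY v -> `|iota v| <= CY * nY v.
Variable F : Z -> (R * E -> R) -> R.
Hypothesis F_dual : forall y, dual VX nX (F y).
Hypothesis F_lipschitz : forall y1 y2, dualnorm VX nX (fun w => F y1 w - F y2 w) <= LF * `|y1 - y2|.
Variable S : (E -> R) -> E -> R.
Hypothesis S_L2 : forall y, L2 mu Om y -> L2 mu Om (S y).
Hypothesis S_lipschitz : forall y1 y2, L2 mu Om y1 -> L2 mu Om y2 ->
  L2norm mu Om (fun x => S y1 x - S y2 x) <= LS * L2norm mu Om (fun x => y1 x - y2 x).
Hypothesis FS_monotone : forall v1 v2, VY v1 -> VY v2 ->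
  0 <= F (iota v1) (fun z => v1 z - v2 z) - F (iota v2) (fun z => v1 z - v2 z)
     + \int[mu]_(x in Om) ((S (tr v1 T) x - S (tr v2 T) x) * (tr v1 T x - tr v2 T x)).
Variables (G : (R * E -> R) -> R) (m0 : E -> R).
Hypotheses (G_dual : dual VX nX G) (mm0 : measurable_fun Om m0).
Variables (u m : R * E -> R).
Hypothesis um_sol : weak_solution T Om nu (Ham b f) iota F S G m0 u m.
Hypothesis m_ge0 : {ae P, forall z, Q z -> 0 <= m z}.
Hypothesis m_bound : {ae P, forall z, Q z -> `|m z| <= Minf}.
Variables (ub mb : R * E -> R).
Hypotheses (Xub : VX ub) (Ymb : VY mb).
Hypothesis mb_ge0 : {ae P, forall z, Q z -> 0 <= mb z}.

Let mOm : measurable Om. Proof. exact: open_rV_measurable. Qed.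
Let mQ : measurable Q. Proof. exact: measurable_QT. Qed.
Let sL := @ipL_semi _ _ R mu Om mOm.
Let sLQ := @ipL_semi _ _ R P Q mQ.
Let sVQ := @ipV_semi _ _ R d.+1 P Q mQ.
Let sX := @ipX_semi R d T Om oOm bOm.
Let nXE := @normXE _ _ T Om oOm.
Local Notation H := (Ham b f : pt -> E -> R).
Local Notation DH := (Hp (Ham b f) : pt -> E -> E).
Local Notation eu := (fun z : pt => u z - ub z).
Local Notation em := (fun z : pt => m z - mb z).

Let Xu : VX u. Proof. by case: um_sol. Qed.
Let Ym : VY m. Proof. by case: um_sol. Qed.
Let Xeu : VX eu. Proof. by have [s _ _ _] := sX; exact: (subspaceB s Xu Xub). Qed.
Let Yem : VY em. Proof. exact: (Y_B oOm bOm Ym Ymb). Qed.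

Lemma speed_ge0 : 0 <= LH.
Proof.
have [x Ox] := Om_nonempty.
have Qz : QT T Om (T / 2, x).
  by split => //=; rewrite in_itv /= divr_gt0//= ltr_pdivrMr// ltr_pMr// ltr1n.
exact: (LH_ge0 bOm A_compact A_nonempty b_cont b_norm (Q_QTbar Qz)).
Qed.

Let LH0 := speed_ge0.

Let mgx v i : VX v -> measurable_fun Q (fun z => gx v z ord0 i).
Proof. by move=> Xv; exact: (L2_measurable mQ (gradx_L2 Xv i)). Qed.

Let mH (g : pt -> E) : (forall i, measurable_fun Q (fun z => g z ord0 i)) ->
  measurable_fun Q (fun z => H z (g z)).
Proof. exact: (Ham_comp_measurable oOm bOm A_compact A_nonempty b_cont f_cont b_norm). Qed.

Let mDH (g : pt -> E) : (forall i, measurable_fun Q (fun z => g z ord0 i)) ->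
  forall i, measurable_fun Q (fun z => DH z (g z) ord0 i).
Proof.
by move=> mg i; exact: (Hp_measurable oOm bOm A_compact A_nonempty b_cont f_cont b_norm H_diff i mg).
Qed.

Let H_lip (z : pt) p q : Q z -> `|H z p - H z q| <= LH * enorm (p - q).
Proof.
by move=> Qz; exact: (Ham_lipschitz bOm A_compact A_nonempty b_cont f_cont b_norm p q (Q_QTbar Qz)).
Qed.

Let DH_le (z : pt) p : Q z -> enorm (DH z p) <= LH.
Proof.
by move=> Qz; exact: (Hp_le bOm A_compact A_nonempty b_cont f_cont b_norm H_diff p (Q_QTbar Qz)).
Qed.

(** [LHp] may be 0, while cocoercivity divides by the Lipschitz constant. *)
Let L := Num.max LHp 1.
Let L_gt0 : 0 < L. Proof. by rewrite /L lt_max ltr01 orbT. Qed.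

Let DH_lip (z : pt) p q : QTbar T Om z -> enorm (DH z p - DH z q) <= L * enorm (p - q).
Proof.
move=> Qz; apply: le_trans (Hp_lipschitz _ _ Qz) _; rewrite ler_wpM2r ?enorm_ge0//.
by rewrite /L le_max lexx.
Qed.

Let H_convex (z : pt) p q : Q z -> H z p + dotv (DH z p) (q - p) <= H z q.
Proof.
by move=> Qz; exact: (Hp_convex bOm A_compact A_nonempty b_cont f_cont b_norm H_diff p q (Q_QTbar Qz)).
Qed.

Let H_coc (z : pt) p q : Q z -> dotv (DH z q - DH z p) (DH z q - DH z p) <=
  4 * L * (H z q - H z p - dotv (DH z p) (q - p)).
Proof.
move=> Qz; apply: (Hp_cocoercive bOm A_compact A_nonempty b_cont f_cont b_norm H_diff) => //.
  exact: Q_QTbar.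
by move=> p' q'; apply: DH_lip; exact: Q_QTbar.
Qed.

Let H2 v : VX v -> L2 P Q (fun z => H z (gx v z)).
Proof.
move=> Xv; have [C hC] := Ham0_bounded bOm A_compact A_nonempty b_cont f_cont b_norm.
apply: (L2_growth oOm bOm (normr_ge0 C) LH0 _ (gradx_L2 Xv)) => [|z Qz].
  by apply: mH => i; exact: mgx.
have := H_lip (gx v z) 0 Qz; rewrite subr0 => h1; have h2 := le_trans (hC _ (Q_QTbar Qz)) (ler_norm C).
have -> : H z (gx v z) = H z 0 + (H z (gx v z) - H z 0) by rewrite addrC subrK.
by apply: le_trans (ler_normD _ _) _; exact: lerD.
Qed.

Let P2 v w : VX v -> L2 P Q w -> L2v P Q (fun z => w z *: DH z (gx v z)).
Proof.
move=> Xv w2; apply: (L2v_scale oOm (c := LH) _ _ w2) => [i|z Qz]; last exact: DH_le.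
by apply: mDH => j; exact: mgx.
Qed.

Let dF v := F (iota m) v - F (iota mb) v.

Let dF_dual : dual VX nX dF.
Proof.
have := dual_comb (-1) (F_dual (iota mb)) (F_dual (iota m)).
by congr (dual _ _ _); apply/funext => v; rewrite /dF; ring.
Qed.

(** The Lipschitz bound in Z is carried to Y by linearity and boundedness of the embedding; absolute
    values keep the factor nonnegative. *)
Let dF_le v : VX v -> `|dF v| <= `|LF| * `|CY| * nY em * nX v.
Proof.
move=> Xv; apply: le_trans (dual_le sX nXE dF_dual Xv) _.
rewrite ler_wpM2r ?(normX_ge0 oOm Xv)//; apply: le_trans (F_lipschitz _ _) _.
have e : iota m - iota mb = iota em.
  have := iota_linear (-1) (Y_X Ymb) (Y_X Ym); rewrite scaleN1r addrC => <-; congr iota.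
  by apply/funext => z; ring.
rewrite e; apply: le_trans (ler_norm _) _; rewrite normrM normr_id -mulrA ler_wpM2l//.
apply: le_trans (iota_Y Yem) _; rewrite ler_wpM2r ?(normY_ge0 T Om)//; exact: ler_norm.
Qed.

Let tT : 0 <= T <= T. Proof. by rewrite lexx ltW. Qed.
Let t0 : 0 <= (0 : R) <= T. Proof. by rewrite lexx ltW. Qed.
Let Tm2 : L2 mu Om (tr m T). Proof. exact: (traceT_L2 T_gt0 oOm bOm Ym). Qed.
Let Tmb2 : L2 mu Om (tr mb T). Proof. exact: (traceT_L2 T_gt0 oOm bOm Ymb). Qed.
Let Tem2 : L2 mu Om (tr em T). Proof. exact: (traceT_L2 T_gt0 oOm bOm Yem). Qed.

Let dS x := S (tr m T) x - S (tr mb T) x.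

Let dS2 : L2 mu Om dS. Proof. by apply: (L2B mOm); apply: S_L2. Qed.

Let Tem_ae : {ae mu, forall x, Om x -> tr m T x - tr mb T x = tr em T x}.
Proof. by apply: filterS (traceB T_gt0 oOm bOm Ym Ymb tT) => x h /h. Qed.

Let dS_le : Num.sqrt (ipL mu Om dS dS) <= `|LS| * nY em.
Proof.
rewrite -(L2normE mOm dS2); apply: le_trans (S_lipschitz Tm2 Tmb2) _.
have B2 := L2B mOm Tm2 Tmb2; have n0 := L2norm_ge0 mOm B2.
apply: le_trans (ler_wpM2r n0 (ler_norm LS)) _; rewrite ler_wpM2l//.
apply: le_trans (traceT_leY T_gt0 oOm bOm Yem).
rewrite (L2normE mOm B2) (L2normE mOm Tem2) ler_wsqrtr// le_eqVlt; apply/orP; left; apply/eqP.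
exact: (ipL_ae mOm B2 Tem2 B2 Tem2 Tem_ae Tem_ae).
Qed.

Let monotone : 0 <= dF em + ipL mu Om dS (tr em T).
Proof.
have := FS_monotone Ym Ymb; have B2 := L2B mOm Tm2 Tmb2.
rewrite -(ipL_ae mOm dS2 dS2 B2 Tem2 (aeW _ (fun x _ => erefl)) Tem_ae).
by [].
Qed.

Let l1 := res1 T Om nu (Ham b f) iota F S ub mb.
Let l2 := res2 T Om nu (Ham b f) G ub mb.

Let hjb_split v w : VX v -> VX w ->
  \int[P]_(z in Q) (nu * dotv (gx v z) (gx w z) + H z (gx v z) * w z) =
  nu * ipX T Om v w + ipL P Q (fun z => H z (gx v z)) w.
Proof.
move=> Xv Xw; have I1 := L2v_dotv mQ (gradx_L2 Xv) (gradx_L2 Xw); have I2 := L1Z mQ nu I1.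
have I3 := L2M mQ (H2 Xv) (spX_L2 Xw).
by rewrite (RintegralD mQ I2 I3) (RintegralZl nu mQ I1).
Qed.

Let E1 v : VY0 v -> l1 v = dtv v eu + nu * ipX T Om eu v + ipL P Q (dH T Om H u ub) v
  - dF v - ipL mu Om dS (tr v T).
Proof.
move=> Y0v; have Yv := Y0_Y Y0v; have Xv := Y_X Yv.
have [_ _ _ sol _] := um_sol; have := sol v Y0v; rewrite (hjb_split Xu Xv).
rewrite /l1 /res1 (hjb_split Xub Xv).
have T2 := traceT_L2 T_gt0 oOm bOm Yv.
have e1 := dualB (dt_dual Yv) Xu Xub.
have e2 := ipBl sX Xu Xub Xv.
have e3 := ipBl sLQ (H2 Xu) (H2 Xub) (spX_L2 Xv).
have e4 := ipBl sL (S_L2 Tm2) (S_L2 Tmb2) T2.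
rewrite -[dtv v eu]/(dtv v (u - ub)) -[ipX T Om eu v]/(ipX T Om (u - ub) v) e1 e2.
rewrite -[ipL P Q (dH T Om H u ub) v]/(ipL P Q ((fun z => H z (gx u z)) - (fun z => H z (gx ub z))) v) e3.
rewrite -[ipL mu Om dS (tr v T)]/(ipL mu Om (S (tr m T) - S (tr mb T)) (tr v T)) e4 /dF.
exact: hjb_numeric.
Qed.

Let kfp_split v w q : VX v -> VX w -> VX q ->
  ipV P Q (fun z => nu *: gx v z + v z *: DH z (gx q z)) (gx w) =
  nu * ipX T Om v w + ipV P Q (fun z => v z *: DH z (gx q z)) (gx w).
Proof.
move=> Xv Xw Xq; have gv := gradx_L2 Xv; have gw := gradx_L2 Xw.
have v2 := P2 Xq (spX_L2 Xv).
have nv := subspaceZ nu (@L2v_subspace _ _ R d.+1 P Q mQ) gv.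
by rewrite -(ipZl sVQ nu gv gw) -(ipDl sVQ nv v2 gw).
Qed.

Let E2 w : VX w -> l2 w = dtv em w + nu * ipX T Om em w + ipV P Q (mdP T Om DH u ub m mb) (gx w).
Proof.
move=> Xw; have Xm := Y_X Ym; have Xmb := Y_X Ymb; have gw := gradx_L2 Xw.
have [_ _ _ _ sol] := um_sol; have := sol w Xw.
have -> : \int[P]_(z in Q) (nu * dotv (gx m z) (gx w z) + m z * dotv (DH z (gx u z)) (gx w z)) =
    ipV P Q (fun z => nu *: gx m z + m z *: DH z (gx u z)) (gx w).
  by apply: eq_Rintegral => z _; rewrite dotvDl !dotvZl.
rewrite (kfp_split Xm Xw Xu).
rewrite /l2 /res2 -[\int[P]_(z in Q) _]/(ipV P Q (fun z => nu *: gx mb z + mb z *: DH z (gx ub z)) (gx w)).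
rewrite (kfp_split Xmb Xw Xub).
have e1 := dtB oOm bOm Ym Ymb Xw.
have e2 := ipBl sX Xm Xmb Xw.
have e3 := ipBl sVQ (P2 Xu (spX_L2 Xm)) (P2 Xub (spX_L2 Xmb)) gw.
rewrite e1 -[ipX T Om em w]/(ipX T Om (m - mb) w) e2.
rewrite -[ipV P Q (mdP T Om DH u ub m mb) (gx w)]/(ipV P Q ((fun z => m z *: DH z (gx u z)) - (fun z => mb z *: DH z (gx ub z))) (gx w)) e3.
exact: kfp_numeric.
Qed.

Let l2_dual : dual VX nX l2.
Proof.
have := dual_comb (-1) (driftop_dual oOm bOm nu_gt0 LH0 (mDH (fun i => mgx i Xub)) (fun z Qz => DH_le _ Qz) Ymb) G_dual.
congr (dual _ _ _); apply/funext => w; rewrite mulN1r addrC.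
transitivity (G w - dtv mb w - drift T Om nu (fun z => DH z (gx ub z)) mb w) => //.
by rewrite /driftop opprD addrA.
Qed.

(** Needed for the dual norm of the first residual to control its values on all of Y_0; linearity is
    read off the identity [E1]. *)
Let l1_lin a v w : VY0 v -> VY0 w -> l1 (a *: v + w) = a * l1 v + l1 w.
Proof.
move=> Y0v Y0w; have Yv := Y0_Y Y0v; have Yw := Y0_Y Y0w; have Xv := Y_X Yv; have Xw := Y_X Yw.
have [_ s] := Y0_subspace T_gt0 oOm bOm; have Y0l := s a _ _ Y0v Y0w.
have [_ sub] := Y_subspace T oOm bOm; have Yl := sub a _ _ Yv Yw.
rewrite (E1 Y0v) (E1 Y0w) (E1 Y0l).
have e1 : dtv (a *: v + w) eu = a * dtv v eu + dtv w eu := dt_lin oOm bOm a Yv Yw Xeu.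
have [[_ sX'] _ _ _] := sX; have av := subspaceZ a (conj (proj1 (proj1 (conj (let: And4 h _ _ _ := sX in h) I))) sX') Xv.
have e2 : ipX T Om eu (a *: v + w) = a * ipX T Om eu v + ipX T Om eu w.
  by rewrite (ipDr sX av Xw Xeu) (ipZr sX a Xv Xeu).
have dh2 : L2 P Q (dH T Om H u ub) by exact: (L2B mQ (H2 Xu) (H2 Xub)).
have e3 : ipL P Q (dH T Om H u ub) (a *: v + w) = a * ipL P Q (dH T Om H u ub) v + ipL P Q (dH T Om H u ub) w.
  by rewrite (ipDr sLQ (L2Z mQ a (spX_L2 Xv)) (spX_L2 Xw) dh2) (ipZr sLQ a (spX_L2 Xv) dh2).
have e4 : dF (a *: v + w) = a * dF v + dF w by exact: (dual_lin a dF_dual Xv Xw).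
have e5 : ipL mu Om dS (tr (a *: v + w) T) = a * ipL mu Om dS (tr v T) + ipL mu Om dS (tr w T).
  have tv := traceT_L2 T_gt0 oOm bOm Yv; have tw := traceT_L2 T_gt0 oOm bOm Yw.
  have tl := traceT_L2 T_gt0 oOm bOm Yl.
  rewrite -(ipZr sL a tv dS2) -(ipDr sL (L2Z mOm a tv) tw dS2).
  exact: (ipL_ae mOm dS2 dS2 tl (L2_lin mOm a tv tw) (aeW _ (fun x _ => erefl)) (trace_lin T_gt0 oOm bOm a Yv Yw tT)).
rewrite e1 e2 e3 e4 e5; exact: lin5.
Qed.

Let Lip0 : 0 <= `|LF| * `|CY|. Proof. exact: mulr_ge0. Qed.

Let k := `|LF| * `|CY| + `|LS|.
Let s := LH * Num.sqrt T.
Let U := nX eu.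
Let Y := nY em.

Let l1_bnd v : VY0 v -> `|l1 v| <= ((1 + nu + s) * U + k * Y) * nY v.
Proof.
exact: (residual1_le T_gt0 oOm bOm nu_gt0 LH0 mH H_lip Xu Xub Lip0 dF_le dS2 dS_le E1).
Qed.

Let l2_bnd w : VX w -> `|l2 w| <= ((1 + nu + s) * Y + `|Minf| * L * U) * nX w.
Proof.
apply: (residual2_le T_gt0 oOm bOm nu_gt0 LH0 L_gt0 (normr_ge0 Minf) mDH DH_le _ Xu Xub Ym Ymb _ E2).
  by move=> z p q Qz; apply: DH_lip; exact: Q_QTbar.
by apply: filterS m_bound => z h Qz; exact: le_trans (h Qz) (ler_norm _).
Qed.

Let U0 : 0 <= U. Proof. exact: (normX_ge0 oOm). Qed.
Let Y0 : 0 <= Y. Proof. exact: normY_ge0. Qed.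
Let k0 : 0 <= k. Proof. by rewrite addr_ge0// mulr_ge0. Qed.
Let s0 : 0 <= s. Proof. exact: mulr_ge0 LH0 (sqrtr_ge0 T). Qed.

Let bnd1 : 0 <= (1 + nu + s) * U + k * Y.
Proof. by have n0 := ltW nu_gt0; rewrite addr_ge0 ?mulr_ge0 ?addr_ge0. Qed.

Let bnd2 : 0 <= (1 + nu + s) * Y + `|Minf| * L * U.
Proof. by have n0 := ltW nu_gt0; rewrite addr_ge0 ?mulr_ge0 ?addr_ge0// ltW. Qed.

(** Since [m] starts from [m0], the initial residual is the initial density error up to sign. *)
Let initial : L2norm mu Om (fun x => tr mb 0 x - m0 x) = L2norm mu Om (tr em 0).
Proof.
have [_ _ hm0 _ _] := um_sol.
have A2 := trace0_L2 T_gt0 oOm bOm Yem; have M2 := trace0_L2 T_gt0 oOm bOm Ym.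
have m02 : L2 mu Om m0 by exact: (L2_ae mOm M2 mm0 hm0).
have B2 := L2B mOm (trace0_L2 T_gt0 oOm bOm Ymb) m02.
rewrite (L2normE mOm B2) (L2normE mOm A2); congr Num.sqrt.
have N2 := L2Z mOm (-1) A2.
have e : {ae mu, forall x, Om x -> tr mb 0 x - m0 x = -1 * tr em 0 x}.
  apply: filterS2 hm0 (traceB T_gt0 oOm bOm Ym Ymb t0) => x h1 h2 Ox.
  by rewrite (h2 Ox) (h1 Ox) mulN1r opprB.
rewrite (ipL_ae mOm B2 N2 B2 N2 e e); apply: eq_Rintegral => x _; ring.
Qed.

Let rho1 := dualnorm VY0 nY l1.
Let rho2 := dualnorm VX nX l2.
Let rho0 := L2norm mu Om (fun x => tr mb 0 x - m0 x).

Lemma residual_le_error : residual T Om nu (Ham b f) iota F S G m0 ub mb <=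
  lower_const nu k s L `|Minf| * (U + Y).
Proof.
apply: (lower_numeric (ltW nu_gt0) k0 s0 (ltW L_gt0) (normr_ge0 _) U0 Y0).
- exact: (dualnorm_bnd (ipY0_semi T_gt0 oOm bOm) (normY0E T_gt0 oOm bOm) bnd1 l1_bnd).
- exact: (dualnorm_bnd sX nXE bnd2 l2_bnd).
- by rewrite -/rho0 /rho0 initial; exact: (trace0_leY T_gt0 oOm bOm Yem).
Qed.

Lemma error_le_residual : U + Y <=
  upper_const (energy_const nu LH T) (energy_const nu 0 T) k s L `|Minf|
    * residual T Om nu (Ham b f) iota F S G m0 ub mb.
Proof.
have l1Z a v : VY0 v -> l1 (a *: v) = a * l1 v.
  have [V0 _] := Y0_subspace T_gt0 oOm bOm => Y0v.
  have l10 : l1 0 = 0.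
    have := l1_lin 1 V0 V0; rewrite scaler0 addr0 mul1r => /eqP.
    by rewrite -subr_eq0 opprD addNKr oppr_eq0 => /eqP.
  by rewrite -[a *: v]addr0 (l1_lin a Y0v V0) l10 addr0.
have sY0 := ipY0_semi T_gt0 oOm bOm; have nY0 := normY0E T_gt0 oOm bOm.
have ex1 : exists C, forall v, VY0 v -> `|l1 v| <= C * nY v by eexists; exact: l1_bnd.
have h1 v : VY0 v -> `|l1 v| <= rho1 * nY v by move=> Y0v; exact: (dualnorm_le sY0 nY0 l1Z ex1 Y0v).
have h2 w : VX w -> `|l2 w| <= rho2 * nX w by exact: (dual_le sX nXE l2_dual).
have r1 : 0 <= rho1 by exact: (dualnorm_ge0 sY0 nY0 ex1).
have r2 : 0 <= rho2 by exact: (dual_norm_ge0 sX nXE l2_dual).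
have h0 : L2norm mu Om (tr em 0) <= rho0 by rewrite /rho0 initial.
have r0 : 0 <= rho0 by apply: le_trans h0; exact: (L2norm_ge0 mOm (trace0_L2 T_gt0 oOm bOm Yem)).
have DHl z p q : Q z -> enorm (DH z p - DH z q) <= L * enorm (p - q).
  by move=> Qz; apply: DH_lip; exact: Q_QTbar.
have hm : {ae P, forall z, Q z -> `|m z| <= `|Minf|}.
  by apply: filterS m_bound => z h Qz; exact: le_trans (h Qz) (ler_norm _).
have g0 := gap_ge0 oOm bOm mDH DH_le Xu Xub Ym m_ge0.
apply: (upper_numeric (sqrtr_ge0 _) (sqrtr_ge0 _) k0 s0 (ltW L_gt0) (normr_ge0 Minf) U0 Y0 g0 r0 r1 r2).
- exact: (value_error T_gt0 oOm bOm nu_gt0 LH0 mH H_lip Xu Xub Lip0 (normr_ge0 LS) dF_le dS2 dS_le E1 r1 h1).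
- move=> e e0.
  exact: (duality_gap T_gt0 oOm bOm nu_gt0 LH0 L_gt0 mH mDH H_lip DH_le H_convex H_coc Xu Xub Ym Ymb
    m_ge0 mb_ge0 Lip0 (normr_ge0 LS) dF_dual dF_le dS2 dS_le E1 E2 r1 h1 h2 h0 monotone e0).
- exact: (density_error T_gt0 oOm bOm nu_gt0 LH0 mDH DH_le Xu Xub Ym Ymb m_ge0 hm E2 r2 h2 h0).
Qed.

End mean_field_game.

(* The constants c and C are chosen before the domain and the data; CX and CY
   bound the embeddings of X and Y into Z. *)
Theorem theorem3p1 (R : realType)
    (nu LH LHp LF LS Minf T diamO CX CY : R) (nu_gt0 : 0 < nu) (T_gt0 : 0 < T) :
  exists c C : R, [/\ 0 < c, 0 < C &
  forall (d : nat) (Om : set 'rV[R]_d.+1)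
    (Om_nonempty : Om !=set0) (Om_open : open Om) (Om_connected : connected Om)
    (Om_bounded : bounded_set Om) (Om_lipschitz : lipschitz_boundary Om)
    (Om_diam : diam Om = diamO)
    (A : metricType R)
    (A_compact : compact [set: A]) (A_nonempty : [set: A] !=set0)
    (b : R * 'rV[R]_d.+1 -> A -> 'rV[R]_d.+1) (f : R * 'rV[R]_d.+1 -> A -> R)
    (b_cont : unif_continuous_on (QTbar T Om) b)
    (f_cont : unif_continuous_on (QTbar T Om) f)
    (b_norm : LH = sup [set enorm (b z a) | z in QTbar T Om & a in [set: A]])
    (H_diff : forall z p, QTbar T Om z -> differentiable (Ham b f z) p)
    (Hp_lipschitz : forall z p q, QTbar T Om z ->
       enorm (Hp (Ham b f) z p - Hp (Ham b f) z q) <= LHp * enorm (p - q))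
    (Z : completeNormedModType R) (Z_hilbert : hilbert Z)
    (iota : (R * 'rV[R]_d.+1 -> R) -> Z)
    (iota_linear : forall a v w, spX T Om v -> spX T Om w ->
       iota (fun z => a * v z + w z) = a *: iota v + iota w)
    (iota_inj : forall v, spX T Om v -> iota v = 0 ->
       {ae lebQ, forall z, QT T Om z -> v z = 0})
    (iota_X : forall v, spX T Om v -> `|iota v| <= CX * normX T Om v)
    (iota_Y : forall v, spY T Om v -> `|iota v| <= CY * normY T Om v)
    (iota_compact : compact (closure
       [set iota v | v in [set v | spY T Om v /\ normY T Om v <= 1]]))
    (F : Z -> (R * 'rV[R]_d.+1 -> R) -> R)
    (F_dual : forall y, dual (spX T Om) (normX T Om) (F y))
    (F_lipschitz : forall y1 y2,
       dualnorm (spX T Om) (normX T Om) (fun w => F y1 w - F y2 w)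
       <= LF * `|y1 - y2|)
    (S : ('rV[R]_d.+1 -> R) -> 'rV[R]_d.+1 -> R)
    (S_L2 : forall y, L2 (lebesgue_rV d.+1) Om y ->
       L2 (lebesgue_rV d.+1) Om (S y))
    (S_lipschitz : forall y1 y2, L2 (lebesgue_rV d.+1) Om y1 ->
       L2 (lebesgue_rV d.+1) Om y2 ->
       L2norm (lebesgue_rV d.+1) Om (fun x => S y1 x - S y2 x)
       <= LS * L2norm (lebesgue_rV d.+1) Om (fun x => y1 x - y2 x))
    (FS_monotone : forall v1 v2, spY T Om v1 -> spY T Om v2 ->
       0 <= F (iota v1) (fun z => v1 z - v2 z)
            - F (iota v2) (fun z => v1 z - v2 z)
            + \int[lebesgue_rV d.+1]_(x in Om)
                ((S (trace T Om v1 T) x - S (trace T Om v2 T) x)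
                 * (trace T Om v1 T x - trace T Om v2 T x)))
    (r s : \bar R) (r_gt1 : (1 < r)%E) (s_gt1 : (1 < s)%E)
    (rs : (r^-1 + (d.+1%:R / 2)%:E * s^-1 < 1)%E)
    (G : (R * 'rV[R]_d.+1 -> R) -> R)
    (g0 : R * 'rV[R]_d.+1 -> R) (g1 : R * 'rV[R]_d.+1 -> 'rV[R]_d.+1)
    (g0_LrLs : LrLs T Om r s g0)
    (g1_LrLs : forall i,
       LrLs T Om (2%:E * r)%E (2%:E * s)%E (fun z => g1 z ord0 i))
    (G_source : is_source T Om G g0 g1)
    (G_ge0 : forall w, spX T Om w ->
       {ae lebQ, forall z, QT T Om z -> 0 <= w z} -> 0 <= G w)
    (m0 : 'rV[R]_d.+1 -> R)
    (m0_Linf : m0 \_ Om \in Lfun (lebesgue_rV d.+1) +oo%E)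
    (m0_ge0 : {ae lebesgue_rV d.+1, forall x, Om x -> 0 <= m0 x})
    (u m : R * 'rV[R]_d.+1 -> R)
    (um_sol : weak_solution T Om nu (Ham b f) iota F S G m0 u m)
    (m_ge0 : {ae lebQ, forall z, QT T Om z -> 0 <= m z})
    (m_bound : {ae lebQ, forall z, QT T Om z -> `|m z| <= Minf})
    (ub mb : R * 'rV[R]_d.+1 -> R)
    (ub_X : spX T Om ub) (mb_Y : spY T Om mb)
    (mb_ge0 : {ae lebQ, forall z, QT T Om z -> 0 <= mb z}),
  c * residual T Om nu (Ham b f) iota F S G m0 ub mb
    <= normX T Om (fun z => u z - ub z) + normY T Om (fun z => m z - mb z) /\
  normX T Om (fun z => u z - ub z) + normY T Om (fun z => m z - mb z)
    <= C * residual T Om nu (Ham b f) iota F S G m0 ub mb].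
Proof.
(* The constants are fixed before the data that give the signs, hence the absolute values; that
   [|LH|] is [LH] is recovered once the data are present. *)
pose k := `|LF| * `|CY| + `|LS|; pose s := `|LH| * Num.sqrt T; pose L := Num.max LHp 1.
have k0 : 0 <= k by rewrite addr_ge0// mulr_ge0.
have s0 : 0 <= s by rewrite mulr_ge0// sqrtr_ge0.
have L0 : 0 <= L by rewrite /L le_max ler01 orbT.
exists (lower_const nu k s L `|Minf|)^-1.
exists (upper_const (energy_const nu `|LH| T) (energy_const nu 0 T) k s L `|Minf|).
have B0 : 0 < lower_const nu k s L `|Minf|.
  exact: lower_const_gt0 (ltW nu_gt0) k0 s0 L0 (normr_ge0 Minf).
split; first by rewrite invr_gt0.
  exact: upper_const_gt0 (sqrtr_ge0 _) (sqrtr_ge0 _) k0 s0 L0 (normr_ge0 Minf).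
move=> d Om Om_nonempty Om_open _ Om_bounded _ _ A A_compact A_nonempty b f b_cont f_cont b_norm.
move=> H_diff Hp_lipschitz Z _ iota iota_linear _ _ iota_Y _ F F_dual F_lipschitz S S_L2 S_lipschitz.
move=> FS_monotone r s' _ _ _ G g0 g1 _ _ [G_dual _] _ m0 m0_Linf _ u m um_sol m_ge0 m_bound.
move=> ub mb ub_X mb_Y mb_ge0.
have mOm : measurable Om by exact: open_rV_measurable.
have mm0 : measurable_fun Om m0.
  by move: m0_Linf; rewrite inE => /andP[/set_mem mf _]; exact/measurable_restrictT.
have LHn : `|LH| = LH.
  exact: ger0_norm (speed_ge0 T_gt0 Om_nonempty Om_bounded A_compact A_nonempty b_cont b_norm).
split.
  rewrite ler_pdivrMl//; have := residual_le_error nu_gt0 T_gt0 Om_nonempty Om_open Om_bounded A_compact A_nonempty b_cont f_cont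
    b_norm H_diff Hp_lipschitz iota_linear iota_Y F_dual F_lipschitz S_L2 S_lipschitz mm0 um_sol m_bound
    ub_X mb_Y.
  by rewrite /s LHn.
have := (error_le_residual nu_gt0 T_gt0 Om_nonempty Om_open Om_bounded A_compact A_nonempty b_cont f_cont
  b_norm H_diff Hp_lipschitz iota_linear iota_Y F_dual F_lipschitz S_L2 S_lipschitz FS_monotone G_dual mm0
  um_sol m_ge0 m_bound ub_X mb_Y mb_ge0).
by rewrite /s LHn.
Qed.
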